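(* Let $R>0$ and let $S$ be a harmonic semi-global invariant with $S_1>\ln|c|$ and satisfying the positivity condition $$S_1(0)>-\min_{\theta\in[0,2\pi]}\frac12\sum_{n\in\mathbb Z}\Bigl[\frac1{|\frac{\theta}{2\pi}+n|}-\kappa(n)\Bigr],$$ where $\kappa(0)=0$ and $\kappa(n)=\frac1{|n|}$ for $n\neq0$. Then the twistor structure determined by the family $\varpi(\zeta)=\frac1{2\pi R}\frac{d\chi_{\gamma_m}(\zeta)}{\chi_{\gamma_m}(\zeta)}\wedge\frac{d\chi_{\gamma_e}(\zeta)}{\chi_{\gamma_e}(\zeta)}$ of instanton corrected holomorphic 2-forms gives a construction of the metric $2\pi g$ on $\widetilde W_0$, where $g$ is (up to the orientation adjustment replacing $\theta_{\gamma_m}$ by $-\theta_{\gamma_m}$) the generalized Ooguri-Vafa metric with potential function $$V=\frac R{4\pi}\Bigl(\sum_{n\in\mathbb Z}\Bigl[\frac1{\sqrt{R^2|c|^2+(\frac{\theta_{\gamma_e}}{2\pi}+n)^2}}-\kappa(n)\Bigr]+2S_1\Bigr).$$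
   Context: Local model. Let $0<\epsilon<1$, $B=\{c=c_1+ic_2\in\mathbb C:|c|<\epsilon\}$, $B_0=B\setminus\{0\}$. The semi-global invariant is a smooth $S:\mathbb R^2\to\mathbb R$ with $S(0)=0$, regarded as a function of $c=(c_1,c_2)$; $S_i=\partial S/\partial c_i$; harmonic means $S_{11}+S_{22}=0$, and then $\widetilde S$ denotes a harmonic conjugate ($S+i\widetilde S$ holomorphic in $c$). The regular part $\widetilde W_0$ of the local model of the focus-focus fibration is $B_0\times\mathbb R^2$ with coordinates $(c;t_1,t_2)$ modulo, over each $c$, the lattice $\langle (S_1-\ln|c|,S_2+\arg c),(0,2\pi)\rangle$. With local branches of $\arg c$ and $\ln c=\ln|c|+i\arg c$ fixed, set $$Z_{\gamma_m}=\tfrac1{2\pi}[c-c\ln c+S+i\widetilde S],\quad Z_{\gamma_e}=-ic,\quad \theta_{\gamma_e}=\tfrac{2\pi t_1}{S_1-\ln|c|},\quad \theta_{\gamma_m}=t_2-\tfrac{S_2+\arg c}{S_1-\ln|c|}t_1 .$$ Instanton corrected Darboux coordinates. For $\zeta\in\mathbb C^*$, $$\chi^{sf}_{\gamma_m}=\exp\Bigl[\tfrac{i\pi R}{\zeta}Z_{\gamma_m}-i\theta_{\gamma_m}-i\pi R\zeta\overline Z_{\gamma_m}\Bigr],\quad \chi_{\gamma_e}=\exp\Bigl[\tfrac{i\pi R}{\zeta}Z_{\gamma_e}+i\theta_{\gamma_e}-i\pi R\zeta\overline Z_{\gamma_e}\Bigr],$$ $$\chi_{\gamma_m}(\zeta)=\chi^{sf}_{\gamma_m}(\zeta)\exp\Bigl[\tfrac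 i{4\pi}\int_{l_+}\tfrac{d\zeta'}{\zeta'}\tfrac{\zeta'+\zeta}{\zeta'-\zeta}\ln(1-\chi_{\gamma_e}(\zeta'))-\tfrac i{4\pi}\int_{l_-}\tfrac{d\zeta'}{\zeta'}\tfrac{\zeta'+\zeta}{\zeta'-\zeta}\ln(1-\chi_{\gamma_e}(\zeta')^{-1})\Bigr],$$ where $l_+$ (resp. $l_-$) is a ray from $0$ to $\infty$ in the half-plane $\mathrm{Re}(c/\zeta')<0$ (resp. $\mathrm{Re}(c/\zeta')>0$), not containing $\zeta$; in particular $l_\pm$ are away from the BPS rays $\{\mathrm{Re}(c/\zeta')=0\}$. Generalized Ooguri-Vafa metric. The metric $g$ with potential $V$ is the Gibbons-Hawking metric, which with the orientation adjustment reads $$g=V^{-1}\Bigl(-\frac{d\theta_{\gamma_m}}{2\pi}+A\Bigr)^2+V\Bigl(dc_1^2+dc_2^2+\Bigl(\frac{d\theta_{\gamma_e}}{2\pi R}\Bigr)^2\Bigr),$$ where the connection form $A=A^{sf}+A^{inst}$ has $$A^{sf}=\tfrac{i}{8\pi^2}(\ln c-\ln\overline c+2iS_2)\,d\theta_{\gamma_e},\quad A^{inst}=-\tfrac R{4\pi}\Bigl(\tfrac{dc}c-\tfrac{d\overline c}{\overline c}\Bigr)\sum_{n\ne0}\mathrm{sign}(n)e^{in\theta_{\gamma_e}}|c|K_1(2\pi R|nc|),$$ with $dA=*dV$ for the flat metric in the coordinates $(c_1,c_2,\theta_{\gamma_e}/2\pi R)$; $K_1$ is the modified Bessel function. In the positivity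 condition the sum is understood as $+\infty$ when $\theta/2\pi\in\mathbb Z$. The potential $V$ is a local positive harmonic function: $\epsilon$ is taken small enough that $V>0$ over $B_0$. The twistor structure determined by $\varpi(\zeta)$ gives a hyperkähler metric $G$ means: $\varpi(\zeta)=-\frac1{2\zeta}\Omega'+\omega'+\frac\zeta2\overline{\Omega'}$, where, for the complex structure determined by $\Omega'$, $\omega'$ is the Kähler form of $G$ and $\Omega'$ is a holomorphic symplectic form with $\omega'\wedge\omega'=\frac12\Omega'\wedge\overline{\Omega'}$.
   Formalization: In both the positivity condition and the potential V, κ(0)=0 is replaced by κ(0)=2(ln(2/R)−γ), γ Euler's constant; with κ(0)=0 the potential is off by the constant (R/2π)(ln(2/R)−γ), so the claim fails unless R=2e^{−γ}. *)

(* Defs.v *)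
From Stdlib Require Import Reals ZArith R_Ifp.
From Coquelicot Require Import Coquelicot.
Open Scope R_scope.

(** * Calculus on real normed spaces *)

Notation RNorm := (NormedModule R_AbsRing).

(** [C_R_NormedModule] is [C] as a real normed space. *)
Notation CR := C_R_NormedModule.
Notation RR := R_NormedModule.

(** [L] is the Frechet differential of [f] at [p]. *)
Definition differential {U V : RNorm} (f : U -> V) (p : U) (L : U -> V) : Prop :=
  filterdiff f (locally p) L.

Fixpoint Cn {U V : RNorm} (n : nat) (D : U -> Prop) (f : U -> V) : Prop :=
  match n with
  | O => forall p, D p -> continuous f p
  | S k => exists df : U -> U -> V,
      (forall p, D p -> differential f p (df p)) /\
      (forall v, Cn k D (fun p => df p v))
  end.

Definition smooth {U V : RNorm} (D : U -> Prop) (f : U -> V) : Prop :=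
  forall n, Cn n D f.

Definition is_bilinear {U V : RNorm} (T : U -> U -> V) : Prop :=
  (forall u, is_linear (T u)) /\ (forall v, is_linear (fun u => T u v)).

(** A 2-form is closed at [p]: the exterior derivative is evaluated on constant
    vector fields, whose brackets vanish. *)
Definition closed2 {U V : RNorm} (T : U -> U -> U -> V) (p : U) : Prop :=
  exists dT : U -> U -> U -> V,
    (forall u v, differential (fun q => T q u v) p (dT u v)) /\
    (forall u v w, plus (dT v w u) (plus (dT w u v) (dT u v w)) = zero).

(** Vanishing at [p] of the Nijenhuis tensor
    [[Ju,Jv] - J[Ju,v] - J[u,Jv] - [u,v]], on constant vector fields [u], [v];
    [dJ u w] is the derivative of [q |-> J q u] in the direction [w]. *)
Definition nijenhuis_zero {U : RNorm} (J : U -> U -> U) (p : U) : Prop :=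
  exists dJ : U -> U -> U,
    (forall u, differential (fun q => J q u) p (dJ u)) /\
    (forall u v,
       plus (minus (dJ v (J p u)) (dJ u (J p v)))
            (minus (J p (dJ u v)) (J p (dJ v u))) = zero).

Definition wedge11 {T : Type} (a b : T -> C) : T -> T -> C :=
  fun u v => (a u * b v - a v * b u)%C.

Definition wedge22 {T : Type} (a b : T -> T -> C) : T -> T -> T -> T -> C :=
  fun u v w x =>
    (a u v * b w x - a u w * b v x + a u x * b v w
     + a v w * b u x - a v x * b u w + a w x * b u v)%C.

(** * Special functions *)

Definition Cexp (z : C) : C := (exp (Re z) * cos (Im z), exp (Re z) * sin (Im z)).

(** Principal argument, in [(-PI, PI]], by the half-angle formula. *)
Definition Carg (z : C) : R :=
  if Rlt_dec 0 (Cmod z + Re z) then 2 * atan (Im z / (Cmod z + Re z)) else PI.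

Definition Clog (z : C) : C := (ln (Cmod z), Carg z).

Definition BesselK1 (x : R) : R :=
  RInt_gen (fun t => exp (- x * cosh t) * cosh t) (at_point 0) (Rbar_locally p_infty).

Definition Euler_gamma : R :=
  real (Lim_seq (fun n => sum_n_m (fun k => / INR k) 1 n - ln (INR n))).

Definition ZSeries (a : Z -> R) : R :=
  Series (fun n => a (Z.of_nat n)) + Series (fun n => a (- Z.of_nat (S n))%Z).

Definition CZSeries (a : Z -> C) : C :=
  (ZSeries (fun n => Re (a n)), ZSeries (fun n => Im (a n))).

(** The integral of [f(z') dz'/z'] over the ray [{s u : s > 0}], on which
    [dz'/z' = ds/s]. *)
Definition ray_int (u : C) (f : C -> C) : C :=
  RInt_gen (V := C_R_CompleteNormedModule)
    (fun s => (f (RtoC s * u) / RtoC s)%C) (at_right 0) (Rbar_locally p_infty).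

Definition on_ray (u z : C) : Prop := exists s : R, 0 < s /\ z = (RtoC s * u)%C.

(** * The semi-global invariant *)

Definition pd1 (f : C -> R) (c : C) : R := Derive (fun x => f (x, Im c)) (Re c).
Definition pd2 (f : C -> R) (c : C) : R := Derive (fun y => f (Re c, y)) (Im c).

Definition harmonic (S : C -> R) : Prop :=
  forall c, pd1 (pd1 S) c + pd2 (pd2 S) c = 0.

Definition harmonic_conjugate (S St : C -> R) : Prop :=
  forall c : C, ex_derive (K := C_AbsRing) (V := C_NormedModule)
                  (fun z : C => (S z, St z) : C) c.

(** * The local model

    A point is [(c, (t1, t2))].  The regular part of the fibration is the quotient
    of [{p | 0 < |c| < eps}] by the period lattices, so that a tensor field on it
    is a tensor field on [{p | 0 < |c| < eps}] invariant under the translations by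
    lattice sections. *)

Definition pt : Type := (C * (R * R))%type.

Definition E4 : RNorm :=
  prod_NormedModule R_AbsRing CR (prod_NormedModule R_AbsRing RR RR).

Definition pc (p : pt) : C := fst p.
Definition pt1 (p : pt) : R := fst (snd p).
Definition pt2 (p : pt) : R := snd (snd p).

Definition B0 (eps : R) (c : C) : Prop := 0 < Cmod c < eps.

Definition cover (eps : R) (p : pt) : Prop := B0 eps (pc p).

(** [a] is a branch of the argument on the open subset [D] of [B0 eps]. *)
Definition arg_branch (eps : R) (D : C -> Prop) (a : C -> R) : Prop :=
  open D /\
  (forall c, D c ->
     B0 eps c /\ continuous a c /\
     c = (RtoC (Cmod c) * (cos (a c), sin (a c)))%C).

Definition period1 (S : C -> R) (c : C) : R := pd1 S c - ln (Cmod c).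
Definition period2 (S a : C -> R) (c : C) : R := pd2 S c + a c.

Definition translate (S a : C -> R) (m n : Z) (p : pt) : pt :=
  (pc p, (pt1 p + IZR m * period1 S (pc p),
          pt2 p + IZR m * period2 S a (pc p) + IZR n * (2 * PI))).

Definition lattice_invariant {V : RNorm} (eps : R) (S : C -> R)
    (T : pt -> pt -> pt -> V) : Prop :=
  forall D a, arg_branch eps D a -> forall (m n : Z) (p : pt), D (pc p) ->
  exists dphi : pt -> pt,
    differential (U := E4) (V := E4) (translate S a m n) p dphi /\
    forall u v, T (translate S a m n p) (dphi u) (dphi v) = T p u v.

Definition tensor2 {V : RNorm} (eps : R) (S : C -> R)
    (T : pt -> pt -> pt -> V) : Prop :=
  (forall p, cover eps p -> is_bilinear (U := E4) (T p)) /\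
  (forall u v, smooth (U := E4) (cover eps) (fun p => T p u v)) /\
  lattice_invariant eps S T.

Definition two_form {V : RNorm} (eps : R) (S : C -> R)
    (T : pt -> pt -> pt -> V) : Prop :=
  tensor2 eps S T /\
  forall p, cover eps p -> forall u v, T p u v = opp (T p v u).

Definition riemannian (eps : R) (S : C -> R) (G : pt -> pt -> pt -> RR) : Prop :=
  tensor2 eps S G /\
  forall p, cover eps p ->
    (forall u v, G p u v = G p v u) /\
    (forall u : E4, u <> zero -> 0 < G p u u).

Definition complex_structure (eps : R) (S : C -> R) (J : pt -> pt -> pt) : Prop :=
  (forall p, cover eps p ->
     is_linear (U := E4) (V := E4) (J p) /\
     (forall u : E4, J p (J p u) = opp u)) /\
  (forall u, smooth (U := E4) (V := E4) (cover eps) (fun p => J p u)) /\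
  (forall p, cover eps p -> nijenhuis_zero (U := E4) J p) /\
  (forall D a, arg_branch eps D a -> forall (m n : Z) (p : pt), D (pc p) ->
   exists dphi : pt -> pt,
     differential (U := E4) (V := E4) (translate S a m n) p dphi /\
     forall u, J (translate S a m n p) (dphi u) = dphi (J p u)).

(** [J] is determined by [Om] through [Om (J u) v = i Om u v], i.e. by [Om] being
    of type (2,0); a closed form of type (2,0) is holomorphic. *)
Definition holomorphic_symplectic (eps : R) (S : C -> R)
    (J : pt -> pt -> pt) (Om : pt -> pt -> pt -> CR) : Prop :=
  two_form eps S Om /\
  forall p, cover eps p ->
    closed2 (U := E4) Om p /\
    (forall u v, Om p (J p u) v = (Ci * Om p u v)%C) /\
    (forall u : E4, (forall v, Om p u v = RtoC 0) -> u = zero).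

Definition kahler_form (eps : R) (S : C -> R) (J : pt -> pt -> pt)
    (G om : pt -> pt -> pt -> RR) : Prop :=
  two_form eps S om /\
  forall p, cover eps p ->
    closed2 (U := E4) om p /\
    (forall u v, G p (J p u) (J p v) = G p u v) /\
    (forall u v, om p u v = G p (J p u) v).

(** The forms [Om], [om] are the coefficients of a twistor family that gives the
    hyperkahler metric [G]. *)
Definition gives_hyperkahler (eps : R) (S : C -> R)
    (Om : pt -> pt -> pt -> CR) (om G : pt -> pt -> pt -> RR) : Prop :=
  riemannian eps S G /\
  (exists J, complex_structure eps S J /\
             holomorphic_symplectic eps S J Om /\
             kahler_form eps S J G om) /\
  (forall p, cover eps p -> forall u v w x,
     wedge22 (fun y z => RtoC (om p y z)) (fun y z => RtoC (om p y z)) u v w x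
     = (/ 2 * wedge22 (Om p) (fun y z => Cconj (Om p y z)) u v w x)%C).

(** * Instanton corrected Darboux coordinates

    [rad] is the parameter R, and [a] a local branch of the argument. *)

Definition lnC (a : C -> R) (c : C) : C := (ln (Cmod c), a c).

Definition Z_m (S St a : C -> R) (c : C) : C :=
  (/ RtoC (2 * PI) * (c - c * lnC a c + (S c, St c)))%C.

Definition Z_e (c : C) : C := (- Ci * c)%C.

Definition theta_e (S : C -> R) (p : pt) : R :=
  2 * PI * pt1 p / period1 S (pc p).

Definition theta_m (S a : C -> R) (p : pt) : R :=
  pt2 p - period2 S a (pc p) / period1 S (pc p) * pt1 p.

Definition chi_sf_m (rad : R) (S St a : C -> R) (zeta : C) (p : pt) : C :=
  Cexp (Ci * RtoC (PI * rad) / zeta * Z_m S St a (pc p)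
        - Ci * RtoC (theta_m S a p)
        - Ci * RtoC (PI * rad) * zeta * Cconj (Z_m S St a (pc p)))%C.

Definition chi_e (rad : R) (S : C -> R) (zeta : C) (p : pt) : C :=
  Cexp (Ci * RtoC (PI * rad) / zeta * Z_e (pc p)
        + Ci * RtoC (theta_e S p)
        - Ci * RtoC (PI * rad) * zeta * Cconj (Z_e (pc p)))%C.

(** [up], [um] are the directions of the rays [l_+], [l_-].  On these rays
    [chi_e], resp. [/ chi_e], has modulus < 1, so that the principal logarithm is
    the smooth one. *)
Definition chi_m (rad : R) (S St a : C -> R) (up um zeta : C) (p : pt) : C :=
  (chi_sf_m rad S St a zeta p *
   Cexp (Ci / RtoC (4 * PI) *
           ray_int up (fun z => (z + zeta) / (z - zeta)
                                * Clog (1 - chi_e rad S z p))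
         - Ci / RtoC (4 * PI) *
           ray_int um (fun z => (z + zeta) / (z - zeta)
                                * Clog (1 - / chi_e rad S z p))))%C.

Definition admissible_rays (c zeta up um : C) : Prop :=
  up <> RtoC 0 /\ um <> RtoC 0 /\
  Re (c / up)%C < 0 /\ 0 < Re (c / um)%C /\
  ~ on_ray up zeta /\ ~ on_ray um zeta.

(** [w] is the value at [p] of
    [1/(2 pi R) dchi_m/chi_m /\ dchi_e/chi_e].  The rays are kept fixed when
    differentiating: being admissible is an open condition on [c]. *)
Definition is_varpi (rad : R) (S St a : C -> R) (up um zeta : C) (p : pt)
    (w : pt -> pt -> C) : Prop :=
  exists dm de : pt -> C,
    differential (U := E4) (V := CR) (chi_m rad S St a up um zeta) p dm /\
    differential (U := E4) (V := CR) (chi_e rad S zeta) p de /\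
    forall u v,
      w u v = (/ RtoC (2 * PI * rad) *
               wedge11 (fun x => dm x / chi_m rad S St a up um zeta p)
                       (fun x => de x / chi_e rad S zeta p) u v)%C.

Definition twistor_family (rad eps : R) (S St : C -> R)
    (Om : pt -> pt -> pt -> C) (om : pt -> pt -> pt -> R) : Prop :=
  forall D a, arg_branch eps D a -> forall p : pt, D (pc p) ->
  forall zeta up um : C, zeta <> RtoC 0 -> admissible_rays (pc p) zeta up um ->
  is_varpi rad S St a up um zeta p
    (fun u v => (- / (2 * zeta) * Om p u v + RtoC (om p u v)
                 + zeta / 2 * Cconj (Om p u v))%C).

(** * The generalized Ooguri-Vafa metric *)

(** The regularization constants.  By Poisson summation the sum
    [sum_n (1 / sqrt (R^2 |c|^2 + (theta/2pi + n)^2) - kappa n)] has zeroth Fourier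
    coefficient in [theta] equal to
    [2 (ln (2/R) - gamma) - kappa 0 - 2 ln |c|],
    while the twistor construction with the charges [Z_m], [Z_e] above yields
    exactly [- 2 ln |c|]; this fixes [kappa 0].  The customary choice
    [kappa 0 = 0] is the case [R = 2 exp (- gamma)]; for other [R] it would shift
    the potential by a constant. *)
Definition kappa (rad : R) (n : Z) : R :=
  if Z.eq_dec n 0 then 2 * (ln (2 / rad) - Euler_gamma) else / Rabs (IZR n).

(** The function of [theta] minimized in the positivity condition. *)
Definition positivity_fun (rad theta : R) : Rbar :=
  if Req_EM_T (frac_part (theta / (2 * PI))) 0 then p_infty
  else Finite (/ 2 * ZSeries (fun n =>
         / Rabs (theta / (2 * PI) + IZR n) - kappa rad n)).

Definition is_min_on (a b : R) (f : R -> Rbar) (m : Rbar) : Prop :=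
  (exists x, a <= x <= b /\ f x = m) /\
  (forall x, a <= x <= b -> Rbar_le m (f x)).

Definition positivity_condition (rad : R) (S : C -> R) : Prop :=
  exists m, is_min_on 0 (2 * PI) (positivity_fun rad) m /\
            Rbar_lt (Rbar_opp m) (pd1 S (RtoC 0)).

(** Points of the base of the Gibbons-Hawking fibration are [(c, theta_e)]. *)
Definition E3 : RNorm := prod_NormedModule R_AbsRing CR RR.

Definition potential (rad : R) (S : C -> R) (x : C * R) : R :=
  rad / (4 * PI) *
  (ZSeries (fun n => / sqrt (rad ^ 2 * Cmod (fst x) ^ 2
                             + (snd x / (2 * PI) + IZR n) ^ 2) - kappa rad n)
   + 2 * pd1 S (fst x)).

Definition potential_pos (rad eps : R) (S : C -> R) : Prop :=
  forall x : C * R, B0 eps (fst x) -> 0 < potential rad S x.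

Definition A_sf (S a : C -> R) (x w : C * R) : C :=
  (Ci / RtoC (8 * PI ^ 2) *
   (lnC a (fst x) - Cconj (lnC a (fst x)) + 2 * Ci * RtoC (pd2 S (fst x)))
   * RtoC (snd w))%C.

(** [Z.sgn 0 = 0] removes the term [n = 0]. *)
Definition A_inst (rad : R) (x w : C * R) : C :=
  let c := fst x in
  (- RtoC (rad / (4 * PI)) * (fst w / c - Cconj (fst w) / Cconj c) *
   CZSeries (fun n =>
     RtoC (IZR (Z.sgn n)) * Cexp (Ci * RtoC (IZR n * snd x))
     * RtoC (Cmod c * BesselK1 (2 * PI * rad * Cmod (RtoC (IZR n) * c)))))%C.

Definition connection (rad : R) (S a : C -> R) (x w : C * R) : C :=
  (A_sf S a x w + A_inst rad x w)%C.

(** [dA = * dV] at [x], for the flat metric for which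
    [(c1, c2, theta_e / (2 pi R))] are oriented orthonormal coordinates. *)
Definition monopole_eq (rad : R) (S a : C -> R) (x : C * R) : Prop :=
  exists (dA : C * R -> C * R -> C) (dV : C * R -> R),
    (forall e, differential (U := E3) (V := CR)
                 (fun y => connection rad S a y e) x (dA e)) /\
    differential (U := E3) (V := RR) (potential rad S) x dV /\
    let e1 := ((1, 0) : C, 0) in
    let e2 := ((0, 1) : C, 0) in
    let e3 := ((0, 0) : C, 2 * PI * rad) in
    let ext u v := (dA v u - dA u v)%C in
    ext e2 e3 = RtoC (dV e1) /\
    ext e3 e1 = RtoC (dV e2) /\
    ext e1 e2 = RtoC (dV e3).

(** [g] is the value at [p] of the Gibbons-Hawking metric, with the orientation in
    which [theta_m] is replaced by [- theta_m]. *)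
Definition is_gibbons_hawking (rad : R) (S a : C -> R) (p : pt)
    (g : pt -> pt -> R) : Prop :=
  let x := (pc p, theta_e S p) in
  monopole_eq rad S a x /\
  exists dte dtm : pt -> R,
    differential (U := E4) (V := RR) (theta_e S) p dte /\
    differential (U := E4) (V := RR) (theta_m S a) p dtm /\
    let alpha u := (- RtoC (dtm u / (2 * PI))
                    + connection rad S a x (pc u, dte u))%C in
    forall u v,
      RtoC (g u v) =
      (RtoC (/ potential rad S x) * (alpha u * alpha v)
       + RtoC (potential rad S x *
               (Re (pc u) * Re (pc v) + Im (pc u) * Im (pc v)
                + dte u / (2 * PI * rad) * (dte v / (2 * PI * rad)))))%C.

Definition ooguri_vafa (rad eps : R) (S : C -> R) (g : pt -> pt -> pt -> R) : Prop :=
  forall D a, arg_branch eps D a -> forall p : pt, D (pc p) ->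
  is_gibbons_hawking rad S a p (g p).

(* Main.v *)
(** The kernel [K = (z + zeta) / (z - zeta)] of the ray integrals satisfies, for the
    exponents [E z = pi R (c / z + z cbar) + i theta_e] of [chi_e z],
      [K dE z = K dE zeta + pi R ((z + zeta) dcbar - (1 / zeta + 1 / z) dc)].
    Differentiating under the integral sign, [dlog chi_m] is therefore, modulo
    [dlog chi_e zeta], a combination of the integrals of [1], [z] and [1 / z] against
    [chi_e z / (1 - chi_e z)].  By an integration by parts these do not change when the
    ray rotates in its half plane, and [l_-] is reduced to [l_+] by
    [(z, zeta, theta_e) -> - (z, zeta, theta_e)].  Hence [varpi] has coefficients
    [Om = dc /\ w], [w = V / R dtheta_e + i beta], and
    [om = 2 pi V dc1 /\ dc2 + dtheta_e /\ beta / (2 pi R)], where [V] and the one-form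
    [beta] are explicit in these integrals.

    The derivatives of such integrals are integrals of the same kind; this gives the
    monopole equation, the closedness of [Om] and [om], and that [dw] is a multiple of
    [dc].  The forms [dc] and [w] being of type (1,0), the complex structure is
    integrable.

    Poisson summation identifies [V] with the potential: write [pi / sqrt (x^2 + v^2)]
    as the integral of [cosh y / (x^2 + sinh^2 y + v^2)], sum over the shifts of [v] by
    the Mittag-Leffler expansion of [sinh / (cosh - cos)], and fix the remaining
    constant by letting [x] tend to infinity.  Expanding [chi / (1 - chi)] in powers of
    [chi] turns [beta] into the Bessel series.  Positivity near [c = 0] is a comparison
    with the sum at [c = 0], which bounds the potential away from the points [theta_e]
    in [2 pi Z]; near those one term of the sum dominates. *)
Require Import Defs.
From Stdlib Require Import Reals ZArith Lra Lia FunctionalExtensionality IndefiniteDescription.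
From Coquelicot Require Import Coquelicot.
Import Defs.
Open Scope R_scope.

(** * Differentials *)

(** The rays of [chi_m] are free, so nothing may depend on a preferred one. All ray integrals are
    moved to the line by [z' = exp y * u] with [|u| = 1]: there [dz' / z'] is [dy], and the exponent
    of [chi_e] has real part [2 pi R Re (c / u) cosh y]. Every integrand is then bounded by a
    multiple of [1 / cosh y], and this single bound yields existence, estimates and differentiation
    under the integral sign.

    The functions that occur are moments of powers of [geo = chi / (1 - chi)] against
    [exp ((m - n) y)], a family closed under differentiation because [geo' = geo + geo ^ 2]. Taken
    in the direction [- c / |c|] they become functions of [(c, theta_e)] alone, smooth for [c <> 0]
    and [2 pi]-periodic in [theta_e].

    All tensors are written in the coframe [(dc, dtheta_e, beta)], which is invariant under the
    period lattice and involves no branch of the argument. The terms of [dlog chi_m] that do depend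
    on the branch or on the rays are multiples of [dlog chi_e], and the wedge product removes
    them. *)

Lemma norm_C (z : CR) : norm z = Cmod z.
Proof. symmetry. apply Cmod_norm. Qed.

(** The carriers of [CR] and [C] are convertible but not syntactically equal. [ring] and [field]
    work once the equation is restated on [C]; [toC] and [toR] do the same for the operations of the
    normed module. *)
Ltac asC := match goal with |- @eq _ ?a ?b => change (@eq C a b) end.
Ltac mult_pos := repeat match goal with |- 0 < ?a * ?b => apply Rmult_lt_0_compat end; try lra.
Ltac asR := match goal with |- @eq _ ?a ?b => change (@eq R a b) end.

Ltac toC := repeat match goal with
  | |- context [@norm ?K ?G ?a] => change (@norm K G a) with (@norm R_AbsRing CR a); rewrite (norm_C a)
  | |- context [@minus ?G ?a ?b] => change (@minus G a b) with (Cminus a b)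
  | |- context [@plus ?G ?a ?b] => change (@plus G a b) with (Cplus a b)
  | |- context [@opp ?G ?a] => change (@opp G a) with (Copp a)
  | |- context [@zero ?G] => change (@zero G) with (RtoC 0)
  end; try asC.
Ltac toR := repeat match goal with
  | |- context [@minus ?G ?a ?b] => change (@minus G a b) with (Rminus a b)
  | |- context [@plus ?G ?a ?b] => change (@plus G a b) with (Rplus a b)
  | |- context [@opp ?G ?a] => change (@opp G a) with (Ropp a)
  | |- context [@zero ?G] => change (@zero G) with 0%R
  | |- context [@scal ?G ?V ?a ?b] => change (@scal G V a b) with (Rmult a b)
  end; try asR.

Lemma differential_ext {U V : RNorm} (f : U -> V) p L L' :
  differential f p L -> (forall h, L h = L' h) -> differential f p L'.
Proof. intros H E. eapply filterdiff_ext_lin; eauto. Qed.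

Lemma differential_eq_near {U V : RNorm} (f g : U -> V) p L :
  locally p (fun q => f q = g q) -> differential f p L -> differential g p L.
Proof. apply filterdiff_ext_locally. Qed.

Lemma differential_comp {U V W : RNorm} (f : U -> V) (g : V -> W) p Lf Lg :
  differential f p Lf -> differential g (f p) Lg ->
  differential (fun q => g (f q)) p (fun h => Lg (Lf h)).
Proof. apply filterdiff_comp'. Qed.

Lemma differential_linear {U V : RNorm} (l : U -> V) p :
  is_linear l -> differential l p l.
Proof. apply filterdiff_linear. Qed.

Lemma differential_is_linear {U V : RNorm} (f : U -> V) p L :
  differential f p L -> is_linear L.
Proof. now intros [H _]. Qed.

Lemma differential_const {U V : RNorm} (k : V) (p : U) :
  differential (fun _ : U => k) p (fun _ => zero).
Proof. apply filterdiff_const. Qed.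

Lemma differential_plus {U V : RNorm} (f g : U -> V) p Lf Lg :
  differential f p Lf -> differential g p Lg ->
  differential (fun q => plus (f q) (g q)) p (fun h => plus (Lf h) (Lg h)).
Proof. apply filterdiff_plus_fct. Qed.

Lemma differential_opp {U V : RNorm} (f : U -> V) p L :
  differential f p L -> differential (fun q => opp (f q)) p (fun h => opp (L h)).
Proof. apply filterdiff_opp_fct. Qed.

Lemma is_linear_bounded {U V : RNorm} (l : U -> V) (M : R) :
  (forall x y, l (plus x y) = plus (l x) (l y)) ->
  (forall k x, l (scal k x) = scal k (l x)) ->
  (forall x, norm (l x) <= M * norm x) -> is_linear l.
Proof.
  intros H1 H2 H3. split; auto.
  exists (Rmax M 1). split.
  - eapply Rlt_le_trans; [|apply Rmax_r]; lra.
  - intros x. eapply Rle_trans; [apply H3|]. apply Rmult_le_compat_r; [apply norm_ge_0|apply Rmax_l].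
Qed.

Lemma norm_fst_le {U V : RNorm} (x : prod_NormedModule R_AbsRing U V) : norm (fst x) <= norm x.
Proof.
  eapply Rle_trans; [|apply (sqrt_plus_sqr (norm (fst x)) (norm (snd x)))].
  rewrite !Rabs_pos_eq by apply norm_ge_0. apply Rmax_l.
Qed.

Lemma norm_snd_le {U V : RNorm} (x : prod_NormedModule R_AbsRing U V) : norm (snd x) <= norm x.
Proof.
  eapply Rle_trans; [|apply (sqrt_plus_sqr (norm (fst x)) (norm (snd x)))].
  rewrite !Rabs_pos_eq by apply norm_ge_0. apply Rmax_r.
Qed.

Lemma is_linear_pair_l {U V : RNorm} :
  is_linear (fun x : U => ((x, zero) : prod_NormedModule R_AbsRing U V)).
Proof.
  apply is_linear_bounded with (M := 1).
  - intros x y. apply (f_equal2 pair); auto. symmetry. apply plus_zero_l.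
  - intros k x. apply (f_equal2 pair); auto. symmetry. apply (@scal_zero_r R_AbsRing).
  - intros x. rewrite Rmult_1_l. unfold norm at 1; simpl. unfold prod_norm; simpl.
    rewrite (@norm_zero _ V). replace (norm x * (norm x * 1) + 0 * (0 * 1)) with (Rsqr (norm x)) by (unfold Rsqr; ring).
    rewrite sqrt_Rsqr; [apply Rle_refl | apply norm_ge_0].
Qed.

Lemma is_linear_pair_r {U V : RNorm} :
  is_linear (fun x : V => ((zero, x) : prod_NormedModule R_AbsRing U V)).
Proof.
  apply is_linear_bounded with (M := 1).
  - intros x y. apply (f_equal2 pair); auto. symmetry. apply plus_zero_l.
  - intros k x. apply (f_equal2 pair); auto. symmetry. apply (@scal_zero_r R_AbsRing).
  - intros x. rewrite Rmult_1_l. unfold norm at 1; simpl. unfold prod_norm; simpl.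
    rewrite (@norm_zero _ U). replace (0 * (0 * 1) + norm x * (norm x * 1)) with (Rsqr (norm x)) by (unfold Rsqr; ring).
    rewrite sqrt_Rsqr; [apply Rle_refl | apply norm_ge_0].
Qed.

Lemma is_linear_fst {U V : RNorm} : is_linear (fun x : prod_NormedModule R_AbsRing U V => fst x).
Proof.
  apply is_linear_bounded with (M := 1); auto.
  intros x. rewrite Rmult_1_l. apply norm_fst_le.
Qed.

Lemma is_linear_snd {U V : RNorm} : is_linear (fun x : prod_NormedModule R_AbsRing U V => snd x).
Proof.
  apply is_linear_bounded with (M := 1); auto.
  intros x. rewrite Rmult_1_l. apply norm_snd_le.
Qed.

Lemma differential_pair {U V W : RNorm} (f : U -> V) (g : U -> W) p Lf Lg :
  differential f p Lf -> differential g p Lg ->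
  differential (V := prod_NormedModule R_AbsRing V W)
    (fun q => (f q, g q)) p (fun h => (Lf h, Lg h)).
Proof.
  intros Hf Hg.
  assert (H := differential_plus _ _ _ _ _
     (differential_comp _ _ _ _ _ Hf (differential_linear _ _ (is_linear_pair_l (V := W))))
     (differential_comp _ _ _ _ _ Hg (differential_linear _ _ (is_linear_pair_r (U := V))))).
  simpl in H.
  assert (E : forall (a : V) (b : W), plus ((a, zero) : prod_NormedModule R_AbsRing V W) (zero, b) = (a, b)).
  { intros a b. apply (f_equal2 pair); [apply plus_zero_r|apply plus_zero_l]. }
  eapply differential_eq_near; [|eapply differential_ext; [apply H|]].
  - apply filter_forall. intros q. apply E.
  - intros h. apply E.
Qed.

Lemma differential_fst {U V W : RNorm} (f : U -> prod_NormedModule R_AbsRing V W) p L :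
  differential f p L -> differential (fun q => fst (f q)) p (fun h => fst (L h)).
Proof. intros H. apply (differential_comp _ _ _ _ _ H (differential_linear _ _ is_linear_fst)). Qed.

Lemma differential_snd {U V W : RNorm} (f : U -> prod_NormedModule R_AbsRing V W) p L :
  differential f p L -> differential (fun q => snd (f q)) p (fun h => snd (L h)).
Proof. intros H. apply (differential_comp _ _ _ _ _ H (differential_linear _ _ is_linear_snd)). Qed.

Lemma differential_continuous {U V : RNorm} (f : U -> V) p L :
  differential f p L -> continuous f p.
Proof. intros H. apply filterdiff_continuous. now exists L. Qed.

Lemma differential_Rmult {U : RNorm} (f g : U -> RR) p Lf Lg :
  differential f p Lf -> differential g p Lg ->
  differential (V := RR) (fun q => f q * g q) p (fun h => Lf h * g p + f p * Lg h).
Proof. apply (filterdiff_mult_fct (K := R_AbsRing)). apply Rmult_comm. Qed.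

Lemma differential_Rcomp {U : RNorm} (f : U -> RR) (g : R -> R) p L d :
  differential f p L -> is_derive g (f p) d ->
  differential (V := RR) (fun q => g (f q)) p (fun h => L h * d).
Proof. intros Hf Hg. apply (differential_comp (V := RR) (W := RR) f g p L _ Hf Hg). Qed.

Lemma is_derive_differential {V : RNorm} (f : RR -> V) (x : R) (l : V) :
  is_derive f x l <-> differential f x (fun h : RR => scal h l).
Proof. reflexivity. Qed.

Lemma differential_of_derive (f : R -> R) (x l : R) :
  is_derive f x l -> differential (U := RR) (V := RR) f x (fun h => h * l).
Proof. intros H. exact H. Qed.

Lemma differential_derive {V : RNorm} (f : RR -> V) x L :
  differential f x L -> is_derive f x (L 1).
Proof.
  intros H. apply (differential_ext (U := RR) _ _ _ _ H). intros h.
  rewrite <- (linear_scal L (differential_is_linear _ _ _ H)). f_equal.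
  symmetry. apply Rmult_1_r.
Qed.

Lemma differential_line {U V : RNorm} (f : U -> V) p h t L :
  differential f (plus p (scal t h)) L ->
  is_derive (fun s : R => f (plus p (scal s h))) t (L h).
Proof.
  intros H.
  replace (L h) with ((fun s : RR => L (scal s h)) 1) by (simpl; f_equal; apply (scal_one h)).
  apply (differential_derive (fun s : RR => f (plus p (scal s h))) t (fun s : RR => L (scal s h))).
  apply (differential_comp (fun s : RR => plus p (scal s h)) f t (fun s => scal s h) L); auto.
  eapply differential_ext.
  - apply differential_plus; [apply differential_const|].
    apply (filterdiff_scal_l (K := R_AbsRing)).
  - intros s. simpl. apply plus_zero_l.
Qed.

Lemma differential_Re {U : RNorm} (f : U -> CR) p L :
  differential f p L -> differential (V := RR) (fun q => Re (f q)) p (fun h => Re (L h)).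
Proof. apply (differential_fst (V := RR) (W := RR)). Qed.

Lemma differential_Im {U : RNorm} (f : U -> CR) p L :
  differential f p L -> differential (V := RR) (fun q => Im (f q)) p (fun h => Im (L h)).
Proof. apply (differential_snd (V := RR) (W := RR)). Qed.

Lemma differential_Cpair {U : RNorm} (f g : U -> RR) p Lf Lg :
  differential f p Lf -> differential g p Lg ->
  differential (V := CR) (fun q => (f q, g q)) p (fun h => (Lf h, Lg h)).
Proof. apply (differential_pair (V := RR) (W := RR)). Qed.

Lemma differential_Cplus {U : RNorm} (f g : U -> CR) p Lf Lg :
  differential f p Lf -> differential g p Lg ->
  differential (V := CR) (fun q => (f q + g q)%C) p (fun h => (Lf h + Lg h)%C).
Proof. apply (differential_plus (V := CR)). Qed.

Lemma differential_Ropp {U : RNorm} (f : U -> RR) p L :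
  differential f p L -> differential (V := RR) (fun q => - f q) p (fun h => - L h).
Proof. apply (differential_opp (V := RR)). Qed.

Lemma differential_Rplus {U : RNorm} (f g : U -> RR) p Lf Lg :
  differential f p Lf -> differential g p Lg ->
  differential (V := RR) (fun q => f q + g q) p (fun h => Lf h + Lg h).
Proof. apply (differential_plus (V := RR)). Qed.

Lemma differential_Rminus {U : RNorm} (f g : U -> RR) p Lf Lg :
  differential f p Lf -> differential g p Lg ->
  differential (V := RR) (fun q => f q - g q) p (fun h => Lf h - Lg h).
Proof. intros Hf Hg. apply differential_Rplus; auto. now apply differential_Ropp. Qed.

#[global] Opaque differential.

Lemma differential_Cmult {U : RNorm} (f g : U -> CR) p Lf Lg :
  differential f p Lf -> differential g p Lg ->
  differential (V := CR) (fun q => (f q * g q)%C) p (fun h => (Lf h * g p + f p * Lg h)%C).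
Proof.
  intros Hf Hg.
  assert (Hfr := differential_Re _ _ _ Hf). assert (Hfi := differential_Im _ _ _ Hf).
  assert (Hgr := differential_Re _ _ _ Hg). assert (Hgi := differential_Im _ _ _ Hg).
  assert (H := differential_Cpair _ _ _ _ _
    (differential_Rminus _ _ _ _ _ (differential_Rmult _ _ _ _ _ Hfr Hgr) (differential_Rmult _ _ _ _ _ Hfi Hgi))
    (differential_Rplus _ _ _ _ _ (differential_Rmult _ _ _ _ _ Hfr Hgi) (differential_Rmult _ _ _ _ _ Hfi Hgr))).
  apply (differential_ext _ _ _ _ H). clear. intros h. destruct (f p) as [a b], (g p) as [c d], (Lf h) as [a' b'], (Lg h) as [c' d'].
    simpl. unfold Cmult, Cplus; simpl. f_equal; ring.
Qed.

Lemma differential_Cmult_const {U : RNorm} (f : U -> CR) (k : C) p L :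
  differential f p L ->
  differential (V := CR) (fun q => (k * f q)%C) p (fun h => (k * L h)%C).
Proof.
  intros H. eapply differential_ext.
  - apply differential_Cmult; [apply (differential_const (V := CR) k)|apply H].
  - intros h. cbv beta. change (@zero CR) with (RtoC 0). asC. ring.
Qed.

Lemma differential_Copp {U : RNorm} (f : U -> CR) p L :
  differential f p L -> differential (V := CR) (fun q => (- f q)%C) p (fun h => (- L h)%C).
Proof. apply (differential_opp (V := CR)). Qed.

Lemma differential_Cminus {U : RNorm} (f g : U -> CR) p Lf Lg :
  differential f p Lf -> differential g p Lg ->
  differential (V := CR) (fun q => (f q - g q)%C) p (fun h => (Lf h - Lg h)%C).
Proof. intros Hf Hg. apply differential_Cplus; auto. now apply differential_Copp. Qed.

Lemma differential_Cconj {U : RNorm} (f : U -> CR) p L :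
  differential f p L -> differential (V := CR) (fun q => Cconj (f q)) p (fun h => Cconj (L h)).
Proof.
  intros H. apply differential_Cpair; [|apply differential_Ropp];
  first [apply differential_Re | apply differential_Im]; assumption.
Qed.

Lemma differential_RtoC {U : RNorm} (f : U -> RR) p L :
  differential f p L -> differential (V := CR) (fun q => RtoC (f q)) p (fun h => RtoC (L h)).
Proof. intros H. apply differential_Cpair; auto. apply (differential_const (V := RR)). Qed.

#[global] Transparent differential.

(** All remainder estimates below come in quadratic form, for the complex inverse as well as for
    integrals with a parameter; such a remainder is [o(|h|)]. *)
Lemma differential_quadratic {U V : RNorm} (f : U -> V) p L r K :
  0 < r -> is_linear L ->
  (forall q, norm (minus q p) < r ->
     norm (minus (minus (f q) (f p)) (L (minus q p))) <= K * (norm (minus q p)) ^ 2) ->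
  differential f p L.
Proof.
  intros Hr HL H. split; auto. intros x Hx.
  apply (is_filter_lim_locally_unique p x) in Hx. subst x.
  intros [e He].
  (* On this radius [K * n <= e]; the [+ 1] keeps the denominator positive. *)
  assert (Hd : 0 < Rmin r (e / (Rabs K + 1))).
  { apply Rmin_glb_lt; auto. apply Rdiv_lt_0_compat; auto. pose proof (Rabs_pos K); lra. }
  apply (locally_le_locally_norm p). exists (mkposreal _ Hd). intros q Hq.
  unfold ball_norm in Hq; simpl in Hq |- *.
  set (n := norm (minus q p)) in *.
  assert (Hn : 0 <= n) by apply norm_ge_0.
  assert (Hn1 : n < r) by (eapply Rlt_le_trans; [apply Hq|apply Rmin_l]).
  assert (Hn2 : n < e / (Rabs K + 1)) by (eapply Rlt_le_trans; [apply Hq|apply Rmin_r]).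
  eapply Rle_trans; [apply H; assumption|]. fold n.
  pose proof (Rabs_pos K). pose proof (Rle_abs K).
  assert (Hk : n * (Rabs K + 1) <= e).
  { apply (Rmult_lt_compat_r (Rabs K + 1)) in Hn2; [|lra].
    unfold Rdiv in Hn2. rewrite Rmult_assoc, Rinv_l in Hn2; lra. }
  simpl. rewrite Rmult_1_r. rewrite <- Rmult_assoc.
  apply Rmult_le_compat_r; auto. nra.
Qed.

#[global] Opaque differential.

Lemma is_linear_Cmult (k : C) : is_linear (U := CR) (V := CR) (fun h => (k * h)%C).
Proof.
  apply is_linear_bounded with (M := Cmod k).
  - intros x y. apply Cmult_plus_distr_l.
  - intros a x. destruct x, k. unfold scal; simpl. unfold prod_scal, Cmult, scal; simpl.
    unfold mult; simpl. f_equal; ring.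
  - intros x. rewrite !norm_C, Cmod_mult. apply Rle_refl.
Qed.

Lemma differential_Cinv (z : C) : z <> RtoC 0 ->
  differential (U := CR) (V := CR) Cinv z (fun h => (- / (z * z) * h)%C).
Proof.
  intros Hz. assert (Hp : 0 < Cmod z) by (now apply Cmod_gt_0).
  (* The remainder is exactly [(q - z)^2 / (z^2 q)], and [|q| >= |z| / 2] on this ball. *)
  apply differential_quadratic with (r := Cmod z / 2) (K := 2 / Cmod z ^ 3); try lra.
  - apply is_linear_Cmult.
  - intros q. toC.
    intros Hq.
    assert (Hq0 : Cmod z / 2 <= Cmod q).
    { pose proof (Cmod_triangle q (- (q - z))) as H. rewrite Cmod_opp in H.
      replace (q + - (q - z))%C with z in H by ring. lra. }
    assert (Hqn : q <> RtoC 0) by (apply Cmod_gt_0; lra).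
    replace (/ q - / z - - / (z * z) * (q - z))%C
      with ((q - z) * (q - z) / (z * z * q))%C.
    2:{ toC. field. tauto. }
    rewrite Cmod_div, !Cmod_mult.
    2:{ repeat apply Cmult_neq_0; auto. }
    replace (2 / Cmod z ^ 3 * Cmod (q - z) ^ 2)
      with (Cmod (q - z) * Cmod (q - z) * (/ (Cmod z * Cmod z * (Cmod z / 2)))) by (field; lra).
    apply Rmult_le_compat_l; [nra|].
    apply Rinv_le_contravar; [repeat apply Rmult_lt_0_compat; lra|].
    apply Rmult_le_compat_l; [nra|lra].
Qed.

Lemma differential_Cinv_fct {U : RNorm} (f : U -> CR) p L : f p <> RtoC 0 ->
  differential f p L ->
  differential (V := CR) (fun q => (/ f q)%C) p (fun h => (- / (f p * f p) * L h)%C).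
Proof.
  intros Hz H. apply (differential_comp f (Cinv : CR -> CR)); auto. now apply differential_Cinv.
Qed.

(** * The complex exponential *)

Lemma Cexp_plus a b : Cexp (a + b)%C = (Cexp a * Cexp b)%C.
Proof.
  destruct a, b. unfold Cexp, Cmult, Cplus; simpl. rewrite exp_plus, cos_plus, sin_plus. apply injective_projections; simpl; ring.
Qed.

Lemma Cmod_Cexp z : Cmod (Cexp z) = exp (Re z).
Proof.
  unfold Cexp, Cmod; simpl.
  replace (_ + _) with (Rsqr (exp (Re z)) * (Rsqr (sin (Im z)) + Rsqr (cos (Im z)))) by (unfold Rsqr; ring).
  rewrite sin2_cos2, Rmult_1_r. apply sqrt_Rsqr. left. apply exp_pos.
Qed.

Lemma Cexp_neq_0 z : Cexp z <> RtoC 0.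
Proof. apply Cmod_gt_0. rewrite Cmod_Cexp. apply exp_pos. Qed.

Lemma Cexp_0 : Cexp 0 = RtoC 1.
Proof. unfold Cexp; simpl. rewrite exp_0, cos_0, sin_0. unfold RtoC. f_equal; ring. Qed.

Lemma Cexp_opp z : Cexp (- z)%C = (/ Cexp z)%C.
Proof.
  assert (H : (Cexp (- z) * Cexp z)%C = RtoC 1).
  { rewrite <- Cexp_plus, <- Cexp_0. f_equal. ring. }
  pose proof (Cexp_neq_0 z).
  replace (/ Cexp z)%C with ((Cexp (- z) * Cexp z) * / Cexp z)%C by (rewrite H; ring).
  field; auto.
Qed.

Lemma Cexp_conj z : Cconj (Cexp z) = Cexp (Cconj z).
Proof. destruct z. unfold Cexp, Cconj; simpl. rewrite cos_neg, sin_neg. apply injective_projections; simpl; ring. Qed.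

Lemma differential_Cexp_fct {U : RNorm} (f : U -> CR) p L :
  differential f p L ->
  differential (V := CR) (fun q => Cexp (f q)) p (fun h => (Cexp (f p) * L h)%C).
Proof.
  intros H. assert (HR := differential_Re _ _ _ H). assert (HI := differential_Im _ _ _ H).
  assert (He := differential_Rcomp _ exp _ _ _ HR (is_derive_exp _)).
  assert (Hc := differential_Rcomp _ cos _ _ _ HI (is_derive_cos _)).
  assert (Hs := differential_Rcomp _ sin _ _ _ HI (is_derive_sin _)).
  assert (K := differential_Cpair _ _ _ _ _ (differential_Rmult _ _ _ _ _ He Hc) (differential_Rmult _ _ _ _ _ He Hs)).
  apply (differential_ext _ _ _ _ K). clear. intros h. destruct (f p) as [a b], (L h) as [c d].
  unfold Cexp, Cmult. apply injective_projections; simpl; ring.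
Qed.

(** * Smoothness *)

Lemma is_linear_continuous {U V : RNorm} (l : U -> V) p : is_linear l -> continuous l p.
Proof. intros H. apply (differential_continuous _ _ l). now apply differential_linear. Qed.

Lemma Cn_ext {U V : RNorm} n (D : U -> Prop) (f g : U -> V) :
  open D -> (forall p, D p -> f p = g p) -> Cn n D f -> Cn n D g.
Proof.
  intros HD E H. destruct n as [|n].
  - intros p Hp. apply (continuous_ext_loc g f p); [|now apply H].
    generalize (HD p Hp). apply filter_imp. intros q Hq. now apply E.
  - destruct H as [df [H1 H2]]. exists df. split; auto. intros p Hp.
    apply (differential_eq_near f); [|now apply H1].
    generalize (HD p Hp). apply filter_imp. auto.
Qed.

Lemma Cn_pred {U V : RNorm} n (D : U -> Prop) : forall f : U -> V, Cn (S n) D f -> Cn n D f.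
Proof.
  induction n as [|n IH]; intros f [df [H1 H2]].
  - intros p Hp. now apply (differential_continuous _ _ (df p)), H1.
  - exists df. split; [exact H1|]. intros v. apply IH, H2.
Qed.

Lemma Cn_const {U V : RNorm} n (D : U -> Prop) : forall k : V, Cn n D (fun _ : U => k).
Proof.
  induction n as [|n IH]; intros k.
  - intros p _. apply continuous_const.
  - exists (fun _ _ => zero). split; [|intros v; apply IH].
    intros p _. apply differential_const.
Qed.

Lemma Cn_linear {U V : RNorm} n (D : U -> Prop) (l : U -> V) : is_linear l -> Cn n D l.
Proof.
  intros Hl. destruct n as [|n].
  - intros p _. now apply is_linear_continuous.
  - exists (fun _ => l). split; [|intros v; apply Cn_const]. intros p _. now apply differential_linear.
Qed.

Lemma Cn_plus {U V : RNorm} n (D : U -> Prop) : forall f g : U -> V,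
  Cn n D f -> Cn n D g -> Cn n D (fun p => plus (f p) (g p)).
Proof.
  induction n as [|n IH]; intros f g Hf Hg.
  - intros p Hp. apply (continuous_plus f g); auto.
  - destruct Hf as [df [Hf1 Hf2]], Hg as [dg [Hg1 Hg2]].
    exists (fun p v => plus (df p v) (dg p v)). split.
    + intros p Hp. apply differential_plus; auto.
    + intros v. apply IH; auto.
Qed.

Lemma Cn_lin_post {U V W : RNorm} n (D : U -> Prop) (l : V -> W) : is_linear l ->
  forall f : U -> V, Cn n D f -> Cn n D (fun p => l (f p)).
Proof.
  intros Hl. induction n as [|n IH]; intros f Hf.
  - intros p Hp. apply (continuous_comp f l); auto. now apply is_linear_continuous.
  - destruct Hf as [df [H1 H2]]. exists (fun p v => l (df p v)). split.
    + intros p Hp. apply (differential_comp f l p); auto. now apply differential_linear.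
    + intros v. apply IH, H2.
Qed.

Lemma Cn_lin_pre {U V W : RNorm} n (D : V -> Prop) (l : U -> V) : is_linear l ->
  forall f : V -> W, Cn n D f -> Cn n (fun p => D (l p)) (fun p => f (l p)).
Proof.
  intros Hl. induction n as [|n IH]; intros f Hf.
  - intros p Hp. apply (continuous_comp l f); auto. now apply is_linear_continuous.
  - destruct Hf as [df [H1 H2]]. exists (fun p v => df (l p) (l v)). split.
    + intros p Hp. apply (differential_comp l f p); auto. now apply differential_linear.
    + intros v. apply (IH (fun q => df q (l v))), H2.
Qed.

Lemma Cn_pair {U V W : RNorm} n (D : U -> Prop) (f : U -> V) (g : U -> W) :
  Cn n D f -> Cn n D g ->
  Cn (V := prod_NormedModule R_AbsRing V W) n D (fun p => (f p, g p)).
Proof.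
  revert f g. induction n as [|n IH]; intros f g Hf Hg.
  - intros p Hp P [e He].
    assert (H1 := proj1 (filterlim_locally f (f p)) (Hf p Hp) e).
    assert (H2 := proj1 (filterlim_locally g (g p)) (Hg p Hp) e).
    unfold filtermap. generalize (filter_and _ _ H1 H2). apply filter_imp. intros q [Q1 Q2]. apply He. now split.
  - destruct Hf as [df [H1 H2]], Hg as [dg [H3 H4]].
    exists (fun p v => (df p v, dg p v)). split.
    + intros p Hp. apply differential_pair; auto.
    + intros v. apply IH; auto.
Qed.

Lemma continuous_Cmult {U : UniformSpace} (f g : U -> CR) p :
  continuous f p -> continuous g p -> continuous (U := CR) (fun q => (f q * g q)%C) p.
Proof.
  intros Hf Hg.
  assert (H : continuous (T := prod_UniformSpace CR CR) (U := CR) (fun z : C * C => (fst z * snd z)%C) (f p, g p)).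
  { apply (differential_continuous (U := prod_NormedModule R_AbsRing CR CR) (V := CR) _ _ 
      (fun h => (fst h * snd (f p, g p) + fst (f p, g p) * snd h)%C)).
    apply (differential_Cmult (U := prod_NormedModule R_AbsRing CR CR) (fun z => fst z) (fun z => snd z));
      apply differential_linear; [apply is_linear_fst|apply is_linear_snd]. }
  apply (continuous_comp_2 (U := U) (V := CR) (W := CR) (X := CR) f g (fun a b => (a * b)%C)); auto.
Qed.

Lemma Cn_Cmult {U : RNorm} n (D : U -> Prop) : forall f g : U -> CR,
  Cn n D f -> Cn n D g -> Cn (V := CR) n D (fun p => (f p * g p)%C).
Proof.
  induction n as [|n IH]; intros f g Hf Hg.
  - intros p Hp. apply continuous_Cmult; auto.
  - assert (Hf' := Cn_pred _ _ _ Hf). assert (Hg' := Cn_pred _ _ _ Hg).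
    destruct Hf as [df [Hf1 Hf2]], Hg as [dg [Hg1 Hg2]].
    exists (fun p v => (df p v * g p + f p * dg p v)%C). split.
    + intros p Hp. apply differential_Cmult; auto.
    + intros v. apply (Cn_plus (V := CR)); apply IH; auto.
Qed.

(** The derivative [- f' / f^2] contains [1 / f] itself, but one order lower, so the induction
    hypothesis applies to it. *)
Lemma Cn_Cinv {U : RNorm} n (D : U -> Prop) (f : U -> CR) : (forall p, D p -> f p <> RtoC 0) ->
  Cn n D f -> Cn (V := CR) n D (fun p => (/ f p)%C).
Proof.
  intros Hn. induction n as [|n IH]; intros Hf.
  - intros p Hp. apply (continuous_comp (U := U) (V := CR) (W := CR) f Cinv); auto.
    eapply (differential_continuous (U := CR) (V := CR)). apply differential_Cinv. auto.
  - assert (Hf' := IH (Cn_pred _ _ _ Hf)).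
    destruct Hf as [df [Hf1 Hf2]].
    exists (fun p v => (- (/ f p * / f p) * df p v)%C). split.
    + intros p Hp. eapply differential_ext; [apply differential_Cinv_fct; eauto|].
      intros h. simpl. assert (f p <> RtoC 0) by auto. toC. field. auto.
    + intros v. apply (Cn_Cmult (U := U)); auto.
      apply (Cn_lin_post (V := CR) (W := CR) n D Copp).
      * apply (is_linear_opp (V := CR)).
      * now apply Cn_Cmult.
Qed.

(** * Integrals over the line *)

Notation CC := C_R_CompleteNormedModule.

Definition IntR (f : R -> C) : C :=
  RInt_gen (V := CC) f (Rbar_locally m_infty) (Rbar_locally p_infty).

Definition is_Int (f : R -> C) (l : C) : Prop :=
  is_RInt_gen (V := CR) f (Rbar_locally m_infty) (Rbar_locally p_infty) l.

(** Decay like [1 / cosh y], whose antiderivative [2 atan (exp y)] is elementary. *)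
Definition sech_bounded (K : R) (f : R -> C) : Prop :=
  (forall y, continuous (U := CR) f y) /\ (forall y, Cmod (f y) <= K / cosh y).

Lemma cosh_ge_1 y : 1 <= cosh y.
Proof.
  unfold cosh. rewrite exp_Ropp. pose proof (exp_pos y). set (e := exp y) in *.
  apply Rmult_le_reg_l with (2 * e); [lra|].
  replace (2 * e * ((e + / e) / 2)) with (e * e + 1) by (field; lra).
  pose proof (Rle_0_sqr (e - 1)) as H1. unfold Rsqr in H1. lra.
Qed.

Lemma cosh_gt_0 y : 0 < cosh y.
Proof. pose proof (cosh_ge_1 y). lra. Qed.

Lemma exp_le_cosh y : exp y <= 2 * cosh y.
Proof. unfold cosh. pose proof (exp_pos (- y)). lra. Qed.

Lemma exp_neg_le_cosh y : exp (- y) <= 2 * cosh y.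
Proof. unfold cosh. pose proof (exp_pos y). lra. Qed.

Lemma cosh_neg y : cosh (- y) = cosh y.
Proof. unfold cosh. rewrite Ropp_involutive. lra. Qed.

Lemma is_derive_cosh y : is_derive cosh y (sinh y).
Proof. unfold cosh, sinh. auto_derive; auto. lra. Qed.

Lemma is_derive_sinh y : is_derive sinh y (cosh y).
Proof. unfold cosh, sinh. auto_derive; auto. lra. Qed.

Lemma continuous_of_derive {V : RNorm} (f : R -> V) (y : R) (l : V) : is_derive f y l -> continuous f y.
Proof. intros H. apply (ex_derive_continuous (K := R_AbsRing) f y). now exists l. Qed.

Lemma is_RInt_sech K a b :
  is_RInt (fun y => K / cosh y) a b (K * (2 * atan (exp b) - 2 * atan (exp a))).
Proof.
  assert (H : is_RInt (V := R_CompleteNormedModule) (fun y => K / cosh y) a b (minus (K * (2 * atan (exp b))) (K * (2 * atan (exp a))))).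
  { apply (is_RInt_derive (V := R_CompleteNormedModule) (fun y => K * (2 * atan (exp y)))).
    - intros x _. auto_derive; auto. unfold cosh. rewrite exp_Ropp. pose proof (exp_pos x).
      field. split; nra.
    - intros x _. apply (continuous_of_derive (V := RR) _ _ (- K * sinh x / cosh x ^ 2)).
      pose proof (cosh_gt_0 x). unfold cosh, sinh in *. auto_derive; [lra|]. field. lra. }
  replace (K * (2 * atan (exp b) - 2 * atan (exp a))) with (minus (K * (2 * atan (exp b))) (K * (2 * atan (exp a)))); [exact H|].
  toR. ring.
Qed.

Lemma sech_K_ge_0 K f : sech_bounded K f -> 0 <= K.
Proof.
  intros [_ H]. specialize (H 0). rewrite cosh_0 in H. pose proof (Cmod_ge_0 (f 0)). lra.
Qed.

Lemma sech_ex_RInt K f a b : sech_bounded K f -> ex_RInt (V := CR) f a b.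
Proof. intros [H _]. apply (ex_RInt_continuous (V := CC)). intros; apply H. Qed.

(** The variation of the antiderivative of [K / cosh] bounds the integral. In this form it is a
    Lipschitz estimate in the bounded variable [atan (exp y)]. *)
Lemma sech_RInt_bound K f a b : sech_bounded K f ->
  Cmod (RInt (V := CC) f a b) <= K * (2 * Rabs (atan (exp b) - atan (exp a))).
Proof.
  intros Hf.
  assert (H0 := sech_K_ge_0 _ _ Hf).
  assert (H : forall a b, a <= b ->
    Cmod (RInt (V := CC) f a b) <= K * (2 * Rabs (atan (exp b) - atan (exp a)))).
  { clear a b. intros a b Hab.
    assert (Hi := RInt_correct (V := CC) f a b (sech_ex_RInt _ _ a b Hf)).
    assert (H := norm_RInt_le (V := CR) f (fun y => K / cosh y) a b _ _ Hab (fun x _ => eq_ind_r (fun t => t <= _) (proj2 Hf x) (norm_C _)) Hi (is_RInt_sech K a b)).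
    rewrite norm_C in H. eapply Rle_trans; [apply H|].
    apply Rmult_le_compat_l; auto. pose proof (Rle_abs (atan (exp b) - atan (exp a))). lra. }
  destruct (Rle_dec a b) as [Hab|Hab]; [now apply H|].
  rewrite <- opp_RInt_swap by (apply (ex_RInt_swap (V := CR)); eapply sech_ex_RInt; eauto).
  rewrite Rabs_minus_sym.
  apply Rle_trans with (Cmod (RInt (V := CC) f b a)); [|apply H; lra].
  right. apply Cmod_opp.
Qed.

Lemma continuous_atan (x : R) : continuous (T := R_UniformSpace) (U := R_UniformSpace) atan x.
Proof. eapply (continuous_of_derive (V := RR)), is_derive_atan. Qed.

Lemma lim_atan_exp_m : filterlim (fun y => atan (exp y)) (Rbar_locally m_infty) (locally 0).
Proof.
  rewrite <- atan_0. apply (filterlim_comp _ _ _ exp atan _ (locally 0)); [apply is_lim_exp_m|].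
  apply continuous_atan.
Qed.

Lemma lim_atan_exp_p : filterlim (fun y => atan (exp y)) (Rbar_locally p_infty) (locally (PI / 2)).
Proof.
  apply (filterlim_ext (fun y => PI / 2 - atan (exp (- y)))).
  { intros y. rewrite exp_Ropp, atan_inv by apply exp_pos. ring. }
  replace (locally (PI / 2)) with (locally (PI / 2 - atan 0)) by (f_equal; rewrite atan_0; ring).
  apply (filterlim_comp _ _ _ (fun y => exp (- y)) (fun e => PI / 2 - atan e) _ (locally 0)).
  - apply (filterlim_comp _ _ _ Ropp exp _ (Rbar_locally m_infty)); [apply (filterlim_Rbar_opp p_infty)|apply is_lim_exp_m].
  - apply (continuous_minus (V := RR) (fun _ => PI / 2) atan 0); [apply continuous_const|apply continuous_atan].
Qed.

(** The primitive from 0 is a Lipschitz function of [atan (exp y)], which has a limit at either end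
    of the line; completeness of [C] then gives the limits of the primitive. *)
Lemma sech_is_Int K f : sech_bounded K f -> exists l, is_Int f l.
Proof.
  intros Hf. assert (H0 := sech_K_ge_0 _ _ Hf).
  set (F := fun y => RInt (V := CC) f 0 y).
  assert (HF : forall a b, is_RInt (V := CC) f a b (minus (F b) (F a))).
  { intros a b. unfold F, minus. rewrite plus_comm, opp_RInt_swap by (eapply sech_ex_RInt; eauto).
    apply (is_RInt_Chasles (V := CC)) with 0; apply (RInt_correct (V := CC)); eapply sech_ex_RInt; eauto. }
  assert (HFb : forall a b, Cmod (F b - F a) <= K * (2 * Rabs (atan (exp b) - atan (exp a)))).
  { intros a b. assert (E : RInt (V := CC) f a b = (F b - F a)%C) by exact (is_RInt_unique (V := CC) _ _ _ _ (HF a b)).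
    rewrite <- E. now apply sech_RInt_bound. }
  assert (Hcau : forall (G : (R -> Prop) -> Prop) (FG : ProperFilter G) (m : R),
     filterlim (fun y => atan (exp y)) G (locally m) -> exists l : CC, filterlim F G (locally l)).
  { intros G FG m Hm. apply (filterlim_locally_cauchy (U := CC)). intros e.
    (* Two values within this distance of the limit differ by less than [e / (4 K + 4)], and the
       Lipschitz constant [2 K] keeps the result below [e], also for [K = 0]. *)
    assert (He : 0 < e / (4 * K + 4) / 2) by (apply Rdiv_lt_0_compat; [apply Rdiv_lt_0_compat; [apply cond_pos|lra]|lra]).
    exists (fun y => ball m (mkposreal _ He) (atan (exp y))). split.
    - exact (proj1 (filterlim_locally _ _) Hm (mkposreal _ He)).
    - intros u v Hu Hv. apply (norm_compat1 (V := CR)). rewrite norm_C.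
      eapply Rle_lt_trans; [apply (HFb u v)|].
      assert (Hd : Rabs (atan (exp v) - atan (exp u)) < e / (4 * K + 4)).
      { change (Rabs (atan (exp u) - m) < e / (4 * K + 4) / 2) in Hu.
        change (Rabs (atan (exp v) - m) < e / (4 * K + 4) / 2) in Hv.
        apply Rabs_def2 in Hu. apply Rabs_def2 in Hv. apply Rabs_def1; lra. }
      pose proof (Rabs_pos (atan (exp v) - atan (exp u))) as Hp.
      pose proof (cond_pos e).
      apply Rle_lt_trans with (K * (2 * (e / (4 * K + 4)))).
      + apply Rmult_le_compat_l; lra.
      + replace (K * (2 * (e / (4 * K + 4)))) with (e * (2 * K / (4 * K + 4))) by (field; lra).
        rewrite <- (Rmult_1_r e) at 2. apply Rmult_lt_compat_l; auto.
        apply Rmult_lt_reg_r with (4 * K + 4); [lra|]. field_simplify; lra. }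
  destruct (Hcau (Rbar_locally m_infty) _ _ lim_atan_exp_m) as [la Hla].
  destruct (Hcau (Rbar_locally p_infty) _ _ lim_atan_exp_p) as [lb Hlb].
  exists (minus lb la : CC). intros P HP.
  assert (HH : filterlim (fun ab : R * R => minus (F (snd ab)) (F (fst ab)) : CC)
     (filter_prod (Rbar_locally m_infty) (Rbar_locally p_infty)) (locally (minus lb la : CC))).
  { assert (HA : filterlim (fun ab : R * R => F (snd ab)) (filter_prod (Rbar_locally m_infty) (Rbar_locally p_infty)) (locally lb))
      by exact (filterlim_comp (R * R) R CC snd F _ _ _ filterlim_snd Hlb).
    assert (HB : filterlim (fun ab : R * R => F (fst ab)) (filter_prod (Rbar_locally m_infty) (Rbar_locally p_infty)) (locally la))
      by exact (filterlim_comp (R * R) R CC fst F _ _ _ filterlim_fst Hla).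
    assert (HC := filterlim_comp (R * R) CC CC _ _ _ _ _ HB (filterlim_opp (V := CR) la)).
    exact (filterlim_comp_2 _ _ _ HA HC (filterlim_plus (V := CR) lb (opp la))). }
  unfold filtermapi. generalize (HH P HP). unfold filtermap. apply filter_imp. intros ab HPab.
  eexists. split; [apply HF|exact HPab].
Qed.

Lemma is_Int_unique f l : is_Int f l -> IntR f = l.
Proof.
  intros H. exact (is_RInt_gen_unique (V := CC) (Fa := Rbar_locally m_infty) (Fb := Rbar_locally p_infty)
    f l H).
Qed.

Lemma Int_correct K f : sech_bounded K f -> is_Int f (IntR f).
Proof. intros H. destruct (sech_is_Int _ _ H) as [l Hl]. now rewrite (is_Int_unique _ _ Hl). Qed.

Lemma Int_ext f g : (forall y, f y = g y) -> IntR f = IntR g.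
Proof.
  intros H. unfold IntR. f_equal. apply functional_extensionality. exact H.
Qed.

Lemma is_Int_plus f g lf lg : is_Int f lf -> is_Int g lg -> is_Int (fun y => (f y + g y)%C) (lf + lg)%C.
Proof. intros Hf Hg. exact (is_RInt_gen_plus (V := CR) f g lf lg Hf Hg). Qed.

(** Linear maps, reflection, substitution and passage to a half line are all instances: each pair of
    new bounds is matched with a pair of old bounds whose integral is carried over by [T]. *)
Lemma is_RInt_gen_map {V W : RNorm} (T : V -> W) (Fa Fb Fa' Fb' : (R -> Prop) -> Prop) f g l :
  Filter Fa' -> Filter Fb' ->
  (forall P, filter_prod Fa Fb P -> filter_prod Fa' Fb' (fun ab => exists ab', P ab' /\
     forall l', is_RInt f (fst ab') (snd ab') l' -> is_RInt g (fst ab) (snd ab) (T l'))) ->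
  continuous T l -> is_RInt_gen f Fa Fb l -> is_RInt_gen g Fa' Fb' (T l).
Proof.
  intros FF1 FF2 Hmap HT Hf P HP.
  assert (H := Hmap _ (Hf (fun y => P (T y)) (HT P HP))).
  unfold filtermapi. generalize H. apply filter_imp.
  intros ab [ab' [[y [Hy Py]] Hl]]. exists (T y). auto.
Qed.

Lemma is_Int_map (T : C -> C) f g l :
  (forall a b l', is_RInt (V := CR) f a b l' -> is_RInt (V := CR) g a b (T l')) ->
  continuous (T := CR) (U := CR) T l -> is_Int f l -> is_Int g (T l).
Proof.
  intros H HT Hf.
  refine (is_RInt_gen_map (V := CR) (W := CR) T (Rbar_locally m_infty) (Rbar_locally p_infty) _ _ f g l _ _ _ HT Hf).
  intros P. apply filter_imp. intros ab Hab. exists ab. auto.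
Qed.

Lemma is_RInt_Re f a b l : is_RInt (V := CR) f a b l -> is_RInt (V := RR) (fun y => Re (f y)) a b (Re l).
Proof. apply (is_RInt_fct_extend_fst (U := RR) (V := RR)). Qed.

Lemma is_RInt_Im f a b l : is_RInt (V := CR) f a b l -> is_RInt (V := RR) (fun y => Im (f y)) a b (Im l).
Proof. apply (is_RInt_fct_extend_snd (U := RR) (V := RR)). Qed.

Lemma is_RInt_Cpair f g a b lf lg : is_RInt (V := RR) f a b lf -> is_RInt (V := RR) g a b lg ->
  is_RInt (V := CR) (fun y => (f y, g y)) a b (lf, lg).
Proof. intros Hf Hg. apply (is_RInt_fct_extend_pair (U := RR) (V := RR)); auto. Qed.

Lemma is_Int_Cmult k f l : is_Int f l -> is_Int (fun y => (k * f y)%C) (k * l)%C.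
Proof.
  apply (is_Int_map (fun z => (k * z)%C)).
  - intros a b l' H. assert (H1 := is_RInt_Re _ _ _ _ H). assert (H2 := is_RInt_Im _ _ _ _ H).
    apply (is_RInt_Cpair (fun y => Re k * Re (f y) - Im k * Im (f y)) (fun y => Re k * Im (f y) + Im k * Re (f y))).
    + apply (is_RInt_minus (V := RR)); apply (is_RInt_scal (V := RR)); auto.
    + apply (is_RInt_plus (V := RR)); apply (is_RInt_scal (V := RR)); auto.
  - apply (is_linear_continuous (U := CR) (V := CR)), is_linear_Cmult.
Qed.

Lemma is_linear_Cconj : is_linear (U := CR) (V := CR) Cconj.
Proof.
  apply is_linear_bounded with (M := 1).
  - intros x y. apply injective_projections; simpl; toR; ring.
  - intros k x. apply injective_projections; simpl; unfold scal; simpl; unfold mult; simpl; toR; ring.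
  - intros x. toC. rewrite Cmod_conj. lra.
Qed.

Lemma is_Int_Cconj f l : is_Int f l -> is_Int (fun y => Cconj (f y)) (Cconj l).
Proof.
  apply (is_Int_map Cconj).
  - intros a b l' H. assert (H1 := is_RInt_Re _ _ _ _ H). assert (H2 := is_RInt_Im _ _ _ _ H).
    apply (is_RInt_Cpair (fun y => Re (f y)) (fun y => - Im (f y))); auto.
    apply (is_RInt_opp (V := RR)); auto.
  - apply (is_linear_continuous (U := CR) (V := CR)), is_linear_Cconj.
Qed.

Lemma is_Int_reflect f l : is_Int f l -> is_Int (fun y => f (- y)) l.
Proof.
  intros H. refine (is_RInt_gen_map (V := CR) (W := CR) (fun z => z) (Rbar_locally m_infty) (Rbar_locally p_infty) _ _ f _ l _ _ _ (continuous_id _) H).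
  intros P [Q1 Q2 H1 H2 HQ]. exists (fun b => Q2 (- b)) (fun a => Q1 (- a)).
  - exact (filterlim_Rbar_opp m_infty _ H2).
  - exact (filterlim_Rbar_opp p_infty _ H1).
  - intros a b Ha Hb. exists (- b, - a). split; [now apply HQ|]. simpl. intros l' Hl.
    apply (is_RInt_swap (V := CR)), (is_RInt_comp_opp (V := CR)), (is_RInt_opp (V := CR)) in Hl.
    rewrite opp_opp in Hl.
    eapply (is_RInt_ext (V := CR)); [|apply Hl].
    intros x _. simpl. now rewrite opp_opp.
Qed.

Lemma Int_Cmult K k f : sech_bounded K f -> IntR (fun y => (k * f y)%C) = (k * IntR f)%C.
Proof. intros H. apply is_Int_unique, is_Int_Cmult. eapply Int_correct; eauto. Qed.

Lemma Int_Cplus K K' f g : sech_bounded K f -> sech_bounded K' g ->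
  IntR (fun y => (f y + g y)%C) = (IntR f + IntR g)%C.
Proof. intros H H'. apply is_Int_unique, is_Int_plus; eapply Int_correct; eauto. Qed.

Lemma Int_Cconj K f : sech_bounded K f -> IntR (fun y => Cconj (f y)) = Cconj (IntR f).
Proof. intros H. apply is_Int_unique, is_Int_Cconj. eapply Int_correct; eauto. Qed.

Lemma Int_reflect K f : sech_bounded K f -> IntR (fun y => f (- y)) = IntR f.
Proof. intros H. apply is_Int_unique, is_Int_reflect. eapply Int_correct; eauto. Qed.

Lemma sech_weaken K K' f : sech_bounded K f -> K <= K' -> sech_bounded K' f.
Proof.
  intros [H1 H2] HK. split; auto. intros y. eapply Rle_trans; [apply H2|].
  apply Rmult_le_compat_r; auto. left. apply Rinv_0_lt_compat, cosh_gt_0.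
Qed.

Lemma sech_Cmult K k f : sech_bounded K f -> sech_bounded (Cmod k * K) (fun y => (k * f y)%C).
Proof.
  intros [H1 H2]. split.
  - intros y. apply continuous_Cmult; auto. apply continuous_const.
  - intros y. rewrite Cmod_mult. unfold Rdiv. rewrite Rmult_assoc.
    apply Rmult_le_compat_l; [apply Cmod_ge_0|apply H2].
Qed.

Lemma sech_Cplus K K' f g : sech_bounded K f -> sech_bounded K' g -> sech_bounded (K + K') (fun y => (f y + g y)%C).
Proof.
  intros [H1 H2] [H3 H4]. split.
  - intros y. apply (continuous_plus (V := CR)); auto.
  - intros y. eapply Rle_trans; [apply Cmod_triangle|]. unfold Rdiv. rewrite Rmult_plus_distr_r.
    apply Rplus_le_compat; auto.
Qed.

Lemma sech_ext K f g : (forall y, f y = g y) -> sech_bounded K f -> sech_bounded K g.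
Proof.
  intros E [H1 H2]. split.
  - intros y. apply (continuous_ext f); auto.
  - intros y. rewrite <- E. auto.
Qed.

(** The integral of [1 / cosh] over the line is [PI]. *)
Lemma is_Int_bound K f l : (forall y, Cmod (f y) <= K / cosh y) -> is_Int f l -> Cmod l <= K * PI.
Proof.
  intros H Hl. rewrite <- norm_C.
  assert (Hg : is_RInt_gen (V := RR) (fun y => K / cosh y) (Rbar_locally m_infty) (Rbar_locally p_infty) (K * PI)).
  { intros P HP.
    assert (HH : filterlim (fun ab : R * R => K * (2 * atan (exp (snd ab)) - 2 * atan (exp (fst ab))))
       (filter_prod (Rbar_locally m_infty) (Rbar_locally p_infty)) (locally (K * PI))).
    { assert (HA := filterlim_comp (R * R) R R snd (fun y => atan (exp y)) (filter_prod (Rbar_locally m_infty) (Rbar_locally p_infty)) _ _ filterlim_snd lim_atan_exp_p).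
      assert (HB := filterlim_comp (R * R) R R fst (fun y => atan (exp y)) (filter_prod (Rbar_locally m_infty) (Rbar_locally p_infty)) _ _ filterlim_fst lim_atan_exp_m).
      assert (HC := filterlim_comp_2 _ _ _ HA (filterlim_comp _ _ _ _ _ _ _ _ HB (filterlim_opp (V := RR) 0)) (filterlim_plus (V := RR) (PI/2) (opp 0))).
      assert (HD := filterlim_comp _ _ _ _ _ _ _ _ HC (filterlim_scal_r (V := RR) (2 * K) (plus (PI / 2) (opp 0)))).
      assert (EQ : scal (2 * K) (plus (PI / 2) (opp 0) : RR) = K * PI) by (unfold scal; simpl; unfold mult; simpl; toR; field).
      refine (eq_ind _ (fun t : RR => filterlim _ _ (locally t)) _ _ EQ).
      refine (filterlim_ext _ _ _ HD). intros ab. cbv beta. toR. unfold scal; simpl; unfold mult; simpl. ring. }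
    unfold filtermapi. generalize (HH P HP). unfold filtermap. apply filter_imp. intros ab Hab.
    eexists. split; [apply is_RInt_sech|exact Hab]. }
  refine (RInt_gen_norm (V := CC) (Fa := Rbar_locally m_infty) (Fb := Rbar_locally p_infty) f (fun y => K / cosh y) l (K * PI) _ _ Hl Hg).
  - exists (fun a => a < 0) (fun b => b > 0); [exists 0; auto|exists 0; auto|]. simpl; intros; lra.
  - apply filter_forall. intros ab x _. exact (eq_ind_r (fun t => t <= _) (H x) (norm_C (f x))).
Qed.

Lemma Int_bound K f : sech_bounded K f -> Cmod (IntR f) <= K * PI.
Proof. intros H. apply (is_Int_bound K f); [apply H|]. eapply Int_correct, H. Qed.

Lemma Int_FTC K F f la lb : sech_bounded K f ->
  (forall y, is_derive (V := CR) F y (f y)) ->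
  filterlim F (Rbar_locally m_infty) (locally (la : CR)) ->
  filterlim F (Rbar_locally p_infty) (locally (lb : CR)) -> IntR f = (lb - la)%C.
Proof.
  intros Hf HF Hla Hlb. apply is_Int_unique. intros P HP.
  assert (HA : filterlim (fun ab : R * R => F (snd ab)) (filter_prod (Rbar_locally m_infty) (Rbar_locally p_infty)) (locally (lb : CR)))
      by exact (filterlim_comp (R * R) R CC snd F _ _ _ filterlim_snd Hlb).
  assert (HB : filterlim (fun ab : R * R => F (fst ab)) (filter_prod (Rbar_locally m_infty) (Rbar_locally p_infty)) (locally (la : CR)))
      by exact (filterlim_comp (R * R) R CC fst F _ _ _ filterlim_fst Hla).
  assert (HC := filterlim_comp (R * R) CC CC _ _ _ _ _ HB (filterlim_opp (V := CR) la)).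
  assert (HH := filterlim_comp_2 _ _ _ HA HC (filterlim_plus (V := CR) lb (opp la))).
  unfold filtermapi. generalize (HH P HP). unfold filtermap. apply filter_imp.
  intros ab Hab. eexists. split; [|exact Hab].
  apply (is_RInt_derive (V := CC)); intros x _; [apply HF|apply Hf].
Qed.

(** Substitution [y = psi s]; [Q] is the domain on which [psi] is defined. *)
Lemma is_Int_subst (Q : R -> Prop) (Fa Fb : (R -> Prop) -> Prop) (f g : R -> C) (psi dpsi : R -> R) l :
  Filter Fa -> Filter Fb -> Fa Q -> Fb Q ->
  (forall a b x, Q a -> Q b -> Rmin a b <= x <= Rmax a b -> Q x) ->
  (forall x, Q x -> is_derive psi x (dpsi x)) ->
  (forall x, Q x -> continuous dpsi x) ->
  (forall y, continuous (U := CR) f y) ->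
  (forall x, Q x -> g x = (RtoC (dpsi x) * f (psi x))%C) ->
  filterlim psi Fa (Rbar_locally m_infty) -> filterlim psi Fb (Rbar_locally p_infty) ->
  is_Int f l -> is_RInt_gen (V := CR) g Fa Fb l.
Proof.
  intros FFa FFb HQa HQb HQ Hd Hdc Hf Hg Hla Hlb Hl.
  refine (is_RInt_gen_map (V := CR) (W := CR) (fun z => z) (Rbar_locally m_infty) (Rbar_locally p_infty) _ _ f _ l _ _ _ (continuous_id _) Hl).
  intros P [Q1 Q2 H1 H2 HP].
  exists (fun a => Q a /\ Q1 (psi a)) (fun b => Q b /\ Q2 (psi b)).
  - apply filter_and; auto. exact (Hla _ H1).
  - apply filter_and; auto. exact (Hlb _ H2).
  - intros a b [Qa Pa] [Qb Pb]. exists (psi a, psi b). split; [now apply HP|]. simpl. intros l' Hl'.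
    assert (H := is_RInt_comp (V := CC) f psi dpsi a b).
    rewrite (is_RInt_unique (V := CC) _ _ _ _ Hl') in H.
    apply (is_RInt_ext (V := CR) (fun y => scal (dpsi y) (f (psi y)))).
    + intros x Hx. rewrite Hg by (apply (HQ a b); auto; lra).
      apply injective_projections; simpl; unfold scal; simpl; unfold mult; simpl; ring.
    + apply H.
      * intros x Hx. apply Hf.
      * intros x Hx. split; [apply Hd|apply Hdc]; apply (HQ a b); auto.
Qed.

(** A remainder that is at most [K |q - p|^2 / cosh y] for every [y] integrates to a quadratic
    remainder with constant [K * PI]; linearity of the candidate differential is checked under the
    integral sign. *)
Lemma differential_Int {U : RNorm} (F : U -> R -> C) (L : R -> U -> C) p r K M :
  0 < r ->
  (forall q, norm (minus q p) < r -> sech_bounded M (F q)) ->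
  (forall y x z, L y (plus x z) = (L y x + L y z)%C) ->
  (forall y (k : R) x, L y (scal k x) = (RtoC k * L y x)%C) ->
  (forall h, sech_bounded (M * norm h) (fun y => L y h)) ->
  (forall q y, norm (minus q p) < r ->
     Cmod (F q y - F p y - L y (minus q p))%C <= K * norm (minus q p) ^ 2 / cosh y) ->
  differential (V := CR) (fun q => IntR (F q)) p (fun h => IntR (fun y => L y h)).
Proof.
  intros Hr HF HLp HLs HL HR.
  apply differential_quadratic with (r := r) (K := K * PI); auto.
  - apply is_linear_bounded with (M := M * PI).
    + intros x z. rewrite (Int_ext _ (fun y => (L y x + L y z)%C)) by (intros; apply HLp).
      eapply Int_Cplus; apply HL.
    + intros k x. rewrite (Int_ext _ (fun y => (RtoC k * L y x)%C)) by (intros; apply HLs).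
      rewrite (Int_Cmult _ _ _ (HL x)).
      apply injective_projections; simpl; unfold scal; simpl; unfold mult; simpl; ring.
    + intros x. rewrite (norm_C (IntR _)). eapply Rle_trans; [eapply Int_bound, HL|]. lra.
  - intros q Hq. toC. 
    assert (Hp : sech_bounded M (F p)).
    { apply HF. assert (E : norm (minus p p) = 0) by (rewrite (minus_eq_zero (G := U) p); apply (@norm_zero _ U)).
      rewrite E. exact Hr. }
    replace (IntR (F q) - IntR (F p) - IntR (fun y => L y (minus q p)))%C
      with (IntR (fun y => (F q y + (- (1)) * F p y + (- (1)) * L y (minus q p))%C)).
    + eapply Rle_trans; [apply (Int_bound (K * norm (minus q p) ^ 2))|right; ring].
      split.
      * intros y. apply (continuous_plus (V := CR)); [apply (continuous_plus (V := CR))|]; [apply HF; auto|..];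
          apply continuous_Cmult; try apply continuous_const; [apply Hp|apply (HL (minus q p))].
      * intros y. replace (F q y + (- (1)) * F p y + (- (1)) * L y (minus q p))%C with (F q y - F p y - L y (minus q p))%C by ring.
        now apply HR.
    + erewrite Int_Cplus; [|eapply sech_Cplus; [apply HF, Hq|apply sech_Cmult, Hp]|apply sech_Cmult, HL].
      erewrite Int_Cplus; [|apply HF, Hq|apply sech_Cmult, Hp].
      erewrite !Int_Cmult; [|apply HL|apply Hp]. ring.
Qed.

(** * Integrals along a ray *)

(** The half-plane [Re z < 0] is where the exponential has modulus less than 1, and it contains all
    exponents met along the rays. *)
Definition holo (G G1 : C -> C) : Prop :=
  forall z, Re z < 0 -> differential (U := CR) (V := CR) G z (fun h => (G1 z * h)%C).

(** The constant may depend on the half-plane [Re z <= - d], because [chi / (1 - chi)] has poles on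
    the imaginary axis. *)
Definition exp_decay (G : C -> C) : Prop :=
  forall d, 0 < d -> exists K, 0 <= K /\ forall z, Re z <= - d -> Cmod (G z) <= K * exp (Re z).

Definition weight (K : R) (N : nat) (W : R -> C) : Prop :=
  (forall y, continuous (U := CR) W y) /\ (forall y, Cmod (W y) <= K * cosh y ^ N).

Lemma is_derive_Re (f : R -> C) t l : is_derive (V := CR) f t l -> is_derive (fun s => Re (f s)) t (Re l).
Proof. apply (differential_Re (U := RR) f t (fun h => scal h l)). Qed.

Lemma is_derive_Im (f : R -> C) t l : is_derive (V := CR) f t l -> is_derive (fun s => Im (f s)) t (Im l).
Proof. apply (differential_Im (U := RR) f t (fun h => scal h l)). Qed.

(** Two applications of the mean value theorem; the factor [1 / 2] of Taylor's formula is given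
    up. *)
Lemma taylor2_R (f f1 f2 : R -> R) M :
  (forall t, 0 <= t <= 1 -> is_derive f t (f1 t)) ->
  (forall t, 0 <= t <= 1 -> is_derive f1 t (f2 t)) ->
  (forall t, 0 <= t <= 1 -> Rabs (f2 t) <= M) ->
  Rabs (f 1 - f 0 - f1 0) <= M.
Proof.
  intros H1 H2 HM.
  destruct (MVT_gen f 0 1 f1) as [x [Hx Ex]].
  { rewrite Rmin_left, Rmax_right by lra. intros; apply H1; lra. }
  { rewrite Rmin_left, Rmax_right by lra. intros t Ht. apply continuity_pt_filterlim.
    apply (continuous_of_derive (V := RR) f t (f1 t)). apply H1; lra. }
  rewrite Rmin_left, Rmax_right in Hx by lra.
  destruct (MVT_gen f1 0 x f2) as [z [Hz Ez]].
  { rewrite Rmin_left, Rmax_right by lra. intros; apply H2; lra. }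
  { rewrite Rmin_left, Rmax_right by lra. intros t Ht. apply continuity_pt_filterlim.
    apply (continuous_of_derive (V := RR) f1 t (f2 t)). apply H2; lra. }
  rewrite Rmin_left, Rmax_right in Hz by lra.
  (* Here [x] is the first intermediate point and [z] the second, taken in [[0, x]]. *)
  replace (f 1 - f 0 - f1 0) with (f2 z * x) by lra.
  rewrite Rabs_mult, (Rabs_pos_eq x) by lra.
  assert (H := HM z ltac:(lra)). pose proof (Rabs_pos (f2 z)). nra.
Qed.

Lemma Cmod_le_Re_Im z : Cmod z <= Rabs (Re z) + Rabs (Im z).
Proof.
  replace z with ((RtoC (Re z)) + Ci * RtoC (Im z))%C at 1
    by (destruct z; apply injective_projections; simpl; ring).
  eapply Rle_trans; [apply Cmod_triangle|]. rewrite Cmod_mult, Cmod_Ci, !Cmod_R. lra.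
Qed.

(** Taylor's formula along the segment from [z] to [z + d], which stays in the half-plane by
    convexity. The mean value theorem is applied to real and imaginary parts separately, whence the
    factor 2. *)
Lemma taylor2_holo G G1 G2 z d a M : holo G G1 -> holo G1 G2 -> a < 0 ->
  Re z <= a -> Re (z + d)%C <= a -> (forall w, Re w <= a -> Cmod (G2 w) <= M) ->
  Cmod (G (z + d) - G z - G1 z * d)%C <= 2 * M * Cmod d ^ 2.
Proof.
  intros H1 H2 Ha Hz Hzd HM.
  assert (Hre : forall t, 0 <= t <= 1 -> Re (z + RtoC t * d)%C <= a).
  { intros t Ht. destruct z, d. simpl in *. nra. }
  assert (E : forall t : R, plus (z : CR) (scal t (d : CR)) = (z + RtoC t * d)%C).
  { intros t. apply injective_projections; simpl; unfold scal; simpl; unfold mult; simpl; toR; ring. }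
  assert (D1 : forall t, 0 <= t <= 1 -> is_derive (V := CR) (fun s => G (z + RtoC s * d)%C) t (G1 (z + RtoC t * d)%C * d)%C).
  { intros t Ht. apply (is_derive_ext (V := CR) (fun s => G (plus (z : CR) (scal s (d : CR))))).
    - intros s. now rewrite E.
    - assert (H := H1 (z + RtoC t * d)%C). rewrite <- E in H at 2.
      apply (differential_line (U := CR) (V := CR)) in H; [exact H|]. specialize (Hre t Ht). lra. }
  assert (D2 : forall t, 0 <= t <= 1 -> is_derive (V := CR) (fun s => (G1 (z + RtoC s * d) * d)%C) t (G2 (z + RtoC t * d)%C * d * d)%C).
  { intros t Ht. 
    apply is_derive_differential.
    apply (differential_ext (U := RR) (V := CR) _ _ (fun h => (d * scal h (G2 (z + RtoC t * d) * d : CR))%C)).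
    - apply (differential_eq_near (U := RR) (V := CR) (fun s => (d * G1 (z + RtoC s * d))%C)).
      + apply filter_forall. intros s. toC. ring.
      + apply (differential_Cmult_const (U := RR)).
        apply (is_derive_differential (V := CR)).
        apply (is_derive_ext (V := CR) (fun s => G1 (plus (z : CR) (scal s (d : CR))))).
        * intros s. now rewrite E.
        * assert (H := H2 (z + RtoC t * d)%C). rewrite <- E in H at 2.
          apply (differential_line (U := CR) (V := CR)) in H; [exact H|]. specialize (Hre t Ht). lra.
    - intros h. apply injective_projections; simpl; unfold scal; simpl; unfold mult; simpl; toR; ring. }
  assert (B : forall t, 0 <= t <= 1 -> Cmod (G2 (z + RtoC t * d) * d * d)%C <= M * Cmod d ^ 2).
  { intros t Ht. rewrite !Cmod_mult. specialize (HM _ (Hre t Ht)).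
    pose proof (Cmod_ge_0 d). replace (M * Cmod d ^ 2) with (M * Cmod d * Cmod d) by ring.
    apply Rmult_le_compat_r; auto. apply Rmult_le_compat_r; auto. }
  eapply Rle_trans; [apply Cmod_le_Re_Im|].
  assert (E0 : (z + RtoC 0 * d)%C = z) by ring.
  assert (E1 : (z + RtoC 1 * d)%C = (z + d)%C) by ring.
  assert (T1 := taylor2_R _ _ _ (M * Cmod d ^ 2) (fun t Ht => is_derive_Re _ _ _ (D1 t Ht))
     (fun t Ht => is_derive_Re _ _ _ (D2 t Ht)) (fun t Ht => Rle_trans _ _ _ (re_le_Cmod _) (B t Ht))).
  assert (I : forall c, Rabs (Im c) <= Cmod c).
  { intros c. eapply Rle_trans; [|apply Rmax_Cmod]. apply Rmax_r. }
  assert (T2 := taylor2_R _ _ _ (M * Cmod d ^ 2) (fun t Ht => is_derive_Im _ _ _ (D1 t Ht))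
     (fun t Ht => is_derive_Im _ _ _ (D2 t Ht)) (fun t Ht => Rle_trans _ _ _ (I _) (B t Ht))).
  cbv beta in T1, T2. rewrite E0, E1 in T1, T2.
  replace (2 * M * Cmod d ^ 2) with (M * Cmod d ^ 2 + M * Cmod d ^ 2) by ring.
  apply Rplus_le_compat; [exact T1|exact T2].
Qed.

(** For [m = S n], raise [a t / m <= exp (a t / m)] to the power [m]. *)
Lemma pow_exp_bounded a N : 0 < a -> exists K, 0 <= K /\ forall t, 0 <= t -> t ^ N * exp (- (a * t)) <= K.
Proof.
  intros Ha. destruct N as [|n].
  - exists 1. split; [lra|]. intros t Ht. simpl. rewrite Rmult_1_l, <- exp_0.
    destruct (Req_dec t 0) as [->|]; [right; f_equal; ring|]. left. apply exp_increasing. nra.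
  - set (m := INR (S n)). assert (Hm : 0 < m) by (apply lt_0_INR; lia).
    exists ((m / a) ^ S n). split; [apply pow_le; left; now apply Rdiv_lt_0_compat|].
    intros t Ht.
    assert (H1 : a * t / m <= exp (a * t / m)).
    { destruct (Req_dec (a * t / m) 0) as [->|H]; [left; apply exp_pos|].
      pose proof (exp_ineq1 _ H). lra. }
    assert (H2 : t <= m / a * exp (a * t / m)).
    { apply Rmult_le_reg_l with (a / m); [now apply Rdiv_lt_0_compat|].
      replace (a / m * (m / a * exp (a * t / m))) with (exp (a * t / m)) by (field; lra).
      eapply Rle_trans; [|apply H1]. right. field. lra. }
    assert (H3 : t ^ S n <= (m / a) ^ S n * exp (a * t)).
    { eapply Rle_trans; [apply pow_incr; split; [apply Ht|apply H2]|].
      rewrite Rpow_mult_distr. right. f_equal.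
      rewrite <- (exp_ln (exp (a * t / m) ^ S n)) by (apply pow_lt, exp_pos).
      rewrite ln_pow by apply exp_pos. rewrite ln_exp. fold m. f_equal. field. lra. }
    rewrite exp_Ropp. apply Rmult_le_reg_r with (exp (a * t)); [apply exp_pos|].
    rewrite Rmult_assoc, Rinv_l, Rmult_1_r; [auto|]. pose proof (exp_pos (a * t)). lra.
Qed.

(** On the ray through [exp y], the exponent of [chi_e] at [(c, theta)]. *)
Definition ray_exp (rad : R) (x : C * R) (y : R) : C :=
  (RtoC (PI * rad) * (fst x * RtoC (exp (- y)) + Cconj (fst x) * RtoC (exp y)) + Ci * RtoC (snd x))%C.

Lemma Re_ray_exp rad x y : Re (ray_exp rad x y) = 2 * PI * rad * Re (fst x) * cosh y.
Proof. unfold ray_exp, cosh. destruct x as [[a b] t]. simpl. field. Qed.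

Lemma ray_exp_plus rad x z y : ray_exp rad (plus (x : E3) z) y = (ray_exp rad x y + ray_exp rad z y)%C.
Proof.
  destruct x as [[a b] t], z as [[c d] s]. apply injective_projections; simpl; unfold plus; simpl; toR; ring.
Qed.

Lemma ray_exp_minus rad q x y : ray_exp rad q y = (ray_exp rad x y + ray_exp rad (minus (q : E3) x) y)%C.
Proof.
  destruct x as [[a b] t], q as [[c d] s]. apply injective_projections; simpl; unfold minus, plus, opp; simpl; toR; ring.
Qed.

Lemma ray_exp_scal rad (k : R) x y : ray_exp rad (scal k (x : E3)) y = (RtoC k * ray_exp rad x y)%C.
Proof.
  destruct x as [[a b] t]. apply injective_projections; simpl; unfold scal; simpl; unfold mult; simpl; toR; ring.
Qed.

Lemma norm_E3_fst (h : E3) : Cmod (fst h) <= norm h.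
Proof. rewrite <- norm_C. apply (norm_fst_le (U := CR) (V := RR)). Qed.

Lemma norm_E3_snd (h : E3) : Rabs (snd h) <= norm h.
Proof. apply (norm_snd_le (U := CR) (V := RR)). Qed.

Lemma Cmod_ray_exp rad (h : E3) y : 0 < rad ->
  Cmod (ray_exp rad h y) <= (4 * PI * rad + 1) * norm h * cosh y.
Proof.
  intros Hr. unfold ray_exp. pose proof PI_RGT_0. pose proof (norm_E3_fst h). pose proof (norm_E3_snd h).
  eapply Rle_trans; [apply Cmod_triangle|]. rewrite !Cmod_mult, Cmod_Ci, !Cmod_R.
  assert (H2 : Cmod (fst h * RtoC (exp (- y)) + Cconj (fst h) * RtoC (exp y)) <= norm h * (4 * cosh y)).
  { eapply Rle_trans; [apply Cmod_triangle|]. rewrite !Cmod_mult, Cmod_conj, !Cmod_R.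
    rewrite !Rabs_pos_eq by (left; apply exp_pos).
    pose proof (exp_le_cosh y). pose proof (exp_neg_le_cosh y). pose proof (exp_pos y). pose proof (exp_pos (- y)).
    pose proof (Cmod_ge_0 (fst h)).
    apply Rle_trans with (Cmod (fst h) * (4 * cosh y)); [|apply Rmult_le_compat_r; [pose proof (cosh_ge_1 y); lra|lra]].
    rewrite <- Rmult_plus_distr_l. apply Rmult_le_compat_l; lra. }
  assert (0 < PI * rad) by (apply Rmult_lt_0_compat; auto).
  rewrite (Rabs_pos_eq (PI * rad)) by lra. pose proof (cosh_ge_1 y). pose proof (norm_ge_0 h).
  rewrite Rmult_1_l.
  replace ((4 * PI * rad + 1) * norm h * cosh y) with (PI * rad * (norm h * (4 * cosh y)) + norm h * cosh y) by ring.
  apply Rplus_le_compat; [apply Rmult_le_compat_l; [lra|exact H2]|].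
  eapply Rle_trans; [exact (norm_E3_snd h)|].
  apply Rle_trans with (norm h * 1); [right; ring|apply Rmult_le_compat_l; [apply norm_ge_0|lra]].
Qed.

Lemma continuous_exp_y y : continuous (T := R_UniformSpace) (U := R_UniformSpace) exp y.
Proof. apply (continuous_of_derive (V := RR) exp y (exp y)), is_derive_exp. Qed.

Lemma continuous_RtoC {T : UniformSpace} (f : T -> R) p : continuous (U := RR) f p -> continuous (U := CR) (fun q => RtoC (f q)) p.
Proof.
  intros H. apply (continuous_comp f (RtoC : RR -> CR)); auto.
  apply (is_linear_continuous (U := RR) (V := CR)). apply (is_linear_pair_l (U := RR) (V := RR)).
Qed.

Lemma continuous_ray_exp rad x y : continuous (U := CR) (ray_exp rad x) y.
Proof.
  assert (H1 : continuous (U := CR) (fun y => RtoC (exp y)) y) by (apply continuous_RtoC, continuous_exp_y).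
  assert (H2 : continuous (U := CR) (fun y => RtoC (exp (- y))) y).
  { apply continuous_RtoC. apply (continuous_comp Ropp exp); [apply (continuous_opp (V := RR)), continuous_id|apply continuous_exp_y]. }
  apply (continuous_plus (V := CR)); [|apply continuous_const].
  apply continuous_Cmult; [apply continuous_const|].
  apply (continuous_plus (V := CR)); apply continuous_Cmult; auto; apply continuous_const.
Qed.

Lemma holo_continuous G G1 z : holo G G1 -> Re z < 0 -> continuous (T := CR) (U := CR) G z.
Proof. intros H Hz. eapply (differential_continuous (U := CR) (V := CR)), H, Hz. Qed.

Lemma Re_ray_exp_le rad x y rho : 0 < rad -> 0 < rho -> Re (fst x) <= - rho ->
  Re (ray_exp rad x y) <= - (2 * PI * rad * rho * cosh y).
Proof.
  intros Hr Hrho Hx. rewrite Re_ray_exp. pose proof PI_RGT_0. pose proof (cosh_gt_0 y).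
  assert (0 < 2 * PI * rad * cosh y) by (mult_pos).
  replace (2 * PI * rad * Re (fst x) * cosh y) with (2 * PI * rad * cosh y * Re (fst x)) by ring.
  replace (- (2 * PI * rad * rho * cosh y)) with (2 * PI * rad * cosh y * - rho) by ring.
  apply Rmult_le_compat_l; lra.
Qed.

(** With [a = 2 PI rad rho] the integrand is at most a constant times
    [cosh y ^ N * exp (- a * cosh y)]. The constant [M] is the same for all weights of degree [N]
    and all points with [Re <= - rho]; differentiation under the integral sign needs this
    uniformity. *)
Lemma sech_weight_decay rad G G1 N rho : 0 < rad -> 0 < rho -> holo G G1 -> exp_decay G ->
  exists M, 0 <= M /\ forall K W x, weight K N W -> Re (fst x) <= - rho ->
    sech_bounded (M * K) (fun y => (W y * G (ray_exp rad x y))%C).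
Proof.
  intros Hr Hrho HG HD. pose proof PI_RGT_0.
  set (a := 2 * PI * rad * rho). assert (Ha : 0 < a) by (unfold a; mult_pos).
  destruct (HD a Ha) as [KG [HKG HG']].
  destruct (pow_exp_bounded a (S N) Ha) as [KE [HKE HE]].
  exists (KG * KE). split; [now apply Rmult_le_pos|]. intros K W x [HW1 HW2] Hx.
  assert (HK : 0 <= K).
  { specialize (HW2 0). rewrite cosh_0, pow1 in HW2. pose proof (Cmod_ge_0 (W 0)). lra. }
  assert (HRe : forall y, Re (ray_exp rad x y) <= - (a * cosh y)) by (intros; now apply Re_ray_exp_le).
  assert (HRe' : forall y, Re (ray_exp rad x y) <= - a).
  { intros y. pose proof (cosh_ge_1 y). specialize (HRe y).
    assert (a * 1 <= a * cosh y) by (apply Rmult_le_compat_l; lra). lra. }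
  split.
  - intros y. apply continuous_Cmult; auto.
    apply (continuous_comp (V := CR) (ray_exp rad x) G); [apply continuous_ray_exp|].
    eapply holo_continuous; eauto. specialize (HRe' y). lra.
  - intros y. rewrite Cmod_mult. pose proof (cosh_gt_0 y) as Hc.
    apply Rmult_le_reg_r with (cosh y); auto. unfold Rdiv. rewrite (Rmult_assoc (KG * KE * K)), Rinv_l, Rmult_1_r by lra.
    apply Rle_trans with (K * cosh y ^ N * (KG * exp (- (a * cosh y))) * cosh y).
    + apply Rmult_le_compat_r; [lra|]. apply Rmult_le_compat; try apply Cmod_ge_0; auto.
      eapply Rle_trans; [apply HG', HRe'|]. apply Rmult_le_compat_l; auto.
      destruct (HRe y) as [Hl|El]; [left; now apply exp_increasing|right; now rewrite El].
    + replace (K * cosh y ^ N * (KG * exp (- (a * cosh y))) * cosh y)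
        with (K * KG * (cosh y ^ S N * exp (- (a * cosh y)))) by (simpl; ring).
      replace (KG * KE * K) with (K * KG * KE) by ring.
      apply Rmult_le_compat_l; [now apply Rmult_le_pos|]. apply HE. lra.
Qed.

(** An increment of the exponent counts as one more power of [cosh]. *)
Lemma weight_mult_ray rad K N W (h : E3) : 0 < rad -> weight K N W ->
  weight (K * ((4 * PI * rad + 1) * norm h)) (S N) (fun y => (W y * ray_exp rad h y)%C).
Proof.
  intros Hr [H1 H2]. split.
  - intros y. apply continuous_Cmult; auto. apply continuous_ray_exp.
  - intros y. rewrite Cmod_mult. 
    replace (K * ((4 * PI * rad + 1) * norm h) * cosh y ^ S N)
      with (K * cosh y ^ N * ((4 * PI * rad + 1) * norm h * cosh y)) by (simpl; ring).
    apply Rmult_le_compat; try apply Cmod_ge_0; auto. now apply Cmod_ray_exp.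
Qed.

Lemma Re_fst_near (q x : C * R) rho : norm (minus (q : E3) x) < rho -> Re (fst x) <= - (2 * rho) ->
  Re (fst q) <= - rho.
Proof.
  intros Hq Hx.
  assert (H1 := norm_E3_fst (minus (q : E3) x)). assert (H2 := re_le_Cmod (fst (minus (q : E3) x))).
  assert (H3 : Rabs (Re (fst q) - Re (fst x)) < rho).
  { eapply Rle_lt_trans; [|apply Hq]. eapply Rle_trans; [|apply H1]. exact H2. }
  apply Rabs_def2 in H3. lra.
Qed.

(** The exponent is linear in the point, with increment at most a multiple of [|h| cosh y]. The
    second order remainder of [G] is therefore quadratic in [h] at the price of [cosh y ^ 2], and
    the exponential decay of [G2] absorbs every power of [cosh]. *)
Theorem differential_ray_Int rad G G1 G2 K N W (x : C * R) :
  0 < rad -> holo G G1 -> holo G1 G2 -> exp_decay G -> exp_decay G1 -> exp_decay G2 ->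
  weight K N W -> Re (fst x) < 0 ->
  differential (U := E3) (V := CR)
    (fun q => IntR (fun y => (W y * G (ray_exp rad q y))%C)) x
    (fun h => IntR (fun y => (W y * ray_exp rad h y * G1 (ray_exp rad x y))%C)).
Proof.
  intros Hr HG HG1 HD HD1 HD2 HW Hx. pose proof PI_RGT_0.
  (* Half the distance to the imaginary axis: points within [rho] of [x] still satisfy
     [Re <= - rho]. *)
  set (rho := - Re (fst x) / 2). assert (Hrho : 0 < rho) by (unfold rho; lra).
  set (a := 2 * PI * rad * rho). assert (Ha : 0 < a) by (unfold a; mult_pos).
  destruct (sech_weight_decay rad G G1 N rho Hr Hrho HG HD) as [M0 [HM0 B0]].
  destruct (sech_weight_decay rad G1 G2 (S N) rho Hr Hrho HG1 HD1) as [M1 [HM1 B1]].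
  destruct (HD2 a Ha) as [KG [HKG HG2]].
  (* [N] powers come from the weight, two from the squared increment, and one is spent on the factor
     [1 / cosh y]. *)
  destruct (pow_exp_bounded a (S (S (S N))) Ha) as [KE [HKE HE]].
  assert (HK : 0 <= K).
  { destruct HW as [_ HW2]. specialize (HW2 0). rewrite cosh_0, pow1 in HW2. pose proof (Cmod_ge_0 (W 0)). lra. }
  set (Q := 4 * PI * rad + 1). assert (HQ : 0 < Q) by (unfold Q; assert (0 < PI * rad) by (apply Rmult_lt_0_compat; lra); lra).
  apply (differential_Int (U := E3) _ (fun y h => (W y * ray_exp rad h y * G1 (ray_exp rad x y))%C) x rho
            (K * (2 * KG * Q ^ 2) * KE) (Rmax (M0 * K) (M1 * (K * Q)))); auto.
  - intros q Hq. eapply sech_weaken; [eapply B0|apply Rmax_l]; eauto.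
    apply (Re_fst_near q x); [exact Hq|unfold rho; lra].
  - intros y u w. rewrite ray_exp_plus. ring.
  - intros y k u. rewrite ray_exp_scal. ring.
  - intros h. eapply sech_weaken.
    + eapply (B1 _ (fun y => (W y * ray_exp rad h y)%C) x); [apply weight_mult_ray; eauto|unfold rho; lra].
    + replace (M1 * (K * ((4 * PI * rad + 1) * norm h))) with (M1 * (K * Q) * norm h) by (unfold Q; ring).
      apply Rmult_le_compat_r; [apply norm_ge_0|apply Rmax_r].
  - intros q y Hq. set (h := minus q x : E3) in *.
    assert (Hqre : Re (fst q) <= - rho).
    { apply (Re_fst_near q x); [exact Hq|unfold rho; lra]. }
    assert (Eq : ray_exp rad q y = (ray_exp rad x y + ray_exp rad h y)%C).
    { apply ray_exp_minus. }
    pose proof (cosh_ge_1 y) as Hc.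
    assert (HT := taylor2_holo G G1 G2 (ray_exp rad x y) (ray_exp rad h y) (- (a * cosh y)) (KG * exp (- (a * cosh y))) HG HG1).
    rewrite <- Eq in HT.
    replace (W y * G (ray_exp rad q y) - W y * G (ray_exp rad x y) - W y * ray_exp rad h y * G1 (ray_exp rad x y))%C
      with (W y * (G (ray_exp rad q y) - G (ray_exp rad x y) - G1 (ray_exp rad x y) * ray_exp rad h y))%C by ring.
    rewrite Cmod_mult.
    apply Rmult_le_reg_r with (cosh y); [lra|]. unfold Rdiv. rewrite (Rmult_assoc _ (/ cosh y)), Rinv_l, Rmult_1_r by lra.
    apply Rle_trans with (K * cosh y ^ N * (2 * (KG * exp (- (a * cosh y))) * (Q * norm h * cosh y) ^ 2) * cosh y).
    + apply Rmult_le_compat_r; [lra|]. apply Rmult_le_compat; try apply Cmod_ge_0; [apply HW|].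
      eapply Rle_trans; [apply HT|].
      * nra.
      * apply Re_ray_exp_le; auto. unfold rho. lra.
      * apply Re_ray_exp_le; auto.
      * intros w Hw. eapply Rle_trans; [apply HG2; nra|]. apply Rmult_le_compat_l; auto.
        destruct Hw as [Hl|El]; [left; now apply exp_increasing|right; now rewrite El].
      * apply Rmult_le_compat_l. { pose proof (exp_pos (- (a * cosh y))). nra. }
        apply pow_incr. split; [apply Cmod_ge_0|]. now apply Cmod_ray_exp.
    + replace (K * cosh y ^ N * (2 * (KG * exp (- (a * cosh y))) * (Q * norm h * cosh y) ^ 2) * cosh y)
        with (K * (2 * KG * Q ^ 2) * norm h ^ 2 * (cosh y ^ S (S (S N)) * exp (- (a * cosh y)))) by (simpl; ring).
      replace (K * (2 * KG * Q ^ 2) * KE * norm h ^ 2) with (K * (2 * KG * Q ^ 2) * norm h ^ 2 * KE) by ring.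
      apply Rmult_le_compat_l; [|apply HE; lra].
      repeat apply Rmult_le_pos; try apply pow2_ge_0; try lra; auto; apply norm_ge_0.
Qed.

(** * The holomorphic integrands: powers of chi / (1 - chi) and the logarithm of 1 - chi *)

(** [chi / (1 - chi)] as a function of the exponent of [chi]. *)
Definition geo (z : C) : C := (Cexp z / (1 - Cexp z))%C.

(** Since [geo' = geo + geo ^ 2], the span of the positive powers is stable under differentiation.
    The exponent [S j] excludes the constant function, which does not decay. *)
Definition geo_pow (j : nat) (z : C) : C := (geo z ^ S j)%C.

Definition log1m (z : C) : C := Clog (1 - Cexp z)%C.

Lemma Cmod_1m_ge z d : 0 < d -> Re z <= - d -> 1 - exp (- d) <= Cmod (1 - Cexp z)%C.
Proof.
  intros Hd Hz. assert (H := Cmod_triangle (1 - Cexp z) (Cexp z)).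
  replace (1 - Cexp z + Cexp z)%C with (RtoC 1) in H by ring. rewrite Cmod_1, Cmod_Cexp in H.
  assert (exp (Re z) <= exp (- d)) by (destruct Hz as [Hz| ->]; [left; now apply exp_increasing|lra]). lra.
Qed.

Lemma exp_neg_lt_1 d : 0 < d -> exp (- d) < 1.
Proof. intros Hd. rewrite <- exp_0. apply exp_increasing. lra. Qed.

Lemma one_minus_Cexp_neq z : Re z < 0 -> (1 - Cexp z)%C <> RtoC 0.
Proof.
  intros Hz. apply Cmod_gt_0. assert (H := Cmod_1m_ge z (- Re z) ltac:(lra) ltac:(lra)).
  assert (H1 := exp_neg_lt_1 (- Re z) ltac:(lra)). lra.
Qed.

Lemma differential_Cid z : differential (U := CR) (V := CR) (fun w => w) z (fun h => h).
Proof. apply differential_linear. apply is_linear_id. Qed.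

Lemma holo_geo : holo geo (fun z => geo z + geo z * geo z)%C.
Proof.
  intros z Hz. unfold geo, Cdiv. assert (Hn := one_minus_Cexp_neq z Hz).
  assert (He := differential_Cexp_fct (U := CR) (fun w => w) z _ (differential_Cid z)).
  assert (Hi := differential_Cinv_fct (U := CR) _ z _ Hn (differential_Cminus _ _ _ _ _ (differential_const (U := CR) (V := CR) (RtoC 1) z) He)).
  apply (differential_ext _ _ _ _ (differential_Cmult _ _ _ _ _ He Hi)).
  intros h. toC. field. exact Hn.
Qed.

Lemma holo_Cmult G G1 H H1 : holo G G1 -> holo H H1 -> holo (fun z => G z * H z)%C (fun z => G1 z * H z + G z * H1 z)%C.
Proof.
  intros HG HH z Hz.
  apply (differential_ext _ _ _ _ (differential_Cmult (U := CR) _ _ _ _ _ (HG z Hz) (HH z Hz))).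
  intros h. toC. ring.
Qed.

Lemma holo_Cplus G G1 H H1 : holo G G1 -> holo H H1 -> holo (fun z => G z + H z)%C (fun z => G1 z + H1 z)%C.
Proof.
  intros HG HH z Hz.
  apply (differential_ext _ _ _ _ (differential_Cplus (U := CR) _ _ _ _ _ (HG z Hz) (HH z Hz))).
  intros h. toC. ring.
Qed.

Lemma holo_scal k G G1 : holo G G1 -> holo (fun z => k * G z)%C (fun z => k * G1 z)%C.
Proof.
  intros HG z Hz.
  apply (differential_ext _ _ _ _ (differential_Cmult_const (U := CR) _ k _ _ (HG z Hz))).
  intros h. toC. ring.
Qed.

Definition geo_pow1 (j : nat) (z : C) : C := (RtoC (INR (S j)) * (geo_pow j z + geo_pow (S j) z))%C.

Lemma holo_geo_pow j : holo (geo_pow j) (geo_pow1 j).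
Proof.
  induction j as [|j IH].
  - intros z Hz. unfold geo_pow1, geo_pow.
    apply (differential_eq_near (U := CR) geo).
    + apply filter_forall. intros w. toC. simpl. ring.
    + apply (differential_ext _ _ _ _ (holo_geo z Hz)). intros h. toC. simpl. ring.
  - intros z Hz. 
    apply (differential_ext _ _ _ _ (holo_Cmult _ _ _ _ holo_geo IH z Hz)). intros h. toC.
    unfold geo_pow1, geo_pow. rewrite (S_INR (S j)), RtoC_plus. simpl (_ ^ _)%C. ring.
Qed.

Lemma exp_decay_Cplus G H : exp_decay G -> exp_decay H -> exp_decay (fun z => G z + H z)%C.
Proof.
  intros HG HH d Hd. destruct (HG d Hd) as [K [HK B]], (HH d Hd) as [K' [HK' B']].
  exists (K + K'). split; [lra|]. intros z Hz. eapply Rle_trans; [apply Cmod_triangle|].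
  rewrite Rmult_plus_distr_r. apply Rplus_le_compat; auto.
Qed.

Lemma exp_decay_scal k G : exp_decay G -> exp_decay (fun z => k * G z)%C.
Proof.
  intros HG d Hd. destruct (HG d Hd) as [K [HK B]].
  exists (Cmod k * K). split; [apply Rmult_le_pos; auto; apply Cmod_ge_0|]. intros z Hz.
  rewrite Cmod_mult, Rmult_assoc. apply Rmult_le_compat_l; auto. apply Cmod_ge_0.
Qed.

Lemma Cmod_geo_le z d : 0 < d -> Re z <= - d -> Cmod (geo z) <= / (1 - exp (- d)) * exp (Re z).
Proof.
  intros Hd Hz. unfold geo. rewrite Cmod_div by (apply one_minus_Cexp_neq; lra).
  rewrite Cmod_Cexp, Rmult_comm. apply Rmult_le_compat_l; [left; apply exp_pos|].
  pose proof (exp_neg_lt_1 d Hd). apply Rinv_le_contravar; [lra|]. now apply Cmod_1m_ge.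
Qed.

Lemma exp_decay_geo_pow j : exp_decay (geo_pow j).
Proof.
  intros d Hd. pose proof (exp_neg_lt_1 d Hd). set (K := / (1 - exp (- d))).
  assert (HK : 0 < K) by (apply Rinv_0_lt_compat; lra).
  exists (K ^ S j). split; [apply pow_le; lra|]. intros z Hz.
  unfold geo_pow. rewrite Cmod_pow.
  eapply Rle_trans; [apply pow_incr; split; [apply Cmod_ge_0|apply (Cmod_geo_le z d Hd Hz)]|].
  fold K. rewrite Rpow_mult_distr. apply Rmult_le_compat_l; [apply pow_le; lra|].
  simpl. rewrite <- (Rmult_1_r (exp (Re z))) at 3. apply Rmult_le_compat_l; [left; apply exp_pos|].
  rewrite <- (pow1 j). apply pow_incr. split; [left; apply exp_pos|].
  rewrite <- exp_0. destruct (Req_dec (Re z) 0) as [->|]; [lra|]. left. apply exp_increasing. lra.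
Qed.

Lemma exp_decay_geo_pow1 j : exp_decay (geo_pow1 j).
Proof. apply exp_decay_scal, exp_decay_Cplus; apply exp_decay_geo_pow. Qed.

Lemma Cmod_plus_Re_pos z : 0 < Re z -> 0 < Cmod z + Re z.
Proof. intros H. pose proof (Cmod_ge_0 z). lra. Qed.

Lemma locally_Re_pos (z : C) : 0 < Re z -> locally (z : CR) (fun w : CR => 0 < Re w).
Proof.
  intros H. exists (mkposreal _ H). intros w [Hw _]. 
  change (Rabs (fst w - fst z) < Re z) in Hw. apply Rabs_def2 in Hw. unfold Re in *. lra.
Qed.

(** On the right half-plane the argument is [2 atan (y / (r + x))] without any case distinction. Its
    derivative simplifies through [1 + (y / (r + x))^2 = 2 r / (r + x)]. *)
Lemma differential_Clog z : 0 < Re z -> differential (U := CR) (V := CR) Clog z (fun h => (/ z * h)%C).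
Proof.
  intros Hz.
  set (m := fun w : CR => Cmod w).
  set (x := Re z) in *. set (y := Im z). set (r := Cmod z).
  assert (Hr2 : r * r = x * x + y * y).
  { unfold r. pose proof (Cmod2_alt z). fold x y in H. nra. }
  assert (Hr : 0 < r) by (apply Cmod_gt_0; intros E; unfold x in Hz; rewrite E in Hz; simpl in Hz; lra).
  assert (DR := differential_Re (U := CR) _ z _ (differential_Cid z)).
  assert (DI := differential_Im (U := CR) _ z _ (differential_Cid z)).
  assert (DM : differential (U := CR) (V := RR) m z (fun h => (x * Re h + y * Im h) / r)).
  { assert (D2 := differential_Rplus _ _ _ _ _ (differential_Rmult _ _ _ _ _ DR DR) (differential_Rmult _ _ _ _ _ DI DI)).
    assert (D3 := differential_Rcomp _ sqrt _ _ (/ (2 * r)) D2).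
    apply (differential_eq_near (U := CR) (V := RR) (fun w => sqrt (Re w * Re w + Im w * Im w))).
    - apply filter_forall. intros w. unfold m, Cmod, Re, Im. asR. f_equal. ring.
    - eapply differential_ext; [apply D3|].
      + replace (Re z * Re z + Im z * Im z) with (r * r) by (rewrite Hr2; reflexivity).
        assert (Hrr : 0 < r * r) by nra.
        assert (Hd := is_derive_sqrt (fun t => t) (r * r) 1 (is_derive_id _) Hrr).
        cbv beta in Hd. rewrite sqrt_square in Hd by lra.
        replace (/ (2 * r)) with (1 / (2 * r)) by (field; lra). exact Hd.
      + intros h. fold x y. cbv beta. toR. field. lra. }
  assert (DL := differential_Rcomp _ ln _ _ _ DM (is_derive_ln _ Hr)).
  assert (DS := differential_Rplus _ _ _ _ _ DM DR).
  assert (Hs : 0 < m z + Re z) by (unfold m; fold r x; lra).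
  assert (DV := differential_Rcomp _ Rinv _ _ (- / (m z + Re z) ^ 2) DS).
  assert (DQ := differential_Rcomp _ atan _ _ _ (differential_Rmult _ _ _ _ _ DI (DV ltac:(auto_derive; [lra|field; lra]))) (is_derive_atan _)).
  assert (DT := differential_Rmult _ _ _ _ _ (differential_const (U := CR) (V := RR) 2 z) DQ).
  apply (differential_eq_near (U := CR) (V := CR) (fun w => (ln (m w), 2 * atan (Im w * / (m w + Re w))))).
  - generalize (locally_Re_pos z Hz). apply filter_imp. intros w Hw.
    unfold Clog, Carg. destruct (Rlt_dec 0 (Cmod w + Re w)) as [_|N]; [reflexivity|].
    exfalso. apply N. now apply Cmod_plus_Re_pos.
  - apply (differential_ext _ _ _ _ (differential_Cpair _ _ _ _ _ DL DT)). intros h.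
    unfold m; fold r x y. 
    assert (Hrx : r + x <> 0) by lra.
    destruct h as [a b]. simpl Re. simpl Im.
    assert (Hinv : (/ z * (a, b))%C = ((x * a + y * b) / (r * r), (x * b - y * a) / (r * r))).
    { rewrite Hr2. assert (x * x + y * y <> 0) by nra.
      replace z with ((x, y) : C) by (destruct z; reflexivity).
      apply injective_projections; simpl; field; simpl in *; nra. }
    rewrite Hinv. apply injective_projections; simpl; toR.
    + field. lra.
    + assert (Hq : 1 + (y * / (r + x)) * (y * / (r + x)) <> 0) by nra.
      unfold Rsqr. assert (E : 1 + (y * / (r + x)) * (y * / (r + x)) = 2 * r / (r + x)).
      { apply Rmult_eq_reg_r with ((r + x) * (r + x)); [|nra]. field_simplify; [|lra|lra]. nra. }
      rewrite E. replace (y * y) with (r * r - x * x) by lra.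
      apply Rmult_eq_reg_r with (r * r * r * (r + x)); [|apply Rgt_not_eq, Rlt_gt; mult_pos].
      field_simplify; [|lra|lra]. 
      replace (y ^ 2) with (r * r - x * x) by (rewrite Hr2; ring). ring.
Qed.

Lemma Re_1m_Cexp z : Re z < 0 -> 0 < Re (1 - Cexp z)%C.
Proof.
  intros Hz. assert (H := re_le_Cmod (Cexp z)). rewrite Cmod_Cexp in H.
  assert (exp (Re z) < 1) by (rewrite <- exp_0; now apply exp_increasing).
  assert (H1 := Rle_abs (Re (Cexp z))). change (0 < 1 + - Re (Cexp z)). lra.
Qed.

Lemma holo_log1m : holo log1m (fun z => - (1) * geo_pow 0 z)%C.
Proof.
  intros z Hz. unfold log1m.
  assert (He := differential_Cexp_fct (U := CR) (fun w => w) z _ (differential_Cid z)).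
  assert (H1 := differential_Cminus _ _ _ _ _ (differential_const (U := CR) (V := CR) (RtoC 1) z) He).
  apply (differential_ext _ _ _ _ (differential_comp _ _ _ _ _ H1 (differential_Clog _ (Re_1m_Cexp z Hz)))).
  intros h. toC. unfold geo_pow, geo. simpl. field. now apply one_minus_Cexp_neq.
Qed.

Lemma atan_le_self x : Rabs (atan x) <= Rabs x.
Proof.
  destruct (MVT_gen atan 0 x (fun t => / (1 + Rsqr t))) as [c [_ Hc]].
  - intros t _. apply is_derive_atan.
  - intros t _. apply continuity_pt_filterlim. apply continuous_atan.
  - rewrite atan_0 in Hc. replace (atan x) with (/ (1 + Rsqr c) * x) by lra.
    rewrite Rabs_mult. rewrite <- (Rmult_1_l (Rabs x)) at 2. apply Rmult_le_compat_r; [apply Rabs_pos|].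
    pose proof (Rle_0_sqr c). rewrite Rabs_pos_eq by (left; apply Rinv_0_lt_compat; lra).
    rewrite <- Rinv_1. apply Rinv_le_contravar; lra.
Qed.

Lemma ln_le_sub1 t : 0 < t -> ln t <= t - 1.
Proof.
  intros Ht. apply Rnot_lt_le. intros H. apply exp_increasing in H. rewrite exp_ln in H by auto.
  destruct (Req_dec (t - 1) 0) as [E|E].
  - rewrite E, exp_0 in H. lra.
  - pose proof (exp_ineq1 _ E). lra.
Qed.

(** With [e = exp (Re z)], the number [1 - Cexp z] lies within [e] of 1 and has modulus at least
    [q = 1 - exp (- d)]. In absolute value its logarithm has real part at most [(1 + 1 / q) e] and
    imaginary part at most [2 e / q]; the constant is the sum of the two. *)
Lemma exp_decay_log1m : exp_decay log1m.
Proof.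
  intros d Hd. pose proof (exp_neg_lt_1 d Hd) as Hq. set (q := 1 - exp (- d)). assert (0 < q) by (unfold q; lra).
  exists (1 + 3 / q). assert (0 < / q) by (now apply Rinv_0_lt_compat). split; [unfold Rdiv; lra|]. intros z Hz.
  unfold log1m. assert (Hm := Cmod_1m_ge z d Hd Hz). fold q in Hm.
  assert (HRe := Re_1m_Cexp z ltac:(lra)).
  set (e := exp (Re z)). assert (He : 0 < e) by apply exp_pos.
  assert (Hmu : Cmod (1 - Cexp z) <= 1 + e).
  { eapply Rle_trans; [apply Cmod_triangle|]. rewrite Cmod_opp, Cmod_1, Cmod_Cexp. apply Rle_refl. }
  assert (Hml : 1 - e <= Cmod (1 - Cexp z)).
  { assert (H1 := Cmod_triangle (1 - Cexp z) (Cexp z)).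
    replace (1 - Cexp z + Cexp z)%C with (RtoC 1) in H1 by ring. rewrite Cmod_1, Cmod_Cexp in H1. fold e in H1. lra. }
  set (m := Cmod (1 - Cexp z)) in *.
  eapply Rle_trans; [apply Cmod_le_Re_Im|].
  change (Rabs (ln m) + Rabs (Carg (1 - Cexp z)) <= (1 + 3 / q) * e).
  assert (HL : Rabs (ln m) <= (1 + / q) * e).
  { apply Rabs_le. split.
    - assert (H1 := ln_le_sub1 (/ m) ltac:(apply Rinv_0_lt_compat; lra)).
      rewrite ln_Rinv in H1 by lra.
      assert (/ m - 1 <= / q * e).
      { replace (/ m - 1) with (/ m * (1 - m)) by (field; lra).
        destruct (Rle_dec m 1).
        - apply Rmult_le_compat; [left; apply Rinv_0_lt_compat; lra|lra|apply Rinv_le_contravar; lra|lra].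
        - assert (0 < / m) by (apply Rinv_0_lt_compat; lra). nra. }
      lra.
    - assert (H1 := ln_le_sub1 m ltac:(lra)). assert (0 < / q * e) by mult_pos. lra. }
  assert (HA : Rabs (Carg (1 - Cexp z)) <= 2 * / q * e).
  { unfold Carg. destruct (Rlt_dec 0 _) as [_|N]; [|exfalso; apply N; now apply Cmod_plus_Re_pos].
    fold m. rewrite Rabs_mult, (Rabs_pos_eq 2) by lra. rewrite Rmult_assoc. apply Rmult_le_compat_l; [lra|].
    eapply Rle_trans; [apply atan_le_self|]. unfold Rdiv. rewrite Rabs_mult, Rmult_comm.
    apply Rmult_le_compat; try apply Rabs_pos.
    - rewrite Rabs_pos_eq; [apply Rinv_le_contravar; lra|left; apply Rinv_0_lt_compat; lra].
    - replace (Im (1 - Cexp z)) with (- Im (Cexp z)) by (simpl; ring). rewrite Rabs_Ropp.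
      unfold e. rewrite <- Cmod_Cexp. eapply Rle_trans; [|apply Rmax_Cmod]. apply Rmax_r. }
  unfold Rdiv. lra.
Qed.

(** * Moments *)

(** The value of [zeta ^ m * zeta ^ - n] at [zeta = exp y]. *)
Definition ray_pow (m n : nat) (y : R) : C := RtoC (exp (INR m * y - INR n * y)).

(** The weight is a function of [m - n]. Differentiating in [c] raises [n], in the conjugate of [c]
    it raises [m]; with two separate exponents both stay natural numbers, and so do the powers of
    the direction introduced later. *)
Definition ray_moment (rad : R) (m n j : nat) (x : C * R) : C :=
  IntR (fun y => (ray_pow m n y * geo_pow j (ray_exp rad x y))%C).

Lemma exp_INR n y : exp (INR n * y) = exp y ^ n.
Proof.
  induction n as [|n IH]; [simpl; rewrite Rmult_0_l; apply exp_0|].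
  rewrite S_INR, Rmult_plus_distr_r, exp_plus, IH, Rmult_1_l, <- tech_pow_Rmult. apply Rmult_comm.
Qed.

Lemma is_derive_ray_pow_exp m n y :
  is_derive (fun y => exp (INR m * y - INR n * y)) y ((INR m - INR n) * exp (INR m * y - INR n * y)).
Proof. auto_derive; auto. unfold Rminus. ring. Qed.

Lemma weight_ray_pow m n : weight (2 ^ (m + n)) (m + n) (ray_pow m n).
Proof.
  split.
  - intros y. apply continuous_RtoC. eapply (continuous_of_derive (V := RR)), is_derive_ray_pow_exp.
  - intros y. unfold ray_pow. rewrite Cmod_R, Rabs_pos_eq by (left; apply exp_pos).
    rewrite <- Rpow_mult_distr, pow_add.
    replace (INR m * y - INR n * y) with (INR m * y + INR n * - y) by ring.
    rewrite exp_plus, !exp_INR. apply Rmult_le_compat; try (apply pow_le; left; apply exp_pos);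
      apply pow_incr; (split; [left; apply exp_pos|]); [apply exp_le_cosh|apply exp_neg_le_cosh].
Qed.

Lemma ray_pow_exp m n y : (ray_pow m n y * RtoC (exp y))%C = ray_pow (S m) n y.
Proof. unfold ray_pow. rewrite <- RtoC_mult, <- exp_plus. do 2 f_equal. rewrite S_INR. ring. Qed.

Lemma ray_pow_exp_neg m n y : (ray_pow m n y * RtoC (exp (- y)))%C = ray_pow m (S n) y.
Proof. unfold ray_pow. rewrite <- RtoC_mult, <- exp_plus. do 2 f_equal. rewrite S_INR. ring. Qed.

Lemma sech_moment rad m n j x : 0 < rad -> Re (fst x) < 0 ->
  exists M, sech_bounded M (fun y => (ray_pow m n y * geo_pow j (ray_exp rad x y))%C).
Proof.
  intros Hr Hx.
  destruct (sech_weight_decay rad _ _ (m + n) (- Re (fst x)) Hr ltac:(lra) (holo_geo_pow j) (exp_decay_geo_pow j)) as [M [_ H]].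
  eexists. apply (H _ _ _ (weight_ray_pow m n)). lra.
Qed.

Lemma holo_geo_pow1 j : exists G2, holo (geo_pow1 j) G2 /\ exp_decay G2.
Proof.
  eexists. split.
  - apply holo_scal. apply holo_Cplus; apply holo_geo_pow.
  - apply exp_decay_scal, exp_decay_Cplus; apply exp_decay_geo_pow1.
Qed.

(** The chain rule for [geo_pow j], whose derivative is [S j] times [geo_pow j + geo_pow (S j)]. The
    family [J] is a parameter because the same formula serves [ray_moment] and [moment]. *)
Definition moment_diff (rad : R) (J : nat -> nat -> nat -> C) (m n j : nat) (h : C * R) : C :=
  (RtoC (INR (S j)) *
    (RtoC (PI * rad) * fst h * (J m (S n) j + J m (S n) (S j))
     + RtoC (PI * rad) * Cconj (fst h) * (J (S m) n j + J (S m) n (S j))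
     + Ci * RtoC (snd h) * (J m n j + J m n (S j))))%C.

Lemma IntR_geo_pow1 rad m n j x h : 0 < rad -> Re (fst x) < 0 ->
  IntR (fun y => (ray_pow m n y * ray_exp rad h y * geo_pow1 j (ray_exp rad x y))%C)
  = moment_diff rad (fun m n j => ray_moment rad m n j x) m n j h.
Proof.
  intros Hr Hx.
  destruct (sech_moment rad m (S n) j x Hr Hx) as [M1 B1]. destruct (sech_moment rad m (S n) (S j) x Hr Hx) as [M2 B2].
  destruct (sech_moment rad (S m) n j x Hr Hx) as [M3 B3]. destruct (sech_moment rad (S m) n (S j) x Hr Hx) as [M4 B4].
  destruct (sech_moment rad m n j x Hr Hx) as [M5 B5]. destruct (sech_moment rad m n (S j) x Hr Hx) as [M6 B6].
  unfold moment_diff, ray_moment.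
  apply is_Int_unique.
  assert (H := is_Int_Cmult (RtoC (INR (S j))) _ _ (is_Int_plus _ _ _ _ (is_Int_plus _ _ _ _
     (is_Int_Cmult (RtoC (PI * rad) * fst h)%C _ _ (is_Int_plus _ _ _ _ (Int_correct _ _ B1) (Int_correct _ _ B2)))
     (is_Int_Cmult (RtoC (PI * rad) * Cconj (fst h))%C _ _ (is_Int_plus _ _ _ _ (Int_correct _ _ B3) (Int_correct _ _ B4))))
     (is_Int_Cmult (Ci * RtoC (snd h))%C _ _ (is_Int_plus _ _ _ _ (Int_correct _ _ B5) (Int_correct _ _ B6))))).
  refine (eq_ind _ (fun f => is_Int f _) H _ _).
  apply functional_extensionality. intros y.
  rewrite <- !ray_pow_exp, <- !ray_pow_exp_neg. unfold geo_pow1, ray_exp. ring.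
Qed.

Lemma differential_ray_moment rad m n j (x : C * R) : 0 < rad -> Re (fst x) < 0 ->
  differential (U := E3) (V := CR) (ray_moment rad m n j) x
    (moment_diff rad (fun m n j => ray_moment rad m n j x) m n j).
Proof.
  intros Hr Hx. destruct (holo_geo_pow1 j) as [G2 [HG2 HD2]].
  apply (differential_ext _ _ _ _ (differential_ray_Int rad _ _ G2 _ _ _ x Hr (holo_geo_pow j) HG2
    (exp_decay_geo_pow j) (exp_decay_geo_pow1 j) HD2 (weight_ray_pow m n) Hx)).
  intros h. now apply IntR_geo_pow1.
Qed.

Lemma sech_lim K f (F : (R -> Prop) -> Prop) : Filter F -> sech_bounded K f ->
  filterlim cosh F (Rbar_locally p_infty) -> filterlim f F (locally (RtoC 0 : CR)).
Proof.
  intros FF [_ Hf] HF. apply (filterlim_locally f). intros e.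
  assert (HK : 0 <= K). { specialize (Hf 0). rewrite cosh_0 in Hf. pose proof (Cmod_ge_0 (f 0)). lra. }
  pose proof (cond_pos e) as He.
  assert (H : F (fun y => K / e + 1 < cosh y)).
  { apply HF. now exists (K / e + 1). }
  generalize H. apply filter_imp. intros y Hy. apply (norm_compat1 (V := CR)). toC.
  replace (f y - 0)%C with (f y) by ring.
  eapply Rle_lt_trans; [apply Hf|]. pose proof (cosh_gt_0 y).
  apply Rmult_lt_reg_r with (cosh y); auto. unfold Rdiv. rewrite Rmult_assoc, Rinv_l, Rmult_1_r by lra.
  assert (K / e * e = K) by (field; lra). nra.
Qed.

Lemma cosh_lim_p : filterlim cosh (Rbar_locally p_infty) (Rbar_locally p_infty).
Proof.
  intros P [M HM]. exists (2 * M). intros y Hy. apply HM.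
  unfold cosh. pose proof (exp_pos (- y)). 
  assert (y < exp y). { destruct (Req_dec y 0) as [->|H0]; [rewrite exp_0; lra|]. pose proof (exp_ineq1 y H0). lra. }
  lra.
Qed.

Lemma cosh_lim_m : filterlim cosh (Rbar_locally m_infty) (Rbar_locally p_infty).
Proof.
  apply (filterlim_ext (fun y => cosh (- y))); [intros; apply cosh_neg|].
  apply (filterlim_comp _ _ _ Ropp cosh _ (Rbar_locally p_infty)); [apply (filterlim_Rbar_opp m_infty)|apply cosh_lim_p].
Qed.

Lemma IntR_derive_0 K K' f df : sech_bounded K f -> sech_bounded K' df ->
  (forall y, is_derive (V := CR) f y (df y)) -> IntR df = RtoC 0.
Proof.
  intros Hf Hdf Hd. rewrite (Int_FTC K' f df (RtoC 0) (RtoC 0)); auto; [ring|..].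
  - eapply sech_lim; eauto using cosh_lim_m. apply _.
  - eapply sech_lim; eauto using cosh_lim_p. apply _.
Qed.

(** Integration by parts: the moments of [d geo_pow / d y]. *)
Lemma ray_moment_parts rad m n j (x : C * R) : 0 < rad -> Re (fst x) < 0 ->
  (RtoC (INR m - INR n) * ray_moment rad m n j x
   + RtoC (INR (S j)) * (RtoC (PI * rad) *
      (Cconj (fst x) * (ray_moment rad (S m) n j x + ray_moment rad (S m) n (S j) x)
       - fst x * (ray_moment rad m (S n) j x + ray_moment rad m (S n) (S j) x))))%C = RtoC 0.
Proof.
  intros Hr Hx.
  destruct (sech_moment rad m (S n) j x Hr Hx) as [M1 B1]. destruct (sech_moment rad m (S n) (S j) x Hr Hx) as [M2 B2].
  destruct (sech_moment rad (S m) n j x Hr Hx) as [M3 B3]. destruct (sech_moment rad (S m) n (S j) x Hr Hx) as [M4 B4].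
  destruct (sech_moment rad m n j x Hr Hx) as [M5 B5].
  (* The derivative in [y] of the integrand, expanded into integrands of moments. *)
  set (df := fun y => (RtoC (INR m - INR n) * (ray_pow m n y * geo_pow j (ray_exp rad x y))
     + RtoC (INR (S j)) * (RtoC (PI * rad) * (Cconj (fst x) *
        (ray_pow (S m) n y * geo_pow j (ray_exp rad x y) + ray_pow (S m) n y * geo_pow (S j) (ray_exp rad x y))
       + (- fst x) * (ray_pow m (S n) y * geo_pow j (ray_exp rad x y) + ray_pow m (S n) y * geo_pow (S j) (ray_exp rad x y)))))%C).
  assert (E : IntR df = RtoC 0).
  { assert (Bdf := sech_Cplus _ _ _ _ (sech_Cmult _ (RtoC (INR m - INR n)) _ B5)
      (sech_Cmult _ (RtoC (INR (S j))) _ (sech_Cmult _ (RtoC (PI * rad)) _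
        (sech_Cplus _ _ _ _ (sech_Cmult _ (Cconj (fst x)) _ (sech_Cplus _ _ _ _ B3 B4))
          (sech_Cmult _ (- fst x)%C _ (sech_Cplus _ _ _ _ B1 B2)))))).
    apply (IntR_derive_0 _ _ _ df B5 Bdf).
    intros y. apply is_derive_differential.
    assert (D1 : differential (U := RR) (V := CR) (ray_pow m n) y (fun h => RtoC (h * ((INR m - INR n) * exp (INR m * y - INR n * y))))).
    { apply (differential_RtoC (U := RR)). apply differential_of_derive, is_derive_ray_pow_exp. }
    assert (De : differential (U := RR) (V := CR) (fun y => RtoC (exp y)) y (fun h => RtoC (h * exp y))).
    { apply (differential_RtoC (U := RR)). apply differential_of_derive, is_derive_exp. }
    assert (Dn : differential (U := RR) (V := CR) (fun y => RtoC (exp (- y))) y (fun h => RtoC (h * - exp (- y)))).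
    { apply (differential_RtoC (U := RR)). apply differential_of_derive. auto_derive; auto. ring. }
    assert (D2 := differential_Cplus _ _ _ _ _ (differential_Cmult_const _ (RtoC (PI * rad)) _ _ (differential_Cplus _ _ _ _ _
       (differential_Cmult_const _ (fst x) _ _ Dn) (differential_Cmult_const _ (Cconj (fst x)) _ _ De)))
       (differential_const (U := RR) (V := CR) (Ci * RtoC (snd x))%C y)).
    assert (HRe : Re (ray_exp rad x y) < 0).
    { assert (H := Re_ray_exp_le rad x y (- Re (fst x)) Hr ltac:(lra) ltac:(lra)).
      pose proof PI_RGT_0. pose proof (cosh_gt_0 y).
      assert (0 < 2 * PI * rad * (- Re (fst x)) * cosh y) by mult_pos. lra. }
    assert (D3 := differential_comp (V := CR) (ray_exp rad x) _ _ _ _ D2 (holo_geo_pow j _ HRe)).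
    apply (differential_ext _ _ _ _ (differential_Cmult _ _ _ _ _ D1 D3)).
    intros h. unfold df. rewrite <- !ray_pow_exp, <- !ray_pow_exp_neg. unfold geo_pow1.
    unfold ray_pow. generalize (INR (S j)) (exp (INR m * y - INR n * y)) (exp y) (exp (- y)) (INR m - INR n) (PI * rad).
    clear. intros. generalize (geo_pow j (ray_exp rad x y)) (geo_pow (S j) (ray_exp rad x y)). intros g g'.
    destruct x as [[a b] t], g as [g1 g2], g' as [g1' g2'].
    apply injective_projections; simpl; unfold scal; simpl; unfold mult; simpl; toR; ring. }
  rewrite <- E. unfold df, ray_moment. symmetry. apply is_Int_unique.
  assert (EC : forall A p q : C, (A - p * q = A + (- p) * q)%C) by (intros; ring).
  rewrite EC.
  exact (is_Int_plus _ _ _ _ (is_Int_Cmult _ _ _ (Int_correct _ _ B5))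
    (is_Int_Cmult _ _ _ (is_Int_Cmult _ _ _ (is_Int_plus _ _ _ _
      (is_Int_Cmult _ _ _ (is_Int_plus _ _ _ _ (Int_correct _ _ B3) (Int_correct _ _ B4)))
      (is_Int_Cmult _ _ _ (is_Int_plus _ _ _ _ (Int_correct _ _ B1) (Int_correct _ _ B2))))))).
Qed.

(** * Independence of the direction of the ray *)

Lemma Cexp_pow z n : (Cexp z ^ n)%C = Cexp (RtoC (INR n) * z).
Proof.
  induction n as [|n IH].
  - simpl. rewrite <- Cexp_0. f_equal. ring.
  - rewrite S_INR, RtoC_plus. change (Cexp z ^ S n)%C with (Cexp z * Cexp z ^ n)%C.
    rewrite IH, <- Cexp_plus. f_equal. ring.
Qed.

Lemma Cexp_i_conj t : Cconj (Cexp (Ci * RtoC t)) = Cexp (- (Ci * RtoC t))%C.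
Proof. rewrite Cexp_conj. f_equal. apply injective_projections; simpl; ring. Qed.

Lemma Cexp_i t : Cexp (Ci * RtoC t) = (cos t, sin t).
Proof.
  unfold Cexp. replace (Re (Ci * RtoC t)) with 0 by (simpl; ring). replace (Im (Ci * RtoC t)) with t by (simpl; ring).
  rewrite exp_0. now rewrite !Rmult_1_l.
Qed.

Lemma differential_Ci_RtoC k t :
  differential (U := RR) (V := CR) (fun t => Cexp (Ci * RtoC (k * t))) t
    (fun h => (Cexp (Ci * RtoC (k * t)) * (Ci * RtoC (h * k)))%C).
Proof.
  apply (differential_Cexp_fct (U := RR)). apply (differential_Cmult_const (U := RR)).
  apply (differential_RtoC (U := RR)). apply differential_of_derive. auto_derive; auto. ring.
Qed.

(** Rotating [c] and the ray together does not change the exponent. *)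
Lemma ray_moment_rotation rad m n j rho phi th : 0 < rad -> 0 < rho -> - (PI / 2) < phi < PI / 2 ->
  (Cexp (Ci * RtoC ((INR n - INR m) * phi)) * ray_moment rad m n j (- RtoC rho * Cexp (Ci * RtoC phi), th))%C
  = ray_moment rad m n j (RtoC (- rho), th).
Proof.
  intros Hr Hrho Hphi.
  (* [F] is shown to be constant on the interval; the factor [1] in [1 * t] matches the shape of
     [differential_Ci_RtoC]. *)
  set (F := fun t => (Cexp (Ci * RtoC ((INR n - INR m) * t)) * ray_moment rad m n j (- RtoC rho * Cexp (Ci * RtoC (1 * t)), th))%C).
  assert (HD : forall t, - (PI / 2) < t < PI / 2 -> is_derive (V := CR) F t (RtoC 0)).
  { intros t Ht. apply is_derive_differential.
    set (w := Cexp (Ci * RtoC (1 * t))). set (x := (- RtoC rho * w, th)%C : C * R).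
    assert (Hx : Re (fst x) < 0).
    { unfold x, w. simpl fst. rewrite Cexp_i, Rmult_1_l. simpl.
      assert (0 < cos t) by (apply cos_gt_0; lra). ring_simplify. nra. }
    assert (D1 := differential_Ci_RtoC (INR n - INR m) t).
    assert (D2 := differential_pair (U := RR) (V := CR) (W := RR) _ _ _ _ _
        (differential_Cmult_const _ (- RtoC rho)%C _ _ (differential_Ci_RtoC 1 t)) (differential_const (U := RR) (V := RR) th t)).
    assert (D3 := differential_comp (U := RR) (V := E3) (W := CR) _ _ _ _ _ D2 (differential_ray_moment rad m n j x Hr Hx)).
    apply (differential_ext _ _ _ _ (differential_Cmult _ _ _ _ _ D1 D3)).
    intros h. cbv beta. fold w. change (- RtoC rho * w, th)%C with x.
    assert (P := ray_moment_parts rad m n j x Hr Hx).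
    unfold moment_diff. simpl fst in P |- *. simpl snd. 
    set (e := Cexp (Ci * RtoC ((INR n - INR m) * t))).
    set (A := ray_moment rad m n j x) in *.
    set (B1 := (ray_moment rad (S m) n j x + ray_moment rad (S m) n (S j) x)%C) in *.
    set (B2 := (ray_moment rad m (S n) j x + ray_moment rad m (S n) (S j) x)%C) in *.
    set (B3 := (ray_moment rad m n j x + ray_moment rad m n (S j) x)%C).
    (* The derivative of [F] is [- i e h] times the expression that vanishes by integration by
       parts. Zero is written as the same multiple of 0 so that [P] can be substituted. *)
    replace (scal h (RtoC 0 : CR)) with (e * RtoC h * Ci * (-(1)) * RtoC 0)%C
      by (apply injective_projections; simpl; unfold scal; simpl; unfold mult; simpl; ring).
    rewrite <- P. clear. generalize (INR (S j)). intros sj. generalize (INR n) (INR m). intros a b.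
    change (@zero RR) with 0. toC.
    rewrite !RtoC_minus, !RtoC_mult, RtoC_minus.
    replace (Cconj (- RtoC rho * (w * (Ci * (RtoC h * RtoC 1)))))%C with (RtoC rho * Cconj w * Ci * RtoC h)%C
      by (destruct w; apply injective_projections; simpl; ring).
    replace (Cconj (- RtoC rho * w))%C with (- RtoC rho * Cconj w)%C
      by (destruct w; apply injective_projections; simpl; ring).
    ring. }
  assert (E : F phi = F 0).
  { destruct (Rtotal_order phi 0) as [H|[->|H]]; auto.
    - apply (eq_is_derive (V := CR)); auto. intros t Ht. apply HD. pose proof PI_RGT_0. lra.
    - symmetry. apply (eq_is_derive (V := CR)); auto. intros t Ht. apply HD. pose proof PI_RGT_0. lra. }
  unfold F in E. rewrite !Rmult_1_l in E. rewrite E, Rmult_0_r.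
  replace (Ci * RtoC 0)%C with (RtoC 0) by ring. rewrite Cexp_0.
  replace (- RtoC rho * RtoC 1)%C with (RtoC (- rho)) by (apply injective_projections; simpl; ring).
  ring.
Qed.

(** The direction [u = - c / |c|] bisects the half-plane in which the ray may lie and turns [c] into
    [- |c|]. The result is a function on all of [c <> 0], without a choice of ray. *)
Definition moment (rad : R) (m n j : nat) (x : C * R) : C :=
  let u := (- fst x / RtoC (Cmod (fst x)))%C in
  (u ^ m * Cconj u ^ n * ray_moment rad m n j (RtoC (- Cmod (fst x)), snd x))%C.

Lemma Cmod_sqr_conj z : (z * Cconj z)%C = RtoC (Cmod z * Cmod z).
Proof. rewrite <- Cmod2_conj. simpl. rewrite Rmult_1_r, RtoC_mult. reflexivity. Qed.

(** An admissible [u] makes an angle in [(- PI / 2, PI / 2)] with [- c / |c|], and the rotation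
    lemma carries one direction to the other. *)
Lemma moment_ray rad m n j u (x : C * R) : 0 < rad -> Cmod u = 1 -> Re (fst x * Cconj u)%C < 0 ->
  (u ^ m * Cconj u ^ n * ray_moment rad m n j (fst x * Cconj u, snd x))%C = moment rad m n j x.
Proof.
  intros Hr Hu Hx. destruct x as [c th]. simpl fst in *. simpl snd.
  assert (Hc : 0 < Cmod c).
  { apply Cmod_gt_0. intros ->. revert Hx. replace (RtoC 0 * Cconj u)%C with (RtoC 0) by ring. simpl. lra. }
  set (rho := Cmod c) in *.
  assert (Hrc : RtoC rho <> RtoC 0) by (intros E; apply RtoC_inj in E; lra).
  set (w := (- (c * Cconj u) / RtoC rho)%C).
  assert (Hw1 : Cmod w = 1).
  { unfold w. rewrite Cmod_div, Cmod_opp, Cmod_mult, Cmod_conj, Hu, Cmod_R, Rabs_pos_eq by (auto; lra).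
    fold rho. field. lra. }
  assert (Hwre : 0 < Re w).
  { unfold w. replace (Re (- (c * Cconj u) / RtoC rho)%C) with (- Re (c * Cconj u)%C / rho).
    - apply Rdiv_lt_0_compat; lra.
    - unfold Cdiv. rewrite <- RtoC_inv by lra. simpl. unfold Rdiv. ring. }
  (* As [w] has modulus 1 and positive real part, this is its argument, strictly inside the
     interval. *)
  set (phi := asin (Im w)).
  assert (Hsq : Re w * Re w + Im w * Im w = 1).
  { assert (H := Cmod2_alt w). rewrite Hw1 in H. lra. }
  assert (Him : -1 < Im w < 1) by nra.
  assert (Hphi : - (PI / 2) < phi < PI / 2).
  { unfold phi. assert (H := asin_bound (Im w)).
    split.
    - destruct (Req_dec (asin (Im w)) (- (PI / 2))) as [E|E]; [|lra].
      assert (H2 := sin_asin (Im w) ltac:(lra)). rewrite E, sin_neg, sin_PI2 in H2. lra.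
    - destruct (Req_dec (asin (Im w)) (PI / 2)) as [E|E]; [|lra].
      assert (H2 := sin_asin (Im w) ltac:(lra)). rewrite E, sin_PI2 in H2. lra. }
  assert (Ew : w = Cexp (Ci * RtoC phi)).
  { rewrite Cexp_i. unfold phi. rewrite sin_asin, cos_asin by lra.
    replace (1 - Rsqr (Im w)) with (Rsqr (Re w)) by (unfold Rsqr; lra).
    rewrite sqrt_Rsqr by lra. destruct w; reflexivity. }
  assert (Ec : (c * Cconj u)%C = (- RtoC rho * Cexp (Ci * RtoC phi))%C).
  { rewrite <- Ew. unfold w. field. auto. }
  assert (Eu : u = (- c / RtoC rho * Cconj w)%C).
  { unfold w. rewrite Cdiv_conj, Copp_conj, Cmult_conj, Cconj_conj by auto.
    replace (Cconj (RtoC rho)) with (RtoC rho) by (apply injective_projections; simpl; ring).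
    transitivity (c * Cconj c * u / (RtoC rho * RtoC rho))%C; [|field; auto].
    rewrite Cmod_sqr_conj. fold rho. rewrite RtoC_mult. field. auto. }
  unfold moment. simpl fst. simpl snd. fold rho.
  rewrite <- (ray_moment_rotation rad m n j rho phi th Hr Hc Hphi), <- Ec.
  rewrite Eu at 1 2. rewrite Cmult_conj, Cconj_conj, !Cpow_mult_l.
  assert (EE : (Cconj w ^ m * w ^ n)%C = Cexp (Ci * RtoC ((INR n - INR m) * phi))).
  { rewrite Ew, Cexp_i_conj, !Cexp_pow, <- Cexp_plus. f_equal. rewrite RtoC_mult, RtoC_minus. ring. }
  rewrite <- EE. ring.
Qed.

Lemma unit_dir c : c <> RtoC 0 ->
  Cmod (- c / RtoC (Cmod c))%C = 1 /\ (c * Cconj (- c / RtoC (Cmod c)))%C = RtoC (- Cmod c).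
Proof.
  intros Hc. assert (Hp : 0 < Cmod c) by now apply Cmod_gt_0.
  assert (Hrc : RtoC (Cmod c) <> RtoC 0) by (intros E; apply RtoC_inj in E; lra).
  split.
  - rewrite Cmod_div, Cmod_opp, Cmod_R, Rabs_pos_eq by (auto; lra). field. lra.
  - rewrite Cdiv_conj, Copp_conj by auto.
    replace (Cconj (RtoC (Cmod c))) with (RtoC (Cmod c)) by (apply injective_projections; simpl; ring).
    transitivity (- (c * Cconj c) / RtoC (Cmod c))%C; [field; auto|].
    rewrite Cmod_sqr_conj, RtoC_mult, RtoC_opp. field. auto.
Qed.

Lemma is_linear_rot u : is_linear (U := E3) (V := E3) (fun q : C * R => (fst q * u, snd q)%C).
Proof.
  assert (H : differential (U := E3) (V := E3) (fun q : C * R => (fst q * u, snd q)%C) (zero : E3) (fun q : C * R => (fst q * u, snd q)%C)).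
  { apply (differential_pair (U := E3) (V := CR) (W := RR)).
    - apply (differential_eq_near (U := E3) (V := CR) (fun q : C * R => (u * fst q)%C)).
      + apply filter_forall. intros q. apply Cmult_comm.
      + apply (differential_ext (U := E3) (V := CR) _ _ _ _ (differential_Cmult_const (U := E3) _ u _ _ (differential_linear (U := E3) (V := CR) _ _ (is_linear_fst (U := CR) (V := RR))))).
        intros h. apply Cmult_comm.
    - apply differential_linear, (is_linear_snd (U := CR) (V := RR)). }
  exact (differential_is_linear _ _ _ H).
Qed.

(** Near [x] the direction can be frozen at its value [u] at [x], by independence of the ray. What
    remains is [ray_moment] composed with a linear map, so [- c / |c|] is never differentiated. *)
Lemma differential_moment rad m n j (x : C * R) : 0 < rad -> fst x <> RtoC 0 ->
  differential (U := E3) (V := CR) (moment rad m n j) x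
    (moment_diff rad (fun m n j => moment rad m n j x) m n j).
Proof.
  intros Hr Hx. destruct (unit_dir (fst x) Hx) as [Hu1 Hu2].
  assert (Hp : 0 < Cmod (fst x)) by now apply Cmod_gt_0.
  set (u := (- fst x / RtoC (Cmod (fst x)))%C) in *.
  set (T := fun q : C * R => (fst q * Cconj u, snd q)%C).
  assert (HTx : Re (fst (T x)) < 0) by (unfold T; simpl fst; rewrite Hu2; simpl; lra).
  apply (differential_eq_near (U := E3) (V := CR) (fun q => (u ^ m * Cconj u ^ n * ray_moment rad m n j (T q))%C)).
  - assert (HC : continuous (T := E3) (U := RR) (fun q => Re (fst (T q))) x).
    { apply (differential_continuous (U := E3) (V := RR) _ _ (fun q => Re (fst (T q)))).
      apply (differential_Re (U := E3)), (differential_fst (U := E3) (V := CR) (W := RR)).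
      apply (differential_linear (U := E3) (V := E3)), is_linear_rot. }
    assert (HO : locally (T := R_UniformSpace) (Re (fst (T x))) (fun t => t < 0)) by now apply (open_lt 0).
    generalize (HC _ HO). unfold filtermap. apply filter_imp. intros q Hq.
    apply (moment_ray rad m n j u q Hr Hu1 Hq).
  - apply (differential_ext _ _ _ _ (differential_Cmult_const (U := E3) _ (u ^ m * Cconj u ^ n)%C _ _
      (differential_comp (U := E3) (V := E3) (W := CR) T _ _ _ _ (differential_linear (U := E3) (V := E3) _ _ (is_linear_rot (Cconj u)))
         (differential_ray_moment rad m n j (T x) Hr HTx)))).
    intros h. unfold moment_diff.
    rewrite <- !(fun m n j => moment_ray rad m n j u x Hr Hu1 HTx).
    change (fst x * Cconj u, snd x)%C with (T x).
    simpl fst. simpl snd. rewrite Cmult_conj, Cconj_conj. rewrite !Cpow_S. toC. ring.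
Qed.

(** A derivative of a moment is a combination of moments whose coefficients are components of
    [dphi]; smoothness of these components carries the induction. *)
Lemma Cn_moment {U : RNorm} rad (D : U -> Prop) (phi : U -> C * R) (dphi : U -> U -> C * R) :
  0 < rad -> (forall p, D p -> fst (phi p) <> RtoC 0) ->
  (forall p, D p -> differential (V := E3) phi p (dphi p)) ->
  (forall k v, Cn (V := CR) k D (fun p => fst (dphi p v))) ->
  (forall k v, Cn (V := CR) k D (fun p => RtoC (snd (dphi p v)))) ->
  forall k m n j, Cn (V := CR) k D (fun p => moment rad m n j (phi p)).
Proof.
  intros Hr H0 Hd H1 H2. induction k as [|k IH]; intros m n j.
  - intros p Hp. apply (differential_continuous (V := CR) _ _ _ 
      (differential_comp (V := E3) (W := CR) _ _ _ _ _ (Hd p Hp) (differential_moment rad m n j (phi p) Hr (H0 p Hp)))).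
  - exists (fun p v => moment_diff rad (fun m n j => moment rad m n j (phi p)) m n j (dphi p v)). split.
    + intros p Hp. apply (differential_comp (V := E3) (W := CR) _ _ _ _ _ (Hd p Hp) (differential_moment rad m n j (phi p) Hr (H0 p Hp))).
    + intros v. unfold moment_diff.
      assert (K : forall k (c : C), Cn (V := CR) k D (fun _ : U => c)) by (intros; apply (Cn_const (V := CR))).
      assert (PL : forall f g : U -> CR, Cn k D f -> Cn k D g -> Cn (V := CR) k D (fun p => (f p + g p)%C))
        by (intros; now apply (Cn_plus (V := CR))).
      repeat first [apply PL | apply IH | apply Cn_Cmult | apply K | apply H1 | apply H2
       | apply (Cn_lin_post (V := CR) (W := CR) k D Cconj is_linear_Cconj)].
Qed.

(** Here [u * Cconj u = 1], and the weight is a function of [m - n]. *)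
Lemma moment_SS rad m n j x : fst x <> RtoC 0 -> moment rad (S m) (S n) j x = moment rad m n j x.
Proof.
  intros Hx. destruct (unit_dir (fst x) Hx) as [Hu1 Hu2]. unfold moment.
  set (u := (- fst x / RtoC (Cmod (fst x)))%C) in *.
  assert (E : ray_moment rad (S m) (S n) j (RtoC (- Cmod (fst x)), snd x) = ray_moment rad m n j (RtoC (- Cmod (fst x)), snd x)).
  { apply Int_ext. intros y. f_equal. unfold ray_pow. do 2 f_equal. rewrite !S_INR. ring. }
  rewrite E, !Cpow_S.
  transitivity ((u * Cconj u) * (u ^ m * Cconj u ^ n * ray_moment rad m n j (RtoC (- Cmod (fst x)), snd x)))%C; [ring|].
  rewrite Cmod_sqr_conj, Hu1, Rmult_1_r. ring.
Qed.

Lemma geo_conj z : Re z < 0 -> Cconj (geo z) = geo (Cconj z).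
Proof.
  intros Hz. unfold geo. rewrite Cdiv_conj by now apply one_minus_Cexp_neq.
  rewrite Cminus_conj, !Cexp_conj. do 2 f_equal. apply injective_projections; simpl; ring.
Qed.

Lemma Re_ray_exp_neg rad x y : 0 < rad -> Re (fst x) < 0 -> Re (ray_exp rad x y) < 0.
Proof.
  intros Hr Hx. assert (H := Re_ray_exp_le rad x y (- Re (fst x)) Hr ltac:(lra) ltac:(lra)).
  pose proof PI_RGT_0. pose proof (cosh_gt_0 y). assert (0 < 2 * PI * rad * (- Re (fst x)) * cosh y) by mult_pos. lra.
Qed.

(** For real [c] the exponent is even in [y], so reflecting [y] only exchanges [m] and [n], while
    conjugation changes the sign of the angle. *)
Lemma ray_moment_conj rad m n j a th : 0 < rad -> a < 0 ->
  Cconj (ray_moment rad m n j (RtoC a, th)) = ray_moment rad n m j (RtoC a, - th).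
Proof.
  intros Hr Ha. destruct (sech_moment rad m n j (RtoC a, th) Hr Ha) as [M B].
  destruct (sech_moment rad n m j (RtoC a, - th) Hr Ha) as [M' B'].
  unfold ray_moment. rewrite <- (Int_Cconj _ _ B), <- (Int_reflect _ _ B'). apply Int_ext. intros y.
  rewrite Cmult_conj. f_equal.
  - unfold ray_pow. apply injective_projections; simpl; [f_equal|]; ring.
  - unfold geo_pow. rewrite Cpow_conj. f_equal. rewrite geo_conj by now apply Re_ray_exp_neg.
    f_equal. unfold ray_exp. rewrite Ropp_involutive. apply injective_projections; simpl; ring.
Qed.

Lemma moment_conj rad m n j c th : 0 < rad -> c <> RtoC 0 ->
  Cconj (moment rad m n j (c, th)) = moment rad n m j (c, - th).
Proof.
  intros Hr Hc. assert (Hp : 0 < Cmod c) by now apply Cmod_gt_0.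
  unfold moment. simpl fst. simpl snd. rewrite !Cmult_conj, !Cpow_conj, Cconj_conj, ray_moment_conj by (auto; lra). ring.
Qed.

Lemma Cexp_period z (k : Z) : Cexp (z + Ci * RtoC (2 * PI * IZR k)) = Cexp z.
Proof.
  rewrite Cexp_plus, Cexp_i.
  assert (E : cos (2 * PI * IZR k) = 1 /\ sin (2 * PI * IZR k) = 0).
  { destruct (Z_le_gt_dec 0 k) as [H|H].
    - replace (2 * PI * IZR k) with (0 + 2 * INR (Z.to_nat k) * PI) by (rewrite INR_IZR_INZ, Z2Nat.id by lia; ring).
      rewrite cos_period, sin_period, cos_0, sin_0. auto.
    - replace (2 * PI * IZR k) with (- (0 + 2 * INR (Z.to_nat (- k)) * PI)) by (rewrite INR_IZR_INZ, Z2Nat.id, opp_IZR by lia; ring).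
      rewrite cos_neg, sin_neg, cos_period, sin_period, cos_0, sin_0. split; ring. }
  destruct E as [-> ->]. change (1, 0) with (RtoC 1). ring.
Qed.

(** This is behind the lattice invariance of all forms below: a period shifts [theta_e] by a
    multiple of [2 PI]. *)
Lemma moment_period rad m n j c th (k : Z) :
  moment rad m n j (c, th + 2 * PI * IZR k) = moment rad m n j (c, th).
Proof.
  unfold moment. simpl fst. simpl snd. f_equal. apply Int_ext. intros y.
  assert (E : ray_exp rad (RtoC (- Cmod c), th + 2 * PI * IZR k) y = (ray_exp rad (RtoC (- Cmod c), th) y + Ci * RtoC (2 * PI * IZR k))%C).
  { unfold ray_exp. simpl fst. simpl snd. rewrite RtoC_plus. ring. }
  unfold geo_pow, geo. now rewrite E, Cexp_period.
Qed.

(** * The ray integrals of [chi_m] *)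

(** The substitution [y = ln s + ln r] moves the length of the direction into the parameter, so that
    unit directions suffice from here on. *)
Lemma ray_int_exp (r : R) (u : C) (f : C -> C) (g : R -> C) M : 0 < r -> sech_bounded M g ->
  (forall y, f (RtoC (exp y) * u)%C = g y) -> ray_int (RtoC r * u)%C f = IntR g.
Proof.
  intros Hr Hg Hfg. unfold ray_int.
  assert (H : is_RInt_gen (V := CR) (fun s => (f (RtoC s * (RtoC r * u)) / RtoC s)%C) (at_right 0) (Rbar_locally p_infty) (IntR g)).
  { refine (is_Int_subst (fun s => 0 < s) (at_right 0) (Rbar_locally p_infty) g _ (fun s => ln s + ln r) (fun s => / s) _ _ _ _ _ _ _ _ _ _ _ _ (Int_correct _ _ Hg)).
    - exists (mkposreal 1 Rlt_0_1). intros y _ Hy. exact Hy.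
    - exists 0. auto.
    - intros a b x Ha Hb [Hx _]. eapply Rlt_le_trans; [|exact Hx]. now apply Rmin_glb_lt.
    - intros x Hx. auto_derive; auto. ring.
    - intros x Hx. apply (continuous_of_derive (V := RR) Rinv x (- / x ^ 2)). auto_derive; [lra|]. field. lra.
    - apply Hg.
    - intros x Hx. rewrite <- Hfg, exp_plus, !exp_ln, RtoC_mult by auto.
      rewrite RtoC_inv by lra. rewrite Cmult_assoc. unfold Cdiv. apply Cmult_comm.
    - apply (filterlim_comp _ _ _ ln (fun t => t + ln r) _ (Rbar_locally m_infty)); [apply is_lim_ln_0|].
      intros P [K HK]. exists (K - ln r). intros y Hy. apply HK. lra.
    - apply (filterlim_comp _ _ _ ln (fun t => t + ln r) _ (Rbar_locally p_infty)); [apply is_lim_ln_p|].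
      intros P [K HK]. exists (K - ln r). intros y Hy. apply HK. lra. }
  exact (is_RInt_gen_unique (V := CC) (Fa := at_right 0) (Fb := Rbar_locally p_infty) _ _ H).
Qed.

Definition kernel (zeta z : C) : C := ((z + zeta) / (z - zeta))%C.

Definition ray_kernel (u zeta : C) (y : R) : C := kernel zeta (RtoC (exp y) * u)%C.

(** With [q = |zeta|] and [k = Re (u * Cconj zeta)], the squared moduli of numerator and denominator
    are [p^2 + 2 p k + q^2] and [p^2 - 2 p k + q^2]. Off the ray [k < q], since equality in the
    Cauchy-Schwarz inequality would put [zeta] on it. *)
Lemma kernel_bound u zeta : Cmod u = 1 -> zeta <> RtoC 0 -> ~ on_ray u zeta ->
  exists K, 0 <= K /\ forall p, 0 < p ->
    (RtoC p * u - zeta)%C <> RtoC 0 /\ Cmod (kernel zeta (RtoC p * u)) <= K.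
Proof.
  intros Hu Hz Hray.
  set (q := Cmod zeta). assert (Hq : 0 < q) by now apply Cmod_gt_0.
  set (k := Re (u * Cconj zeta)%C).
  assert (Hu2 : Re u * Re u + Im u * Im u = 1).
  { assert (H := Cmod2_alt u). rewrite Hu in H. lra. }
  assert (Hq2 : q * q = Re zeta * Re zeta + Im zeta * Im zeta).
  { assert (H := Cmod2_alt zeta). fold q in H. lra. }
  assert (Hk : k = Re u * Re zeta + Im u * Im zeta) by (unfold k; simpl; unfold Re, Im; ring).
  assert (Hn : forall p, 0 < p -> (RtoC p * u - zeta)%C <> RtoC 0).
  { intros p Hp E. apply Hray. exists p. split; auto.
    replace zeta with (RtoC p * u - (RtoC p * u - zeta))%C by ring. rewrite E. ring. }
  assert (Hkq : k < q).
  { destruct (Rlt_le_dec k q) as [H|H]; auto. exfalso. apply (Hn q Hq).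
    assert (E : (Re zeta - q * Re u) * (Re zeta - q * Re u) + (Im zeta - q * Im u) * (Im zeta - q * Im u) <= 0).
    { replace (_ + _) with (q * q + q * q * (Re u * Re u + Im u * Im u) - 2 * q * k) by (rewrite Hk, Hq2 at 1; ring).
      rewrite Hu2. nra. }
    destruct (Rplus_sqr_eq_0 (Re zeta - q * Re u) (Im zeta - q * Im u)) as [E1 E2].
    { pose proof (Rle_0_sqr (Re zeta - q * Re u)). pose proof (Rle_0_sqr (Im zeta - q * Im u)). unfold Rsqr in *. lra. }
    destruct u, zeta. apply injective_projections; simpl in *; lra. }
  assert (M1 : forall p, Cmod (RtoC p * u - zeta) ^ 2 = p * p - 2 * p * k + q * q).
  { intros p. rewrite Cmod2_alt, Hk, Hq2. replace (p * p) with (p * p * (Re u * Re u + Im u * Im u)) by (rewrite Hu2; ring).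
    destruct u, zeta. simpl. ring. }
  assert (M2 : forall p, Cmod (RtoC p * u + zeta) ^ 2 = p * p + 2 * p * k + q * q).
  { intros p. rewrite Cmod2_alt, Hk, Hq2. replace (p * p) with (p * p * (Re u * Re u + Im u * Im u)) by (rewrite Hu2; ring).
    destruct u, zeta. simpl. ring. }
  (* For [k > 0] the quotient of the squares is at most [2 q / (q - k)]. The [+ 1] makes [K2 >= 1],
     which covers [k <= 0] and lets [K2] bound the quotient itself as well as its square. *)
  set (K2 := 2 * q / (q - k) + 1).
  assert (HK2 : 1 <= K2). { unfold K2. assert (0 < 2 * q / (q - k)) by (apply Rdiv_lt_0_compat; lra). lra. }
  exists K2. split; [lra|]. intros p Hp. split; auto.
  unfold kernel. rewrite Cmod_div by auto. specialize (M1 p). specialize (M2 p). specialize (Hn p Hp).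
  apply Cmod_gt_0 in Hn. set (a := Cmod (RtoC p * u - zeta)) in *.
  assert (Hb := Cmod_ge_0 (RtoC p * u + zeta)). set (b := Cmod (RtoC p * u + zeta)) in *.
  apply Rmult_le_reg_r with a; auto. unfold Rdiv. rewrite Rmult_assoc, Rinv_l, Rmult_1_r by lra.
  apply Rsqr_incr_0_var; [|nra]. unfold Rsqr.
  assert (Hmain : b ^ 2 <= K2 * a ^ 2).
  { rewrite M1, M2. destruct (Rle_dec k 0) as [Hk0|Hk0].
    - assert (0 <= p * (- k)) by nra. assert (0 <= K2 - 1) by lra. nra.
    - assert (H : (q - k) * (p * p + 2 * p * k + q * q) <= 2 * q * (p * p - 2 * p * k + q * q)).
      { assert (Hpq := Rle_0_sqr (p - q)). unfold Rsqr in Hpq.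
        assert (H1 : 0 <= k * ((p - q) * (p - q))) by (apply Rmult_le_pos; lra).
        assert (H2 : p * k <= p * q) by (apply Rmult_le_compat_l; lra).
        assert (H3 : (q - k) * (p * p + 2 * p * k + q * q) <= (q - k) * (2 * (p * p + q * q))) by (apply Rmult_le_compat_l; lra).
        lra. }
      unfold K2. apply Rle_trans with (2 * q / (q - k) * (p * p - 2 * p * k + q * q)).
      + apply Rmult_le_reg_l with (q - k); [lra|].
        replace ((q - k) * (2 * q / (q - k) * (p * p - 2 * p * k + q * q))) with (2 * q * (p * p - 2 * p * k + q * q)) by (field; lra).
        exact H.
      + rewrite <- M1. assert (0 <= a ^ 2) by apply pow2_ge_0. nra. }
  assert (0 <= a ^ 2) by apply pow2_ge_0. nra.
Qed.

Lemma weight_kernel u zeta : Cmod u = 1 -> zeta <> RtoC 0 -> ~ on_ray u zeta ->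
  exists K, weight K 0 (ray_kernel u zeta).
Proof.
  intros Hu Hz Hray. destruct (kernel_bound u zeta Hu Hz Hray) as [K [HK B]].
  exists K. split.
  - intros y. unfold ray_kernel, kernel, Cdiv.
    assert (H1 : continuous (U := CR) (fun y => (RtoC (exp y) * u)%C) y).
    { apply continuous_Cmult; [apply continuous_RtoC, continuous_exp_y|apply continuous_const]. }
    apply continuous_Cmult.
    + apply (continuous_plus (V := CR)); auto. apply continuous_const.
    + apply (continuous_comp (V := CR) (W := CR) (fun y => (RtoC (exp y) * u - zeta)%C) Cinv).
      * apply (continuous_minus (V := CR)); auto. apply continuous_const.
      * eapply (differential_continuous (U := CR) (V := CR)). apply differential_Cinv. apply B, exp_pos.
  - intros y. simpl. rewrite Rmult_1_r. apply B, exp_pos.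
Qed.

(** The differential of the exponent of [chi_e (zeta)]. *)
Definition dexponent (rad : R) (zeta : C) (h : C * R) : C :=
  (RtoC (PI * rad) * (fst h / zeta + Cconj (fst h) * zeta) + Ci * RtoC (snd h))%C.

Lemma holo_geo_0 : exists G2, holo (fun z => - (1) * geo_pow 0 z)%C G2 /\ exp_decay G2.
Proof.
  eexists. split; [apply holo_scal, holo_geo_pow|apply exp_decay_scal, exp_decay_geo_pow1].
Qed.

Definition log_int (rad : R) (u zeta : C) (q : C * R) : C :=
  IntR (fun y => (ray_kernel u zeta y * log1m (ray_exp rad (fst q * Cconj u, snd q)%C y))%C).

(** [kernel (z') d(z') = kernel (z') d(zeta) + pi R ((z' + zeta) dcbar - (1/zeta + 1/z') dc)],
    where [d] is [dexponent]; hence only three moments survive the wedge product with [d (zeta)]. *)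
Lemma differential_log_int rad u zeta (x : C * R) :
  0 < rad -> Cmod u = 1 -> zeta <> RtoC 0 -> ~ on_ray u zeta -> Re (fst x * Cconj u)%C < 0 ->
  exists M : C, differential (U := E3) (V := CR) (log_int rad u zeta) x (fun h =>
    (M * dexponent rad zeta h
     - RtoC (PI * rad) * ((moment rad 1 0 0 x + zeta * moment rad 0 0 0 x) * Cconj (fst h)
                          - (moment rad 0 0 0 x / zeta + moment rad 0 1 0 x) * fst h))%C).
Proof.
  intros Hr Hu Hz Hray Hx.
  destruct (weight_kernel u zeta Hu Hz Hray) as [K HW]. destruct (kernel_bound u zeta Hu Hz Hray) as [K' [_ HB]].
  destruct holo_geo_0 as [G2 [HG2 HD2]].
  set (T := fun q : C * R => (fst q * Cconj u, snd q)%C).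
  assert (HTx : Re (fst (T x)) < 0) by exact Hx.
  assert (D := differential_comp (U := E3) (V := E3) (W := CR) T _ _ _ _ (differential_linear (U := E3) (V := E3) _ _ (is_linear_rot (Cconj u)))
    (differential_ray_Int rad _ _ G2 K 0 _ (T x) Hr holo_log1m HG2 exp_decay_log1m (exp_decay_scal _ _ (exp_decay_geo_pow 0)) HD2 HW HTx)).
  destruct (sech_weight_decay rad _ _ 0 (- Re (fst (T x))) Hr ltac:(lra) (holo_geo_pow 0) (exp_decay_geo_pow 0)) as [M0 [_ HM0]].
  specialize (HM0 K _ (T x) HW ltac:(lra)).
  (* The integral against the full kernel appears only as coefficient of [dexponent]; such a term is
     removed by the wedge product with [dlog chi_e]. *)
  exists (- (1) * IntR (fun y => ray_kernel u zeta y * geo_pow 0 (ray_exp rad (T x) y)))%C.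
  apply (differential_ext _ _ _ _ D). intros h. clear D.
  destruct (sech_moment rad 1 0 0 (T x) Hr HTx) as [M1 B1].
  destruct (sech_moment rad 0 1 0 (T x) Hr HTx) as [M2 B2].
  destruct (sech_moment rad 0 0 0 (T x) Hr HTx) as [M3 B3].
  rewrite <- !(fun m n j => moment_ray rad m n j u x Hr Hu Hx). change (fst x * Cconj u, snd x)%C with (T x).
  assert (H := is_Int_plus _ _ _ _ (is_Int_Cmult (- (1) * dexponent rad zeta h)%C _ _ (Int_correct _ _ HM0))
     (is_Int_Cmult (- RtoC (PI * rad))%C _ _ (is_Int_plus _ _ _ _
        (is_Int_Cmult (Cconj (fst h)) _ _ (is_Int_plus _ _ _ _ (is_Int_Cmult u _ _ (Int_correct _ _ B1)) (is_Int_Cmult zeta _ _ (Int_correct _ _ B3))))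
        (is_Int_Cmult (- fst h)%C _ _ (is_Int_plus _ _ _ _ (is_Int_Cmult (/ zeta) _ _ (Int_correct _ _ B3)) (is_Int_Cmult (Cconj u) _ _ (Int_correct _ _ B2))))))).
  transitivity (- (1) * dexponent rad zeta h * IntR (fun y => ray_kernel u zeta y * geo_pow 0 (ray_exp rad (T x) y))
    + - RtoC (PI * rad) * (Cconj (fst h) * (u * ray_moment rad 1 0 0 (T x) + zeta * ray_moment rad 0 0 0 (T x))
        + - fst h * (/ zeta * ray_moment rad 0 0 0 (T x) + Cconj u * ray_moment rad 0 1 0 (T x))))%C.
  2:{ rewrite !Cpow_S. simpl Cpow. toC. unfold Cdiv. ring. }
  apply is_Int_unique. refine (eq_ind _ (fun f => is_Int f _) H _ _).
  apply functional_extensionality. intros y.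
  destruct (HB (exp y) (exp_pos y)) as [Hne _].
  assert (P0 : ray_pow 0 0 y = RtoC 1).
  { unfold ray_pow. simpl. replace (0 * y - 0 * y) with 0 by ring. now rewrite exp_0. }
  assert (P1 : ray_pow 1 0 y = RtoC (exp y)) by (rewrite <- ray_pow_exp, P0; ring).
  assert (P2 : ray_pow 0 1 y = RtoC (exp (- y))) by (rewrite <- ray_pow_exp_neg, P0; ring).
  generalize (geo_pow 0 (ray_exp rad (T x) y)). intros g.
  rewrite P0, P1, P2. unfold T, ray_kernel, kernel, dexponent, ray_exp. simpl fst. simpl snd.
  rewrite Cmult_conj, Cconj_conj.
  assert (He : RtoC (exp y) <> RtoC 0) by (intros E; apply RtoC_inj in E; pose proof (exp_pos y); lra).
  assert (Hun : u <> RtoC 0) by (intros E; rewrite E, Cmod_0 in Hu; lra).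
  assert (Ecu : Cconj u = (/ u)%C).
  { assert (E := Cmod_sqr_conj u). rewrite Hu, Rmult_1_r in E.
    transitivity (u * Cconj u / u)%C; [field; auto|]. rewrite E. field. auto. }
  rewrite exp_Ropp, RtoC_inv, Ecu by (pose proof (exp_pos y); lra).
  field. auto.
Qed.

(** * Harmonic functions and branches of the logarithm *)

Definition smoothC (f : C -> R) : Prop := smooth (U := CR) (V := RR) (fun _ => True) f.

Lemma pd_differential (f : C -> R) c L : differential (U := CR) (V := RR) f c L ->
  pd1 f c = L (1, 0) /\ pd2 f c = L (0, 1) /\
  ex_derive (fun x => f (x, Im c)) (Re c) /\ ex_derive (fun y => f (Re c, y)) (Im c).
Proof.
  intros H. destruct c as [a b]. simpl Re. simpl Im.
  assert (D1 : differential (U := RR) (V := CR) (fun x => (x, b)) a (fun h => (h, 0))).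
  { apply (differential_Cpair (U := RR)); [apply differential_linear, is_linear_id|apply (differential_const (V := RR))]. }
  assert (D2 : differential (U := RR) (V := CR) (fun x => (a, x)) b (fun h => (0, h))).
  { apply (differential_Cpair (U := RR)); [apply (differential_const (V := RR))|apply differential_linear, is_linear_id]. }
  assert (H1 := differential_derive _ _ _ (differential_comp (U := RR) (V := CR) (W := RR) _ f a _ _ D1 H)).
  assert (H2 := differential_derive _ _ _ (differential_comp (U := RR) (V := CR) (W := RR) _ f b _ _ D2 H)).
  repeat split.
  - exact (is_derive_unique _ _ _ H1).
  - exact (is_derive_unique _ _ _ H2).
  - now exists (L (1, 0)).
  - now exists (L (0, 1)).
Qed.

Lemma open_true {T : UniformSpace} : open (fun _ : T => True).
Proof. intros x _. now apply filter_forall. Qed.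

Lemma smoothC_pd1 f : smoothC f -> smoothC (pd1 f).
Proof.
  intros Hf n. destruct (Hf (S n)) as [df [H1 H2]].
  apply (Cn_ext (U := CR) (V := RR) n _ (fun p => df p (1, 0))); [apply open_true| |apply H2].
  intros p _. symmetry. now apply pd_differential, H1.
Qed.

Lemma smoothC_pd2 f : smoothC f -> smoothC (pd2 f).
Proof.
  intros Hf n. destruct (Hf (S n)) as [df [H1 H2]].
  apply (Cn_ext (U := CR) (V := RR) n _ (fun p => df p (0, 1))); [apply open_true| |apply H2].
  intros p _. symmetry. now apply pd_differential, H1.
Qed.

Lemma smoothC_differential f c : smoothC f ->
  differential (U := CR) (V := RR) f c (fun h => Re h * pd1 f c + Im h * pd2 f c).
Proof.
  intros Hf. destruct (Hf 1%nat) as [df [H1 _]].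
  assert (H := H1 c I). destruct (pd_differential f c _ H) as [E1 [E2 _]].
  apply (differential_ext _ _ _ _ H). intros h. rewrite E1, E2.
  assert (HL := differential_is_linear _ _ _ H).
  transitivity (plus (scal (Re h) (df c (1, 0) : RR)) (scal (Im h) (df c (0, 1) : RR))); [|reflexivity].
  rewrite <- !(linear_scal _ HL), <- (linear_plus _ HL). f_equal.
  destruct h as [x y]. apply injective_projections; simpl; unfold scal, plus; simpl; unfold mult; simpl; toR; ring.
Qed.

Lemma smoothC_continuous f c : smoothC f -> continuous (T := CR) (U := RR) f c.
Proof. intros Hf. now apply (Hf 0%nat). Qed.

Lemma pd12 f c : smoothC f -> pd2 (pd1 f) c = pd1 (pd2 f) c.
Proof.
  intros Hf. destruct c as [x y]. unfold pd1, pd2; simpl.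
  symmetry. apply (Schwarz (fun x y => f (x, y)) x y).
  - exists (mkposreal 1 Rlt_0_1). intros u v _ _.
    assert (E := pd_differential f (u, v) _ (smoothC_differential f (u, v) Hf)).
    assert (E1 := pd_differential _ (u, v) _ (smoothC_differential _ (u, v) (smoothC_pd1 f Hf))).
    assert (E2 := pd_differential _ (u, v) _ (smoothC_differential _ (u, v) (smoothC_pd2 f Hf))).
    repeat split; [apply E|apply E|apply E2|apply E1].
  - apply continuity_2d_pt_filterlim.
    eapply filterlim_ext; [|apply (smoothC_continuous (pd1 (pd2 f)) (x, y)); now apply smoothC_pd1, smoothC_pd2].
    intros [a b]. reflexivity.
  - apply continuity_2d_pt_filterlim.
    eapply filterlim_ext; [|apply (smoothC_continuous (pd2 (pd1 f)) (x, y)); now apply smoothC_pd2, smoothC_pd1].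
    intros [a b]. reflexivity.
Qed.

Lemma harmonic_pd1 f : smoothC f -> harmonic f -> harmonic (pd1 f).
Proof.
  intros Hf Hh c.
  assert (E : pd2 (pd1 f) = pd1 (pd2 f)) by (apply functional_extensionality; intros; now apply pd12).
  rewrite E, pd12 by now apply smoothC_pd2.
  assert (E2 : pd2 (pd2 f) = fun c => - pd1 (pd1 f) c).
  { apply functional_extensionality. intros z. specialize (Hh z). lra. }
  rewrite E2. unfold pd1 at 4. rewrite Derive_opp. unfold pd1 at 1. lra.
Qed.

(** The complex derivative of the holomorphic function with real part [f]. *)
Definition dholo (f : C -> R) (c : C) : C := (pd1 f c, - pd2 f c).

(** Harmonicity and the equality of mixed partial derivatives are the Cauchy-Riemann equations for
    the pair [(f_1, - f_2)]. *)
Lemma differential_dholo f c : smoothC f -> harmonic f ->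
  differential (U := CR) (V := CR) (dholo f) c (fun h => (dholo (pd1 f) c * h)%C).
Proof.
  intros Hf Hh.
  assert (D1 := smoothC_differential _ c (smoothC_pd1 f Hf)).
  assert (D2 := differential_Ropp _ _ _ (smoothC_differential _ c (smoothC_pd2 f Hf))).
  apply (differential_ext _ _ _ _ (differential_Cpair _ _ _ _ _ D1 D2)).
  intros [a b]. specialize (Hh c). assert (E := pd12 f c Hf). unfold dholo.
  apply injective_projections; simpl; toR.
  - ring.
  - rewrite <- E. replace (pd2 (pd2 f) c) with (- pd1 (pd1 f) c) by lra. ring.
Qed.

Lemma Cn_dholo n f : smoothC f -> Cn (U := CR) (V := CR) n (fun _ => True) (dholo f).
Proof.
  intros Hf. apply (Cn_pair (U := CR) (V := RR) (W := RR)); [now apply smoothC_pd1|].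
  apply (Cn_lin_post (V := RR) (W := RR) n _ (fun x : R => - x)); [apply (is_linear_opp (V := RR))|now apply smoothC_pd2].
Qed.

(** The complex derivative refers to the uniform structure given by the modulus, [differential] to
    that of the product; [locally_C] says that both have the same neighbourhoods. *)
Lemma differential_complex (F : C -> C) (c l : C) :
  is_derive (K := C_AbsRing) (V := C_NormedModule) F c l ->
  differential (U := CR) (V := CR) F c (fun h => (l * h)%C).
Proof.
  intros [_ H].
  assert (HF : is_filter_lim (T := AbsRing_UniformSpace C_AbsRing) (@locally (AbsRing_UniformSpace C_AbsRing) c) c) by (intros P HP; exact HP).
  specialize (H c HF).
  split; [apply is_linear_Cmult|].
  intros x Hx. apply (is_filter_lim_locally_unique (c : CR) x) in Hx. subst x.
  intros e. specialize (H e). apply locally_C in H.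
  generalize H. apply filter_imp. intros q Hq. rewrite !norm_C.
  match goal with |- Cmod ?A <= _ => replace A with (F q - F c - (q - c) * l)%C by (toC; ring) end.
  exact Hq.
Qed.

(** A complex linear differential is determined by its real part, here the differential of [S]. *)
Lemma differential_conjugate S St c : smoothC S -> harmonic_conjugate S St ->
  differential (U := CR) (V := CR) (fun z => (S z, St z) : C) c (fun h => (dholo S c * h)%C).
Proof.
  intros HS Hc. destruct (Hc c) as [l Hl]. apply differential_complex in Hl.
  assert (HR := differential_Re _ _ _ Hl). destruct (pd_differential S c _ HR) as [E1 [E2 _]].
  replace (dholo S c) with l; [exact Hl|]. unfold dholo. rewrite E1, E2.
  destruct l. apply injective_projections; simpl; ring.
Qed.

(** * Local branches of the logarithm *)

Lemma Carg_polar r t : 0 < r -> - (PI / 2) < t < PI / 2 -> Carg (r * cos t, r * sin t) = t.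
Proof.
  intros Hr Ht. assert (Hc : 0 < cos t) by (apply cos_gt_0; lra).
  assert (Hm : Cmod (r * cos t, r * sin t) = r).
  { unfold Cmod; simpl. replace (_ + _) with (Rsqr r * (Rsqr (sin t) + Rsqr (cos t))) by (unfold Rsqr; ring).
    rewrite sin2_cos2, Rmult_1_r. apply sqrt_Rsqr. lra. }
  unfold Carg. rewrite Hm. simpl. destruct (Rlt_dec 0 (r + r * cos t)) as [_|N]; [|exfalso; apply N; nra].
  assert (Hc2 : 0 < cos (t / 2)) by (apply cos_gt_0; lra).
  assert (E : r * sin t / (r + r * cos t) = tan (t / 2)).
  { replace (sin t) with (2 * sin (t / 2) * cos (t / 2)) by (rewrite <- sin_2a; f_equal; field).
    assert (Ec : cos t = 2 * cos (t / 2) * cos (t / 2) - 1) by (rewrite <- cos_2a_cos; f_equal; field).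
    rewrite Ec in *. unfold tan. field. split; nra. }
  rewrite E, atan_tan by lra. field.
Qed.

(** Near [q = c] the quotient is close to 1, where the principal logarithm is smooth; every local
    branch of the logarithm is this function plus a constant. *)
Lemma differential_ln_quot c : c <> RtoC 0 ->
  differential (U := CR) (V := CR) (fun q => Clog (q / c)%C) c (fun h => (h / c)%C).
Proof.
  intros Hc.
  assert (D1 : differential (U := CR) (V := CR) (fun q => (/ c * q)%C) c (fun h => (/ c * h)%C))
    by (apply (differential_Cmult_const (U := CR)), differential_Cid).
  assert (E1 : (/ c * c)%C = RtoC 1) by (field; auto).
  assert (D2 := differential_Clog (/ c * c)%C). rewrite E1 in D2. specialize (D2 ltac:(simpl; lra)).
  rewrite <- E1 in D2 at 1.
  apply (differential_eq_near (U := CR) (V := CR) (fun q => Clog (/ c * q)%C)).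
  - apply filter_forall. intros q. f_equal. apply Cmult_comm.
  - apply (differential_ext _ _ _ _ (differential_comp (U := CR) (V := CR) (W := CR) _ _ _ _ _ D1 D2)).
    intros h. toC. field. auto.
Qed.

Lemma locally_neq_0 c : c <> RtoC 0 -> locally (c : CR) (fun q : CR => q <> RtoC 0).
Proof.
  intros Hc. apply Cmod_gt_0 in Hc. apply (locally_le_locally_norm (V := CR)). exists (mkposreal _ Hc).
  intros q Hq ->. unfold ball_norm in Hq. rewrite norm_C in Hq. simpl in Hq.
  replace (minus (RtoC 0 : CR) c) with (- c)%C in Hq by (toC; ring). rewrite Cmod_opp in Hq. lra.
Qed.

Lemma differential_ln_Cmod c : c <> RtoC 0 ->
  differential (U := CR) (V := RR) (fun q => ln (Cmod q)) c (fun h => Re (h / c)%C).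
Proof.
  intros Hc. assert (D := differential_Re _ _ _ (differential_ln_quot c Hc)).
  assert (D2 := differential_Rplus _ _ _ _ _ (differential_const (U := CR) (V := RR) (ln (Cmod c)) c) D).
  apply (differential_eq_near (U := CR) (V := RR) (fun q => ln (Cmod c) + Re (Clog (q / c)%C))).
  - generalize (locally_neq_0 c Hc). apply filter_imp. intros q Hq. simpl.
    apply Cmod_gt_0 in Hq. rewrite Cmod_div by auto. apply Cmod_gt_0 in Hc. rewrite ln_div; auto. ring.
  - apply (differential_ext _ _ _ _ D2). intros h. toR. ring.
Qed.

(** Continuity keeps [a q] within [PI / 2] of [a c], so that [a q - a c] is the principal argument
    of [q / c]. *)
Lemma arg_branch_near eps D a c : arg_branch eps D a -> D c ->
  locally (c : CR) (fun q => D q /\ lnC a q = (lnC a c + Clog (q / c))%C).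
Proof.
  intros [HD Ha] Hc. destruct (Ha c Hc) as [HB [Hcont Epol]].
  assert (Hp : 0 < Cmod c) by apply HB.
  assert (Hp2 : 0 < PI / 2) by (pose proof PI_RGT_0; lra).
  assert (H1 := proj1 (filterlim_locally (U := RR) a (a c)) Hcont (mkposreal _ Hp2)).
  generalize (filter_and _ _ (HD c Hc) H1). apply filter_imp.
  intros q [Dq Hq]. split; auto.
  destruct (Ha q Dq) as [HBq [_ Epq]]. assert (Hpq : 0 < Cmod q) by apply HBq.
  change (Rabs (a q - a c) < PI / 2) in Hq. apply Rabs_def2 in Hq.
  set (r := Cmod q / Cmod c). assert (Hr : 0 < r) by now apply Rdiv_lt_0_compat.
  assert (E : (q / c)%C = (r * cos (a q - a c), r * sin (a q - a c))).
  { assert (Hcn : c <> RtoC 0) by now apply Cmod_gt_0.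
    set (w := ((r * cos (a q - a c))%R, (r * sin (a q - a c))%R) : C).
    transitivity (w * c / c)%C; [|field; auto]. f_equal.
    transitivity (RtoC (Cmod q) * (cos (a q), sin (a q)))%C; [exact Epq|].
    transitivity (w * (RtoC (Cmod c) * (cos (a c), sin (a c))))%C; [|f_equal; symmetry; exact Epol].
    unfold w, r. rewrite cos_minus, sin_minus.
    assert (P := sin2_cos2 (a c)). unfold Rsqr in P.
    assert (Hpc : Cmod c <> 0) by lra.
    apply injective_projections; simpl; rewrite !Rmult_0_l, ?Rminus_0_r, ?Rplus_0_r.
    - transitivity (Cmod q * cos (a q) * (sin (a c) * sin (a c) + cos (a c) * cos (a c))); [rewrite P; ring|field; auto].
    - transitivity (Cmod q * sin (a q) * (sin (a c) * sin (a c) + cos (a c) * cos (a c))); [rewrite P; ring|field; auto]. }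
  unfold lnC, Clog. rewrite (f_equal Carg E), Carg_polar by (auto; lra).
  rewrite Cmod_div by (now apply Cmod_gt_0). rewrite ln_div by auto.
  apply injective_projections; simpl; ring.
Qed.

Lemma differential_lnC eps D a c : arg_branch eps D a -> D c ->
  differential (U := CR) (V := CR) (lnC a) c (fun h => (h / c)%C).
Proof.
  intros Ha Hc. assert (Hcn : c <> RtoC 0) by (apply Cmod_gt_0; apply (proj2 Ha c Hc)).
  assert (D2 := differential_Cplus _ _ _ _ _ (differential_const (U := CR) (V := CR) (lnC a c) c) (differential_ln_quot c Hcn)).
  apply (differential_eq_near (U := CR) (V := CR) (fun q => lnC a c + Clog (q / c))%C).
  - generalize (arg_branch_near _ _ _ _ Ha Hc). apply filter_imp. intros q [_ Hq]. symmetry. exact Hq.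
  - apply (differential_ext _ _ _ _ D2). intros h. toC. ring.
Qed.

(** * Poisson summation *)

(** The window runs from [- (N + 1)] to [N]. It is stable under [n -> - 1 - n], which suits the
    reflection [u -> 1 - u], and the window for [2 N + 1] splits into the even and the odd images of
    the window for [N]. *)
Definition Zpart (a : Z -> R) (N : nat) : R :=
  sum_n (fun n => a (Z.of_nat n)) N + sum_n (fun n => a (- Z.of_nat (S n))%Z) N.

Definition ex_Zseries (a : Z -> R) : Prop :=
  ex_series (fun n => a (Z.of_nat n)) /\ ex_series (fun n => a (- Z.of_nat (S n))%Z).

Lemma Zpart_lim a : ex_Zseries a -> is_lim_seq (Zpart a) (ZSeries a).
Proof.
  intros [H1 H2]. apply is_lim_seq_plus'.
  - exact (Series_correct _ H1).
  - exact (Series_correct _ H2).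
Qed.

Lemma sum_n_S (a : nat -> R) N : sum_n a (S N) = sum_n a N + a (S N).
Proof. exact (sum_Sn a N). Qed.

Lemma sum_n_0 (a : nat -> R) : sum_n a 0 = a 0%nat.
Proof. exact (sum_O a). Qed.

Lemma inv_sqr_le_telescope n : / (INR n + 1) ^ 2 <= 2 * (/ (INR n + 1) - / (INR (S n) + 1)).
Proof.
  rewrite S_INR. pose proof (pos_INR n). set (t := INR n + 1). assert (1 <= t) by (unfold t; lra).
  replace (INR n + 1 + 1) with (t + 1) by (unfold t; ring).
  replace (2 * (/ t - / (t + 1))) with (2 * / (t * (t + 1))) by (field; lra).
  replace (/ t ^ 2) with (2 * / (2 * t ^ 2)) by (field; lra).
  apply Rmult_le_compat_l; [lra|]. apply Rinv_le_contravar; nra.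
Qed.

Lemma sum_telescope_le (a b : nat -> R) N : (forall n, a n <= b n - b (S n)) -> sum_n a N <= b 0%nat - b (S N).
Proof.
  intros H. induction N as [|N IH].
  - rewrite sum_n_0. apply H.
  - rewrite sum_n_S. specialize (H (S N)). lra.
Qed.

Lemma ex_series_inv_sqr : ex_series (fun n => / (INR n + 1) ^ 2).
Proof.
  destruct (ex_finite_lim_seq_incr (sum_n (fun n => / (INR n + 1) ^ 2)) 2) as [l Hl].
  - intros n. rewrite sum_n_S. assert (0 < / (INR (S n) + 1) ^ 2); [|lra].
    apply Rinv_0_lt_compat, pow_lt. pose proof (pos_INR (S n)). lra.
  - intros n. eapply Rle_trans; [apply (sum_telescope_le _ (fun n => 2 * / (INR n + 1)))|].
    + intros k. assert (H := inv_sqr_le_telescope k). lra.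
    + assert (0 < / (INR (S n) + 1)) by (apply Rinv_0_lt_compat; pose proof (pos_INR (S n)); lra).
      rewrite INR_0 at 1. replace (/ (0 + 1)) with 1 by field. lra.
  - exists l. exact Hl.
Qed.

Lemma ex_series_le_abs (a b : nat -> R) : (forall n, Rabs (a n) <= b n) -> ex_series b -> ex_series a.
Proof. intros H Hb. apply (ex_series_le (V := R_CompleteNormedModule) a b); auto. Qed.

Lemma ex_series_le_inv_sqr (a : nat -> R) K : (forall n, Rabs (a n) <= K / (INR n + 1) ^ 2) -> ex_series a.
Proof.
  intros H. apply (ex_series_le_abs a (fun n => K * / (INR n + 1) ^ 2)); auto.
  apply (ex_series_scal (V := R_NormedModule) K), ex_series_inv_sqr.
Qed.

(** * The Poisson kernel as a sum of Cauchy kernels *)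

Definition cauchy_kernel (X v : R) : R := X / (X ^ 2 + v ^ 2).

Lemma cauchy_kernel_pos X v : 0 < X -> 0 < cauchy_kernel X v.
Proof. intros. unfold cauchy_kernel. pose proof (pow_lt X 2 H). pose proof (pow2_ge_0 v). apply Rdiv_lt_0_compat; lra. Qed.

Lemma cauchy_kernel_le X v t K : 0 < X -> 0 < t -> t ^ 2 <= K * (X ^ 2 + v ^ 2) -> cauchy_kernel X v <= X * K / t ^ 2.
Proof.
  intros HX Ht H. unfold cauchy_kernel, Rdiv. rewrite Rmult_assoc. apply Rmult_le_compat_l; [lra|].
  assert (H1 := pow_lt t 2 Ht). assert (H2 := pow_lt X 2 HX). assert (H3 := pow2_ge_0 v).
  apply Rmult_le_reg_r with (t ^ 2 * (X ^ 2 + v ^ 2)); [apply Rmult_lt_0_compat; lra|].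
  replace (/ (X ^ 2 + v ^ 2) * (t ^ 2 * (X ^ 2 + v ^ 2))) with (t ^ 2) by (field; lra).
  replace (K * / t ^ 2 * (t ^ 2 * (X ^ 2 + v ^ 2))) with (K * (X ^ 2 + v ^ 2)) by (field; lra). exact H.
Qed.

Lemma ex_Zseries_cauchy X u : 0 < X -> ex_Zseries (fun n => cauchy_kernel X (u + IZR n)).
Proof.
  intros HX. split.
  (* From [n + 1 = (u + n) + (1 - u)] the square is at most [2 (u + n)^2 + 2 (1 - u)^2], and the
     last summand is absorbed by dividing by [X^2]. *)
  - apply (ex_series_le_inv_sqr _ (X * (2 + 2 * (1 - u) ^ 2 / X ^ 2))). intros n.
    rewrite Rabs_pos_eq by (left; now apply cauchy_kernel_pos). pose proof (pos_INR n).
    apply cauchy_kernel_le; [auto|lra|]. rewrite <- INR_IZR_INZ.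
    assert (E : (2 + 2 * (1 - u) ^ 2 / X ^ 2) * (X ^ 2 + (u + INR n) ^ 2)
      = 2 * X ^ 2 + 2 * (u + INR n) ^ 2 + 2 * (1 - u) ^ 2 + 2 * (1 - u) ^ 2 / X ^ 2 * (u + INR n) ^ 2) by (field; lra).
    rewrite E. assert (0 <= 2 * (1 - u) ^ 2 / X ^ 2 * (u + INR n) ^ 2).
    { apply Rmult_le_pos; [|apply pow2_ge_0]. apply Rmult_le_pos; [pose proof (pow2_ge_0 (1 - u)); lra|].
      left. apply Rinv_0_lt_compat. now apply pow_lt. }
    pose proof (pow2_ge_0 (u + INR n - (1 - u))). pose proof (pow2_ge_0 X).
    replace ((INR n + 1) ^ 2) with (2 * (u + INR n) ^ 2 + 2 * (1 - u) ^ 2 - (u + INR n - (1 - u)) ^ 2) by ring. lra.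
  - apply (ex_series_le_inv_sqr _ (X * (2 + 2 * u ^ 2 / X ^ 2))). intros n.
    rewrite Rabs_pos_eq by (left; now apply cauchy_kernel_pos). pose proof (pos_INR n).
    apply cauchy_kernel_le; [auto|lra|]. rewrite opp_IZR, <- INR_IZR_INZ, S_INR.
    set (v := u + - (INR n + 1)).
    assert (E : (2 + 2 * u ^ 2 / X ^ 2) * (X ^ 2 + v ^ 2)
      = 2 * X ^ 2 + 2 * v ^ 2 + 2 * u ^ 2 + 2 * u ^ 2 / X ^ 2 * v ^ 2) by (field; lra).
    rewrite E. assert (0 <= 2 * u ^ 2 / X ^ 2 * v ^ 2).
    { apply Rmult_le_pos; [|apply pow2_ge_0]. apply Rmult_le_pos; [pose proof (pow2_ge_0 u); lra|].
      left. apply Rinv_0_lt_compat. now apply pow_lt. }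
    pose proof (pow2_ge_0 (u + v)). pose proof (pow2_ge_0 X). replace (INR n + 1) with (u - v) by (unfold v; ring).
    replace ((u - v) ^ 2) with (2 * v ^ 2 + 2 * u ^ 2 - (u + v) ^ 2) by ring. lra.
Qed.

Definition cauchy_sum (X u : R) : R := ZSeries (fun n => cauchy_kernel X (u + IZR n)).

(** [PI] times the Poisson kernel of the unit disc at radius [exp (- 2 PI X)] and angle [2 PI u]. *)
Definition poisson_kernel (X u : R) : R := PI * sinh (2 * PI * X) / (cosh (2 * PI * X) - cos (2 * PI * u)).

Lemma sum_n_even_odd (a : nat -> R) N : sum_n a (2 * N + 1) = sum_n (fun k => a (2 * k)%nat) N + sum_n (fun k => a (2 * k + 1)%nat) N.
Proof.
  induction N as [|N IH].
  - change (2 * 0 + 1)%nat with 1%nat. rewrite sum_n_S, !sum_n_0. reflexivity.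
  - replace (2 * S N + 1)%nat with (S (S (2 * N + 1))) by lia. rewrite !sum_n_S, IH.
    replace (S (2 * N + 1)) with (2 * S N)%nat by lia. replace (S (2 * S N)) with (2 * S N + 1)%nat by lia. asR. ring.
Qed.

Lemma sum_n_Rmult_l k (a : nat -> R) N : sum_n (fun n => k * a n) N = k * sum_n a N.
Proof. induction N as [|N IH]; [now rewrite !sum_n_0|rewrite !sum_n_S, IH; asR; ring]. Qed.

Lemma sum_n_Rext (a b : nat -> R) N : (forall n, a n = b n) -> sum_n a N = sum_n b N.
Proof. intros H. now apply sum_n_ext. Qed.

(** Even and odd integers are separated: [u + 2 k = 2 (u / 2 + k)] and
    [u + 2 k + 1 = 2 ((u + 1) / 2 + k)], and the Cauchy kernel is homogeneous of degree -1. *)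
Lemma cauchy_sum_duplication X u : 0 < X ->
  cauchy_sum X u = (cauchy_sum (X / 2) (u / 2) + cauchy_sum (X / 2) ((u + 1) / 2)) / 2.
Proof.
  intros HX. assert (HX2 : 0 < X / 2) by lra.
  assert (L0 := Zpart_lim _ (ex_Zseries_cauchy X u HX)).
  assert (L1 := Zpart_lim _ (ex_Zseries_cauchy (X / 2) (u / 2) HX2)).
  assert (L2 := Zpart_lim _ (ex_Zseries_cauchy (X / 2) ((u + 1) / 2) HX2)).
  assert (L3 := is_lim_seq_scal_l _ (/ 2) _ (is_lim_seq_plus' _ _ _ _ L1 L2)).
  assert (L4 : is_lim_seq (fun N => Zpart (fun n => cauchy_kernel X (u + IZR n)) (2 * N + 1)) (cauchy_sum X u)).
  { apply (is_lim_seq_subseq _ _ (fun N => (2 * N + 1)%nat)) in L0; [exact L0|].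
    apply eventually_subseq. intros n. lia. }
  assert (K : forall v, cauchy_kernel (X / 2) (v / 2) = 2 * cauchy_kernel X v).
  { intros v. unfold cauchy_kernel. pose proof (pow_lt X 2 HX). pose proof (pow2_ge_0 v).
    replace ((X / 2) ^ 2 + (v / 2) ^ 2) with ((X ^ 2 + v ^ 2) / 4) by field. field. lra. }
  assert (E : forall N, Zpart (fun n => cauchy_kernel X (u + IZR n)) (2 * N + 1) =
     / 2 * (Zpart (fun n => cauchy_kernel (X / 2) (u / 2 + IZR n)) N + Zpart (fun n => cauchy_kernel (X / 2) ((u + 1) / 2 + IZR n)) N)).
  { intros N. unfold Zpart. rewrite !sum_n_even_odd.
    rewrite (sum_n_Rext (fun n => cauchy_kernel (X / 2) (u / 2 + IZR (Z.of_nat n))) (fun k => 2 * cauchy_kernel X (u + IZR (Z.of_nat (2 * k))))).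
    2:{ intros n. rewrite <- K. f_equal. rewrite <- !INR_IZR_INZ, mult_INR. simpl. field. }
    rewrite (sum_n_Rext (fun n => cauchy_kernel (X / 2) ((u + 1) / 2 + IZR (Z.of_nat n))) (fun k => 2 * cauchy_kernel X (u + IZR (Z.of_nat (2 * k + 1))))).
    2:{ intros n. rewrite <- K. f_equal. rewrite <- !INR_IZR_INZ, plus_INR, mult_INR. simpl. field. }
    rewrite (sum_n_Rext (fun n => cauchy_kernel (X / 2) (u / 2 + IZR (- Z.of_nat (S n)))) (fun k => 2 * cauchy_kernel X (u + IZR (- Z.of_nat (S (2 * k + 1)))))).
    2:{ intros n. rewrite <- K. f_equal. rewrite !opp_IZR, <- !INR_IZR_INZ, !S_INR, plus_INR, mult_INR. simpl. field. }
    rewrite (sum_n_Rext (fun n => cauchy_kernel (X / 2) ((u + 1) / 2 + IZR (- Z.of_nat (S n)))) (fun k => 2 * cauchy_kernel X (u + IZR (- Z.of_nat (S (2 * k)))))).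
    2:{ intros n. rewrite <- K. f_equal. rewrite !opp_IZR, <- !INR_IZR_INZ, !S_INR, mult_INR. simpl. field. }
    rewrite !sum_n_Rmult_l. field. }
  assert (L5 := is_lim_seq_ext _ _ _ E L4).
  assert (E2 := is_lim_seq_unique _ _ L5). rewrite (is_lim_seq_unique _ _ L3) in E2. simpl in E2.
  injection E2. intros E3. unfold cauchy_sum in *. lra.
Qed.

Lemma poisson_den_pos X u : 0 < X -> 0 < cosh (2 * PI * X) - cos (2 * PI * u).
Proof.
  intros HX. pose proof PI_RGT_0. assert (H1 : 0 < 2 * PI * X) by mult_pos.
  pose proof (COS_bound (2 * PI * u)).
  assert (1 < cosh (2 * PI * X)); [|lra].
  unfold cosh. rewrite exp_Ropp. assert (H2 := exp_ineq1 (2 * PI * X) ltac:(lra)).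
  set (e := exp (2 * PI * X)) in *. assert (0 < / e) by (apply Rinv_0_lt_compat; lra).
  apply Rmult_lt_reg_r with (2 * e); [lra|]. field_simplify; [|lra]. nra.
Qed.

Lemma poisson_kernel_alt X u : 0 < X -> poisson_kernel X u
  = PI * (sinh (PI * X) * cosh (PI * X)) / (sinh (PI * X) ^ 2 + sin (PI * u) ^ 2).
Proof.
  intros HX. assert (Hd := poisson_den_pos X u HX). unfold poisson_kernel.
  assert (E1 : sinh (2 * PI * X) = 2 * sinh (PI * X) * cosh (PI * X)).
  { unfold sinh, cosh. replace (2 * PI * X) with (PI * X + PI * X) by ring. replace (- (PI * X + PI * X)) with (- (PI * X) + - (PI * X)) by ring.
    rewrite !exp_plus. field. }
  assert (E2 : cosh (2 * PI * X) - cos (2 * PI * u) = 2 * (sinh (PI * X) ^ 2 + sin (PI * u) ^ 2)).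
  { replace (2 * PI * u) with (2 * (PI * u)) by ring. rewrite cos_2a_sin.
    unfold sinh, cosh. replace (2 * PI * X) with (PI * X + PI * X) by ring. replace (- (PI * X + PI * X)) with (- (PI * X) + - (PI * X)) by ring.
    rewrite !exp_plus, exp_Ropp. field. pose proof (exp_pos (PI * X)). lra. }
  rewrite E1, E2 in *. field. lra.
Qed.

(** By the double angle formulas the denominator is a multiple of [sinh^2 + sin^2], which factors as
    [(cosh - cos) (cosh + cos)], the two denominators on the right. *)
Lemma poisson_kernel_duplication X u : 0 < X ->
  poisson_kernel X u = (poisson_kernel (X / 2) (u / 2) + poisson_kernel (X / 2) ((u + 1) / 2)) / 2.
Proof.
  intros HX. assert (H1 := poisson_den_pos (X / 2) (u / 2) ltac:(lra)). assert (H2 := poisson_den_pos (X / 2) ((u + 1) / 2) ltac:(lra)).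
  assert (H0 := poisson_den_pos X u HX). rewrite poisson_kernel_alt in * by auto. unfold poisson_kernel in *.
  replace (2 * PI * (X / 2)) with (PI * X) in * by field. replace (2 * PI * (u / 2)) with (PI * u) in * by field.
  replace (2 * PI * ((u + 1) / 2)) with (PI * u + PI) in * by field. rewrite neg_cos in *.
  assert (E : sinh (PI * X) ^ 2 + sin (PI * u) ^ 2 = (cosh (PI * X) - cos (PI * u)) * (cosh (PI * X) - - cos (PI * u))).
  { assert (P := sin2_cos2 (PI * u)). unfold Rsqr in P.
    assert (Q : cosh (PI * X) * cosh (PI * X) - sinh (PI * X) * sinh (PI * X) = 1).
    { unfold cosh, sinh. rewrite exp_Ropp. field. pose proof (exp_pos (PI * X)). lra. }
    simpl. nra. }
  rewrite E. field. lra.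
Qed.

Lemma mvt_le (f df : R -> R) (b M : R) : 0 <= b -> (forall x, is_derive f x (df x)) ->
  (forall x, 0 <= x <= b -> df x <= M) -> f b - f 0 <= M * b.
Proof.
  intros Hb Hd HM. destruct (MVT_gen f 0 b df) as [c [Hc E]].
  - intros; apply Hd.
  - intros x _. apply continuity_pt_filterlim. apply (continuous_of_derive (V := RR) f x (df x)), Hd.
  - rewrite Rmin_left, Rmax_right in Hc by auto. rewrite E, Rminus_0_r. apply Rmult_le_compat_r; auto.
Qed.

Lemma mvt_ge (f df : R -> R) (b M : R) : 0 <= b -> (forall x, is_derive f x (df x)) ->
  (forall x, 0 <= x <= b -> M <= df x) -> M * b <= f b - f 0.
Proof.
  intros Hb Hd HM. destruct (MVT_gen f 0 b df) as [c [Hc E]].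
  - intros; apply Hd.
  - intros x _. apply continuity_pt_filterlim. apply (continuous_of_derive (V := RR) f x (df x)), Hd.
  - rewrite Rmin_left, Rmax_right in Hc by auto. rewrite E, Rminus_0_r. apply Rmult_le_compat_r; auto.
Qed.

Lemma cosh_sinh_sqr x : cosh x * cosh x - sinh x * sinh x = 1.
Proof. unfold cosh, sinh. rewrite exp_Ropp. field. pose proof (exp_pos x). lra. Qed.

Lemma sinh_ge_self x : 0 <= x -> x <= sinh x.
Proof.
  intros Hx. assert (H := mvt_ge sinh cosh x 1 Hx is_derive_sinh (fun t _ => cosh_ge_1 t)). rewrite sinh_0 in H. lra.
Qed.

Lemma sinh_incr x y : x <= y -> sinh x <= sinh y.
Proof.
  intros H. unfold sinh. assert (exp x <= exp y) by (destruct H as [H| ->]; [left; now apply exp_increasing|lra]).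
  assert (exp (- y) <= exp (- x)) by (destruct H as [H| ->]; [left; apply exp_increasing; lra|lra]). lra.
Qed.

(** The derivative of [t cosh t - sinh t] is [t sinh t], which increases from 0. *)
Lemma cosh_sinh_bound x : 0 <= x -> 0 <= x * cosh x - sinh x <= x ^ 2 * sinh x.
Proof.
  intros Hx.
  assert (Hd : forall t, is_derive (fun t => t * cosh t - sinh t) t (t * sinh t)).
  { intros t. unfold cosh, sinh. auto_derive; auto. field. }
  assert (H1 := mvt_le _ _ x (x * sinh x) Hx Hd). assert (H2 := mvt_ge _ _ x 0 Hx Hd).
  cbv beta in H1, H2. rewrite sinh_0 in H1, H2. split.
  - specialize (H2 (fun t Ht => Rmult_le_pos _ _ (proj1 Ht) (Rle_trans _ _ _ (proj1 Ht) (sinh_ge_self t (proj1 Ht))))). lra.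
  - assert (H3 : forall t, 0 <= t <= x -> t * sinh t <= x * sinh x).
    { intros t Ht. assert (0 <= sinh t) by (pose proof (sinh_ge_self t); lra).
      apply Rmult_le_compat; try lra. now apply sinh_incr. }
    specialize (H1 H3). lra.
Qed.

Lemma sinh_cosh_bound x : 0 <= x -> 0 <= sinh x * cosh x - x <= 2 * sinh x ^ 2 * x.
Proof.
  intros Hx.
  assert (Hd : forall t, is_derive (fun t => sinh t * cosh t - t) t (2 * sinh t ^ 2)).
  { intros t. assert (E := cosh_sinh_sqr t).
    replace (2 * sinh t ^ 2) with (cosh t * cosh t + sinh t * sinh t - 1) by (simpl; lra).
    unfold cosh, sinh. auto_derive; auto. field. }
  assert (H1 := mvt_le _ _ x (2 * sinh x ^ 2) Hx Hd). assert (H2 := mvt_ge _ _ x 0 Hx Hd).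
  cbv beta in H1, H2. rewrite sinh_0 in H1, H2. split.
  - specialize (H2 (fun t Ht => ltac:(pose proof (pow2_ge_0 (sinh t)); lra))). lra.
  - assert (H3 : forall t, 0 <= t <= x -> 2 * sinh t ^ 2 <= 2 * sinh x ^ 2).
    { intros t Ht. assert (0 <= sinh t) by (pose proof (sinh_ge_self t); lra).
      apply Rmult_le_compat_l; [lra|]. apply pow_incr. split; auto. now apply sinh_incr. }
    specialize (H1 H3). lra.
Qed.

Lemma sin_le_self x : 0 <= x -> sin x <= x.
Proof.
  intros Hx. assert (H := mvt_le sin cos x 1 Hx is_derive_sin (fun t _ => proj2 (COS_bound t))). rewrite sin_0 in H. lra.
Qed.

Lemma sin_ge_cubic x : 0 <= x -> x - x ^ 3 / 6 <= sin x.
Proof.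
  intros Hx.
  assert (Hc : forall t, 0 <= t -> 1 - t ^ 2 / 2 <= cos t).
  { intros t Ht. replace (cos t) with (cos (2 * (t / 2))) by (f_equal; field). rewrite cos_2a_sin.
    assert (H1 := sin_le_self (t / 2) ltac:(lra)).
    destruct (Rle_dec 0 (sin (t / 2))) as [H|H].
    - assert (sin (t / 2) * sin (t / 2) <= t / 2 * (t / 2)) by (apply Rmult_le_compat; lra). lra.
    - destruct (Rle_dec t 2) as [H2|H2].
      + exfalso. apply H. apply sin_ge_0; [lra|]. pose proof PI2_1. lra.
      + assert (H3 := SIN_bound (t / 2)). nra. }
  assert (Hd : forall t, is_derive (fun t => sin t - (t - t ^ 3 / 6)) t (cos t - (1 - t ^ 2 / 2))).
  { intros t. auto_derive; auto. field. }
  assert (H := mvt_ge _ _ x 0 Hx Hd (fun t Ht => ltac:(specialize (Hc t (proj1 Ht)); lra))).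
  cbv beta in H. rewrite sin_0 in H. lra.
Qed.

(** The numerator of the difference of the two kernels, with [A = PI X] and [U = PI u]. Both have
    the same pole at [A = U = 0], so the difference gains the full denominator. The constant 7 is
    [1 + 2 + 4], from the three terms of the decomposition [E]. *)
Lemma poisson_pole_numerator A U : 0 <= A -> 0 <= U <= PI / 2 ->
  let a := sinh A in let b := sin U in
  A * (a ^ 2 + b ^ 2) <= a * cosh A * (A ^ 2 + U ^ 2) /\
  a * cosh A * (A ^ 2 + U ^ 2) - A * (a ^ 2 + b ^ 2) <= 7 * A * ((a ^ 2 + b ^ 2) * (A ^ 2 + U ^ 2)).
Proof.
  intros HA HU a b.
  assert (Ha := sinh_ge_self A HA). fold a in Ha.
  assert (H1 := cosh_sinh_bound A HA). fold a in H1.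
  assert (H2 := sinh_cosh_bound A HA). fold a in H2.
  assert (Hb1 := sin_le_self U (proj1 HU)). fold b in Hb1.
  assert (Hb2 := sin_ge_cubic U (proj1 HU)). fold b in Hb2.
  (* [U^2 <= 3] turns the cubic lower bound of the sine into [U / 2 <= sin U]; a partial sum of the
     Leibniz series gives enough digits of [PI]. *)
  assert (Hpi : PI / 2 <= 1.68).
  { destruct (PI_ineq 2) as [_ H]. unfold tg_alt, PI_tg in H. simpl in H. lra. }
  assert (HU2 : U * U <= 2.83) by nra.
  assert (Hb3 : U / 2 <= b).
  { replace (U ^ 3) with (U * (U * U)) in Hb2 by ring. nra. }
  assert (Hb4 : b ^ 2 <= U ^ 2) by (apply pow_incr; lra).
  assert (Hb5 : U ^ 2 <= 4 * b ^ 2).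
  { replace (4 * b ^ 2) with ((2 * b) ^ 2) by ring. apply pow_incr. lra. }
  assert (Hb6 : U ^ 2 - b ^ 2 <= U ^ 2 * U ^ 2).
  { replace (U ^ 2 - b ^ 2) with ((U - b) * (U + b)) by ring.
    apply Rle_trans with (U ^ 3 / 6 * (2 * U)).
    - apply Rmult_le_compat; lra.
    - replace (U ^ 3 / 6 * (2 * U)) with (U ^ 2 * U ^ 2 / 3) by field.
      assert (0 <= U ^ 2 * U ^ 2) by (apply Rmult_le_pos; apply pow2_ge_0). lra. }
  assert (E : a * cosh A * (A ^ 2 + U ^ 2) - A * (a ^ 2 + b ^ 2)
     = a * A * (A * cosh A - a) + (a * cosh A - A) * U ^ 2 + A * (U ^ 2 - b ^ 2)) by ring.
  assert (Ha2 := pow2_ge_0 a). assert (HA2 := pow2_ge_0 A). assert (HUp := pow2_ge_0 U). assert (Hbp := pow2_ge_0 b).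
  assert (HaA : 0 <= a * A) by (apply Rmult_le_pos; lra).
  split.
  - assert (0 <= a * A * (A * cosh A - a)) by (apply Rmult_le_pos; lra).
    assert (0 <= (a * cosh A - A) * U ^ 2) by (apply Rmult_le_pos; lra).
    assert (0 <= A * (U ^ 2 - b ^ 2)) by (apply Rmult_le_pos; lra). lra.
  - rewrite E.
    assert (T1 : a * A * (A * cosh A - a) <= A * (a ^ 2 * A ^ 2)).
    { replace (A * (a ^ 2 * A ^ 2)) with (a * A * (A ^ 2 * a)) by ring. apply Rmult_le_compat_l; lra. }
    assert (T2 : (a * cosh A - A) * U ^ 2 <= 2 * A * (a ^ 2 * U ^ 2)).
    { replace (2 * A * (a ^ 2 * U ^ 2)) with (2 * a ^ 2 * A * U ^ 2) by ring. apply Rmult_le_compat_r; lra. }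
    assert (T3 : A * (U ^ 2 - b ^ 2) <= 4 * A * (b ^ 2 * U ^ 2)).
    { replace (4 * A * (b ^ 2 * U ^ 2)) with (A * (4 * b ^ 2 * U ^ 2)) by ring. apply Rmult_le_compat_l; auto.
      eapply Rle_trans; [exact Hb6|]. apply Rmult_le_compat_r; auto. }
    assert (P1 : 0 <= A * (a ^ 2 * A ^ 2)) by (apply Rmult_le_pos; [exact HA|apply Rmult_le_pos; assumption]).
    assert (P2 : 0 <= A * (a ^ 2 * U ^ 2)) by (apply Rmult_le_pos; [exact HA|apply Rmult_le_pos; assumption]).
    assert (P3 : 0 <= A * (b ^ 2 * U ^ 2)) by (apply Rmult_le_pos; [exact HA|apply Rmult_le_pos; assumption]).
    assert (P4 : 0 <= A * (b ^ 2 * A ^ 2)) by (apply Rmult_le_pos; [exact HA|apply Rmult_le_pos; assumption]).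
    replace (7 * A * ((a ^ 2 + b ^ 2) * (A ^ 2 + U ^ 2))) with (7 * (A * (a ^ 2 * A ^ 2)) + 7 * (A * (a ^ 2 * U ^ 2)) + 7 * (A * (b ^ 2 * U ^ 2)) + 7 * (A * (b ^ 2 * A ^ 2))) by ring.
    lra.
Qed.

Lemma poisson_pole X u : 0 < X -> 0 <= u <= / 2 ->
  0 <= poisson_kernel X u - cauchy_kernel X u <= 7 * PI ^ 2 * X.
Proof.
  intros HX Hu. pose proof PI_RGT_0 as Hpi. rewrite poisson_kernel_alt by auto.
  destruct (poisson_pole_numerator (PI * X) (PI * u)) as [H1 H2].
  - apply Rmult_le_pos; lra.
  - split; [apply Rmult_le_pos; lra|]. apply Rle_trans with (PI * / 2); [apply Rmult_le_compat_l; lra|lra].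
  - set (A := PI * X) in *. set (U := PI * u) in *.
    assert (HA : 0 < A) by (unfold A; mult_pos).
    assert (Hc : cauchy_kernel X u = PI * (A / (A ^ 2 + U ^ 2))).
    { unfold cauchy_kernel, A, U. pose proof (pow_lt X 2 HX). pose proof (pow2_ge_0 u).
      replace ((PI * X) ^ 2 + (PI * u) ^ 2) with (PI ^ 2 * (X ^ 2 + u ^ 2)) by ring. field. split; lra. }
    rewrite Hc. set (D := (sinh A ^ 2 + sin U ^ 2) * (A ^ 2 + U ^ 2)) in *.
    assert (D1 : 0 < sinh A ^ 2 + sin U ^ 2).
    { assert (0 < sinh A) by (pose proof (sinh_ge_self A ltac:(lra)); lra). pose proof (pow_lt _ 2 H). pose proof (pow2_ge_0 (sin U)). lra. }
    assert (D2 : 0 < A ^ 2 + U ^ 2) by (pose proof (pow_lt A 2 HA); pose proof (pow2_ge_0 U); lra).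
    assert (HD : 0 < D) by (unfold D; now apply Rmult_lt_0_compat).
    set (N := sinh A * cosh A * (A ^ 2 + U ^ 2) - A * (sinh A ^ 2 + sin U ^ 2)) in *.
    replace (PI * (sinh A * cosh A) / (sinh A ^ 2 + sin U ^ 2) - PI * (A / (A ^ 2 + U ^ 2))) with (PI * (N / D)) by (unfold N, D; field; lra).
    split.
    + apply Rmult_le_pos; [lra|]. apply Rmult_le_pos; [unfold N; lra|]. left. now apply Rinv_0_lt_compat.
    + replace (7 * PI ^ 2 * X) with (PI * (7 * A)) by (unfold A; ring). apply Rmult_le_compat_l; [lra|].
      apply Rmult_le_reg_r with D; auto. unfold Rdiv. rewrite Rmult_assoc, Rinv_l, Rmult_1_r by lra. exact H2.
Qed.

Definition inv_sqr_sum : R := Series (fun n => / (INR n + 1) ^ 2).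

Lemma inv_sqr_sum_ge_0 : 0 <= inv_sqr_sum.
Proof.
  apply Rle_trans with (Series (fun n => 0 * / (INR n + 1) ^ 2)); [rewrite Series_scal_l; lra|].
  apply Series_le; [|apply ex_series_inv_sqr]. intros n. rewrite Rmult_0_l. split; [lra|].
  left. apply Rinv_0_lt_compat, pow_lt. pose proof (pos_INR n). lra.
Qed.

(** Without the pole term the sum is [O(X)]. For [n >= 1] the distance is at least [n]; for
    [n <= - 1] it is at least [|n| / 2] because [u <= 1 / 2], which costs a factor 4. *)
Lemma cauchy_sum_pole X u : 0 < X -> 0 <= u <= / 2 ->
  0 <= cauchy_sum X u - cauchy_kernel X u <= 5 * inv_sqr_sum * X.
Proof.
  intros HX Hu. destruct (ex_Zseries_cauchy X u HX) as [E1 E2]. unfold cauchy_sum, ZSeries.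
  rewrite (Series_incr_1 _ E1). apply (ex_series_incr_1 (fun n => cauchy_kernel X (u + IZR (Z.of_nat n)))) in E1.
  replace (u + IZR (Z.of_nat 0)) with u by (simpl; ring).
  set (S1 := Series (fun k => cauchy_kernel X (u + IZR (Z.of_nat (S k))))). set (S2 := Series (fun n => cauchy_kernel X (u + IZR (- Z.of_nat (S n))))).
  assert (B1 : 0 <= S1 <= X * inv_sqr_sum).
  { unfold S1, inv_sqr_sum. rewrite <- Series_scal_l. split.
    - apply Rle_trans with (Series (fun n => 0 * / (INR n + 1) ^ 2)); [rewrite Series_scal_l; lra|].
      apply Series_le; auto. intros n. split; [lra|]. rewrite Rmult_0_l. left. now apply cauchy_kernel_pos.
    - apply Series_le; [|apply (ex_series_scal (V := R_NormedModule) X), ex_series_inv_sqr].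
      intros n. split; [left; now apply cauchy_kernel_pos|]. pose proof (pos_INR n).
      rewrite <- INR_IZR_INZ, S_INR. rewrite <- (Rmult_1_r X) at 2. apply cauchy_kernel_le; try lra.
      pose proof (pow2_ge_0 X). assert ((INR n + 1) ^ 2 <= (u + (INR n + 1)) ^ 2) by (apply pow_incr; lra). lra. }
  assert (B2 : 0 <= S2 <= X * 4 * inv_sqr_sum).
  { unfold S2, inv_sqr_sum. rewrite <- Series_scal_l. split.
    - apply Rle_trans with (Series (fun n => 0 * / (INR n + 1) ^ 2)); [rewrite Series_scal_l; lra|].
      apply Series_le; auto. intros n. split; [lra|]. rewrite Rmult_0_l. left. now apply cauchy_kernel_pos.
    - apply Series_le; [|apply (ex_series_scal (V := R_NormedModule) (X * 4)), ex_series_inv_sqr].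
      intros n. split; [left; now apply cauchy_kernel_pos|]. pose proof (pos_INR n).
      rewrite opp_IZR, <- INR_IZR_INZ, S_INR. apply cauchy_kernel_le; try lra.
      pose proof (pow2_ge_0 X). assert ((INR n + 1) ^ 2 <= (2 * - (u + - (INR n + 1))) ^ 2) by (apply pow_incr; lra). 
      replace ((2 * - (u + - (INR n + 1))) ^ 2) with (4 * (u + - (INR n + 1)) ^ 2) in H1 by ring. lra. }
  lra.
Qed.

Lemma cauchy_kernel_even X v : cauchy_kernel X (- v) = cauchy_kernel X v.
Proof. unfold cauchy_kernel. f_equal. ring. Qed.

Lemma cauchy_sum_reflect X u : cauchy_sum X (1 - u) = cauchy_sum X u.
Proof.
  unfold cauchy_sum, ZSeries. rewrite Rplus_comm. f_equal; apply Series_ext; intros n; rewrite <- cauchy_kernel_even; f_equal;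
    rewrite !opp_IZR, <- !INR_IZR_INZ, S_INR; ring.
Qed.

Lemma poisson_kernel_reflect X u : poisson_kernel X (1 - u) = poisson_kernel X u.
Proof.
  unfold poisson_kernel. do 2 f_equal. replace (2 * PI * (1 - u)) with (- (2 * PI * u) + 2 * PI) by ring.
  rewrite <- (cos_neg (2 * PI * u)). rewrite cos_plus, cos_2PI, sin_2PI. ring.
Qed.

(** The difference of the two sides satisfies the duplication formula and is [O(X)] uniformly in [u]. *)
Theorem cauchy_sum_poisson X u : 0 < X -> 0 <= u <= 1 -> cauchy_sum X u = poisson_kernel X u.
Proof.
  intros HX Hu. set (K := 7 * PI ^ 2 + 5 * inv_sqr_sum).
  assert (Hpi2 := pow2_ge_0 PI). assert (Hz := inv_sqr_sum_ge_0).
  assert (HK : forall X u, 0 < X -> 0 <= u <= 1 -> Rabs (poisson_kernel X u - cauchy_sum X u) <= K * X).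
  { assert (H : forall X u, 0 < X -> 0 <= u <= / 2 -> Rabs (poisson_kernel X u - cauchy_sum X u) <= K * X).
    { clear X u HX Hu. intros X u HX Hu. destruct (poisson_pole X u HX Hu). destruct (cauchy_sum_pole X u HX Hu).
      assert (0 <= 7 * PI ^ 2 * X) by (apply Rmult_le_pos; lra). assert (0 <= 5 * inv_sqr_sum * X) by (apply Rmult_le_pos; lra).
      unfold K. rewrite Rmult_plus_distr_r. apply Rabs_le. lra. }
    clear X u HX Hu. intros X u HX Hu. destruct (Rle_dec u (/ 2)) as [H1|H1]; [apply H; lra|].
    rewrite <- cauchy_sum_reflect, <- poisson_kernel_reflect. apply H; lra. }
  (* Each duplication halves [X], so the bound [K X] gains a factor [1 / 2]. *)
  assert (HI : forall k X u, 0 < X -> 0 <= u <= 1 -> Rabs (poisson_kernel X u - cauchy_sum X u) <= K * X * (/ 2) ^ k).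
  { induction k as [|k IH]; intros Y v HY Hv; [simpl; rewrite Rmult_1_r; auto|].
    rewrite poisson_kernel_duplication, cauchy_sum_duplication by auto.
    assert (A1 := IH (Y / 2) (v / 2) ltac:(lra) ltac:(lra)). assert (A2 := IH (Y / 2) ((v + 1) / 2) ltac:(lra) ltac:(lra)).
    set (g1 := poisson_kernel (Y / 2) (v / 2) - cauchy_sum (Y / 2) (v / 2)) in *.
    set (g2 := poisson_kernel (Y / 2) ((v + 1) / 2) - cauchy_sum (Y / 2) ((v + 1) / 2)) in *.
    match goal with |- Rabs ?t <= _ => replace t with ((g1 + g2) / 2) by (unfold g1, g2; field) end.
    unfold Rdiv. rewrite Rabs_mult, (Rabs_pos_eq (/ 2)) by lra. pose proof (Rabs_triang g1 g2). simpl. lra. }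
  apply Rminus_diag_uniq_sym. apply Rabs_eq_0.
  apply Rle_antisym; [|apply Rabs_pos].
  assert (L : is_lim_seq (fun k => K * X * (/ 2) ^ k) 0).
  { replace 0 with (K * X * 0) by ring. apply is_lim_seq_mult'; [apply is_lim_seq_const|].
    apply is_lim_seq_geom. rewrite Rabs_pos_eq; lra. }
  exact (is_lim_seq_le (fun _ => Rabs (poisson_kernel X u - cauchy_sum X u)) _ _ _ (fun k => HI k X u HX Hu) (is_lim_seq_const _) L).
Qed.

(** * Lattice sums of inverse distances *)

Definition inv_dist (x v : R) : R := / sqrt (x ^ 2 + v ^ 2).

Lemma dist_bounds x v : 0 < x -> x <= sqrt (x ^ 2 + v ^ 2) /\ Rabs v <= sqrt (x ^ 2 + v ^ 2) /\ sqrt (x ^ 2 + v ^ 2) <= x + Rabs v.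
Proof.
  intros Hx. assert (H1 := sqrt_plus_sqr x v). rewrite (Rabs_pos_eq x) in H1 by lra. destruct H1 as [H1 _].
  pose proof (Rmax_l x (Rabs v)). pose proof (Rmax_r x (Rabs v)). pose proof (Rabs_pos v). repeat split; try lra.
  rewrite <- (sqrt_pow2 (x + Rabs v)) by lra. apply sqrt_le_1_alt. rewrite <- (pow2_abs v).
  assert (0 <= x * Rabs v) by (apply Rmult_le_pos; lra). simpl. lra.
Qed.

Lemma kappa_abs rad n : kappa rad (Z.of_nat (S n)) = / INR (S n) /\ kappa rad (- Z.of_nat (S n)) = / INR (S n).
Proof.
  unfold kappa. destruct (Z.eq_dec (Z.of_nat (S n)) 0) as [E|_]; [lia|]. destruct (Z.eq_dec (- Z.of_nat (S n)) 0) as [E|_]; [lia|].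
  rewrite opp_IZR, Rabs_Ropp, <- INR_IZR_INZ, Rabs_pos_eq by apply pos_INR. auto.
Qed.

(** With [r] the distance, [1 / r - 1 / m = (m - r) / (r m)], where [|m - r| <= x + |u|] and
    [m / r <= 1 + |u| / x]. *)
Lemma inv_dist_kappa_bound x u v m : 0 < x -> 1 <= m -> Rabs (Rabs v - m) <= Rabs u ->
  Rabs (inv_dist x v - / m) <= (x + Rabs u) * (1 + Rabs u / x) / m ^ 2.
Proof.
  intros Hx Hm Hv. destruct (dist_bounds x v Hx) as [B1 [B2 B3]]. unfold inv_dist. set (r := sqrt (x ^ 2 + v ^ 2)) in *.
  pose proof (Rabs_pos u). pose proof (Rabs_pos v).
  replace (/ r - / m) with ((m - r) * (/ r * / m)) by (field; lra).
  rewrite Rabs_mult. assert (Hi : 0 < / r * / m) by (apply Rmult_lt_0_compat; apply Rinv_0_lt_compat; lra).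
  rewrite (Rabs_pos_eq (/ r * / m)) by lra.
  unfold Rdiv at 1. rewrite Rmult_assoc. apply Rmult_le_compat; try lra; [apply Rabs_pos| |].
  - destruct (Rabs_le_between (Rabs v - m) (Rabs u)) as [Q _]. specialize (Q Hv). apply Rabs_le. lra.
  - replace ((1 + Rabs u / x) * / m ^ 2) with ((1 + Rabs u / x) * / m * / m) by (field; lra).
    apply Rmult_le_compat_r; [left; apply Rinv_0_lt_compat; lra|].
    apply Rmult_le_reg_r with (r * m); [apply Rmult_lt_0_compat; lra|]. field_simplify; [|lra|lra].
    apply Rmult_le_reg_r with x; auto. unfold Rdiv. rewrite Rmult_assoc, Rinv_l, Rmult_1_r by lra.
    destruct (Rabs_le_between (Rabs v - m) (Rabs u)) as [Q _]. specialize (Q Hv).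
    assert (m * x <= (r + Rabs u) * x) by (apply Rmult_le_compat_r; lra).
    assert (x * Rabs u <= r * Rabs u) by (apply Rmult_le_compat_r; lra). lra.
Qed.

Lemma ex_Zseries_dist rad x u : 0 < x -> ex_Zseries (fun n => inv_dist x (u + IZR n) - kappa rad n).
Proof.
  intros Hx. split.
  (* The term [n = 0], where [kappa] is not [1 / |n|], is split off. *)
  - apply (ex_series_incr_1 (fun n => inv_dist x (u + IZR (Z.of_nat n)) - kappa rad (Z.of_nat n))).
    apply (ex_series_le_inv_sqr _ ((x + Rabs u) * (1 + Rabs u / x))). intros n.
    rewrite (proj1 (kappa_abs rad n)), <- INR_IZR_INZ, S_INR. pose proof (pos_INR n).
    apply inv_dist_kappa_bound; auto; [lra|]. assert (Q := Rabs_triang_inv2 (u + (INR n + 1)) (INR n + 1)).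
    rewrite (Rabs_pos_eq (INR n + 1)) in Q by lra. eapply Rle_trans; [exact Q|]. right. f_equal. ring.
  - apply (ex_series_le_inv_sqr _ ((x + Rabs u) * (1 + Rabs u / x))). intros n.
    rewrite (proj2 (kappa_abs rad n)), opp_IZR, <- INR_IZR_INZ, S_INR. pose proof (pos_INR n).
    apply inv_dist_kappa_bound; auto; [lra|]. assert (Q := Rabs_triang_inv2 (u + - (INR n + 1)) (- (INR n + 1))).
    rewrite Rabs_Ropp, (Rabs_pos_eq (INR n + 1)) in Q by lra. eapply Rle_trans; [exact Q|]. right. f_equal. ring.
Qed.

Lemma filterlim_atan_p : filterlim atan (Rbar_locally p_infty) (locally (PI / 2)).
Proof.
  apply (filterlim_ext_loc (fun t => atan (exp (ln t)))).
  - exists 0. intros t Ht. now rewrite exp_ln.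
  - apply (filterlim_comp _ _ _ ln (fun y => atan (exp y)) _ (Rbar_locally p_infty)); [apply is_lim_ln_p|apply lim_atan_exp_p].
Qed.

Lemma filterlim_atan_m : filterlim atan (Rbar_locally m_infty) (locally (- (PI / 2))).
Proof.
  apply (filterlim_ext (fun t => - atan (- t))); [intros t; rewrite atan_opp; ring|].
  apply (filterlim_comp _ _ _ (fun t => atan (- t)) Ropp _ (locally (PI / 2))); [|apply (filterlim_opp (V := RR))].
  apply (filterlim_comp _ _ _ Ropp atan _ (Rbar_locally p_infty)); [apply (filterlim_Rbar_opp m_infty)|apply filterlim_atan_p].
Qed.

Lemma sinh_neg y : sinh (- y) = - sinh y.
Proof. unfold sinh. rewrite Ropp_involutive. field. Qed.

Lemma filterlim_sinh_p : filterlim sinh (Rbar_locally p_infty) (Rbar_locally p_infty).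
Proof.
  intros P [M HM]. exists (Rmax 0 M). intros y Hy. apply HM.
  assert (H := sinh_ge_self y). pose proof (Rmax_l 0 M). pose proof (Rmax_r 0 M). lra.
Qed.

Lemma filterlim_sinh_m : filterlim sinh (Rbar_locally m_infty) (Rbar_locally m_infty).
Proof.
  intros P [M HM]. exists (Rmin 0 M). intros y Hy. apply HM.
  assert (H := sinh_ge_self (- y)). rewrite sinh_neg in H. pose proof (Rmin_l 0 M). pose proof (Rmin_r 0 M). lra.
Qed.

Lemma filterlim_RtoC (F : (R -> Prop) -> Prop) (f : R -> R) l : filterlim f F (locally l) ->
  filterlim (fun y => RtoC (f y)) F (locally (RtoC l : CR)).
Proof.
  intros H. apply (filterlim_comp _ _ _ f (RtoC : R -> CR) _ (locally l)); auto.
  apply (continuous_RtoC (T := RR) (fun t => t) l). apply continuous_id.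
Qed.

Lemma is_derive_RtoC (f : R -> R) y l : is_derive f y l -> is_derive (V := CR) (fun t => RtoC (f t)) y (RtoC l).
Proof.
  intros H. apply is_derive_differential. 
  apply (differential_ext _ _ _ _ (differential_RtoC (U := RR) _ _ _ (differential_of_derive _ _ _ H))).
  intros h. apply injective_projections; simpl; unfold scal; simpl; unfold mult; simpl; ring.
Qed.

Lemma IntR_RtoC_FTC K f F la lb : sech_bounded K (fun y => RtoC (f y)) ->
  (forall y, is_derive F y (f y)) -> filterlim F (Rbar_locally m_infty) (locally la) ->
  filterlim F (Rbar_locally p_infty) (locally lb) -> is_Int (fun y => RtoC (f y)) (RtoC (lb - la)).
Proof.
  intros Hf HF Ha Hb.
  assert (E := Int_FTC K (fun y => RtoC (F y)) _ (RtoC la) (RtoC lb) Hf (fun y => is_derive_RtoC _ _ _ (HF y)) (filterlim_RtoC _ _ _ Ha) (filterlim_RtoC _ _ _ Hb)).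
  rewrite RtoC_minus, <- E. eapply Int_correct, Hf.
Qed.

Lemma sech_RtoC K (f : R -> R) : (forall y, exists l, is_derive f y l) -> (forall y, Rabs (f y) <= K / cosh y) -> sech_bounded K (fun y => RtoC (f y)).
Proof.
  intros H1 H2. split.
  - intros y. destruct (H1 y) as [l Hl]. apply continuous_RtoC. apply (continuous_of_derive (V := RR) f y l Hl).
  - intros y. rewrite Cmod_R. apply H2.
Qed.

(** [cosh y / (x ^ 2 + v ^ 2 + sinh y ^ 2)], the density of [dw / (x ^ 2 + v ^ 2 + w ^ 2)] in the variable [w = sinh y]. *)
Definition dist_density (x v y : R) : R := cosh y / (x ^ 2 + sinh y ^ 2 + v ^ 2).

Lemma cosh_le_sinh x y : 0 < x -> cosh y ^ 2 <= (1 + / x ^ 2) * (x ^ 2 + sinh y ^ 2).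
Proof.
  intros Hx. assert (E := cosh_sinh_sqr y). pose proof (pow2_ge_0 (sinh y)). pose proof (pow2_ge_0 x).
  assert (0 < / x ^ 2) by (apply Rinv_0_lt_compat, pow_lt; auto).
  replace ((1 + / x ^ 2) * (x ^ 2 + sinh y ^ 2)) with (x ^ 2 + 1 + sinh y ^ 2 + / x ^ 2 * sinh y ^ 2) by (field; lra).
  assert (0 <= / x ^ 2 * sinh y ^ 2) by (apply Rmult_le_pos; lra). simpl in *. lra.
Qed.

Lemma cosh_div_le x y d : 0 < x -> x ^ 2 + sinh y ^ 2 <= d -> cosh y / d <= (1 + / x ^ 2) / cosh y.
Proof.
  intros Hx Hd. pose proof (cosh_gt_0 y). pose proof (pow_lt x 2 Hx). pose proof (pow2_ge_0 (sinh y)).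
  assert (H2 := cosh_le_sinh x y Hx). assert (0 < / x ^ 2) by now apply Rinv_0_lt_compat.
  apply Rmult_le_reg_r with (d * cosh y); [apply Rmult_lt_0_compat; lra|].
  replace (cosh y / d * (d * cosh y)) with (cosh y ^ 2) by (field; lra).
  replace ((1 + / x ^ 2) / cosh y * (d * cosh y)) with ((1 + / x ^ 2) * d) by (field; lra).
  eapply Rle_trans; [exact H2|]. apply Rmult_le_compat_l; lra.
Qed.

Lemma is_derive_dist_density x v y : 0 < x -> exists l, is_derive (dist_density x v) y l.
Proof.
  intros Hx. unfold dist_density, cosh, sinh. eexists. auto_derive; [|reflexivity].
  pose proof (pow_lt x 2 Hx). pose proof (pow2_ge_0 v). pose proof (pow2_ge_0 ((exp y + - exp (- y)) * / 2)). simpl in *. lra.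
Qed.

Lemma sech_dist_density x v : 0 < x -> sech_bounded (1 + / x ^ 2) (fun y => RtoC (dist_density x v y)).
Proof.
  intros Hx. apply sech_RtoC; [intros; now apply is_derive_dist_density|].
  intros y. unfold dist_density. pose proof (cosh_gt_0 y). pose proof (pow_lt x 2 Hx). pose proof (pow2_ge_0 v). pose proof (pow2_ge_0 (sinh y)).
  rewrite Rabs_pos_eq by (left; apply Rdiv_lt_0_compat; lra). apply cosh_div_le; auto. lra.
Qed.

(** In the variable [w = sinh y] this is the integral of [dw / (r^2 + w^2)], that is [PI / r], with
    [r^2 = x^2 + v^2]. *)
Lemma is_Int_dist x v : 0 < x -> is_Int (fun y => RtoC (dist_density x v y)) (RtoC (PI * inv_dist x v)).
Proof.
  intros Hx. set (r := sqrt (x ^ 2 + v ^ 2)). assert (Hr : 0 < r) by (pose proof (proj1 (dist_bounds x v Hx)); unfold r; lra).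
  assert (Hr2 : r * r = x ^ 2 + v ^ 2) by (unfold r; apply sqrt_sqrt; pose proof (pow2_ge_0 x); pose proof (pow2_ge_0 v); lra).
  replace (PI * inv_dist x v) with (/ r * (PI / 2) - / r * (- (PI / 2))) by (unfold inv_dist; fold r; field; lra).
  apply (IntR_RtoC_FTC _ _ (fun y => / r * atan (/ r * sinh y)) _ _ (sech_dist_density x v Hx)).
  - intros y.
    assert (D := is_derive_scal _ y (/ r) _ (is_derive_comp atan (fun y => / r * sinh y) y _ _ (is_derive_atan _) (is_derive_scal _ _ (/ r) _ (is_derive_sinh y)))).
    assert (E : dist_density x v y = / r * scal (/ r * cosh y) (/ (1 + Rsqr (/ r * sinh y)))).
    { unfold dist_density, scal; simpl; unfold mult; simpl; unfold Rsqr.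
      replace (x * (x * 1) + sinh y * (sinh y * 1) + v * (v * 1)) with (r * r + sinh y * sinh y) by (simpl in Hr2; lra).
      field. pose proof (Rle_0_sqr (sinh y)). unfold Rsqr in *. split; [lra|]. nra. }
    rewrite E. exact D.
  - apply (filterlim_comp _ _ _ (fun y => atan (/ r * sinh y)) (fun t => / r * t) _ (locally (- (PI / 2)))); [|apply (filterlim_scal_r (V := RR))].
    apply (filterlim_comp _ _ _ sinh (fun s => atan (/ r * s)) _ (Rbar_locally m_infty)); [apply filterlim_sinh_m|].
    apply (filterlim_comp _ _ _ (fun s => / r * s) atan _ (Rbar_locally m_infty)); [|apply filterlim_atan_m].
    intros P [M HM]. exists (M * r). intros s Hs. apply HM. apply Rmult_lt_reg_r with r; auto. field_simplify; lra.
  - apply (filterlim_comp _ _ _ (fun y => atan (/ r * sinh y)) (fun t => / r * t) _ (locally (PI / 2))); [|apply (filterlim_scal_r (V := RR))].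
    apply (filterlim_comp _ _ _ sinh (fun s => atan (/ r * s)) _ (Rbar_locally p_infty)); [apply filterlim_sinh_p|].
    apply (filterlim_comp _ _ _ (fun s => / r * s) atan _ (Rbar_locally p_infty)); [|apply filterlim_atan_p].
    intros P [M HM]. exists (M * r). intros s Hs. apply HM. apply Rmult_lt_reg_r with r; auto. field_simplify; lra.
Qed.

Lemma is_Int_sum_n (f : nat -> R -> R) (l : nat -> R) N : (forall n, is_Int (fun y => RtoC (f n y)) (RtoC (l n))) ->
  is_Int (fun y => RtoC (sum_n (fun n => f n y) N)) (RtoC (sum_n l N)).
Proof.
  intros H. induction N as [|N IH].
  - rewrite sum_n_0. refine (eq_ind _ (fun g => is_Int g _) (H 0%nat) _ _).
    apply functional_extensionality. intros y. now rewrite sum_n_0.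
  - rewrite sum_n_S, RtoC_plus. refine (eq_ind _ (fun g => is_Int g _) (is_Int_plus _ _ _ _ IH (H (S N))) _ _).
    apply functional_extensionality. intros y. now rewrite sum_n_S, RtoC_plus.
Qed.

Lemma is_Int_Zpart (f : Z -> R -> R) (l : Z -> R) N : (forall n, is_Int (fun y => RtoC (f n y)) (RtoC (l n))) ->
  is_Int (fun y => RtoC (Zpart (fun n => f n y) N)) (RtoC (Zpart l N)).
Proof.
  intros H. unfold Zpart. rewrite RtoC_plus.
  refine (eq_ind _ (fun g => is_Int g _) (is_Int_plus _ _ _ _
    (is_Int_sum_n (fun n => f (Z.of_nat n)) _ N (fun n => H _)) (is_Int_sum_n (fun n => f (- Z.of_nat (S n))%Z) _ N (fun n => H _))) _ _).
  apply functional_extensionality. intros y. now rewrite RtoC_plus.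
Qed.

Lemma sum_n_le_Series (a : nat -> R) N : (forall n, 0 <= a n) -> ex_series a -> sum_n a N <= Series a.
Proof.
  intros H Ha.
  apply (is_lim_seq_incr_compare (sum_n a)); [exact (Series_correct _ Ha)|].
  intros n. rewrite sum_n_S. specialize (H (S n)). lra.
Qed.

Lemma Zpart_remainder (a e : Z -> R) N : (forall n, 0 <= a n <= e n) -> ex_Zseries a -> ex_Zseries e ->
  0 <= ZSeries a - Zpart a N <= ZSeries e - Zpart e N.
Proof.
  intros H [A1 A2] [E1 E2]. unfold ZSeries, Zpart.
  assert (K : forall b c : nat -> R, (forall n, 0 <= b n <= c n) -> ex_series b -> ex_series c ->
     0 <= Series b - sum_n b N <= Series c - sum_n c N).
  { intros b c Hbc Hb Hc. split.
    - assert (Q := sum_n_le_Series b N (fun n => proj1 (Hbc n)) Hb). lra.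
    - assert (Q := sum_n_le_Series (fun n => c n - b n) N (fun n => ltac:(specialize (Hbc n); lra)) (ex_series_minus (V := R_NormedModule) c b Hc Hb)).
      rewrite Series_minus in Q by auto.
      assert (ES : sum_n (fun n => c n - b n) N = sum_n c N - sum_n b N).
      { clear. induction N as [|N IH]; [now rewrite !sum_n_0|rewrite !sum_n_S, IH; asR; ring]. }
      rewrite ES in Q. lra. }
  assert (Q1 := K _ _ (fun n => H (Z.of_nat n)) A1 E1). assert (Q2 := K _ _ (fun n => H (- Z.of_nat (S n))%Z) A2 E2). lra.
Qed.

(** * Constant and oscillating part of the sum *)

(** With [w] the exponential, the kernel is [PI] times the real part of
    [(1 + w) / (1 - w) = 1 + 2 w / (1 - w)]. *)
Lemma poisson_geo X u : 0 < X -> poisson_kernel X u = PI * (1 + 2 * Re (geo (- (2 * PI * X), 2 * PI * u))).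
Proof.
  intros HX. assert (Hd := poisson_den_pos X u HX). pose proof PI_RGT_0.
  assert (HA : 0 < 2 * PI * X) by mult_pos.
  assert (Hn : 0 < (1 - exp (- (2 * PI * X)) * cos (2 * PI * u)) * (1 - exp (- (2 * PI * X)) * cos (2 * PI * u))
      + exp (- (2 * PI * X)) * sin (2 * PI * u) * (exp (- (2 * PI * X)) * sin (2 * PI * u))).
  { assert (N := one_minus_Cexp_neq (- (2 * PI * X), 2 * PI * u) ltac:(simpl; lra)). apply Cmod_gt_0 in N.
    assert (N2 := Cmod2_alt (1 - Cexp (- (2 * PI * X), 2 * PI * u))). 
    assert (0 < Cmod (1 - Cexp (- (2 * PI * X), 2 * PI * u)) ^ 2) by now apply pow_lt.
    rewrite N2 in H0. simpl in H0. lra. }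
  unfold poisson_kernel, geo. unfold Cdiv, Cinv, Cexp. simpl.
  rewrite !exp_Ropp in *. set (e := exp (2 * PI * X)) in *. assert (He : 1 < e).
  { unfold e. rewrite <- exp_0. now apply exp_increasing. }
  unfold sinh, cosh in *. rewrite exp_Ropp in *. fold e in Hd |- *.
  set (c := cos (2 * PI * u)) in *. set (s := sin (2 * PI * u)) in *.
  assert (P : s * s = 1 - c * c) by (assert (P := sin2_cos2 (2 * PI * u)); unfold Rsqr in P; fold c s in P; lra).
  assert (Hd2 : e * e - 2 * e * c + 1 <> 0).
  { assert (0 < 2 * e * ((e + / e) / 2 - c)) by mult_pos. replace (2 * e * ((e + / e) / 2 - c)) with (e * e - 2 * e * c + 1) in H0 by (field; lra). lra. }
  match goal with |- context [_ / (?A * (?A * 1) + ?B * (?B * 1))] =>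
    replace (A * (A * 1) + B * (B * 1)) with ((e * e - 2 * e * c + 1) / (e * e))
  end.
  2:{ transitivity ((1 - / e * c) * (1 - / e * c) + / e * / e * (s * s)); [rewrite P; field; lra|ring]. }
  match goal with |- _ = PI * (1 + 2 * ?T) =>
    replace T with ((/ e * c - / e * / e * (c * c + s * s)) * ((e * e) / (e * e - 2 * e * c + 1)))
      by (field; split; lra)
  end.
  rewrite P. field. repeat split; lra.
Qed.

Definition inst_density (x u y : R) : R := 2 * Re (geo (- (2 * PI * (x * cosh y)), 2 * PI * u)).

(** The nonzero Fourier modes in [u] of the lattice sum of inverse distances; after rescaling, twice
    the real part of [moment rad 0 0 0]. *)
Definition inst_sum (x u : R) : C := IntR (fun y => RtoC (inst_density x u y)).

Lemma sech_Cconj K f : sech_bounded K f -> sech_bounded K (fun y => Cconj (f y)).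
Proof.
  intros [H1 H2]. split.
  - intros y. apply (continuous_comp (V := CR) (W := CR) f Cconj); auto. apply (is_linear_continuous (U := CR) (V := CR)), is_linear_Cconj.
  - intros y. rewrite Cmod_conj. auto.
Qed.

Lemma inst_density_geo x u y : RtoC (inst_density x u y) =
  (ray_pow 0 0 y * geo_pow 0 (ray_exp 1 (RtoC (- x), 2 * PI * u)%R y) + Cconj (ray_pow 0 0 y * geo_pow 0 (ray_exp 1 (RtoC (- x), 2 * PI * u)%R y)))%C.
Proof.
  assert (E : ray_exp 1 (RtoC (- x), 2 * PI * u)%R y = (- (2 * PI * (x * cosh y)), 2 * PI * u)).
  { unfold ray_exp, cosh. apply injective_projections; simpl; field. }
  assert (P0 : ray_pow 0 0 y = RtoC 1).
  { unfold ray_pow. simpl. replace (0 * y - 0 * y) with 0 by ring. now rewrite exp_0. }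
  rewrite E, P0. unfold inst_density, geo_pow.
  generalize (geo (- (2 * PI * (x * cosh y)), 2 * PI * u)). intros z. destruct z. apply injective_projections; simpl; ring.
Qed.

Lemma sech_inst x u : 0 < x -> exists K, sech_bounded K (fun y => RtoC (inst_density x u y)).
Proof.
  intros Hx. destruct (sech_moment 1 0 0 0 (RtoC (- x), 2 * PI * u)%R Rlt_0_1 ltac:(simpl; lra)) as [M B].
  eexists. eapply sech_ext; [|apply (sech_Cplus _ _ _ _ B (sech_Cconj _ _ B))].
  intros y. symmetry. apply inst_density_geo.
Qed.

(** The decay serves to identify a constant at infinity, and for this [exp (- t) <= 1 / t] is
    enough. *)
Lemma inst_sum_bound x u : 1 <= x -> Cmod (inst_sum x u) <= 2 * / (1 - exp (- (2 * PI))) * / x * PI.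
Proof.
  intros Hx. destruct (sech_inst x u ltac:(lra)) as [K B]. apply (is_Int_bound _ (fun y => RtoC (inst_density x u y))); [|eapply Int_correct, B].
  intros y. rewrite Cmod_R. unfold inst_density. rewrite Rabs_mult, (Rabs_pos_eq 2) by lra.
  pose proof PI_RGT_0. pose proof (cosh_ge_1 y).
  assert (Hxc : 1 <= x * cosh y) by nra.
  assert (H1 : 2 * PI <= 2 * PI * (x * cosh y)).
  { rewrite <- (Rmult_1_r (2 * PI)) at 1. apply Rmult_le_compat_l; lra. }
  assert (Q := Cmod_geo_le (- (2 * PI * (x * cosh y)), 2 * PI * u) (2 * PI) ltac:(lra) ltac:(simpl; lra)).
  assert (Q2 := re_le_Cmod (geo (- (2 * PI * (x * cosh y)), 2 * PI * u))).
  change (Re (- (2 * PI * (x * cosh y)), 2 * PI * u)) with (- (2 * PI * (x * cosh y))) in Q.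
  assert (E : exp (- (2 * PI * (x * cosh y))) <= / (x * cosh y)).
  { rewrite exp_Ropp. apply Rinv_le_contravar; [lra|].
    assert (H2 := exp_ineq1 (2 * PI * (x * cosh y)) ltac:(lra)).
    assert (1 * (x * cosh y) <= 2 * PI * (x * cosh y)) by (apply Rmult_le_compat_r; [lra|]; pose proof PI2_1; lra). lra. }
  assert (0 < / (1 - exp (- (2 * PI)))) by (apply Rinv_0_lt_compat; pose proof (exp_neg_lt_1 (2 * PI) ltac:(lra)); lra).
  assert (Q3 := Rle_trans _ _ _ Q2 (Rle_trans _ _ _ Q (Rmult_le_compat_l _ _ _ (Rlt_le _ _ H2) E))).
  rewrite Rinv_mult in Q3. apply (Rmult_le_compat_l 2) in Q3; [|lra].
  eapply Rle_trans; [exact Q3|]. right. unfold Rdiv. ring.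
Qed.

Definition hyp (x y : R) : R := sqrt (x ^ 2 + sinh y ^ 2).

Lemma hyp_bounds x y : 0 < x -> x <= hyp x y /\ Rabs (sinh y) <= hyp x y /\ 0 < sinh y + hyp x y /\ hyp x y * hyp x y = x ^ 2 + sinh y ^ 2.
Proof.
  intros Hx. destruct (dist_bounds x (sinh y) Hx) as [H1 [H2 _]]. fold (hyp x y) in H1, H2.
  assert (E : hyp x y * hyp x y = x ^ 2 + sinh y ^ 2).
  { unfold hyp. apply sqrt_sqrt. pose proof (pow2_ge_0 x). pose proof (pow2_ge_0 (sinh y)). lra. }
  repeat split; auto.
  assert (- sinh y < hyp x y); [|lra]. apply Rnot_le_lt. intros N.
  assert (hyp x y * hyp x y <= (- sinh y) * (- sinh y)) by (apply Rmult_le_compat; lra).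
  pose proof (pow_lt x 2 Hx). simpl in *. lra.
Qed.

(** The inverse of [y' |-> y] where [sinh y = x * sinh y']. *)
Definition resc (x y : R) : R := ln ((sinh y + hyp x y) / x).

Lemma is_derive_resc x y : 0 < x -> is_derive (resc x) y (cosh y / hyp x y).
Proof.
  intros Hx. destruct (hyp_bounds x y Hx) as [H1 [_ [H2 H3]]].
  assert (D1 : is_derive (hyp x) y (sinh y * cosh y / hyp x y)).
  { assert (D := is_derive_sqrt (fun y => x ^ 2 + sinh y ^ 2) y (2 * sinh y * cosh y)).
    assert (D0 : is_derive (fun y => x ^ 2 + sinh y ^ 2) y (2 * sinh y * cosh y)).
    { unfold sinh, cosh. auto_derive; auto. field. }
    specialize (D D0). fold (hyp x y) in D. 
    replace (sinh y * cosh y / hyp x y) with (2 * sinh y * cosh y / (2 * hyp x y)) by (field; lra).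
    apply D. pose proof (pow_lt x 2 Hx). pose proof (pow2_ge_0 (sinh y)). lra. }
  assert (D2 := is_derive_scal _ y (/ x) _ (is_derive_plus _ _ _ _ _ (is_derive_sinh y) D1)).
  assert (Hp : 0 < / x * (sinh y + hyp x y)) by (apply Rmult_lt_0_compat; auto; now apply Rinv_0_lt_compat).
  assert (D3 := is_derive_comp ln _ y _ _ (is_derive_ln _ Hp) D2).
  apply (is_derive_ext (fun y => ln (/ x * plus (sinh y) (hyp x y)))).
  - intros t. unfold resc, Rdiv. rewrite Rmult_comm. reflexivity.
  - replace (cosh y / hyp x y) with (scal (/ x * plus (cosh y) (sinh y * cosh y / hyp x y)) (/ (/ x * (sinh y + hyp x y)))); [exact D3|].
    unfold scal; simpl; unfold mult, plus; simpl. field. repeat split; lra.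
Qed.

Lemma cosh_resc x y : 0 < x -> cosh (resc x y) = hyp x y / x.
Proof.
  intros Hx. destruct (hyp_bounds x y Hx) as [H1 [_ [H2 H3]]]. unfold resc, cosh. rewrite exp_Ropp, exp_ln by (now apply Rdiv_lt_0_compat).
  replace (/ ((sinh y + hyp x y) / x)) with ((hyp x y - sinh y) / x); [field; lra|].
  apply Rmult_eq_reg_r with (x * (sinh y + hyp x y)); [|apply Rgt_not_eq, Rlt_gt; mult_pos].
  field_simplify; [|lra|lra]. simpl in *. lra.
Qed.

Lemma resc_neg x y : 0 < x -> resc x (- y) = - resc x y.
Proof.
  intros Hx. destruct (hyp_bounds x y Hx) as [H1 [_ [H2 H3]]]. destruct (hyp_bounds x (- y) Hx) as [_ [_ [H4 _]]].
  assert (E : hyp x (- y) = hyp x y) by (unfold hyp; rewrite sinh_neg; f_equal; ring).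
  unfold resc. rewrite <- ln_Rinv by (now apply Rdiv_lt_0_compat). f_equal.
  rewrite E, sinh_neg in *. apply Rmult_eq_reg_r with (x * (sinh y + hyp x y)); [|apply Rgt_not_eq, Rlt_gt; mult_pos].
  field_simplify; [|lra|lra]. simpl in *. lra.
Qed.

Lemma filterlim_resc_p x : 0 < x -> filterlim (resc x) (Rbar_locally p_infty) (Rbar_locally p_infty).
Proof.
  intros Hx P [M HM]. 
  destruct (filterlim_sinh_p (fun s => Rmax 0 (x * exp M) < s)) as [N HN]; [now exists (Rmax 0 (x * exp M))|].
  exists N. intros y Hy. apply HM. specialize (HN y Hy). pose proof (Rmax_l 0 (x * exp M)). pose proof (Rmax_r 0 (x * exp M)).
  destruct (hyp_bounds x y Hx) as [H1 _]. rewrite <- (ln_exp M). unfold resc. apply ln_increasing; [apply exp_pos|].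
  apply Rmult_lt_reg_r with x; auto. unfold Rdiv. rewrite Rmult_assoc, Rinv_l, Rmult_1_r by lra. lra.
Qed.

Lemma filterlim_resc_m x : 0 < x -> filterlim (resc x) (Rbar_locally m_infty) (Rbar_locally m_infty).
Proof.
  intros Hx. apply (filterlim_ext (fun y => - resc x (- y))); [intros; rewrite resc_neg by auto; ring|].
  apply (filterlim_comp _ _ _ Ropp (fun y => - resc x y) _ (Rbar_locally p_infty)); [apply (filterlim_Rbar_opp m_infty)|].
  apply (filterlim_comp _ _ _ (resc x) Ropp _ (Rbar_locally p_infty)); [now apply filterlim_resc_p|apply (filterlim_Rbar_opp p_infty)].
Qed.

(** As [x * cosh (resc x y) = hyp x y], the substitution replaces [x * cosh y] by [hyp x y], the
    width of the Cauchy kernel contained in [dist_density]. *)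
Lemma is_Int_inst_hyp x u : 0 < x ->
  is_Int (fun y => RtoC (cosh y / hyp x y * (2 * Re (geo (- (2 * PI * hyp x y), 2 * PI * u))))) (inst_sum x u).
Proof.
  intros Hx. destruct (sech_inst x u Hx) as [K B].
  refine (is_Int_subst (fun _ => True) _ _ (fun y => RtoC (inst_density x u y)) _ (resc x) (fun y => cosh y / hyp x y) _ _ _ _ _ _ _ _ _ _ _ _ (Int_correct _ _ B)); auto.
  - apply filter_true.
  - apply filter_true.
  - intros y _. now apply is_derive_resc.
  - intros y _. destruct (hyp_bounds x y Hx) as [H1 _]. apply (continuous_mult (K := R_AbsRing) cosh (fun y => / hyp x y)).
    + apply (continuous_of_derive (V := RR) cosh y (sinh y)), is_derive_cosh.
    + apply (continuous_comp (hyp x) Rinv).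
      * unfold hyp. apply (continuous_comp (fun y => x ^ 2 + sinh y ^ 2) sqrt).
        -- apply (continuous_of_derive (V := RR) _ y (2 * sinh y * cosh y)). unfold sinh, cosh. auto_derive; auto. field.
        -- apply continuity_pt_filterlim, continuity_pt_sqrt. pose proof (pow2_ge_0 x). pose proof (pow2_ge_0 (sinh y)). lra.
      * apply (continuous_of_derive (V := RR) Rinv (hyp x y) (- / hyp x y ^ 2)). auto_derive; [lra|]. field. lra.
  - apply B.
  - intros y _. rewrite <- RtoC_mult. f_equal. unfold inst_density. rewrite cosh_resc by auto.
    replace (x * (hyp x y / x)) with (hyp x y) by (field; lra). reflexivity.
  - now apply filterlim_resc_m.
  - now apply filterlim_resc_p.
Qed.

Lemma resc_diff_lim x x' : 0 < x <= x' ->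
  filterlim (fun y => resc x y - resc x' y) (Rbar_locally p_infty) (locally (ln (x' / x))).
Proof.
  intros Hx. apply filterlim_locally. intros e. pose proof (cond_pos e).
  destruct (filterlim_sinh_p (fun s => x' / e < s)) as [N HN]; [now exists (x' / e)|].
  exists N. intros y Hy. specialize (HN y Hy).
  assert (Hs : 0 < sinh y) by (assert (0 < x' / e) by (apply Rdiv_lt_0_compat; lra); lra).
  destruct (hyp_bounds x y ltac:(lra)) as [A1 [A2 [A3 A4]]]. destruct (hyp_bounds x' y ltac:(lra)) as [B1 [B2 [B3 B4]]].
  destruct (dist_bounds x' (sinh y) ltac:(lra)) as [_ [_ B5]]. fold (hyp x' y) in B5. rewrite (Rabs_pos_eq (sinh y)) in * by lra.
  change (Rabs ((resc x y - resc x' y) - ln (x' / x)) < e).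
  assert (E : resc x y - resc x' y - ln (x' / x) = ln ((sinh y + hyp x y) / (sinh y + hyp x' y))).
  { unfold resc. rewrite !ln_div by lra. ring. }
  rewrite E. set (t := (sinh y + hyp x y) / (sinh y + hyp x' y)). assert (Ht : 0 < t) by now apply Rdiv_lt_0_compat.
  assert (Hmono : hyp x y <= hyp x' y).
  { unfold hyp. apply sqrt_le_1_alt. apply Rplus_le_compat_r. apply pow_incr. lra. }
  assert (Ht1 : t <= 1).
  { unfold t. apply Rmult_le_reg_r with (sinh y + hyp x' y); auto. unfold Rdiv. rewrite Rmult_assoc, Rinv_l by lra. lra. }
  assert (L1 := ln_le_sub1 t Ht). assert (L2 := ln_le_sub1 (/ t) (Rinv_0_lt_compat _ Ht)). rewrite ln_Rinv in L2 by auto.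
  assert (L3 : / t - 1 < e).
  { unfold t. replace (/ ((sinh y + hyp x y) / (sinh y + hyp x' y)) - 1) with ((hyp x' y - hyp x y) / (sinh y + hyp x y)) by (field; lra).
    apply Rmult_lt_reg_r with (sinh y + hyp x y); auto. unfold Rdiv. rewrite Rmult_assoc, Rinv_l, Rmult_1_r by lra.
    apply Rle_lt_trans with x'; [lra|].
    assert (x' < e * sinh y). { apply Rmult_lt_reg_r with (/ e); [now apply Rinv_0_lt_compat|]. replace (e * sinh y * / e) with (sinh y) by (field; lra). exact HN. }
    assert (0 <= e * hyp x y) by (apply Rmult_le_pos; lra). lra. }
  apply Rabs_def1; lra.
Qed.

(** The zero mode. Each of the two terms diverges logarithmically by itself, which is why the
    lattice sums are compared at two values of [x]; the difference has the primitive
    [resc x - resc x']. *)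
Lemma is_Int_log x x' : 0 < x <= x' ->
  is_Int (fun y => RtoC (cosh y / hyp x y - cosh y / hyp x' y)) (RtoC (2 * ln (x' / x))).
Proof.
  intros Hx. replace (2 * ln (x' / x)) with (ln (x' / x) - - ln (x' / x)) by ring.
  assert (HK : sech_bounded ((x' ^ 2 - x ^ 2) * / x * (1 + / x ^ 2)) (fun y => RtoC (cosh y / hyp x y - cosh y / hyp x' y))).
  { apply sech_RtoC.
    - intros y. destruct (hyp_bounds x y ltac:(lra)) as [A1 _]. destruct (hyp_bounds x' y ltac:(lra)) as [B1 _].
      unfold hyp, cosh, sinh in *. pose proof (pow2_ge_0 ((exp y - exp (- y)) / 2)). pose proof (pow_lt x 2 ltac:(lra)). pose proof (pow_lt x' 2 ltac:(lra)).
      eexists. auto_derive; [|reflexivity]. unfold Rdiv, Rminus in *. simpl in *. repeat split; try lra.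
    - intros y. destruct (hyp_bounds x y ltac:(lra)) as [A1 [_ [_ A4]]]. destruct (hyp_bounds x' y ltac:(lra)) as [B1 [_ [_ B4]]].
      pose proof (cosh_gt_0 y).
      assert (Hmono : hyp x y <= hyp x' y).
      { unfold hyp. apply sqrt_le_1_alt. apply Rplus_le_compat_r. apply pow_incr. lra. }
      assert (Hsq : x ^ 2 <= x' ^ 2) by (apply pow_incr; lra).
      replace (cosh y / hyp x y - cosh y / hyp x' y) with (cosh y * ((x' ^ 2 - x ^ 2) / (hyp x y * hyp x' y * (hyp x y + hyp x' y)))).
      2:{ replace (x' ^ 2 - x ^ 2) with (hyp x' y * hyp x' y - hyp x y * hyp x y) by lra. field. repeat split; lra. }
      rewrite Rabs_pos_eq.
      2:{ apply Rmult_le_pos; [lra|]. apply Rmult_le_pos; [lra|]. left. apply Rinv_0_lt_compat. mult_pos. }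
      apply Rle_trans with ((x' ^ 2 - x ^ 2) * / x * (cosh y / (x ^ 2 + sinh y ^ 2))).
      + rewrite <- A4. 
        replace ((x' ^ 2 - x ^ 2) * / x * (cosh y / (hyp x y * hyp x y))) with (cosh y * (x' ^ 2 - x ^ 2) * / (hyp x y * hyp x y * x)) by (field; lra).
        unfold Rdiv. rewrite <- Rmult_assoc. apply Rmult_le_compat_l; [apply Rmult_le_pos; lra|].
        apply Rinv_le_contravar; [mult_pos|].
        apply Rmult_le_compat; try lra; [apply Rmult_le_pos; lra|]. apply Rmult_le_compat_l; lra.
      + unfold Rdiv. rewrite (Rmult_assoc _ (1 + / x ^ 2)). apply Rmult_le_compat_l.
        * apply Rmult_le_pos; [lra|]. left. apply Rinv_0_lt_compat. lra.
        * apply cosh_div_le; lra. }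
  apply (IntR_RtoC_FTC _ _ (fun y => resc x y - resc x' y) _ _ HK).
  - intros y. apply (is_derive_minus (resc x) (resc x')); apply is_derive_resc; lra.
  - apply (filterlim_ext (fun y => - (resc x (- y) - resc x' (- y)))); [intros y; rewrite !resc_neg by lra; ring|].
    apply (filterlim_comp _ _ _ (fun y => resc x (- y) - resc x' (- y)) Ropp _ (locally (ln (x' / x)))); [|apply (filterlim_opp (V := RR))].
    apply (filterlim_comp _ _ _ Ropp (fun y => resc x y - resc x' y) _ (Rbar_locally p_infty)); [apply (filterlim_Rbar_opp m_infty)|now apply resc_diff_lim].
  - now apply resc_diff_lim.
Qed.

Lemma lim_seq_eq (s : nat -> R) (a b : R) : is_lim_seq s a -> is_lim_seq s b -> a = b.
Proof.
  intros Ha Hb. apply Rbar_finite_eq. rewrite <- (is_lim_seq_unique _ _ Ha). exact (is_lim_seq_unique _ _ Hb).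
Qed.

Definition dist_sum (rad x u : R) : R := ZSeries (fun n => inv_dist x (u + IZR n) - kappa rad n).

Lemma dist_density_cauchy x v y : 0 < x -> dist_density x v y = cosh y / hyp x y * cauchy_kernel (hyp x y) v.
Proof.
  intros Hx. destruct (hyp_bounds x y Hx) as [H1 [_ [_ H2]]]. unfold dist_density, cauchy_kernel.
  replace (hyp x y ^ 2) with (x ^ 2 + sinh y ^ 2) by (rewrite <- H2; ring).
  pose proof (pow_lt x 2 Hx). pose proof (pow2_ge_0 (sinh y)). pose proof (pow2_ge_0 v). field. split; lra.
Qed.

(** The bound is a product of an integrable function of [y] and a function of [v] that is summable
    over the shifts; this permits the exchange of sum and integral. *)
Lemma dist_density_diff x x' v y : 0 < x <= x' ->
  0 <= dist_density x v y - dist_density x' v y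
  <= (x' ^ 2 - x ^ 2) * ((1 + / x ^ 2) / cosh y) * (/ x * cauchy_kernel x v).
Proof.
  intros Hx. unfold dist_density, cauchy_kernel. pose proof (cosh_gt_0 y) as Hc.
  assert (Hx2 := pow_lt x 2 ltac:(lra)). assert (Hs := pow2_ge_0 (sinh y)). assert (Hv := pow2_ge_0 v).
  assert (Hle : x ^ 2 <= x' ^ 2) by (apply pow_incr; lra).
  set (d := x ^ 2 + sinh y ^ 2 + v ^ 2). set (d' := x' ^ 2 + sinh y ^ 2 + v ^ 2).
  assert (Hd : 0 < d) by (unfold d; lra). assert (Hd' : 0 < d') by (unfold d'; lra).
  replace (cosh y / d - cosh y / d') with ((x' ^ 2 - x ^ 2) * (cosh y / d) * / d') by (unfold d, d' in *; field; lra).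
  replace (/ x * (x / (x ^ 2 + v ^ 2))) with (/ (x ^ 2 + v ^ 2)) by (field; lra).
  assert (H0 : 0 < cosh y / d) by (apply Rdiv_lt_0_compat; lra).
  assert (H1 : 0 < / d') by (now apply Rinv_0_lt_compat).
  split.
  - apply Rmult_le_pos; [apply Rmult_le_pos|]; lra.
  - apply Rmult_le_compat; try lra; [apply Rmult_le_pos; lra| |].
    + apply Rmult_le_compat_l; [lra|]. apply cosh_div_le; [lra|]. unfold d. lra.
    + apply Rinv_le_contravar; unfold d'; lra.
Qed.

Lemma ZSeries_lin (a b : Z -> R) k l : ex_Zseries a -> ex_Zseries b ->
  ex_Zseries (fun n => k * a n - l * b n) /\ ZSeries (fun n => k * a n - l * b n) = k * ZSeries a - l * ZSeries b.
Proof.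
  intros [A1 A2] [B1 B2].
  assert (S : forall (c : nat -> R) k, ex_series c -> ex_series (fun n => k * c n)).
  { intros c k' Hc. apply (ex_series_scal (V := R_NormedModule) k' c Hc). }
  split.
  - split; apply (ex_series_minus (V := R_NormedModule)); auto.
  - unfold ZSeries. rewrite !Series_minus, !Series_scal_l by auto. ring.
Qed.

(** The partial sum of the integrands misses the full sum by at most [K * tau N / cosh y], where
    [tau N] is the tail of the Cauchy sum at [x]. After integration the partial sums therefore
    converge to the integral of the full sum, which is known through the Poisson kernel. *)
Lemma dist_diff_lim x x' u : 0 < x <= x' -> 0 <= u <= 1 ->
  is_lim_seq (fun N => Zpart (fun n => inv_dist x (u + IZR n) - inv_dist x' (u + IZR n)) N)
    (2 * ln (x' / x) + Re (inst_sum x u) - Re (inst_sum x' u)).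
Proof.
  intros Hx Hu. pose proof PI_RGT_0 as Hpi.
  set (K := (x' ^ 2 - x ^ 2) * (1 + / x ^ 2) * / x).
  set (tau := fun N => cauchy_sum x u - Zpart (fun n => cauchy_kernel x (u + IZR n)) N).
  set (g := fun x y => cosh y / hyp x y * (2 * Re (geo (- (2 * PI * hyp x y), 2 * PI * u)))).
  (* The sum of the integrands over all [n]: the zero mode and the oscillating parts at [x] and
     [x']. *)
  set (hinf := fun y => (RtoC PI * (RtoC (cosh y / hyp x y - cosh y / hyp x' y) + RtoC (g x y) + (- (1)) * RtoC (g x' y)))%C).
  assert (Hinf : is_Int hinf (RtoC PI * (RtoC (2 * ln (x' / x)) + inst_sum x u + (- (1)) * inst_sum x' u))%C).
  { apply is_Int_Cmult. apply is_Int_plus; [apply is_Int_plus|apply is_Int_Cmult].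
    - now apply is_Int_log.
    - apply is_Int_inst_hyp. lra.
    - apply is_Int_inst_hyp. lra. }
  set (L := 2 * ln (x' / x) + Re (inst_sum x u) - Re (inst_sum x' u)).
  set (RN := fun N => Zpart (fun n => inv_dist x (u + IZR n) - inv_dist x' (u + IZR n)) N).
  assert (Htau : is_lim_seq tau 0).
  { replace 0 with (cauchy_sum x u - cauchy_sum x u) by ring. apply is_lim_seq_minus'; [apply is_lim_seq_const|].
    apply Zpart_lim, ex_Zseries_cauchy. lra. }
  assert (HB : forall N, Rabs (L - RN N) <= K * tau N).
  { intros N.
    assert (HN : is_Int (fun y => RtoC (Zpart (fun n => dist_density x (u + IZR n) y - dist_density x' (u + IZR n) y) N)) (RtoC (Zpart (fun n => PI * inv_dist x (u + IZR n) - PI * inv_dist x' (u + IZR n)) N))).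
    { apply (is_Int_Zpart (fun n y => dist_density x (u + IZR n) y - dist_density x' (u + IZR n) y)). intros n.
      assert (H := is_Int_plus _ _ _ _ (is_Int_dist x (u + IZR n) ltac:(lra)) (is_Int_Cmult (- (1))%C _ _ (is_Int_dist x' (u + IZR n) ltac:(lra)))).
      rewrite RtoC_minus.
      replace (RtoC (PI * inv_dist x (u + IZR n)) - RtoC (PI * inv_dist x' (u + IZR n)))%C with (RtoC (PI * inv_dist x (u + IZR n)) + (- (1)) * RtoC (PI * inv_dist x' (u + IZR n)))%C by ring.
      refine (eq_ind _ (fun g => is_Int g _) H _ _). apply functional_extensionality. intros y. rewrite RtoC_minus. ring. }
    assert (HD := is_Int_plus _ _ _ _ Hinf (is_Int_Cmult (- (1))%C _ _ HN)).
    assert (EN : Zpart (fun n => PI * inv_dist x (u + IZR n) - PI * inv_dist x' (u + IZR n)) N = PI * RN N).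
    { unfold RN, Zpart. rewrite Rmult_plus_distr_l, <- !sum_n_Rmult_l. f_equal; apply sum_n_Rext; intros; ring. }
    rewrite EN in HD.
    apply (is_Int_bound (K * tau N)) in HD.
    - apply Rmult_le_reg_r with PI; auto. eapply Rle_trans; [|exact HD].
      eapply Rle_trans; [|apply re_le_Cmod].
      match goal with |- _ <= Rabs ?t => replace t with ((L - RN N) * PI) by (unfold L; simpl; ring) end.
      rewrite Rabs_mult, (Rabs_pos_eq PI) by lra. apply Rle_refl.
    - intros y. destruct (hyp_bounds x y ltac:(lra)) as [A1 _]. destruct (hyp_bounds x' y ltac:(lra)) as [B1 _].
      set (a := fun n => dist_density x (u + IZR n) y - dist_density x' (u + IZR n) y).
      set (kk := (x' ^ 2 - x ^ 2) * ((1 + / x ^ 2) / cosh y) * / x).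
      (* A multiple of the Cauchy kernel in the shape of [ZSeries_lin], with second coefficient
         0. *)
      set (e := fun n => kk * cauchy_kernel x (u + IZR n) - 0 * cauchy_kernel x (u + IZR n)).
      assert (Ex := ex_Zseries_cauchy x u ltac:(lra)).
      destruct (ZSeries_lin _ _ kk 0 Ex Ex) as [Ee Se]. fold e in Ee, Se.
      destruct (ZSeries_lin _ _ (cosh y / hyp x y) (cosh y / hyp x' y) (ex_Zseries_cauchy (hyp x y) u ltac:(lra)) (ex_Zseries_cauchy (hyp x' y) u ltac:(lra))) as [Ea Sa].
      assert (EA : (fun n => cosh y / hyp x y * cauchy_kernel (hyp x y) (u + IZR n) - cosh y / hyp x' y * cauchy_kernel (hyp x' y) (u + IZR n)) = a).
      { apply functional_extensionality. intros n. unfold a. rewrite !dist_density_cauchy by lra. reflexivity. }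
      rewrite EA in Ea, Sa.
      assert (Hae : forall n, 0 <= a n <= e n).
      { intros n. assert (H := dist_density_diff x x' (u + IZR n) y Hx). unfold a, e, kk. lra. }
      assert (HR := Zpart_remainder a e N Hae Ea Ee).
      assert (EH : (hinf y + (- (1)) * RtoC (Zpart a N))%C = RtoC (ZSeries a - Zpart a N)).
      { unfold hinf, g. rewrite Sa. change (ZSeries (fun n => cauchy_kernel (hyp x y) (u + IZR n))) with (cauchy_sum (hyp x y) u).
        change (ZSeries (fun n => cauchy_kernel (hyp x' y) (u + IZR n))) with (cauchy_sum (hyp x' y) u).
        rewrite !cauchy_sum_poisson, !poisson_geo by lra. apply injective_projections; simpl; ring. }
      rewrite EH, Cmod_R, Rabs_pos_eq by apply HR.
      eapply Rle_trans; [apply HR|]. right.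
      assert (EP : Zpart e N = kk * Zpart (fun n => cauchy_kernel x (u + IZR n)) N).
      { unfold Zpart. rewrite Rmult_plus_distr_l, <- !sum_n_Rmult_l. f_equal; apply sum_n_Rext; intros; unfold e; ring. }
      rewrite Se, EP. unfold tau, kk, K, cauchy_sum. pose proof (cosh_gt_0 y). field. repeat split; lra. }
  apply (is_lim_seq_le_le (fun N => L - K * tau N) _ (fun N => L + K * tau N)).
  - intros N. assert (H := HB N). apply Rabs_le_between in H. lra.
  - replace (Finite L) with (Finite (L - K * 0)) by (f_equal; ring). apply is_lim_seq_minus'; [apply is_lim_seq_const|].
    apply is_lim_seq_mult'; [apply is_lim_seq_const|exact Htau].
  - replace (Finite L) with (Finite (L + K * 0)) by (f_equal; ring). apply is_lim_seq_plus'; [apply is_lim_seq_const|].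
    apply is_lim_seq_mult'; [apply is_lim_seq_const|exact Htau].
Qed.

Lemma Zpart_minus (a b : Z -> R) N : Zpart (fun n => a n - b n) N = Zpart a N - Zpart b N.
Proof.
  unfold Zpart.
  assert (ES : forall c d : nat -> R, sum_n (fun n => c n - d n) N = sum_n c N - sum_n d N).
  { intros c d. clear. induction N as [|N IH]; [now rewrite !sum_n_0|rewrite !sum_n_S, IH; asR; ring]. }
  rewrite !ES. ring.
Qed.

Lemma dist_sum_difference rad x x' u : 0 < x <= x' -> 0 <= u <= 1 ->
  dist_sum rad x u - dist_sum rad x' u = 2 * ln (x' / x) + Re (inst_sum x u) - Re (inst_sum x' u).
Proof.
  intros Hx Hu.
  assert (L1 := Zpart_lim _ (ex_Zseries_dist rad x u ltac:(lra))). assert (L2 := Zpart_lim _ (ex_Zseries_dist rad x' u ltac:(lra))).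
  assert (L3 := is_lim_seq_minus' _ _ _ _ L1 L2). assert (L4 := dist_diff_lim x x' u Hx Hu).
  assert (L5 : is_lim_seq (fun N => Zpart (fun n => inv_dist x (u + IZR n) - kappa rad n) N - Zpart (fun n => inv_dist x' (u + IZR n) - kappa rad n) N)
    (2 * ln (x' / x) + Re (inst_sum x u) - Re (inst_sum x' u))).
  { eapply is_lim_seq_ext; [|exact L4]. intros N. rewrite !Zpart_minus. ring. }
  exact (lim_seq_eq _ _ _ L3 L5).
Qed.

(** * The constant term, from the asymptotics for large x *)

(** This is [arsinh (v / x)], the primitive of [inv_dist x] that vanishes at 0. *)
Definition dist_primitive (x v : R) : R := ln (v + sqrt (x ^ 2 + v ^ 2)) - ln x.

Lemma is_derive_dist_primitive x v : 0 < x -> is_derive (dist_primitive x) v (inv_dist x v).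
Proof.
  intros Hx. destruct (dist_bounds x v Hx) as [H1 [H2 _]].
  assert (Hp : 0 < x ^ 2 + v ^ 2) by (pose proof (pow_lt x 2 Hx); pose proof (pow2_ge_0 v); lra).
  assert (Hs : sqrt (x ^ 2 + v ^ 2) * sqrt (x ^ 2 + v ^ 2) = x ^ 2 + v ^ 2) by (apply sqrt_sqrt; lra).
  assert (Hv : 0 < v + sqrt (x ^ 2 + v ^ 2)).
  { assert (- v < sqrt (x ^ 2 + v ^ 2)); [|lra]. apply Rnot_le_lt. intros N.
    assert (sqrt (x ^ 2 + v ^ 2) * sqrt (x ^ 2 + v ^ 2) <= (- v) * (- v)) by (apply Rmult_le_compat; lra).
    pose proof (pow_lt x 2 Hx). simpl in *. lra. }
  unfold dist_primitive, inv_dist. simpl in *. auto_derive; [repeat split; auto|]. field. split; lra.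
Qed.

Lemma inv_dist_decr x v w : 0 < x -> 0 <= v <= w -> inv_dist x w <= inv_dist x v.
Proof.
  intros Hx Hv. destruct (dist_bounds x v Hx) as [H1 _]. unfold inv_dist. apply Rinv_le_contravar; [lra|].
  apply sqrt_le_1_alt, Rplus_le_compat_l, pow_incr. lra.
Qed.

Lemma inv_dist_le x v : 0 < x -> 0 < inv_dist x v <= / x.
Proof.
  intros Hx. destruct (dist_bounds x v Hx) as [H1 _]. unfold inv_dist. split.
  - apply Rinv_0_lt_compat. lra.
  - apply Rinv_le_contravar; lra.
Qed.

Lemma dist_primitive_mvt x v w : 0 < x -> 0 <= v <= w ->
  inv_dist x w * (w - v) <= dist_primitive x w - dist_primitive x v <= inv_dist x v * (w - v).
Proof.
  intros Hx Hv. destruct (MVT_gen (dist_primitive x) v w (inv_dist x)) as [c [Hc E]].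
  - intros; now apply is_derive_dist_primitive.
  - intros t _. apply continuity_pt_filterlim, (continuous_of_derive (V := RR) _ t (inv_dist x t)). now apply is_derive_dist_primitive.
  - rewrite Rmin_left, Rmax_right in Hc by lra. rewrite E. split; apply Rmult_le_compat_r; try lra; apply inv_dist_decr; lra.
Qed.

(** Comparison of a decreasing function with its integral; the boundary terms are controlled by the
    maximum [1 / x]. *)
Lemma sum_inv_dist x v0 N : 0 < x -> 0 <= v0 <= 1 ->
  dist_primitive x (v0 + INR (S N)) - / x <= sum_n (fun n => inv_dist x (v0 + INR n)) N <= dist_primitive x (v0 + INR (S N)) + / x.
Proof.
  intros Hx Hv.
  assert (H : dist_primitive x (v0 + INR (S N)) - dist_primitive x v0 <= sum_n (fun n => inv_dist x (v0 + INR n)) N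
    /\ sum_n (fun n => inv_dist x (v0 + INR n)) N <= inv_dist x v0 + (dist_primitive x (v0 + INR N) - dist_primitive x v0)).
  { induction N as [|N IH].
    - rewrite sum_n_0. simpl INR. rewrite Rplus_0_r. split; [|lra].
      assert (Q := dist_primitive_mvt x v0 (v0 + 1) Hx ltac:(lra)). lra.
    - rewrite sum_n_S. destruct IH as [I1 I2]. pose proof (pos_INR N). rewrite !S_INR in *. split.
      + assert (Q := dist_primitive_mvt x (v0 + (INR N + 1)) (v0 + (INR N + 1 + 1)) Hx ltac:(lra)).
        replace (v0 + (INR N + 1 + 1) - (v0 + (INR N + 1))) with 1 in Q by ring. lra.
      + assert (Q := dist_primitive_mvt x (v0 + INR N) (v0 + (INR N + 1)) Hx ltac:(lra)).
        replace (v0 + (INR N + 1) - (v0 + INR N)) with 1 in Q by ring. lra. }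
  assert (B := inv_dist_le x v0 Hx). pose proof (pos_INR N).
  assert (P0 : dist_primitive x 0 = 0).
  { unfold dist_primitive. replace (x ^ 2 + 0 ^ 2) with (x ^ 2) by ring. rewrite sqrt_pow2, Rplus_0_l by lra. ring. }
  assert (Q := dist_primitive_mvt x 0 v0 Hx ltac:(lra)). rewrite P0, !Rminus_0_r in Q.
  assert (B0 := inv_dist_le x 0 Hx).
  assert (inv_dist x 0 * v0 <= / x * 1) by (apply Rmult_le_compat; lra).
  assert (0 <= inv_dist x v0 * v0) by (apply Rmult_le_pos; lra).
  rewrite S_INR in *. assert (Q2 := dist_primitive_mvt x (v0 + INR N) (v0 + (INR N + 1)) Hx ltac:(lra)).
  assert (B1 := inv_dist_le x (v0 + (INR N + 1)) Hx).
  replace (v0 + (INR N + 1) - (v0 + INR N)) with 1 in Q2 by ring. lra.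
Qed.

Lemma is_lim_seq_inv_S : is_lim_seq (fun n => / INR (S n)) 0.
Proof.
  apply (is_lim_seq_incr_1 (fun n => / INR n)).
  replace (Finite 0) with (Rbar_inv p_infty) by reflexivity.
  apply is_lim_seq_inv; [apply is_lim_seq_INR|discriminate].
Qed.

(** With [m = N + 1] and [r] the distance at [s + m], the number [s + m + r] lies between
    [2 s + 2 m] and [2 s + 2 m + x], so its quotient by [m] tends to 2. *)
Lemma dist_primitive_lim x s : 0 < x -> 0 <= s ->
  is_lim_seq (fun N => dist_primitive x (s + INR (S N)) - ln (INR (S N))) (ln 2 - ln x).
Proof.
  intros Hx Hs.
  assert (HL : forall B, is_lim_seq (fun N => ln (2 + B * / INR (S N))) (ln 2)).
  { intros B. apply (is_lim_seq_continuous ln (fun N => 2 + B * / INR (S N)) 2).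
    - apply continuity_pt_filterlim, (continuous_of_derive (V := RR) ln 2 (/ 2)), is_derive_ln. lra.
    - replace (Finite 2) with (Finite (2 + B * 0)) by (f_equal; ring). apply is_lim_seq_plus'; [apply is_lim_seq_const|].
      apply is_lim_seq_mult'; [apply is_lim_seq_const|apply is_lim_seq_inv_S]. }
  apply (is_lim_seq_le_le (fun N => ln (2 + (2 * s) * / INR (S N)) - ln x) _ (fun N => ln (2 + (2 * s + x) * / INR (S N)) - ln x)).
  2, 3: apply is_lim_seq_minus'; [apply HL|apply is_lim_seq_const].
  intros N. assert (Hm : 0 < INR (S N)) by (apply lt_0_INR; lia). set (m := INR (S N)) in *.
  assert (Hi : 0 < / m) by now apply Rinv_0_lt_compat.
  destruct (dist_bounds x (s + m) Hx) as [H1 [H2 H3]]. rewrite (Rabs_pos_eq (s + m)) in * by lra.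
  unfold dist_primitive. set (r := sqrt (x ^ 2 + (s + m) ^ 2)) in *.
  assert (E : ln (s + m + r) = ln ((s + m + r) * / m) + ln m).
  { rewrite <- ln_mult; [|apply Rmult_lt_0_compat; lra|lra]. f_equal. field. lra. }
  rewrite E.
  assert (M : forall p q, 0 < p -> p <= q -> ln p <= ln q) by (intros p q Hp [Hq| ->]; [left; now apply ln_increasing|lra]).
  assert (0 <= s * / m) by (apply Rmult_le_pos; lra).
  split.
  - assert (ln (2 + 2 * s * / m) <= ln ((s + m + r) * / m)); [|lra].
    apply M; [lra|]. replace (2 + 2 * s * / m) with ((s + m + (s + m)) * / m) by (field; lra). apply Rmult_le_compat_r; lra.
  - assert (ln ((s + m + r) * / m) <= ln (2 + (2 * s + x) * / m)); [|lra].
    apply M; [apply Rmult_lt_0_compat; lra|]. replace (2 + (2 * s + x) * / m) with ((s + m + (x + (s + m))) * / m) by (field; lra). apply Rmult_le_compat_r; lra.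
Qed.

Lemma ln_ge t : 0 < t -> 1 - / t <= ln t.
Proof. intros Ht. assert (H := ln_le_sub1 (/ t) (Rinv_0_lt_compat _ Ht)). rewrite ln_Rinv in H by auto. lra. Qed.

(** [Euler_gamma] is defined through [Lim_seq], so convergence has to be established: the sequence
    decreases because [1 - 1 / t <= ln t], and it is bounded below because [ln t <= t - 1]. *)
Lemma Euler_gamma_lim : is_lim_seq (fun n => sum_n_m (fun k => / INR k) 1 (S n) - ln (INR (S n))) Euler_gamma.
Proof.
  set (a := fun n => sum_n_m (fun k => / INR k) 1 n - ln (INR n)).
  assert (ES : forall n, sum_n_m (fun k => / INR k) 1 (S (S n)) = sum_n_m (fun k => / INR k) 1 (S n) + / INR (S (S n))).
  { intros n. rewrite sum_n_Sm by lia. reflexivity. }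
  assert (E1 : sum_n_m (fun k => / INR k) 1 1 = 1) by (rewrite sum_n_n; simpl; field).
  assert (Hdec : forall n, a (S (S n)) <= a (S n)).
  { intros n. unfold a. rewrite ES. assert (Hp : 0 < INR (S n)) by (apply lt_0_INR; lia). assert (Hp2 : 0 < INR (S (S n))) by (apply lt_0_INR; lia).
    assert (H := ln_ge (INR (S (S n)) / INR (S n)) ltac:(now apply Rdiv_lt_0_compat)). rewrite ln_div in H by auto.
    replace (1 - / (INR (S (S n)) / INR (S n))) with (/ INR (S (S n))) in H; [lra|].
    rewrite (S_INR (S n)). field. lra. }
  assert (Hb : forall n, ln (INR (S (S n))) <= sum_n_m (fun k => / INR k) 1 (S n)).
  { induction n as [|n IH].
    - rewrite E1. assert (H := ln_le_sub1 (INR 2) ltac:(simpl; lra)). simpl in *. lra.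
    - rewrite ES. assert (Hp : 0 < INR (S (S n))) by (apply lt_0_INR; lia). assert (Hp2 : 0 < INR (S (S (S n)))) by (apply lt_0_INR; lia).
      assert (H := ln_le_sub1 (INR (S (S (S n))) / INR (S (S n))) ltac:(now apply Rdiv_lt_0_compat)). rewrite ln_div in H by auto.
      replace (INR (S (S (S n))) / INR (S (S n)) - 1) with (/ INR (S (S n))) in H; [lra|].
      rewrite (S_INR (S (S n))). field. lra. }
  destruct (ex_finite_lim_seq_decr (fun n => a (S n)) 0) as [l Hl]; [exact Hdec| |].
  - intros n. unfold a. specialize (Hb n). assert (Hp : 0 < INR (S n)) by (apply lt_0_INR; lia).
    assert (ln (INR (S n)) < ln (INR (S (S n)))) by (apply ln_increasing; auto; rewrite (S_INR (S n)); lra). lra.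
  - assert (Hl' := proj2 (is_lim_seq_incr_1 a l) Hl). unfold Euler_gamma. fold a. rewrite (is_lim_seq_unique _ _ Hl'). exact Hl.
Qed.

(** The window contains [N] positive and [N + 1] negative integers, whence the correction
    [1 / (N + 1)]. *)
Lemma Zpart_kappa rad N : Zpart (kappa rad) N = kappa rad 0 + 2 * sum_n_m (fun k => / INR k) 1 (S N) - / INR (S N).
Proof.
  unfold Zpart. induction N as [|N IH].
  - rewrite !sum_n_0, sum_n_n. rewrite (proj2 (kappa_abs rad 0)). simpl Z.of_nat. ring.
  - rewrite !sum_n_S. rewrite (proj2 (kappa_abs rad (S N))), (proj1 (kappa_abs rad N)).
    assert (ES : sum_n_m (fun k => / INR k) 1 (S (S N)) = sum_n_m (fun k => / INR k) 1 (S N) + / INR (S (S N))).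
    { rewrite sum_n_Sm by lia. reflexivity. }
    rewrite ES. lra.
Qed.

(** The half with [n >= 0] starts at [u], the other half, reflected, at [1 - u]. Each is an [arsinh]
    up to [1 / x], and the logarithms of [N + 1] combine with the harmonic sums of [kappa] into
    [Euler_gamma]. *)
Lemma dist_sum_asymptotics rad x u : 0 < x -> 0 <= u <= 1 ->
  Rabs (dist_sum rad x u + 2 * ln x - (2 * ln 2 - kappa rad 0 - 2 * Euler_gamma)) <= 2 * / x.
Proof.
  intros Hx Hu.
  set (w := fun N => (dist_primitive x (u + INR (S N)) - ln (INR (S N))) + (dist_primitive x (1 - u + INR (S N)) - ln (INR (S N)))
    - (kappa rad 0 + 2 * (sum_n_m (fun k => / INR k) 1 (S N) - ln (INR (S N))) - / INR (S N))).
  assert (Hw : is_lim_seq w ((ln 2 - ln x) + (ln 2 - ln x) - (kappa rad 0 + 2 * Euler_gamma - 0))).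
  { apply is_lim_seq_minus'; [apply is_lim_seq_plus'; apply dist_primitive_lim; lra|].
    apply is_lim_seq_minus'; [|apply is_lim_seq_inv_S]. apply is_lim_seq_plus'; [apply is_lim_seq_const|].
    apply is_lim_seq_mult'; [apply is_lim_seq_const|apply Euler_gamma_lim]. }
  assert (L := Zpart_lim _ (ex_Zseries_dist rad x u Hx)). fold (dist_sum rad x u) in L.
  assert (B : forall N, w N - 2 * / x <= Zpart (fun n => inv_dist x (u + IZR n) - kappa rad n) N <= w N + 2 * / x).
  { intros N. rewrite Zpart_minus, Zpart_kappa. unfold Zpart, w.
    assert (S1 := sum_inv_dist x u N Hx Hu). assert (S2 := sum_inv_dist x (1 - u) N Hx ltac:(lra)).
    rewrite (sum_n_Rext (fun n => inv_dist x (u + IZR (Z.of_nat n))) (fun n => inv_dist x (u + INR n))) by (intros; now rewrite <- INR_IZR_INZ).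
    rewrite (sum_n_Rext (fun n => inv_dist x (u + IZR (- Z.of_nat (S n)))) (fun n => inv_dist x (1 - u + INR n))).
    2:{ intros n. rewrite opp_IZR, <- INR_IZR_INZ, S_INR. unfold inv_dist. do 3 f_equal. ring. }
    lra. }
  assert (L1 := is_lim_seq_le _ _ _ _ (fun N => proj1 (B N)) (is_lim_seq_minus' _ _ _ _ Hw (is_lim_seq_const (2 * / x))) L).
  assert (L2 := is_lim_seq_le _ _ _ _ (fun N => proj2 (B N)) L (is_lim_seq_plus' _ _ _ _ Hw (is_lim_seq_const (2 * / x)))).
  simpl in L1, L2. apply Rabs_le. lra.
Qed.

Lemma eq_of_inv_bound a C : (forall x, 1 <= x -> Rabs a <= C * / x) -> a = 0.
Proof.
  intros H. destruct (Req_dec a 0) as [|N]; auto. exfalso. assert (Ha := Rabs_pos_lt a N).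
  assert (H1 := H 1 (Rle_refl 1)). rewrite Rinv_1, Rmult_1_r in H1.
  assert (Hx : 1 <= 2 * C / Rabs a). { apply Rmult_le_reg_r with (Rabs a); auto. unfold Rdiv. rewrite Rmult_assoc, Rinv_l by lra. lra. }
  assert (H2 := H _ Hx). replace (C * / (2 * C / Rabs a)) with (Rabs a / 2) in H2 by (field; lra). lra.
Qed.

Lemma dist_sum_unit rad x u : 0 < x -> 0 <= u <= 1 ->
  dist_sum rad x u = - 2 * ln x + Re (inst_sum x u) + (2 * ln 2 - kappa rad 0 - 2 * Euler_gamma).
Proof.
  intros Hx Hu. apply Rminus_diag_uniq.
  set (J := fun x => Re (inst_sum x u)). fold (J x). set (k := 2 * ln 2 - kappa rad 0 - 2 * Euler_gamma).
  (* This combination does not depend on [x], so its value can be read off as [x] grows. *)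
  assert (Q : forall x, 0 < x -> dist_sum rad 1 u + 2 * ln 1 - J 1 = dist_sum rad x u + 2 * ln x - J x).
  { intros y Hy. destruct (Rle_dec 1 y) as [H|H].
    - assert (D := dist_sum_difference rad 1 y u ltac:(lra) Hu). rewrite ln_div in D by lra. unfold J. lra.
    - assert (D := dist_sum_difference rad y 1 u ltac:(lra) Hu). rewrite ln_div in D by lra. unfold J. lra. }
  apply (eq_of_inv_bound _ (2 + 2 * / (1 - exp (- (2 * PI))) * PI)). intros y Hy.
  replace (dist_sum rad x u - (- 2 * ln x + J x + k)) with ((dist_sum rad y u + 2 * ln y - k) - J y)
    by (rewrite <- (Rplus_0_r (dist_sum rad y u + 2 * ln y - k)); assert (Q1 := Q x Hx); assert (Q2 := Q y ltac:(lra)); lra).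
  eapply Rle_trans; [apply Rabs_triang|]. rewrite Rabs_Ropp.
  assert (A := dist_sum_asymptotics rad y u ltac:(lra) Hu). fold k in A.
  assert (B := Rle_trans _ _ _ (re_le_Cmod _) (inst_sum_bound y u Hy)). fold (J y) in B. lra.
Qed.

Lemma inst_sum_period x u (k : Z) : inst_sum x (u + IZR k) = inst_sum x u.
Proof.
  apply Int_ext. intros y. f_equal. unfold inst_density. do 2 f_equal. unfold geo.
  set (z := (- (2 * PI * (x * cosh y)), 2 * PI * u) : C).
  assert (E : (- (2 * PI * (x * cosh y)), 2 * PI * (u + IZR k)) = (z + Ci * RtoC (2 * PI * IZR k))%C)
    by (apply injective_projections; simpl; ring).
  now rewrite E, Cexp_period.
Qed.

(** A shift by one changes a partial sum by the terms at its two ends. These are values of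
    [inv_dist] without [kappa]; they tend to 0 because the terms of the series do and [1 / n]
    does. *)
Lemma dist_sum_period rad x u (k : Z) : 0 < x -> dist_sum rad x (u + IZR k) = dist_sum rad x u.
Proof.
  intros Hx. 
  assert (H1 := ex_Zseries_dist rad x u Hx). assert (H2 := ex_Zseries_dist rad x (u + IZR k) Hx).
  assert (S : forall v w, (forall n, inv_dist x (v + IZR n) = inv_dist x (w + IZR (n + 1))) -> dist_sum rad x v = dist_sum rad x w).
  { intros v w E. assert (L1 := Zpart_lim _ (ex_Zseries_dist rad x v Hx)). assert (L2 := Zpart_lim _ (ex_Zseries_dist rad x w Hx)).
    assert (L3 : is_lim_seq (fun N => Zpart (fun n => inv_dist x (w + IZR n) - kappa rad n) N + inv_dist x (w + IZR (Z.of_nat (S N))) - inv_dist x (w + IZR (- Z.of_nat (S N)))) (dist_sum rad x w + 0 - 0)).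
    { apply is_lim_seq_minus'; [apply is_lim_seq_plus'; [exact L2|]|].
      - assert (T := ex_series_lim_0 _ (proj1 (ex_Zseries_dist rad x w Hx))). apply (is_lim_seq_incr_1 (fun n => inv_dist x (w + IZR (Z.of_nat n)) - kappa rad (Z.of_nat n))) in T.
        assert (T2 := is_lim_seq_plus' _ _ _ _ T is_lim_seq_inv_S). replace (Finite 0) with (Finite (0 + 0)) by (f_equal; ring).
        eapply is_lim_seq_ext; [|exact T2]. intros n. cbv beta. rewrite (proj1 (kappa_abs rad n)). ring.
      - assert (T := ex_series_lim_0 _ (proj2 (ex_Zseries_dist rad x w Hx))).
        assert (T2 := is_lim_seq_plus' _ _ _ _ T is_lim_seq_inv_S). replace (Finite 0) with (Finite (0 + 0)) by (f_equal; ring).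
        eapply is_lim_seq_ext; [|exact T2]. intros n. cbv beta. rewrite (proj2 (kappa_abs rad n)). ring. }
    assert (L4 : is_lim_seq (Zpart (fun n => inv_dist x (v + IZR n) - kappa rad n)) (dist_sum rad x w + 0 - 0)).
    { eapply is_lim_seq_ext; [|exact L3]. intros N. rewrite !Zpart_minus.
      assert (EE : Zpart (fun n => inv_dist x (v + IZR n)) N = Zpart (fun n => inv_dist x (w + IZR n)) N + inv_dist x (w + IZR (Z.of_nat (S N))) - inv_dist x (w + IZR (- Z.of_nat (S N)))); [|rewrite EE; ring].
      unfold Zpart. induction N as [|N IH].
      - rewrite !sum_n_0, !E. simpl. ring.
      - rewrite !sum_n_S, !E. replace (Z.of_nat (S N) + 1)%Z with (Z.of_nat (S (S N))) by lia.
        replace (- Z.of_nat (S (S N)) + 1)%Z with (- Z.of_nat (S N))%Z by lia. lra. }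
    assert (EQ := lim_seq_eq _ _ _ L1 L4). fold (dist_sum rad x v) in EQ. rewrite EQ. ring. }
  assert (Hn : forall (m : nat) v, dist_sum rad x (v + INR m) = dist_sum rad x v).
  { induction m as [|m IH]; intros v; [simpl; now rewrite Rplus_0_r|].
    rewrite <- (IH v). apply S. intros n. f_equal. rewrite S_INR, plus_IZR. ring. }
  destruct (Z_le_gt_dec 0 k) as [Hk|Hk].
  - rewrite <- (Hn (Z.to_nat k) u), INR_IZR_INZ, Z2Nat.id by lia. reflexivity.
  - rewrite <- (Hn (Z.to_nat (- k)) (u + IZR k)), INR_IZR_INZ, Z2Nat.id, opp_IZR by lia. f_equal. ring.
Qed.

(** The constant is the one absorbed by the definition of [kappa rad 0]. *)
Theorem dist_sum_poisson rad x u : 0 < x ->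
  dist_sum rad x u = - 2 * ln x + Re (inst_sum x u) + (2 * ln 2 - kappa rad 0 - 2 * Euler_gamma).
Proof.
  intros Hx. rewrite <- (dist_sum_period rad x u (- Int_part u)), <- (inst_sum_period x u (- Int_part u)) by auto.
  apply dist_sum_unit; auto. rewrite opp_IZR. destruct (base_Int_part u). lra.
Qed.

(** * The potential and the connection as moments *)

Lemma inst_sum_moment rad c th : 0 < rad -> c <> RtoC 0 ->
  Re (inst_sum (rad * Cmod c) (th / (2 * PI))) = 2 * Re (moment rad 0 0 0 (c, th)).
Proof.
  intros Hr Hc. assert (Hp : 0 < Cmod c) by now apply Cmod_gt_0. pose proof PI_RGT_0.
  destruct (sech_moment rad 0 0 0 (RtoC (- Cmod c), th) Hr ltac:(simpl; lra)) as [M B].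
  assert (E : inst_sum (rad * Cmod c) (th / (2 * PI)) = (ray_moment rad 0 0 0 (RtoC (- Cmod c), th) + Cconj (ray_moment rad 0 0 0 (RtoC (- Cmod c), th)))%C).
  { unfold inst_sum. apply is_Int_unique.
    refine (eq_ind _ (fun f => is_Int f _) (is_Int_plus _ _ _ _ (Int_correct _ _ B) (is_Int_Cconj _ _ (Int_correct _ _ B))) _ _).
    apply functional_extensionality. intros y. rewrite inst_density_geo.
    assert (EE : ray_exp 1 (RtoC (- (rad * Cmod c)), 2 * PI * (th / (2 * PI)))%R y = ray_exp rad (RtoC (- Cmod c), th) y).
    { unfold ray_exp. apply injective_projections; simpl; field; lra. }
    rewrite EE. reflexivity. }
  rewrite E. unfold moment. simpl. ring.
Qed.

(** By the value of [kappa rad 0] the constant left by the summation is [2 ln rad], which turns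
    [- 2 ln (rad |c|)] into [- 2 ln |c|]. *)
Lemma potential_eq rad S c th : 0 < rad -> c <> RtoC 0 ->
  potential rad S (c, th) = rad / (2 * PI) * (period1 S c + Re (moment rad 0 0 0 (c, th))).
Proof.
  intros Hr Hc. assert (Hp : 0 < Cmod c) by now apply Cmod_gt_0. pose proof PI_RGT_0.
  unfold potential. simpl fst. simpl snd.
  assert (E : ZSeries (fun n => / sqrt (rad ^ 2 * Cmod c ^ 2 + (th / (2 * PI) + IZR n) ^ 2) - kappa rad n) = dist_sum rad (rad * Cmod c) (th / (2 * PI))).
  { unfold dist_sum, inv_dist. f_equal. apply functional_extensionality. intros n. now rewrite Rpow_mult_distr. }
  rewrite E, dist_sum_poisson by (now apply Rmult_lt_0_compat). rewrite inst_sum_moment by auto.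
  unfold kappa. destruct (Z.eq_dec 0 0) as [_|N]; [|congruence].
  rewrite ln_mult, ln_div by lra. unfold period1. field. lra.
Qed.

(** * The Bessel series of the connection *)

(** [BesselK1] is an integral over a half line; for an even integrand the interval from 0 to [b]
    contributes half of the interval from [- b] to [b]. *)
Lemma is_half_Int (f : R -> C) L : (forall y, continuous (U := CR) f y) -> (forall y, f (- y) = f y) -> is_Int f L ->
  is_RInt_gen (V := RR) (fun y => Re (f y)) (at_point 0) (Rbar_locally p_infty) (Re L / 2).
Proof.
  intros Hc He HL.
  refine (is_RInt_gen_map (V := CR) (W := RR) (fun z => Re z / 2) (Rbar_locally m_infty) (Rbar_locally p_infty) (at_point 0) (Rbar_locally p_infty) f _ L _ _ _ _ HL).
  - intros P [Q1 Q2 H1 H2 HP]. exists (fun a => a = 0) (fun b => Q2 b /\ Q1 (- b)).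
    + reflexivity.
    + apply filter_and; auto. exact (filterlim_Rbar_opp p_infty _ H1).
    + intros a b -> [Hb2 Hb1]. exists (- b, b). split; [now apply HP|]. simpl. intros l' Hl.
      apply is_RInt_Re in Hl.
      assert (Hg : ex_RInt (V := RR) (fun y => Re (f y)) 0 b).
      { apply (ex_RInt_continuous (V := R_CompleteNormedModule)). intros z _.
        apply (continuous_comp (V := CR) (W := RR) f Re); auto. apply (is_linear_continuous (U := CR) (V := RR)), (is_linear_fst (U := RR) (V := RR)). }
      destruct Hg as [v Hv].
      assert (Hv2 : is_RInt (V := RR) (fun y => Re (f y)) (- b) 0 v).
      { assert (Hs := is_RInt_swap (V := RR) _ _ _ _ Hv). rewrite <- (Ropp_involutive b) in Hs at 1. rewrite <- Ropp_0 in Hs at 1.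
        apply (is_RInt_comp_opp (V := RR)) in Hs. apply (is_RInt_opp (V := RR)) in Hs. rewrite opp_opp in Hs.
        eapply (is_RInt_ext (V := RR)); [|exact Hs]. intros y _. simpl. rewrite opp_opp, He. reflexivity. }
      assert (Hsum := is_RInt_Chasles (V := RR) _ _ _ _ _ _ Hv2 Hv).
      assert (E := is_RInt_unique (V := R_CompleteNormedModule) _ _ _ _ Hsum). rewrite (is_RInt_unique (V := R_CompleteNormedModule) _ _ _ _ Hl) in E.
      assert (Ev : Re l' / 2 = v) by (rewrite E; change (plus v v) with (v + v); field). rewrite Ev. exact Hv.
  - apply (continuous_mult (K := R_AbsRing) (fun z : CR => Re z) (fun _ => / 2)); [|apply continuous_const].
    apply (is_linear_continuous (U := CR) (V := RR)), (is_linear_fst (U := RR) (V := RR)).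
Qed.

Lemma sech_Bessel x : 0 < x -> exists K, sech_bounded K (fun y => RtoC (exp (- x * cosh y) * cosh y)).
Proof.
  intros Hx. destruct (pow_exp_bounded x 2 Hx) as [K [HK B]]. exists K. apply sech_RtoC.
  - intros y. unfold cosh. eexists. auto_derive; [|reflexivity]. auto.
  - intros y. pose proof (cosh_gt_0 y). rewrite Rabs_pos_eq by (apply Rmult_le_pos; [left; apply exp_pos|lra]).
    apply Rmult_le_reg_r with (cosh y); auto. unfold Rdiv. rewrite (Rmult_assoc K), Rinv_l, Rmult_1_r by lra.
    specialize (B (cosh y) ltac:(lra)). replace (- x * cosh y) with (- (x * cosh y)) by ring. simpl in B. lra.
Qed.

Lemma is_Int_Bessel x : 0 < x -> is_Int (fun y => RtoC (exp (- x * cosh y) * cosh y)) (RtoC (2 * BesselK1 x)).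
Proof.
  intros Hx. destruct (sech_Bessel x Hx) as [K B]. assert (HI := Int_correct _ _ B).
  set (L := IntR (fun y => RtoC (exp (- x * cosh y) * cosh y))) in *.
  assert (He : forall y, RtoC (exp (- x * cosh (- y)) * cosh (- y)) = RtoC (exp (- x * cosh y) * cosh y)) by (intros y; now rewrite cosh_neg).
  assert (H := is_half_Int _ _ (proj1 B) He HI).
  assert (EK : BesselK1 x = Re L / 2) by exact (is_RInt_gen_unique (V := R_CompleteNormedModule) (Fa := at_point 0) (Fb := Rbar_locally p_infty) _ _ H).
  rewrite EK. replace (RtoC (2 * (Re L / 2))) with L; auto.
  (* The integral equals its conjugate, hence is real. *)
  assert (EL : Cconj L = L).
  { unfold L. rewrite <- (Int_Cconj _ _ B). apply Int_ext. intros y. apply injective_projections; simpl; ring. }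
  destruct L as [a b]. injection EL. intros E. apply injective_projections; simpl in *; lra.
Qed.

Lemma geo_partial z N : Re z < 0 -> sum_n (fun k => Im (Cexp (RtoC (INR (S k)) * z))) N = Im (geo z * (1 - Cexp (RtoC (INR (S N)) * z))).
Proof.
  intros Hz. assert (Hn := one_minus_Cexp_neq z Hz).
  assert (E : forall N, Cexp (RtoC (INR (S N)) * z) = (Cexp z * Cexp (RtoC (INR N) * z))%C).
  { intros n. rewrite <- Cexp_plus. f_equal. rewrite S_INR, RtoC_plus. ring. }
  induction N as [|N IH].
  - rewrite sum_n_0. f_equal. simpl INR. replace (RtoC 1 * z)%C with z by ring. unfold geo. field. auto.
  - rewrite sum_n_S, IH. change (Im ?a + Im ?b) with (Im (a + b)%C). rewrite !E. f_equal. unfold geo. field. auto.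
Qed.

(** After [N + 1] terms the geometric series misses [geo z] by [geo z * Cexp z ^ (N + 1)], and
    [|Cexp z| <= exp (- q)] along the whole ray. The remainder is thus uniformly small against
    [1 / cosh y], and the series may be integrated term by term. *)
Lemma Bessel_sine_series rad rho th : 0 < rad -> 0 < rho ->
  exists M, is_Int (fun y => RtoC (cosh y * Im (geo (ray_exp rad (RtoC (- rho), th) y)))) (RtoC M) /\
    is_series (fun k => sin (INR (S k) * th) * (2 * BesselK1 (2 * PI * rad * (INR (S k) * rho)))) M.
Proof.
  intros Hr Hrho. pose proof PI_RGT_0.
  set (x := (RtoC (- rho), th)). set (q := 2 * PI * rad * rho). assert (Hq : 0 < q) by (unfold q; mult_pos).
  assert (Hx : Re (fst x) < 0) by (simpl; lra).
  assert (HE : forall y, ray_exp rad x y = (- (q * cosh y), th)).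
  { intros y. unfold ray_exp, cosh, q. apply injective_projections; simpl; field. }
  destruct (sech_moment rad 1 0 0 x Hr Hx) as [M1 B1]. destruct (sech_moment rad 0 1 0 x Hr Hx) as [M2 B2].
  set (A := IntR (fun y => (ray_pow 1 0 y * geo_pow 0 (ray_exp rad x y))%C)). set (B := IntR (fun y => (ray_pow 0 1 y * geo_pow 0 (ray_exp rad x y))%C)).
  assert (HA : is_Int _ A) by exact (Int_correct _ _ B1). assert (HB : is_Int _ B) by exact (Int_correct _ _ B2).
  assert (Hg : is_Int (fun y => (RtoC (cosh y) * geo (ray_exp rad x y))%C) (RtoC (/ 2) * (A + B))%C).
  { refine (eq_ind _ (fun f => is_Int f _) (is_Int_Cmult (RtoC (/ 2)) _ _ (is_Int_plus _ _ _ _ HA HB)) _ _).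
    apply functional_extensionality. intros y. unfold ray_pow, geo_pow, cosh.
    simpl INR. replace (1 * y - 0 * y) with y by ring. replace (0 * y - 1 * y) with (- y) by ring. simpl Cpow.
    unfold Rdiv. rewrite RtoC_mult, RtoC_plus. ring. }
  set (G := (RtoC (/ 2) * (A + B))%C) in *.
  assert (HIm : is_Int (fun y => RtoC (cosh y * Im (geo (ray_exp rad x y)))) (RtoC (Im G))).
  { assert (H1 := is_Int_Cmult (/ (2 * Ci))%C _ _ (is_Int_plus _ _ _ _ Hg (is_Int_Cmult (- (1))%C _ _ (is_Int_Cconj _ _ Hg)))).
    assert (EG : forall g : C, (/ (2 * Ci) * (g + - (1) * Cconj g))%C = RtoC (Im g)).
    { intros [a b]. unfold Cinv. apply injective_projections; simpl; field. }
    rewrite EG in H1. refine (eq_ind _ (fun f => is_Int f _) H1 _ _).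
    apply functional_extensionality. intros y. rewrite EG. f_equal. simpl. ring. }
  exists (Im G). split; [exact HIm|].
  set (b := fun k => sin (INR (S k) * th) * (2 * BesselK1 (2 * PI * rad * (INR (S k) * rho)))).
  assert (HS : forall N, is_Int (fun y => RtoC (cosh y * sum_n (fun k => Im (Cexp (RtoC (INR (S k)) * ray_exp rad x y))) N)) (RtoC (sum_n b N))).
  { intros N. assert (H1 := is_Int_sum_n (fun k y => sin (INR (S k) * th) * (exp (- (INR (S k) * q) * cosh y) * cosh y)) b N).
    assert (H2 : forall n, is_Int (fun y => RtoC (sin (INR (S n) * th) * (exp (- (INR (S n) * q) * cosh y) * cosh y))) (RtoC (b n))).
    { intros n. assert (Hn : 0 < INR (S n)) by (apply lt_0_INR; lia).
      assert (H3 := is_Int_Cmult (RtoC (sin (INR (S n) * th))) _ _ (is_Int_Bessel (INR (S n) * q) ltac:(mult_pos))).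
      rewrite <- RtoC_mult in H3. unfold b. replace (2 * PI * rad * (INR (S n) * rho)) with (INR (S n) * q) by (unfold q; ring).
      refine (eq_ind _ (fun f => is_Int f _) H3 _ _). apply functional_extensionality. intros y. symmetry. apply RtoC_mult. }
    specialize (H1 H2). refine (eq_ind _ (fun f => is_Int f _) H1 _ _). apply functional_extensionality. intros y.
    f_equal. rewrite <- sum_n_Rmult_l. apply sum_n_Rext. intros n. rewrite HE. unfold Cexp.
    assert (ERe : forall a b t : R, Re (RtoC a * (b, t)%R) = a * b) by (intros; simpl; ring).
    assert (EIm : forall a b t : R, Im (RtoC a * (b, t)%R) = a * t) by (intros; simpl; ring).
    rewrite ERe, EIm. change (Im (?a, ?b)) with b. replace (INR (S n) * - (q * cosh y)) with (- (INR (S n) * q) * cosh y) by ring. ring. }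
  set (M0 := (M1 + M2) * 1).
  assert (HM : forall y, cosh y * Cmod (geo (ray_exp rad x y)) <= M0 / cosh y).
  { intros y. destruct B1 as [_ B1]. destruct B2 as [_ B2]. specialize (B1 y). specialize (B2 y).
    rewrite Cmod_mult in B1, B2. unfold ray_pow, geo_pow in B1, B2. rewrite Cmod_R, Rabs_pos_eq in B1, B2 by (left; apply exp_pos).
    simpl INR in B1, B2. replace (1 * y - 0 * y) with y in B1 by ring. replace (0 * y - 1 * y) with (- y) in B2 by ring.
    rewrite Cpow_S in B1, B2. simpl Cpow in B1, B2. rewrite Cmult_1_r in B1, B2.
    set (g := Cmod (geo (ray_exp rad x y))) in *. assert (0 <= g) by apply Cmod_ge_0.
    apply Rle_trans with (exp y * g + exp (- y) * g).
    - unfold cosh. assert (0 <= exp y * g) by (apply Rmult_le_pos; [left; apply exp_pos|auto]). assert (0 <= exp (- y) * g) by (apply Rmult_le_pos; [left; apply exp_pos|auto]). lra.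
    - unfold M0, Rdiv in *. rewrite Rmult_1_r, Rmult_plus_distr_r. lra. }
  assert (HB2 : forall N, Rabs (Im G - sum_n b N) <= M0 * exp (- q) ^ S N * PI).
  { intros N. assert (HD := is_Int_plus _ _ _ _ HIm (is_Int_Cmult (- (1))%C _ _ (HS N))).
    apply (is_Int_bound (M0 * exp (- q) ^ S N)) in HD.
    - eapply Rle_trans; [|exact HD]. eapply Rle_trans; [|apply re_le_Cmod]. right. f_equal. simpl. ring.
    - intros y. assert (Hz := Re_ray_exp_neg rad x y Hr Hx). rewrite geo_partial by auto.
      set (z := ray_exp rad x y) in *. set (w := Cexp (RtoC (INR (S N)) * z)).
      assert (EE : (RtoC (cosh y * Im (geo z)) + - (1) * RtoC (cosh y * Im (geo z * (1 - w))))%C = RtoC (cosh y * Im (geo z * w))).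
      { destruct (geo z), w. apply injective_projections; simpl; ring. }
      rewrite EE, Cmod_R, Rabs_mult, (Rabs_pos_eq (cosh y)) by (left; apply cosh_gt_0).
      assert (I1 : Rabs (Im (geo z * w)) <= Cmod (geo z) * Cmod w).
      { rewrite <- Cmod_mult. eapply Rle_trans; [|apply Rmax_Cmod]. apply Rmax_r. }
      assert (I2 : Cmod w <= exp (- q) ^ S N).
      { unfold w. rewrite <- Cexp_pow, Cmod_pow, Cmod_Cexp. apply pow_incr. split; [left; apply exp_pos|].
        unfold z. rewrite HE. change (Re (- (q * cosh y), th)) with (- (q * cosh y)).
        pose proof (cosh_ge_1 y). assert (q * 1 <= q * cosh y) by (apply Rmult_le_compat_l; lra).
        destruct (Req_dec (cosh y) 1) as [->|]; [right; f_equal; ring|]. left. apply exp_increasing.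
        assert (q * 1 < q * cosh y) by (apply Rmult_lt_compat_l; lra). lra. }
      pose proof (cosh_gt_0 y). specialize (HM y). fold z in HM. pose proof (Cmod_ge_0 (geo z)).
      apply Rle_trans with (cosh y * Cmod (geo z) * exp (- q) ^ S N).
      + rewrite Rmult_assoc. apply Rmult_le_compat_l; [lra|]. eapply Rle_trans; [exact I1|]. apply Rmult_le_compat_l; auto.
      + replace (M0 * exp (- q) ^ S N / cosh y) with (M0 / cosh y * exp (- q) ^ S N) by (field; lra).
        apply Rmult_le_compat_r; auto. apply pow_le. left. apply exp_pos. }
  assert (HL : is_lim_seq (sum_n b) (Im G)).
  { assert (HZ : is_lim_seq (fun N => M0 * exp (- q) ^ S N * PI) 0).
    { replace (Finite 0) with (Finite (M0 * 0 * PI)) by (f_equal; ring). apply is_lim_seq_mult'; [|apply is_lim_seq_const].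
      apply is_lim_seq_mult'; [apply is_lim_seq_const|]. apply (is_lim_seq_incr_1 (fun n => exp (- q) ^ n)). apply is_lim_seq_geom.
      rewrite Rabs_pos_eq by (left; apply exp_pos). now apply exp_neg_lt_1. }
    apply (is_lim_seq_le_le (fun N => Im G - M0 * exp (- q) ^ S N * PI) _ (fun N => Im G + M0 * exp (- q) ^ S N * PI)).
    - intros N. specialize (HB2 N). apply Rabs_le_between in HB2. lra.
    - replace (Finite (Im G)) with (Finite (Im G - 0)) by (f_equal; ring). apply is_lim_seq_minus'; auto. apply is_lim_seq_const.
    - replace (Finite (Im G)) with (Finite (Im G + 0)) by (f_equal; ring). apply is_lim_seq_plus'; auto. apply is_lim_seq_const. }
  exact HL.
Qed.

(** In the two-sided series the terms at [n] and [- n] have opposite real and equal imaginary parts,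
    so a sine series remains, the same that represents the difference of the two moments. *)
Lemma connection_sum rad c th : 0 < rad -> c <> RtoC 0 ->
  exists M : R, (ray_moment rad 1 0 0 (RtoC (- Cmod c), th) - Cconj (ray_moment rad 0 1 0 (RtoC (- Cmod c), th)))%C = (2 * Ci * RtoC M)%C /\
  CZSeries (fun n => RtoC (IZR (Z.sgn n)) * Cexp (Ci * RtoC (IZR n * th)) * RtoC (Cmod c * BesselK1 (2 * PI * rad * Cmod (RtoC (IZR n) * c))))%C
  = (RtoC (Cmod c) * Ci * RtoC M)%C.
Proof.
  intros Hr Hc. assert (Hp : 0 < Cmod c) by now apply Cmod_gt_0. set (rho := Cmod c) in *.
  destruct (Bessel_sine_series rad rho th Hr Hp) as [M [HM HS]].
  set (x := (RtoC (- rho), th)) in *. assert (Hx : Re (fst x) < 0) by (simpl; lra).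
  destruct (sech_moment rad 1 0 0 x Hr Hx) as [M1 B1]. destruct (sech_moment rad 0 1 0 x Hr Hx) as [M2 B2].
  assert (ED : (ray_moment rad 1 0 0 x - Cconj (ray_moment rad 0 1 0 x))%C = (2 * Ci * RtoC M)%C).
  { assert (HA : is_Int _ (ray_moment rad 1 0 0 x)) by exact (Int_correct _ _ B1).
    assert (HB : is_Int _ (ray_moment rad 0 1 0 x)) by exact (Int_correct _ _ B2).
    assert (H1 := is_Int_plus _ _ _ _ HA (is_Int_Cmult (- (1))%C _ _ (is_Int_Cconj _ _ HB))).
    assert (H2 := is_Int_reflect _ _ H1).
    assert (H3 := is_Int_unique _ _ (is_Int_plus _ _ _ _ H1 H2)).
    assert (H4 := is_Int_unique _ _ (is_Int_Cmult (4 * Ci)%C _ _ HM)).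
    (* Adding the reflection in [y] symmetrizes the integrand to [(exp y + exp (- y)) (g - Cconj g)
       = 4 i cosh y Im g]. *)
    assert (E : (fun y => (4 * Ci * RtoC (cosh y * Im (geo (ray_exp rad x y))))%C) =
       (fun y => (ray_pow 1 0 y * geo_pow 0 (ray_exp rad x y) + - (1) * Cconj (ray_pow 0 1 y * geo_pow 0 (ray_exp rad x y)) +
         (ray_pow 1 0 (- y) * geo_pow 0 (ray_exp rad x (- y)) + - (1) * Cconj (ray_pow 0 1 (- y) * geo_pow 0 (ray_exp rad x (- y)))))%C)).
    { apply functional_extensionality. intros y.
      assert (EE : ray_exp rad x (- y) = ray_exp rad x y).
      { unfold ray_exp. rewrite Ropp_involutive. apply injective_projections; simpl; ring. }
      rewrite EE. generalize (ray_exp rad x y). intros z. unfold ray_pow, geo_pow, cosh. simpl INR.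
      replace (1 * y - 0 * y) with y by ring. replace (0 * y - 1 * y) with (- y) by ring.
      replace (1 * - y - 0 * - y) with (- y) by ring. replace (0 * - y - 1 * - y) with y by ring.
      destruct (geo z). apply injective_projections; simpl; field. }
    cbv beta in H3, H4. rewrite E, H3 in H4.
    transitivity (/ 2 * (ray_moment rad 1 0 0 x + - (1) * Cconj (ray_moment rad 0 1 0 x) + (ray_moment rad 1 0 0 x + - (1) * Cconj (ray_moment rad 0 1 0 x))))%C; [field|].
    rewrite H4. field. }
  exists M. split; [exact ED|]. clear ED. replace (RtoC rho * Ci * RtoC M)%C with (RtoC (rho / 2) * (2 * Ci * RtoC M))%C
    by (apply injective_projections; simpl; field).
  set (T := fun n : Z => (RtoC (IZR (Z.sgn n)) * Cexp (Ci * RtoC (IZR n * th)) * RtoC (rho * BesselK1 (2 * PI * rad * Cmod (RtoC (IZR n) * c))))%C).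
  assert (TP : forall k, T (Z.of_nat (S k)) = (cos (INR (S k) * th) * (rho * BesselK1 (2 * PI * rad * (INR (S k) * rho))), sin (INR (S k) * th) * (rho * BesselK1 (2 * PI * rad * (INR (S k) * rho))))).
  { intros k. unfold T. rewrite Cexp_i, <- INR_IZR_INZ, Cmod_mult, Cmod_R, (Rabs_pos_eq (INR (S k))) by apply pos_INR. fold rho.
    replace (Z.sgn (Z.of_nat (S k))) with 1%Z by lia. generalize (INR (S k)). intros t. apply injective_projections; simpl; ring. }
  assert (TN : forall k, T (- Z.of_nat (S k))%Z = (- (cos (INR (S k) * th) * (rho * BesselK1 (2 * PI * rad * (INR (S k) * rho)))), sin (INR (S k) * th) * (rho * BesselK1 (2 * PI * rad * (INR (S k) * rho))))).
  { intros k. unfold T. rewrite Cexp_i, opp_IZR, <- INR_IZR_INZ, Cmod_mult, Cmod_R, Rabs_Ropp, (Rabs_pos_eq (INR (S k))) by apply pos_INR. fold rho.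
    replace (Z.sgn (- Z.of_nat (S k))) with (-1)%Z by lia. replace (- INR (S k) * th) with (- (INR (S k) * th)) by ring. rewrite cos_neg, sin_neg.
    generalize (INR (S k)). intros t. apply injective_projections; simpl; ring. }
  assert (T0 : T 0%Z = RtoC 0) by (unfold T; simpl; ring).
  change (CZSeries T = (RtoC (rho / 2) * (2 * Ci * RtoC M))%C). apply injective_projections.
  - change (Series (fun n => Re (T (Z.of_nat n))) + Series (fun n => Re (T (- Z.of_nat (S n))%Z)) = fst (RtoC (rho / 2) * (2 * Ci * RtoC M))%C).
    rewrite (Series_incr_1_aux (fun n => Re (T (Z.of_nat n)))) by (simpl Z.of_nat; now rewrite T0).
    rewrite (Series_ext (fun n => Re (T (- Z.of_nat (S n))%Z)) (fun n => - Re (T (Z.of_nat (S n))))) by (intros n; now rewrite TN, TP).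
    rewrite Series_opp. simpl. ring.
  - change (Series (fun n => Im (T (Z.of_nat n))) + Series (fun n => Im (T (- Z.of_nat (S n))%Z)) = snd (RtoC (rho / 2) * (2 * Ci * RtoC M))%C).
    rewrite (Series_incr_1_aux (fun n => Im (T (Z.of_nat n)))) by (simpl Z.of_nat; now rewrite T0).
    rewrite (Series_ext (fun n => Im (T (- Z.of_nat (S n))%Z)) (fun n => Im (T (Z.of_nat (S n))))) by (intros n; now rewrite TN, TP).
    rewrite (Series_ext (fun n => Im (T (Z.of_nat (S n)))) (fun k => rho / 2 * (sin (INR (S k) * th) * (2 * BesselK1 (2 * PI * rad * (INR (S k) * rho)))))).
    2:{ intros n. rewrite TP. unfold Im, snd. field. }
    rewrite Series_scal_l, (is_series_unique _ _ HS). simpl. field.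
Qed.

(** * Positivity *)

Lemma Series_zero : Series (fun _ : nat => 0) = 0.
Proof.
  transitivity (Series (fun _ : nat => 0 * 0)); [apply Series_ext; intros n; ring|]. rewrite Series_scal_l. ring.
Qed.

Lemma Series_ge_sub (a b : nat -> R) k : ex_series a -> ex_series b ->
  (forall n, b n - k / (INR n + 1) ^ 2 <= a n) ->
  Series b - k * Series (fun n => / (INR n + 1) ^ 2) <= Series a.
Proof.
  intros Ha Hb H.
  assert (Hq : ex_series (fun n => k * / (INR n + 1) ^ 2)) by exact (ex_series_scal (V := R_NormedModule) k _ ex_series_inv_sqr).
  rewrite <- Series_scal_l. rewrite <- Series_minus by auto.
  assert (E := Series_minus _ _ Ha (ex_series_minus (V := R_NormedModule) _ _ Hb Hq)).
  assert (H0 : Series (fun _ : nat => 0) <= Series (fun n => a n - (b n - k * / (INR n + 1) ^ 2))).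
  { apply Series_le.
    - intros n. specialize (H n). unfold Rdiv in H. lra.
    - exact (ex_series_minus (V := R_NormedModule) _ _ Ha (ex_series_minus (V := R_NormedModule) _ _ Hb Hq)). }
  rewrite Series_zero in H0.
  change (Series (fun n => a n - (b n - k * / (INR n + 1) ^ 2)) = Series a - Series (fun n => b n - k * / (INR n + 1) ^ 2)) in E. lra.
Qed.

(** For [u] in [[0, 1]] the terms [n = 0] and [n = - 1] are the ones that can become singular. *)
Lemma ZSeries_split a : ex_Zseries a ->
  ex_series (fun n => a (Z.of_nat (S n))) /\ ex_series (fun n => a (- Z.of_nat (S (S n)))%Z) /\
  ZSeries a = a 0%Z + a (-1)%Z + Series (fun n => a (Z.of_nat (S n))) + Series (fun n => a (- Z.of_nat (S (S n)))%Z).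
Proof.
  intros [H1 H2]. split; [|split].
  - exact (proj1 (ex_series_incr_1 (V := R_NormedModule) (fun n => a (Z.of_nat n))) H1).
  - exact (proj1 (ex_series_incr_1 (V := R_NormedModule) (fun n => a (- Z.of_nat (S n))%Z)) H2).
  - unfold ZSeries. rewrite (Series_incr_1 _ H1), (Series_incr_1 _ H2). change (- Z.of_nat 1)%Z with (-1)%Z. change (Z.of_nat 0) with 0%Z. ring.
Qed.

Lemma inv_abs_inv_dist x v : 0 < x -> v <> 0 -> 0 <= / Rabs v - inv_dist x v <= x / v ^ 2.
Proof.
  intros Hx Hv. destruct (dist_bounds x v Hx) as [B1 [B2 B3]]. unfold inv_dist. set (s := sqrt (x ^ 2 + v ^ 2)) in *.
  assert (H := Rabs_pos_lt v Hv). rewrite <- (pow2_abs v). set (w := Rabs v) in *.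
  replace (/ w - / s) with ((s - w) / (w * s)) by (field; lra). split.
  - apply Rdiv_le_0_compat; [lra|]. apply Rmult_lt_0_compat; lra.
  - apply Rle_trans with (x / (w * s)).
    + apply Rmult_le_compat_r; [left; apply Rinv_0_lt_compat, Rmult_lt_0_compat|]; lra.
    + apply Rmult_le_compat_l; [lra|]. apply Rinv_le_contravar; nra.
Qed.

Lemma inv_sqr_ge_succ (n : nat) w : INR n + 1 <= w -> / w ^ 2 <= / (INR n + 1) ^ 2.
Proof. pose proof (pos_INR n). intros H1. apply Rinv_le_contravar; [apply pow_lt; lra|]. apply pow_incr. lra. Qed.

(** Replacing [x] by 0 raises the term at [n] by at most [x / (u + n)^2]. For [n = 0] and [n = - 1]
    this is not uniform in [u], so these two are listed separately. *)
Lemma dist_sum_ge rad x u : 0 < x -> 0 < u < 1 ->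
  ZSeries (fun n => / Rabs (u + IZR n) - kappa rad n) - x / u ^ 2 - x / (1 - u) ^ 2 - 2 * x * Series (fun n => / (INR n + 1) ^ 2)
  <= dist_sum rad x u.
Proof.
  intros Hx Hu. set (b := fun n : Z => / Rabs (u + IZR n) - kappa rad n). set (a := fun n : Z => inv_dist x (u + IZR n) - kappa rad n).
  assert (D : forall n, u + IZR n <> 0 -> 0 <= b n - a n <= x / (u + IZR n) ^ 2).
  { intros n Hn. pose proof (inv_abs_inv_dist x _ Hx Hn). unfold a, b. lra. }
  assert (EP : forall n : nat, IZR (Z.of_nat (S n)) = INR n + 1) by (intros n; now rewrite <- INR_IZR_INZ, S_INR).
  assert (EN : forall n : nat, IZR (- Z.of_nat (S (S n)))%Z = - (INR n + 2)) by (intros n; rewrite opp_IZR, <- INR_IZR_INZ, !S_INR; ring).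
  assert (DP : forall n, 0 <= b (Z.of_nat (S n)) - a (Z.of_nat (S n)) <= x / (INR n + 1) ^ 2).
  { intros n. pose proof (pos_INR n). destruct (D (Z.of_nat (S n))) as [D1 D2]; [rewrite EP; lra|]. split; [exact D1|]. eapply Rle_trans; [exact D2|].
    apply Rmult_le_compat_l; [lra|]. apply inv_sqr_ge_succ. rewrite EP. lra. }
  assert (DN : forall n, 0 <= b (- Z.of_nat (S (S n)))%Z - a (- Z.of_nat (S (S n)))%Z <= x / (INR n + 1) ^ 2).
  { intros n. pose proof (pos_INR n). destruct (D (- Z.of_nat (S (S n)))%Z) as [D1 D2]; [rewrite EN; lra|]. split; [exact D1|]. eapply Rle_trans; [exact D2|].
    apply Rmult_le_compat_l; [lra|]. rewrite EN. replace ((u + - (INR n + 2)) ^ 2) with ((INR n + 2 - u) ^ 2) by ring. apply inv_sqr_ge_succ. lra. }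
  assert (Ea := ex_Zseries_dist rad x u Hx). fold a in Ea. destruct (ZSeries_split a Ea) as [Ea1 [Ea2 Eqa]].
  (* Convergence of the sum at distance 0 follows from that at [x], since the difference is
     summable. *)
  assert (Eb1 : ex_series (fun n => b (Z.of_nat (S n)))).
  { assert (H := ex_series_plus (V := R_NormedModule) _ _ Ea1 (ex_series_le_inv_sqr (fun n => b (Z.of_nat (S n)) - a (Z.of_nat (S n))) x (fun n => Rle_trans _ _ _ (Req_le _ _ (Rabs_pos_eq _ (proj1 (DP n)))) (proj2 (DP n))))).
    eapply ex_series_ext; [|exact H]. intros n. set (k := Z.of_nat (S n)). change (a k + (b k - a k) = b k). ring. }
  assert (Eb2 : ex_series (fun n => b (- Z.of_nat (S (S n)))%Z)).
  { assert (H := ex_series_plus (V := R_NormedModule) _ _ Ea2 (ex_series_le_inv_sqr (fun n => b (- Z.of_nat (S (S n)))%Z - a (- Z.of_nat (S (S n)))%Z) x (fun n => Rle_trans _ _ _ (Req_le _ _ (Rabs_pos_eq _ (proj1 (DN n)))) (proj2 (DN n))))).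
    eapply ex_series_ext; [|exact H]. intros n. set (k := (- Z.of_nat (S (S n)))%Z). change (a k + (b k - a k) = b k). ring. }
  assert (Eb : ex_Zseries b).
  { split.
    - exact (proj2 (ex_series_incr_1 (V := R_NormedModule) (fun n => b (Z.of_nat n))) Eb1).
    - exact (proj2 (ex_series_incr_1 (V := R_NormedModule) (fun n => b (- Z.of_nat (S n))%Z)) Eb2). }
  destruct (ZSeries_split b Eb) as [_ [_ Eqb]].
  assert (G1 := Series_ge_sub _ _ x Ea1 Eb1 (fun n => ltac:(pose proof (DP n); lra))).
  assert (G2 := Series_ge_sub _ _ x Ea2 Eb2 (fun n => ltac:(pose proof (DN n); lra))).
  assert (D0 := D 0%Z ltac:(lra)). assert (D1 := D (-1)%Z ltac:(lra)).
  replace ((u + IZR 0) ^ 2) with (u ^ 2) in D0 by ring. replace ((u + IZR (-1)) ^ 2) with ((1 - u) ^ 2) in D1 by ring.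
  change (dist_sum rad x u) with (ZSeries a). rewrite Eqa, Eqb. lra.
Qed.

(** Near an end of [[0, 1]] one of the terms 0 and -1 is at least [1 / (x + d)]; everything else is
    bounded below independently of [x] and [u]. *)
Lemma dist_sum_ge_large rad x u d : 0 < x <= 1 -> 0 <= u <= 1 -> 0 < d -> u <= d \/ 1 - u <= d ->
  / (x + d) - Rabs (kappa rad 0) - 1 - 4 * Series (fun n => / (INR n + 1) ^ 2) <= dist_sum rad x u.
Proof.
  intros Hx Hu Hd0 Hd. set (a := fun n : Z => inv_dist x (u + IZR n) - kappa rad n).
  assert (Ea := ex_Zseries_dist rad x u (proj1 Hx)). fold a in Ea. destruct (ZSeries_split a Ea) as [Ea1 [Ea2 Eqa]].
  assert (L : forall v, / (x + Rabs v) <= inv_dist x v).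
  { intros v. destruct (dist_bounds x v (proj1 Hx)) as [B1 [B2 B3]]. apply Rinv_le_contravar; lra. }
  assert (L2 : forall v (n : nat), 0 <= v <= INR n + 2 -> - 2 / (INR n + 1) ^ 2 <= / (x + v) - / (INR n + 1)).
  { intros v n Hv. pose proof (pos_INR n). replace (/ (x + v) - / (INR n + 1)) with (- ((x + v - (INR n + 1)) / ((x + v) * (INR n + 1)))) by (field; lra).
    replace (- 2 / (INR n + 1) ^ 2) with (- (2 / (INR n + 1) ^ 2)) by (unfold Rdiv; ring). apply Ropp_le_contravar. unfold Rdiv.
    destruct (Rle_dec (x + v) (INR n + 1)) as [H1|H1].
    - apply Rle_trans with 0.
      + assert (0 < / ((x + v) * (INR n + 1))) by (apply Rinv_0_lt_compat, Rmult_lt_0_compat; lra). nra.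
      + assert (0 < / (INR n + 1) ^ 2) by (apply Rinv_0_lt_compat, pow_lt; lra). lra.
    - apply Rmult_le_compat; try lra.
      + left. apply Rinv_0_lt_compat, Rmult_lt_0_compat; lra.
      + apply Rinv_le_contravar; [apply pow_lt; lra|]. simpl. nra. }
  assert (E0 : ex_series (fun _ : nat => 0)).
  { apply (ex_series_le_inv_sqr _ 0). intros n. rewrite Rabs_R0. unfold Rdiv. rewrite Rmult_0_l. apply Rle_refl. }
  assert (EP : forall n : nat, IZR (Z.of_nat (S n)) = INR n + 1) by (intros n; now rewrite <- INR_IZR_INZ, S_INR).
  assert (EN : forall n : nat, IZR (- Z.of_nat (S (S n)))%Z = - (INR n + 2)) by (intros n; rewrite opp_IZR, <- INR_IZR_INZ, !S_INR; ring).
  assert (G1 : Series (fun _ : nat => 0) - 2 * Series (fun n => / (INR n + 1) ^ 2) <= Series (fun n => a (Z.of_nat (S n)))).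
  { apply Series_ge_sub; auto. intros n. pose proof (pos_INR n). unfold a. rewrite (proj1 (kappa_abs rad n)), EP, S_INR.
    specialize (L (u + (INR n + 1))). rewrite Rabs_pos_eq in L by lra. specialize (L2 (u + (INR n + 1)) n ltac:(lra)). unfold Rdiv in *. lra. }
  assert (G2 : Series (fun _ : nat => 0) - 2 * Series (fun n => / (INR n + 1) ^ 2) <= Series (fun n => a (- Z.of_nat (S (S n)))%Z)).
  { apply Series_ge_sub; auto. intros n. pose proof (pos_INR n). unfold a. rewrite (proj2 (kappa_abs rad (S n))), EN, !S_INR.
    specialize (L (u + - (INR n + 2))). rewrite <- Rabs_Ropp, Rabs_pos_eq in L by lra. specialize (L2 (- (u + - (INR n + 2))) n ltac:(lra)).
    assert (/ (INR n + 1 + 1) <= / (INR n + 1)) by (apply Rinv_le_contravar; lra). unfold Rdiv in *. lra. }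
  rewrite Series_zero in G1, G2.
  change (dist_sum rad x u) with (ZSeries a). rewrite Eqa.
  assert (K1 : kappa rad (-1) = 1) by (pose proof (proj2 (kappa_abs rad 0)) as K; change (- Z.of_nat 1)%Z with (-1)%Z in K; rewrite K; simpl; field).
  pose proof (Rle_abs (kappa rad 0)).
  assert (P1 : 0 < inv_dist x (u + IZR 0)) by (apply inv_dist_le; lra).
  assert (P2 : 0 < inv_dist x (u + IZR (-1))) by (apply inv_dist_le; lra).
  assert (M : / (x + d) <= inv_dist x (u + IZR 0) + inv_dist x (u + IZR (-1))).
  { destruct Hd as [Hd|Hd].
    - specialize (L (u + IZR 0)). rewrite Rabs_pos_eq in L by lra. assert (/ (x + d) <= / (x + (u + 0))) by (apply Rinv_le_contravar; lra). lra.
    - specialize (L (u + IZR (-1))). rewrite <- Rabs_Ropp, Rabs_pos_eq in L by lra. assert (/ (x + d) <= / (x + - (u + -1))) by (apply Rinv_le_contravar; lra). lra. }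
  unfold a at 1 2. rewrite K1. lra.
Qed.

Lemma potential_dist rad S c th :
  potential rad S (c, th) = rad / (4 * PI) * (dist_sum rad (rad * Cmod c) (th / (2 * PI)) + 2 * pd1 S c).
Proof.
  unfold potential, dist_sum, inv_dist. simpl fst. simpl snd. do 3 f_equal.
  apply functional_extensionality. intros n. now rewrite Rpow_mult_distr.
Qed.

Lemma positivity_lower_bound rad S : positivity_condition rad S ->
  exists m : R, - m < pd1 S (RtoC 0) /\
    forall u, 0 < u < 1 -> 2 * m <= ZSeries (fun n => / Rabs (u + IZR n) - kappa rad n).
Proof.
  intros [m [[[x [Hx Ex]] Hmin] Hlt]]. pose proof PI_RGT_0.
  assert (F : forall u, 0 < u < 1 -> positivity_fun rad (2 * PI * u) = Finite (/ 2 * ZSeries (fun n => / Rabs (u + IZR n) - kappa rad n))).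
  { intros u Hu. unfold positivity_fun. replace (2 * PI * u / (2 * PI)) with u by (field; lra).
    destruct (Req_EM_T (frac_part u) 0) as [E|E]; auto. exfalso. unfold frac_part in E.
    assert (A : 0 < IZR (Int_part u) < 1) by lra. destruct A as [A1 A2]. apply lt_IZR in A1. apply lt_IZR in A2. lia. }
  assert (Hm : forall u, 0 < u < 1 -> Rbar_le m (Finite (/ 2 * ZSeries (fun n => / Rabs (u + IZR n) - kappa rad n)))).
  { intros u Hu. rewrite <- F by auto. apply Hmin. nra. }
  destruct m as [m| |].
  - exists m. split; [exact Hlt|]. intros u Hu. specialize (Hm u Hu). simpl in Hm. lra.
  (* The minimum is not [p_infty], since the value at [u = 1 / 2] is finite; [m_infty] is not a
     value of the function. *)
  - destruct (Hm (/ 2) ltac:(lra)).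
  - unfold positivity_fun in Ex. destruct (Req_EM_T _ _); discriminate.
Qed.

Lemma potential_pos_small rad eps S : 0 < rad -> 0 < eps -> smoothC S -> positivity_condition rad S ->
  exists e, 0 < e <= eps /\ potential_pos rad e S.
Proof.
  intros Hr He HS HP. destruct (positivity_lower_bound rad S HP) as [m [Hm HB]]. pose proof PI_RGT_0.
  set (Q := Series (fun n => / (INR n + 1) ^ 2)). set (d := pd1 S (RtoC 0) + m). assert (Hd : 0 < d) by (unfold d; lra).
  assert (HQ : 0 <= Q).
  { rewrite <- Series_zero. apply Series_le; [|exact ex_series_inv_sqr]. intros n. pose proof (pos_INR n).
    split; [lra|]. left. apply Rinv_0_lt_compat, pow_lt. lra. }
  (* Chosen together with [t] so that [1 / (x + t) >= 1 / (2 t) = K] for [x <= t]: within [t] of an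
     end of [[0, 1]] one term already pushes the sum above [2 m]. *)
  set (K := Rabs (kappa rad 0) + 1 + 4 * Q + 2 * Rabs m + 1).
  assert (HK : 2 <= K) by (unfold K; pose proof (Rabs_pos (kappa rad 0)); pose proof (Rabs_pos m); lra).
  set (t := / (2 * K)). assert (Ht : 0 < t <= 1) by (split; [apply Rinv_0_lt_compat; lra|unfold t; rewrite <- Rinv_1; apply Rinv_le_contravar; lra]).
  (* Away from the ends the sum loses at most [M x] against its value at distance 0. *)
  set (M := 2 * / t ^ 2 + 2 * Q).
  assert (HM : 0 < M) by (unfold M; assert (0 < / t ^ 2) by (apply Rinv_0_lt_compat, pow_lt; lra); lra).
  assert (LB : forall x u, 0 < x -> x <= t -> 0 <= u <= 1 -> 2 * m - M * x <= dist_sum rad x u).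
  { intros x u Hx Hxt Hu. assert (0 < M * x) by (apply Rmult_lt_0_compat; lra).
    destruct (Rle_dec u t) as [H1|H1]; [|destruct (Rle_dec (1 - u) t) as [H2|H2]].
    1,2: assert (G := dist_sum_ge_large rad x u t ltac:(lra) Hu (proj1 Ht) ltac:(auto));
      assert (G2 : K <= / (x + t)) by
        (replace K with (/ (t + t)) by (unfold t; field; lra); apply Rinv_le_contravar; lra);
      fold Q in G; pose proof (Rle_abs m); unfold K in G2; pose proof (Rabs_pos m); lra.
    assert (G := dist_sum_ge rad x u Hx ltac:(lra)). specialize (HB u ltac:(lra)). fold Q in G.
    assert (P1 : / u ^ 2 <= / t ^ 2) by (apply Rinv_le_contravar; [apply pow_lt; lra|apply pow_incr; lra]).
    assert (P2 : / (1 - u) ^ 2 <= / t ^ 2) by (apply Rinv_le_contravar; [apply pow_lt; lra|apply pow_incr; lra]).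
    assert (x * / u ^ 2 <= x * / t ^ 2) by (apply Rmult_le_compat_l; lra).
    assert (x * / (1 - u) ^ 2 <= x * / t ^ 2) by (apply Rmult_le_compat_l; lra).
    unfold M, Rdiv in *. lra. }
  assert (CS := smoothC_continuous _ (RtoC 0) (smoothC_pd1 _ HS)).
  destruct (CS (ball (pd1 S (RtoC 0)) (d / 2)) (locally_ball _ (mkposreal (d / 2) ltac:(lra)))) as [r Hrr].
  (* The last three bounds give [|S_1(c) - S_1(0)| < d / 2], [rad |c| < t] and [M rad |c| < d]. The
     losses [M x] and [2 |S_1(c) - S_1(0)|] together stay below [2 d], the margin at [c = 0]. *)
  set (e := Rmin eps (Rmin r (Rmin (t / rad) (d / (M * rad))))).
  assert (HMr : 0 < M * rad) by (apply Rmult_lt_0_compat; lra).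
  assert (He1 : e <= eps) by apply Rmin_l.
  assert (He2 : e <= r) by (eapply Rle_trans; [apply Rmin_r|apply Rmin_l]).
  assert (He3 : e <= t / rad) by (eapply Rle_trans; [apply Rmin_r|eapply Rle_trans; [apply Rmin_r|apply Rmin_l]]).
  assert (He4 : e <= d / (M * rad)) by (eapply Rle_trans; [apply Rmin_r|eapply Rle_trans; [apply Rmin_r|apply Rmin_r]]).
  exists e. split; [split; auto|].
  { unfold e. repeat apply Rmin_case; auto; [apply cond_pos| |]; apply Rdiv_lt_0_compat; lra. }
  intros [c th] [Hc1 Hc2]. simpl fst in Hc1, Hc2. rewrite potential_dist.
  apply Rmult_lt_0_compat; [apply Rdiv_lt_0_compat; lra|].
  set (x := rad * Cmod c). assert (Hx : 0 < x) by now apply Rmult_lt_0_compat.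
  assert (Hxt : x < t).
  { unfold x. replace t with (rad * (t / rad)) by (field; lra). apply Rmult_lt_compat_l; lra. }
  assert (HMx : M * x < d).
  { unfold x. replace d with (M * rad * (d / (M * rad))) by (field; lra). rewrite <- Rmult_assoc. apply Rmult_lt_compat_l; lra. }
  set (u := th / (2 * PI)). rewrite <- (dist_sum_period rad x u (- Int_part u) Hx).
  assert (G := LB x (u + IZR (- Int_part u)) Hx ltac:(lra) ltac:(rewrite opp_IZR; destruct (base_Int_part u); lra)).
  assert (G2 : ball (pd1 S (RtoC 0)) (d / 2) (pd1 S c)).
  { apply Hrr. apply (norm_compat1 (V := CR)). toC. replace (c - 0)%C with c by ring. lra. }
  change (Rabs (pd1 S c - pd1 S (RtoC 0)) < d / 2) in G2. apply Rabs_lt_between in G2. unfold d in *. lra.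
Qed.

(** * The twistor family *)

(** [period1 - i period2] is a local holomorphic function of [c]; this is its derivative. *)
Definition dperiod (S : C -> R) (c : C) : C := (dholo (pd1 S) c - / c)%C.

Lemma is_derive_inv_R x : x <> 0 -> is_derive Rinv x (- / x ^ 2).
Proof. intros Hx. auto_derive; auto. field. auto. Qed.

Lemma differential_period1 S c : smoothC S -> harmonic S -> c <> RtoC 0 ->
  differential (U := CR) (V := RR) (period1 S) c (fun h => Re (dperiod S c * h)%C).
Proof.
  intros HS HH Hc.
  assert (D := differential_Rminus _ _ _ _ _ (differential_Re _ _ _ (differential_dholo S c HS HH)) (differential_ln_Cmod c Hc)).
  apply (differential_ext _ _ _ _ D). intros h. unfold dperiod, Cdiv.
  replace ((dholo (pd1 S) c - / c) * h)%C with (dholo (pd1 S) c * h - h * / c)%C by ring.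
  reflexivity.
Qed.

Lemma differential_period2 eps D a S c : smoothC S -> harmonic S -> arg_branch eps D a -> D c ->
  differential (U := CR) (V := RR) (period2 S a) c (fun h => - Im (dperiod S c * h)%C).
Proof.
  intros HS HH Ha Hc.
  assert (D1 := differential_Rminus _ _ _ _ _ (differential_Im _ _ _ (differential_lnC eps D a c Ha Hc)) (differential_Im _ _ _ (differential_dholo S c HS HH))).
  apply (differential_eq_near (U := CR) (V := RR) (fun q => Im (lnC a q) - Im (dholo S q))).
  - apply filter_forall. intros q. unfold lnC, dholo, period2. simpl. ring.
  - apply (differential_ext _ _ _ _ D1). intros h. unfold dperiod, Cdiv.
    replace ((dholo (pd1 S) c - / c) * h)%C with (dholo (pd1 S) c * h - h * / c)%C by ring.
    change (Im (h * / c) - Im (dholo (pd1 S) c * h) = - (Im (dholo (pd1 S) c * h) - Im (h * / c)))%R. ring.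
Qed.

Lemma differential_pc p : differential (U := E4) (V := CR) pc p pc.
Proof. apply differential_linear, (is_linear_fst (U := CR) (V := prod_NormedModule R_AbsRing RR RR)). Qed.

Lemma differential_pt1 p : differential (U := E4) (V := RR) pt1 p pt1.
Proof.
  exact (differential_fst (U := E4) (V := RR) (W := RR) _ _ _ (differential_linear _ _ (is_linear_snd (U := CR) (V := prod_NormedModule R_AbsRing RR RR)))).
Qed.

Lemma differential_pt2 p : differential (U := E4) (V := RR) pt2 p pt2.
Proof.
  exact (differential_snd (U := E4) (V := RR) (W := RR) _ _ _ (differential_linear _ _ (is_linear_snd (U := CR) (V := prod_NormedModule R_AbsRing RR RR)))).
Qed.

(** With [t1 = theta_e period1 / 2 pi], this is [d theta_e]. *)
Definition dtheta (S : C -> R) (p u : pt) : R :=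
  2 * PI * pt1 u / period1 S (pc p) - theta_e S p / period1 S (pc p) * Re (dperiod S (pc p) * pc u)%C.

Lemma differential_theta_e S p : smoothC S -> harmonic S -> pc p <> RtoC 0 -> period1 S (pc p) <> 0 ->
  differential (U := E4) (V := RR) (theta_e S) p (dtheta S p).
Proof.
  intros HS HH Hc Hp.
  assert (D1 := differential_comp (U := E4) (V := CR) (W := RR) pc _ _ _ _ (differential_pc p) (differential_period1 S _ HS HH Hc)).
  assert (D2 := differential_Rcomp _ Rinv _ _ _ D1 (is_derive_inv_R _ Hp)).
  assert (D3 := differential_Rmult _ _ _ _ _ (differential_Rmult _ _ _ _ _ (differential_const (U := E4) (V := RR) (2 * PI) p) (differential_pt1 p)) D2).
  apply (differential_ext _ _ _ _ D3). intros h. unfold dtheta, theta_e. toR. field. auto.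
Qed.

Definition fiber_point (S : C -> R) (p : pt) : C * R := (pc p, theta_e S p).

Lemma differential_theta_m eps D a S p : smoothC S -> harmonic S -> arg_branch eps D a -> D (pc p) -> period1 S (pc p) <> 0 ->
  differential (U := E4) (V := RR) (theta_m S a) p
    (fun u => pt2 u + theta_e S p / (2 * PI) * Im (dperiod S (pc p) * pc u)%C - period2 S a (pc p) / (2 * PI) * dtheta S p u).
Proof.
  intros HS HH Ha Hc Hp. assert (Hcn : pc p <> RtoC 0) by (apply Cmod_gt_0; apply (proj2 Ha _ Hc)). pose proof PI_RGT_0.
  assert (D1 := differential_comp (U := E4) (V := CR) (W := RR) pc _ _ _ _ (differential_pc p) (differential_period2 eps D a S _ HS HH Ha Hc)).
  assert (D2 := differential_Rmult _ _ _ _ _ (differential_Rmult _ _ _ _ _ D1 (differential_theta_e S p HS HH Hcn Hp)) (differential_const (U := E4) (V := RR) (/ (2 * PI)) p)).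
  assert (D3 := differential_Rminus _ _ _ _ _ (differential_pt2 p) D2).
  apply (differential_eq_near (U := E4) (V := RR) (fun q => pt2 q - period2 S a (pc q) * theta_e S q * / (2 * PI))).
  (* The convention [/ 0 = 0] makes the two expressions agree also where [period1] vanishes, so the
     equality holds everywhere. *)
  - apply filter_forall. intros q. unfold theta_m, theta_e. destruct (Req_dec (period1 S (pc q)) 0) as [E|E].
    + rewrite E. unfold Rdiv. rewrite Rinv_0. asR. ring.
    + asR. field. lra.
  - apply (differential_ext _ _ _ _ D3). intros h. toR. field. lra.
Qed.

(** The first term comes from [l_+], the second from [l_-]: by [moment_conj] the conjugate is the
    moment with exponents [1 0] at the opposite angle. *)
Definition odd_moment (rad : R) (x : C * R) : C := (moment rad 1 0 0 x - Cconj (moment rad 0 1 0 x))%C.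

(** The potential as the twistor construction produces it; Poisson summation identifies it with
    [potential]. *)
Definition Vpot (rad : R) (S : C -> R) (x : C * R) : R :=
  rad / (2 * PI) * (period1 S (fst x) + Re (moment rad 0 0 0 x)).

(** [2 pi] times the connection form of the Gibbons-Hawking fibration. *)
Definition beta (rad : R) (S : C -> R) (p u : pt) : R :=
  - pt2 u - theta_e S p / (2 * PI) * Im (dperiod S (pc p) * pc u)%C
  - rad / 2 * Re (odd_moment rad (fiber_point S p) * Cconj (pc u))%C.

Definition Omega (rad : R) (S : C -> R) (p u v : pt) : C :=
  let w x := (dtheta S p x * (Vpot rad S (fiber_point S p) / rad), beta rad S p x)%R : C in
  (pc u * w v - pc v * w u)%C.

Definition omega (rad : R) (S : C -> R) (p u v : pt) : R :=
  2 * PI * Vpot rad S (fiber_point S p) * (Re (pc u) * Im (pc v) - Re (pc v) * Im (pc u))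
  + / (2 * PI * rad) * (dtheta S p u * beta rad S p v - dtheta S p v * beta rad S p u).

(** The exponent is real linear in [(c, theta_e)], so [dexponent] serves both as the exponent and as
    its differential. *)
Lemma chi_e_Cexp rad S zeta p : chi_e rad S zeta p = Cexp (dexponent rad zeta (fiber_point S p)).
Proof.
  unfold chi_e, dexponent, fiber_point, Z_e. simpl fst. simpl snd. f_equal.
  rewrite Cmult_conj, Copp_conj. unfold Cdiv.
  replace (Cconj Ci) with (- Ci)%C by (apply injective_projections; simpl; ring).
  assert (E : (Ci * Ci)%C = (- (1))%C) by (apply injective_projections; simpl; ring).
  generalize (Cconj (pc p)). intros cb. generalize (pc p) (/ zeta)%C. intros c iz.
  transitivity (- (Ci * Ci) * RtoC (PI * rad) * (iz * c) + Ci * RtoC (theta_e S p) - (Ci * Ci) * RtoC (PI * rad) * zeta * cb)%C; [ring|].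
  rewrite E. ring.
Qed.

Lemma normalized w : w <> RtoC 0 ->
  Cmod (w / RtoC (Cmod w))%C = 1 /\ w = (RtoC (Cmod w) * (w / RtoC (Cmod w)))%C /\
  forall c, (c * Cconj (w / RtoC (Cmod w)))%C = (RtoC (Cmod w) * (c / w))%C.
Proof.
  intros Hw. assert (Hp : 0 < Cmod w) by now apply Cmod_gt_0.
  assert (Hr : RtoC (Cmod w) <> RtoC 0) by (intros E; apply RtoC_inj in E; lra).
  repeat split.
  - rewrite Cmod_div, Cmod_R, Rabs_pos_eq by (auto; lra). field. lra.
  - field. auto.
  - intros c. rewrite Cdiv_conj by auto. replace (Cconj (RtoC (Cmod w))) with (RtoC (Cmod w)) by (apply injective_projections; simpl; ring).
    assert (E := Cmod_sqr_conj w). rewrite RtoC_mult in E.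
    transitivity (c / (RtoC (Cmod w) * w) * (w * Cconj w))%C; [field; auto|]. rewrite E. field. auto.
Qed.

Lemma sech_log_int rad u zeta (x : C * R) :
  0 < rad -> Cmod u = 1 -> zeta <> RtoC 0 -> ~ on_ray u zeta -> Re (fst x * Cconj u)%C < 0 ->
  exists M, sech_bounded M (fun y => (ray_kernel u zeta y * log1m (ray_exp rad (fst x * Cconj u, snd x)%C y))%C).
Proof.
  intros Hr Hu Hz Hray Hx. destruct (weight_kernel u zeta Hu Hz Hray) as [K HW].
  destruct (sech_weight_decay rad _ _ 0 (- Re (fst x * Cconj u)%C) Hr ltac:(lra) holo_log1m exp_decay_log1m) as [M0 [_ HM0]].
  exists (M0 * K)%R. apply (HM0 K _ (fst x * Cconj u, snd x)%C HW). simpl. lra.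
Qed.

Lemma on_ray_normalized w z : w <> RtoC 0 -> on_ray (w / RtoC (Cmod w))%C z -> on_ray w z.
Proof.
  intros Hw [s [Hs E]]. assert (Hp : 0 < Cmod w) by now apply Cmod_gt_0.
  assert (Hr : RtoC (Cmod w) <> RtoC 0) by (intros E'; apply RtoC_inj in E'; lra).
  exists (s / Cmod w). split; [now apply Rdiv_lt_0_compat|]. rewrite E, RtoC_div by lra. field. auto.
Qed.

Lemma dexponent_ray rad u y (x : C * R) : Cmod u = 1 ->
  dexponent rad (RtoC (exp y) * u) x = ray_exp rad (fst x * Cconj u, snd x)%C y.
Proof.
  intros Hu. unfold dexponent, ray_exp. simpl fst. simpl snd. rewrite exp_Ropp, RtoC_inv by (pose proof (exp_pos y); lra).
  assert (He : RtoC (exp y) <> RtoC 0) by (intros E; apply RtoC_inj in E; pose proof (exp_pos y); lra).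
  assert (Hu0 : u <> RtoC 0) by (apply Cmod_gt_0; lra).
  assert (Ei : (/ u)%C = Cconj u).
  { assert (E := Cmod_sqr_conj u). rewrite Hu, Rmult_1_r in E. transitivity (/ u * (u * Cconj u))%C; [rewrite E; ring|field; auto]. }
  replace (Cconj (fst x * Cconj u))%C with (Cconj (fst x) * u)%C by (rewrite Cmult_conj, Cconj_conj; reflexivity).
  rewrite <- Ei. field. auto.
Qed.

Lemma dexponent_opp rad zeta (x : C * R) : zeta <> RtoC 0 -> dexponent rad (- zeta) (fst x, - snd x) = (- dexponent rad zeta x)%C.
Proof. intros Hz. unfold dexponent. simpl fst. simpl snd. rewrite RtoC_opp. field. auto. Qed.

Lemma ray_int_plus rad S w zeta p : 0 < rad -> w <> RtoC 0 -> zeta <> RtoC 0 -> ~ on_ray w zeta -> Re (pc p / w)%C < 0 ->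
  ray_int w (fun z => (z + zeta) / (z - zeta) * Clog (1 - chi_e rad S z p))%C
  = log_int rad (w / RtoC (Cmod w)) zeta (fiber_point S p).
Proof.
  intros Hr Hw Hz Hray Hx. destruct (normalized w Hw) as [N1 [N2 N3]].
  assert (Hp : 0 < Cmod w) by now apply Cmod_gt_0.
  assert (Hray' : ~ on_ray (w / RtoC (Cmod w))%C zeta) by (intros H; apply Hray, on_ray_normalized; auto).
  set (u := (w / RtoC (Cmod w))%C) in *.
  assert (Hx' : Re (fst (fiber_point S p) * Cconj u)%C < 0).
  { simpl fst. rewrite N3. replace (Re (RtoC (Cmod w) * (pc p / w))%C) with (Cmod w * Re (pc p / w)%C)%R by (generalize (pc p / w)%C; intros [z1 z2]; simpl; ring). nra. }
  destruct (sech_log_int rad u zeta (fiber_point S p) Hr N1 Hz Hray' Hx') as [M B].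
  rewrite N2. apply (ray_int_exp _ u _ _ M Hp B). intros y. unfold ray_kernel, kernel. f_equal.
  unfold log1m. rewrite chi_e_Cexp, dexponent_ray by auto. reflexivity.
Qed.

(** Changing the signs of [z] and [zeta] leaves the kernel fixed; changing that of [theta_e] as well
    reverses the exponent, which inverts [chi_e]. *)
Lemma ray_int_minus rad S w zeta p : 0 < rad -> w <> RtoC 0 -> zeta <> RtoC 0 -> ~ on_ray w zeta -> 0 < Re (pc p / w)%C ->
  ray_int w (fun z => (z + zeta) / (z - zeta) * Clog (1 - / chi_e rad S z p))%C
  = log_int rad (- (w / RtoC (Cmod w))) (- zeta) (pc p, - theta_e S p).
Proof.
  intros Hr Hw Hz Hray Hx. destruct (normalized w Hw) as [N1 [N2 N3]].
  assert (Hp : 0 < Cmod w) by now apply Cmod_gt_0.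
  set (u := (w / RtoC (Cmod w))%C) in *.
  assert (Hray' : ~ on_ray (- u)%C (- zeta)%C).
  { intros [s [Hs E]]. apply Hray, on_ray_normalized; auto. exists s. split; auto.
    transitivity (- (- zeta))%C; [ring|]. rewrite E. unfold u. ring. }
  assert (Hx' : Re (pc p * Cconj (- u))%C < 0).
  { rewrite Copp_conj. replace (pc p * - Cconj u)%C with (- (pc p * Cconj u))%C by ring. rewrite N3.
    replace (Re (- (RtoC (Cmod w) * (pc p / w)))%C) with (- (Cmod w * Re (pc p / w)%C))%R by (generalize (pc p / w)%C; intros [z1 z2]; simpl; ring). nra. }
  assert (N1' : Cmod (- u)%C = 1) by now rewrite Cmod_opp.
  assert (Hz' : (- zeta)%C <> RtoC 0) by (intros E; apply Hz; transitivity (- - zeta)%C; [ring|rewrite E; ring]).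
  destruct (sech_log_int rad (- u)%C (- zeta)%C (pc p, - theta_e S p) Hr N1' Hz' Hray' Hx') as [M B].
  rewrite N2. apply (ray_int_exp _ u _ _ M Hp B). intros y.
  assert (He : (RtoC (exp y) * u)%C <> RtoC 0).
  { apply Cmod_gt_0. rewrite Cmod_mult, N1, Cmod_R, Rabs_pos_eq by (left; apply exp_pos). pose proof (exp_pos y). lra. }
  unfold ray_kernel, kernel, log1m. rewrite <- dexponent_ray by auto.
  rewrite chi_e_Cexp, <- Cexp_opp, <- dexponent_opp by auto. simpl fst. simpl snd.
  replace (RtoC (exp y) * - u)%C with (- (RtoC (exp y) * u))%C by ring. f_equal.
  assert (Hne : (RtoC (exp y) * u - zeta)%C <> RtoC 0).
  { intros E. apply Hray, on_ray_normalized; auto. exists (exp y). split; [apply exp_pos|]. fold u.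
    transitivity (RtoC (exp y) * u - (RtoC (exp y) * u - zeta))%C; [ring|rewrite E; ring]. }
  revert Hne. generalize (RtoC (exp y) * u)%C. intros z Hne. field. split; auto. intros E. apply Hne.
  transitivity (- (- z - - zeta))%C; [ring|rewrite E; ring].
Qed.

(** * The logarithmic differential of chi_m *)

Lemma differential_Z_m eps D S St a c : smoothC S -> harmonic_conjugate S St -> arg_branch eps D a -> D c ->
  differential (U := CR) (V := CR) (Z_m S St a) c
    (fun h => (/ RtoC (2 * PI) * ((RtoC (period1 S c) - Ci * RtoC (period2 S a c)) * h))%C).
Proof.
  intros HS HC Ha Hc. assert (Hcn : c <> RtoC 0) by (apply Cmod_gt_0; apply (proj2 Ha _ Hc)).
  assert (DI := differential_linear (U := CR) (V := CR) (fun q => q) c (is_linear_id (V := CR))).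
  assert (D1 := differential_Cplus _ _ _ _ _ (differential_Cminus _ _ _ _ _ DI (differential_Cmult _ _ _ _ _ DI (differential_lnC eps D a c Ha Hc)))
    (differential_conjugate S St c HS HC)).
  apply (differential_ext _ _ _ _ (differential_Cmult_const _ (/ RtoC (2 * PI))%C _ _ D1)). intros h.
  assert (E : (RtoC (period1 S c) - Ci * RtoC (period2 S a c))%C = (dholo S c - lnC a c)%C).
  { unfold period1, period2, dholo, lnC. apply injective_projections; simpl; ring. }
  rewrite E. toC. f_equal. field. auto.
Qed.

(** The [I] and [cI] stand for the moments and their conjugates, [e] for [dlog chi_e]. All
    quantities are free complex numbers, so that [field] decides the identity. As [J] is constrained
    by [J^2 = - 1], the multiple of [J^2 + 1] by which the two sides differ has to be given
    explicitly. *)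
Lemma log_derivative_algebra (J P Rd z h hb p1 p2 m t I1 Im0 I0 cI1 cIm cI0 M1 M2 : C) :
  (J * J)%C = (- (1))%C -> P <> RtoC 0 -> z <> RtoC 0 ->
  let e := (P * Rd * (h / z + hb * z) + J * t)%C in
  let V := (Rd / (2 * P) * (p1 + (I0 + cI0) / 2))%C in
  let b := (- m - Rd / 2 * (((I1 - cIm) * hb + (cI1 - Im0) * h) / 2))%C in
  (J * (P * Rd) / z * (/ (2 * P) * ((p1 - J * p2) * h)) - J * (m - p2 / (2 * P) * t)
   - J * (P * Rd) * z * (/ (2 * P) * ((p1 + J * p2) * hb))
   + (J / (4 * P) * (M1 * e - P * Rd * ((I1 + z * I0) * hb - (I0 / z + Im0) * h))
      - J / (4 * P) * (M2 * (- e) - P * Rd * ((cIm + - z * cI0) * hb - (cI0 / - z + cI1) * h))))%C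
  = (J * (P * V) * (h / z - z * hb) + J * b + (p2 / (2 * P) + J / (4 * P) * (M1 + M2)) * e)%C.
Proof.
  intros HJ HP Hz e V b.
  assert (H : forall X Y K : C, (X = Y - (J * J + 1) * K)%C -> X = Y).
  { intros X Y K ->. rewrite HJ. ring. }
  apply (H _ _ (Rd / 2 * p2 * (h / z + z * hb))%C). unfold e, V, b. field.
  repeat split; auto; try (intros E; apply RtoC_inj in E; lra).
Qed.

(** [L] is [dlog chi_m]; its multiple [N] of [e] cancels in the wedge product. The terms in
    [1 / z^2] and [z^2] vanish because [dc /\ dc = 0], which leaves the three powers of a twistor
    family. *)
Lemma twistor_algebra (J P Rd z V N cu cv cbu cbv tu tv bu bv : C) :
  (J * J)%C = (- (1))%C -> P <> RtoC 0 -> Rd <> RtoC 0 -> z <> RtoC 0 ->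
  let e c cb t := (P * Rd * (c / z + cb * z) + J * t)%C in
  let L c cb t b := (J * (P * V) * (c / z - z * cb) + J * b + N * e c cb t)%C in
  (- / (2 * z) * (cu * (tv * (V / Rd) + J * bv) - cv * (tu * (V / Rd) + J * bu))
   + (2 * P * V * (J / 2 * (cu * cbv - cv * cbu)) + / (2 * P * Rd) * (tu * bv - tv * bu))
   + z / 2 * (cbu * (tv * (V / Rd) - J * bv) - cbv * (tu * (V / Rd) - J * bu)))%C
  = (/ (2 * P * Rd) * (L cu cbu tu bu * e cv cbv tv - L cv cbv tv bv * e cu cbu tu))%C.
Proof.
  intros HJ HP HR Hz e L.
  assert (H : forall X Y K : C, (X = Y - (J * J + 1) * K)%C -> X = Y).
  { intros X Y K ->. rewrite HJ. ring. }
  apply (H _ _ (V / (2 * Rd) * ((cu / z - z * cbu) * tv - (cv / z - z * cbv) * tu) + (bu * tv - bv * tu) / (2 * P * Rd))%C).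
  unfold L, e. field.
  repeat split; auto; intros E; apply RtoC_inj in E; lra.
Qed.

Lemma Ci_sqr : (Ci * Ci)%C = (- (1))%C.
Proof. apply injective_projections; simpl; ring. Qed.

(** All terms that depend on the branch of the argument or on the rays are collected in the
    coefficient [N] of [dlog chi_e]. *)
Lemma chi_m_log_differential rad eps D S St a zeta up um p :
  0 < rad -> smoothC S -> harmonic S -> harmonic_conjugate S St -> arg_branch eps D a -> D (pc p) ->
  0 < period1 S (pc p) -> zeta <> RtoC 0 -> admissible_rays (pc p) zeta up um ->
  exists N : C, differential (U := E4) (V := CR) (chi_m rad S St a up um zeta) p (fun u =>
    (chi_m rad S St a up um zeta p *
     (Ci * (RtoC PI * RtoC (Vpot rad S (fiber_point S p))) * (pc u / zeta - zeta * Cconj (pc u))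
      + Ci * RtoC (beta rad S p u) + N * dexponent rad zeta (pc u, dtheta S p u)))%C).
Proof.
  intros Hr HS HH HC Ha Hc Hp Hz [Hup [Hum [Hxp [Hxm [Hrp Hrm]]]]]. pose proof PI_RGT_0.
  assert (Hcn : pc p <> RtoC 0) by (apply Cmod_gt_0; apply (proj2 Ha _ Hc)).
  destruct (normalized up Hup) as [P1 [_ P3]]. destruct (normalized um Hum) as [Q1 [_ Q3]].
  assert (Hlp : 0 < Cmod up) by now apply Cmod_gt_0. assert (Hlm : 0 < Cmod um) by now apply Cmod_gt_0.
  set (u1 := (up / RtoC (Cmod up))%C) in *. set (u2 := (um / RtoC (Cmod um))%C) in *.
  (* A logarithm of [chi_m] near [p], with unit directions and with the second ray integral brought
     to the form of the first. *)
  set (F := fun q : pt => ((Ci * RtoC (PI * rad) / zeta * Z_m S St a (pc q) - Ci * RtoC (theta_m S a q) - Ci * RtoC (PI * rad) * zeta * Cconj (Z_m S St a (pc q)))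
    + (Ci / RtoC (4 * PI) * log_int rad u1 zeta (fiber_point S q) - Ci / RtoC (4 * PI) * log_int rad (- u2) (- zeta) (pc q, - theta_e S q)%R))%C).
  assert (EF : forall q, Re (pc q / up)%C < 0 -> 0 < Re (pc q / um)%C -> Cexp (F q) = chi_m rad S St a up um zeta q).
  { intros q H1 H2. unfold F, chi_m, chi_sf_m. rewrite Cexp_plus. rewrite (ray_int_plus rad S up zeta q), (ray_int_minus rad S um zeta q) by auto. reflexivity. }
  (* The half-plane conditions on the fixed rays persist for nearby [c]. *)
  assert (Hnear : locally (p : E4) (fun q : E4 => Cexp (F q) = chi_m rad S St a up um zeta q)).
  { assert (C1 : forall w, differential (U := E4) (V := RR) (fun q => Re (pc q / w)%C) p (fun h => Re (/ w * pc h)%C)).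
    { intros w. apply (differential_eq_near (U := E4) (V := RR) (fun q => Re (/ w * pc q)%C)).
      - apply filter_forall. intros q. unfold Cdiv. now rewrite Cmult_comm.
      - apply (differential_Re (U := E4)), differential_Cmult_const, differential_pc. }
    assert (L1 : locally (p : E4) (fun q : E4 => Re (pc q / up)%C < 0)).
    { refine (differential_continuous _ _ _ (C1 up) (fun y : R => y < 0) _). exact (open_lt 0 _ Hxp). }
    assert (L2 : locally (p : E4) (fun q : E4 => 0 < Re (pc q / um)%C)).
    { refine (differential_continuous _ _ _ (C1 um) (fun y : R => 0 < y) _). exact (open_gt 0 _ Hxm). }
    generalize (filter_and _ _ L1 L2).
    apply filter_imp. intros q [H1 H2]. now apply EF. }
  assert (Hray2 : ~ on_ray (- u2)%C (- zeta)%C).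
  { intros [s [Hs E]]. apply Hrm, on_ray_normalized; auto. exists s. split; auto.
    transitivity (- (- zeta))%C; [ring|]. rewrite E. unfold u2. ring. }
  assert (Hray1 : ~ on_ray u1 zeta) by (intros E; apply Hrp, on_ray_normalized; auto).
  assert (Hd1 : Re (fst (fiber_point S p) * Cconj u1)%C < 0).
  { simpl fst. rewrite P3. generalize dependent (pc p / up)%C. intros [z1 z2] Hz1. simpl in *. nra. }
  assert (Hd2 : Re (fst (pc p, - theta_e S p)%R * Cconj (- u2))%C < 0).
  { simpl fst. rewrite Copp_conj. replace (pc p * - Cconj u2)%C with (- (pc p * Cconj u2))%C by ring. rewrite Q3.
    generalize dependent (pc p / um)%C. intros [z1 z2] Hz1. simpl in *. nra. }
  assert (Hz' : (- zeta)%C <> RtoC 0) by (intros E; apply Hz; transitivity (- - zeta)%C; [ring|rewrite E; ring]).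
  destruct (differential_log_int rad u1 zeta (fiber_point S p) Hr P1 Hz Hray1 Hd1) as [M1 DL1].
  destruct (differential_log_int rad (- u2)%C (- zeta)%C (pc p, - theta_e S p) Hr ltac:(now rewrite Cmod_opp) Hz' Hray2 Hd2) as [M2 DL2].
  assert (Dth := differential_theta_e S p HS HH Hcn (Rgt_not_eq _ _ Hp)).
  assert (DQ1 := differential_comp (U := E4) (V := E3) (W := CR) (fiber_point S) _ _ _ _ (differential_pair (U := E4) (V := CR) (W := RR) _ _ _ _ _ (differential_pc p) Dth) DL1).
  assert (DQ2 := differential_comp (U := E4) (V := E3) (W := CR) (fun q => (pc q, - theta_e S q)) _ _ _ _ (differential_pair (U := E4) (V := CR) (W := RR) _ _ _ _ _ (differential_pc p) (differential_Ropp _ _ _ Dth)) DL2).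
  assert (DZ := differential_comp (U := E4) (V := CR) (W := CR) pc _ _ _ _ (differential_pc p) (differential_Z_m eps D S St a _ HS HC Ha Hc)).
  assert (Dtm := differential_theta_m eps D a S p HS HH Ha Hc (Rgt_not_eq _ _ Hp)).
  assert (DS := differential_Cminus _ _ _ _ _ (differential_Cminus _ _ _ _ _ (differential_Cmult_const _ (Ci * RtoC (PI * rad) / zeta)%C _ _ DZ)
     (differential_Cmult_const _ Ci _ _ (differential_RtoC _ _ _ Dtm))) (differential_Cmult_const _ (Ci * RtoC (PI * rad) * zeta)%C _ _ (differential_Cconj _ _ _ DZ))).
  assert (DR := differential_Cminus _ _ _ _ _ (differential_Cmult_const _ (Ci / RtoC (4 * PI))%C _ _ DQ1) (differential_Cmult_const _ (Ci / RtoC (4 * PI))%C _ _ DQ2)).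
  assert (DF := differential_Cplus _ _ _ _ _ DS DR).
  (* [period2] comes from the semi-flat part, [M1] and [M2] from the integrals of the full kernel
     over the two rays. *)
  exists (RtoC (period2 S a (pc p)) / (2 * RtoC PI) + Ci / (4 * RtoC PI) * (M1 + M2))%C.
  apply (differential_eq_near (U := E4) (V := CR) (fun q => Cexp (F q)) _ _ _ Hnear).
  apply (differential_ext _ _ _ _ (differential_Cexp_fct F _ _ DF)). intros h.
  change (@eq C) with (@eq C). rewrite (EF p Hxp Hxm). f_equal. clear DF DR DS Dtm DZ DQ1 DQ2 Dth DL1 DL2 Hnear EF.
  assert (HPI : RtoC PI <> RtoC 0) by (intros E; apply RtoC_inj in E; lra).
  simpl fst. simpl snd.
  rewrite <- !moment_conj by auto. fold (fiber_point S p).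
  assert (G := log_derivative_algebra Ci (RtoC PI) (RtoC rad) zeta (pc h) (Cconj (pc h)) (RtoC (period1 S (pc p))) (RtoC (period2 S a (pc p)))
    (RtoC (pt2 h + theta_e S p / (2 * PI) * Im (dperiod S (pc p) * pc h)%C)) (RtoC (dtheta S p h))
    (moment rad 1 0 0 (fiber_point S p)) (moment rad 0 1 0 (fiber_point S p)) (moment rad 0 0 0 (fiber_point S p))
    (Cconj (moment rad 1 0 0 (fiber_point S p))) (Cconj (moment rad 0 1 0 (fiber_point S p))) (Cconj (moment rad 0 0 0 (fiber_point S p))) M1 M2 Ci_sqr HPI Hz).
  cbv zeta in G.
  assert (EV : RtoC (Vpot rad S (fiber_point S p)) = (RtoC rad / (2 * RtoC PI) * (RtoC (period1 S (pc p)) + (moment rad 0 0 0 (fiber_point S p) + Cconj (moment rad 0 0 0 (fiber_point S p))) / 2))%C).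
  { unfold Vpot. simpl fst. rewrite RtoC_mult, RtoC_plus, re_alt, RtoC_div, RtoC_mult by lra. reflexivity. }
  assert (EB : RtoC (beta rad S p h) = (- RtoC (pt2 h + theta_e S p / (2 * PI) * Im (dperiod S (pc p) * pc h)%C) - RtoC rad / 2 *
    (((moment rad 1 0 0 (fiber_point S p) - Cconj (moment rad 0 1 0 (fiber_point S p))) * Cconj (pc h) + (Cconj (moment rad 1 0 0 (fiber_point S p)) - moment rad 0 1 0 (fiber_point S p)) * pc h) / 2))%C).
  { unfold beta. rewrite RtoC_minus, RtoC_mult, re_alt, RtoC_div by lra. unfold odd_moment.
    rewrite Cmult_conj, Cminus_conj, !Cconj_conj. rewrite RtoC_minus, RtoC_opp, RtoC_plus. ring. }
  assert (Ee : dexponent rad zeta (pc h, dtheta S p h) = (RtoC PI * RtoC rad * (pc h / zeta + Cconj (pc h) * zeta) + Ci * RtoC (dtheta S p h))%C).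
  { unfold dexponent. simpl fst. simpl snd. now rewrite RtoC_mult. }
  rewrite <- EV, <- EB, <- Ee in G. rewrite <- G. clear G EV EB.
  rewrite <- (dexponent_opp rad zeta (pc h, dtheta S p h) Hz). simpl fst. simpl snd.
  rewrite !Cmult_conj. rewrite Cminus_conj, Cmult_conj. 
  replace (Cconj (/ RtoC (2 * PI))) with (/ (2 * RtoC PI))%C.
  2:{ rewrite <- RtoC_mult, <- RtoC_inv by lra. apply injective_projections; simpl; ring. }
  replace (Cconj Ci) with (- Ci)%C by (apply injective_projections; simpl; ring).
  replace (Cconj (RtoC (period1 S (pc p)))) with (RtoC (period1 S (pc p))) by (apply injective_projections; simpl; ring).
  replace (Cconj (RtoC (period2 S a (pc p)))) with (RtoC (period2 S a (pc p))) by (apply injective_projections; simpl; ring).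
  rewrite !RtoC_minus, !RtoC_mult, (RtoC_div (period2 S a (pc p))), !RtoC_mult by lra.
  asC.
  replace (RtoC (period1 S (pc p)) - - Ci * RtoC (period2 S a (pc p)))%C with (RtoC (period1 S (pc p)) + Ci * RtoC (period2 S a (pc p)))%C by ring.
  reflexivity.
Qed.

Lemma twistor rad eps S St : 0 < rad -> smoothC S -> harmonic S -> harmonic_conjugate S St ->
  (forall c, B0 eps c -> 0 < period1 S c) ->
  twistor_family rad eps S St (Omega rad S) (omega rad S).
Proof.
  intros Hr HS HH HC Hper D a Ha p Hc zeta up um Hz Had. pose proof PI_RGT_0.
  assert (HB : B0 eps (pc p)) by apply (proj2 Ha _ Hc). assert (Hcn : pc p <> RtoC 0) by (apply Cmod_gt_0, HB).
  destruct (chi_m_log_differential rad eps D S St a zeta up um p Hr HS HH HC Ha Hc (Hper _ HB) Hz Had) as [N DM].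
  assert (Dth := differential_theta_e S p HS HH Hcn (Rgt_not_eq _ _ (Hper _ HB))).
  assert (DE : differential (U := E4) (V := CR) (chi_e rad S zeta) p (fun u => (chi_e rad S zeta p * dexponent rad zeta (pc u, dtheta S p u))%C)).
  { assert (DX := differential_Cplus _ _ _ _ _ (differential_Cmult_const _ (RtoC (PI * rad)) _ _
      (differential_Cplus _ _ _ _ _ (differential_Cmult_const _ (/ zeta)%C _ _ (differential_pc p)) (differential_Cmult_const _ zeta _ _ (differential_Cconj _ _ _ (differential_pc p)))))
      (differential_Cmult_const _ Ci _ _ (differential_RtoC _ _ _ Dth))).
    apply (differential_eq_near (U := E4) (V := CR) (fun q => Cexp (RtoC (PI * rad) * (/ zeta * pc q + zeta * Cconj (pc q)) + Ci * RtoC (theta_e S q))%C)).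
    - apply filter_forall. intros q. rewrite chi_e_Cexp. unfold dexponent. simpl fst. simpl snd. asC. do 2 f_equal. unfold Cdiv. ring.
    - apply (differential_ext _ _ _ _ (differential_Cexp_fct _ _ _ DX)). intros h. rewrite chi_e_Cexp. unfold dexponent. simpl fst. simpl snd. asC. unfold Cdiv.
      f_equal; [do 2 f_equal|]; ring. }
  eexists. eexists. split; [exact DM|]. split; [exact DE|]. intros u v.
  assert (K1 : chi_e rad S zeta p <> RtoC 0) by (rewrite chi_e_Cexp; apply Cexp_neq_0).
  assert (K2 : chi_m rad S St a up um zeta p <> RtoC 0).
  { unfold chi_m, chi_sf_m. rewrite <- Cexp_plus. apply Cexp_neq_0. }
  unfold wedge11. generalize dependent (chi_m rad S St a up um zeta p). generalize dependent (chi_e rad S zeta p).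
  intros ce _ K1 cm _ K2.
  assert (HPI : RtoC PI <> RtoC 0) by (intros E; apply RtoC_inj in E; lra).
  assert (HR : RtoC rad <> RtoC 0) by (intros E; apply RtoC_inj in E; lra).
  assert (G := twistor_algebra Ci (RtoC PI) (RtoC rad) zeta (RtoC (Vpot rad S (fiber_point S p))) N (pc u) (pc v) (Cconj (pc u)) (Cconj (pc v))
    (RtoC (dtheta S p u)) (RtoC (dtheta S p v)) (RtoC (beta rad S p u)) (RtoC (beta rad S p v)) Ci_sqr HPI HR Hz).
  cbv zeta in G.
  assert (Ew : forall x, ((dtheta S p x * (Vpot rad S (fiber_point S p) / rad), beta rad S p x)%R : C) =
     (RtoC (dtheta S p x) * (RtoC (Vpot rad S (fiber_point S p)) / RtoC rad) + Ci * RtoC (beta rad S p x))%C).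
  { intros x. rewrite <- RtoC_div by lra. apply injective_projections; simpl; ring. }
  assert (EO : Omega rad S p u v = (pc u * (RtoC (dtheta S p v) * (RtoC (Vpot rad S (fiber_point S p)) / RtoC rad) + Ci * RtoC (beta rad S p v))
     - pc v * (RtoC (dtheta S p u) * (RtoC (Vpot rad S (fiber_point S p)) / RtoC rad) + Ci * RtoC (beta rad S p u)))%C).
  { unfold Omega. rewrite !Ew. reflexivity. }
  assert (EC : Cconj (Omega rad S p u v) = (Cconj (pc u) * (RtoC (dtheta S p v) * (RtoC (Vpot rad S (fiber_point S p)) / RtoC rad) - Ci * RtoC (beta rad S p v))
     - Cconj (pc v) * (RtoC (dtheta S p u) * (RtoC (Vpot rad S (fiber_point S p)) / RtoC rad) - Ci * RtoC (beta rad S p u)))%C).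
  { rewrite EO, <- RtoC_div by lra. generalize (pc u) (pc v). intros [u1 u2] [v1 v2]. apply injective_projections; simpl; ring. }
  assert (Eo : RtoC (omega rad S p u v) = (2 * RtoC PI * RtoC (Vpot rad S (fiber_point S p)) * (Ci / 2 * (pc u * Cconj (pc v) - pc v * Cconj (pc u)))
     + / (2 * RtoC PI * RtoC rad) * (RtoC (dtheta S p u) * RtoC (beta rad S p v) - RtoC (dtheta S p v) * RtoC (beta rad S p u)))%C).
  { unfold omega. rewrite <- !RtoC_mult, <- !RtoC_minus, <- RtoC_inv by (assert (0 < PI * rad) by (now apply Rmult_lt_0_compat); lra).
    generalize (pc u) (pc v). intros [u1 u2] [v1 v2]. apply injective_projections; simpl; field; assert (0 < PI * rad) by (now apply Rmult_lt_0_compat); lra. }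
  rewrite <- EO, <- EC, <- Eo in G. rewrite G. clear G Eo EC EO Ew.
  unfold dexponent. simpl fst. simpl snd. rewrite !RtoC_mult. field. repeat split; auto; intros E; apply RtoC_inj in E; lra.
Qed.

(** * Smoothness and derivatives of the coframe *)

Lemma is_linear_Re : is_linear (U := CR) (V := RR) Re.
Proof. apply (is_linear_fst (U := RR) (V := RR)). Qed.

Lemma is_linear_Im : is_linear (U := CR) (V := RR) Im.
Proof. apply (is_linear_snd (U := RR) (V := RR)). Qed.

Lemma is_linear_RtoC : is_linear (U := RR) (V := CR) RtoC.
Proof. apply (is_linear_pair_l (U := RR) (V := RR)). Qed.

Lemma Cn_weaken_domain {U V : RNorm} n (D D' : U -> Prop) : (forall p, D' p -> D p) ->
  forall f : U -> V, Cn n D f -> Cn n D' f.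
Proof.
  intros HD. induction n as [|n IH]; intros f Hf.
  - intros p Hp. apply Hf. auto.
  - destruct Hf as [df [H1 H2]]. exists df. split; auto.
Qed.

Section CnReal.
Context {U : RNorm} (n : nat) (D : U -> Prop).

Lemma Cn_Re (f : U -> CR) : Cn n D f -> Cn (V := RR) n D (fun p => Re (f p)).
Proof. apply Cn_lin_post, is_linear_Re. Qed.

Lemma Cn_Im (f : U -> CR) : Cn n D f -> Cn (V := RR) n D (fun p => Im (f p)).
Proof. apply Cn_lin_post, is_linear_Im. Qed.

Lemma Cn_RtoC (f : U -> RR) : Cn n D f -> Cn (V := CR) n D (fun p => RtoC (f p)).
Proof. apply Cn_lin_post, is_linear_RtoC. Qed.

Lemma Cn_Cconj (f : U -> CR) : Cn n D f -> Cn (V := CR) n D (fun p => Cconj (f p)).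
Proof. apply Cn_lin_post, is_linear_Cconj. Qed.

Lemma Cn_Rplus (f g : U -> RR) : Cn n D f -> Cn n D g -> Cn (V := RR) n D (fun p => f p + g p).
Proof. apply (Cn_plus (V := RR)). Qed.

Lemma Cn_Ropp (f : U -> RR) : Cn n D f -> Cn (V := RR) n D (fun p => - f p).
Proof. apply (Cn_lin_post (V := RR) (W := RR) n D Ropp (is_linear_opp (V := RR))). Qed.

Lemma Cn_Rminus (f g : U -> RR) : Cn n D f -> Cn n D g -> Cn (V := RR) n D (fun p => f p - g p).
Proof. intros Hf Hg. apply Cn_Rplus; auto. now apply Cn_Ropp. Qed.

Lemma Cn_Cplus (f g : U -> CR) : Cn n D f -> Cn n D g -> Cn (V := CR) n D (fun p => (f p + g p)%C).
Proof. apply (Cn_plus (V := CR)). Qed.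

Lemma Cn_Copp (f : U -> CR) : Cn n D f -> Cn (V := CR) n D (fun p => (- f p)%C).
Proof. apply (Cn_lin_post (V := CR) (W := CR) n D Copp (is_linear_opp (V := CR))). Qed.

Lemma Cn_Cminus (f g : U -> CR) : Cn n D f -> Cn n D g -> Cn (V := CR) n D (fun p => (f p - g p)%C).
Proof. intros Hf Hg. apply Cn_Cplus; auto. now apply Cn_Copp. Qed.

Lemma Cn_Rmult (f g : U -> RR) : open D -> Cn n D f -> Cn n D g -> Cn (V := RR) n D (fun p => f p * g p).
Proof.
  intros HD Hf Hg. apply (Cn_ext n D (fun p => Re (RtoC (f p) * RtoC (g p))%C)); auto.
  - intros p _. simpl. ring.
  - apply Cn_Re, Cn_Cmult; now apply Cn_RtoC.
Qed.

Lemma Cn_Rinv (f : U -> RR) : open D -> (forall p, D p -> f p <> 0) -> Cn n D f -> Cn (V := RR) n D (fun p => / f p).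
Proof.
  intros HD H0 Hf. apply (Cn_ext n D (fun p => Re (/ RtoC (f p))%C)); auto.
  - intros p Hp. rewrite <- RtoC_inv by auto. reflexivity.
  - apply Cn_Re, Cn_Cinv; [|now apply Cn_RtoC]. intros p Hp E. apply RtoC_inj in E. now apply (H0 p Hp).
Qed.
End CnReal.

Lemma open_B0 eps : open (T := CR) (B0 eps).
Proof.
  assert (H : forall c : CR, filterlim (fun q : CR => Cmod q) (locally c) (locally (Cmod c))).
  { intros c. apply (filterlim_ext (fun q : CR => norm q)); [intros q; apply norm_C|]. rewrite <- norm_C. apply (filterlim_norm (V := CR)). }
  apply (open_and (T := CR)).
  - intros c Hc. exact (H c (fun y => 0 < y) (open_gt 0 _ Hc)).
  - intros c Hc. exact (H c (fun y => y < eps) (open_lt eps _ Hc)).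
Qed.

Lemma open_cover eps : open (T := E4) (cover eps).
Proof.
  intros p Hp. exact (differential_continuous _ _ _ (differential_pc p) _ (open_B0 eps _ Hp)).
Qed.

Lemma Cn_pc n D : Cn (U := E4) (V := CR) n D pc.
Proof. apply Cn_linear. exact (differential_is_linear _ _ _ (differential_pc (zero : E4))). Qed.

Lemma Cn_pt1 n D : Cn (U := E4) (V := RR) n D pt1.
Proof. apply Cn_linear. exact (differential_is_linear _ _ _ (differential_pt1 (zero : E4))). Qed.

Lemma Cn_dperiod n eps S : smoothC S -> Cn (U := CR) (V := CR) n (B0 eps) (dperiod S).
Proof.
  intros HS. apply Cn_Cminus.
  - generalize (Cn_dholo n (pd1 S) (smoothC_pd1 _ HS)). apply Cn_weaken_domain. auto.
  - apply (Cn_Cinv (U := CR) n _ (fun c => c)); [intros p Hp; now apply Cmod_gt_0, Hp|]. apply Cn_linear, (is_linear_id (V := CR)).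
Qed.

(** The differential is given by [dperiod], so smoothness of the logarithm reduces to that of
    [1 / c]. *)
Lemma Cn_period1 n eps S : smoothC S -> harmonic S -> Cn (U := CR) (V := RR) n (B0 eps) (period1 S).
Proof.
  intros HS HH. assert (D : forall c, B0 eps c -> differential (U := CR) (V := RR) (period1 S) c (fun h => Re (dperiod S c * h)%C)).
  { intros c Hc. apply differential_period1; auto. now apply Cmod_gt_0, Hc. }
  destruct n as [|n].
  - intros c Hc. exact (differential_continuous _ _ _ (D c Hc)).
  - exists (fun c h => Re (dperiod S c * h)%C). split; auto. intros v. apply Cn_Re, Cn_Cmult; [now apply Cn_dperiod|apply (Cn_const (V := CR))].
Qed.

Definition admissible (rad eps : R) (S : C -> R) : Prop :=
  0 < rad /\ smoothC S /\ harmonic S /\ (forall c, B0 eps c -> 0 < period1 S c).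

Lemma cover_neq_0 eps p : cover eps p -> pc p <> RtoC 0.
Proof. intros Hp. now apply Cmod_gt_0, Hp. Qed.

Ltac cn_step := first [ assumption | apply (Cn_const (V := RR)) | apply (Cn_const (V := CR)) | apply Cn_pc | apply Cn_pt1
  | match goal with
    | |- Cn _ _ (fun p => Rplus (@?f p) (@?g p)) => apply (Cn_Rplus _ _ f g)
    | |- Cn _ _ (fun p => Rminus (@?f p) (@?g p)) => apply (Cn_Rminus _ _ f g)
    | |- Cn _ _ (fun p => Ropp (@?f p)) => apply (Cn_Ropp _ _ f)
    | |- Cn _ _ (fun p => Rmult (@?f p) (@?g p)) => apply (Cn_Rmult _ _ f g); [apply open_cover| |]
    | |- Cn _ _ (fun p => Cplus (@?f p) (@?g p)) => apply (Cn_Cplus _ _ f g)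
    | |- Cn _ _ (fun p => Cminus (@?f p) (@?g p)) => apply (Cn_Cminus _ _ f g)
    | |- Cn _ _ (fun p => Copp (@?f p)) => apply (Cn_Copp _ _ f)
    | |- Cn _ _ (fun p => Cmult (@?f p) (@?g p)) => apply (Cn_Cmult _ _ f g)
    | |- Cn _ _ (fun p => Cconj (@?f p)) => apply (Cn_Cconj _ _ f)
    | |- Cn _ _ (fun p => Re (@?f p)) => apply (Cn_Re _ _ f)
    | |- Cn _ _ (fun p => Im (@?f p)) => apply (Cn_Im _ _ f)
    | |- Cn _ _ (fun p => RtoC (@?f p)) => apply (Cn_RtoC _ _ f)
    end ].
Ltac cn := unfold Rdiv; repeat cn_step.

Section CnCoframe.
Context (rad eps : R) (S : C -> R) (H : admissible rad eps S).

Lemma Cn_period1_pc n : Cn (U := E4) (V := RR) n (cover eps) (fun p => period1 S (pc p)).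
Proof.
  destruct H as [_ [HS [HH _]]].
  apply (Cn_lin_pre (U := E4) (V := CR) (W := RR) n (B0 eps) pc); [|now apply Cn_period1].
  exact (differential_is_linear _ _ _ (differential_pc (zero : E4))).
Qed.

Lemma Cn_inv_period1 n : Cn (U := E4) (V := RR) n (cover eps) (fun p => / period1 S (pc p)).
Proof.
  apply (Cn_Rinv (U := E4)); [apply open_cover| |apply Cn_period1_pc]. intros p Hp. apply Rgt_not_eq. now apply H.
Qed.

Lemma Cn_dperiod_pc n : Cn (U := E4) (V := CR) n (cover eps) (fun p => dperiod S (pc p)).
Proof.
  apply (Cn_lin_pre (U := E4) (V := CR) (W := CR) n (B0 eps) pc); [|apply Cn_dperiod, H].
  exact (differential_is_linear _ _ _ (differential_pc (zero : E4))).
Qed.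

Lemma Cn_theta_e n : Cn (U := E4) (V := RR) n (cover eps) (fun p => theta_e S p).
Proof. assert (H1 := Cn_inv_period1 n). unfold theta_e. cn. Qed.

Lemma Cn_dtheta n v : Cn (U := E4) (V := RR) n (cover eps) (fun p => dtheta S p v).
Proof. assert (H1 := Cn_inv_period1 n). assert (H2 := Cn_theta_e n). assert (H3 := Cn_dperiod_pc n). unfold dtheta. cn. Qed.

Lemma differential_fiber_point p : cover eps p ->
  differential (U := E4) (V := E3) (fiber_point S) p (fun u => (pc u, dtheta S p u)).
Proof.
  intros Hp. destruct H as [_ [HS [HH Hper]]].
  apply (differential_pair (U := E4) (V := CR) (W := RR)); [apply differential_pc|].
  apply differential_theta_e; auto; [now apply (cover_neq_0 eps)|now apply Rgt_not_eq, Hper].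
Qed.

Lemma Cn_fiber_moment k m n j : Cn (U := E4) (V := CR) k (cover eps) (fun p => moment rad m n j (fiber_point S p)).
Proof.
  apply (Cn_moment (U := E4) rad (cover eps) (fiber_point S) (fun p u => (pc u, dtheta S p u))).
  - apply H.
  - intros p Hp. now apply (cover_neq_0 eps).
  - exact differential_fiber_point.
  - intros n' v. exact (Cn_const (U := E4) (V := CR) n' _ (pc v)).
  - intros n' v. exact (Cn_RtoC _ _ _ (Cn_dtheta n' v)).
Qed.

Lemma Cn_Vpot n : Cn (U := E4) (V := RR) n (cover eps) (fun p => Vpot rad S (fiber_point S p)).
Proof. assert (H1 := Cn_period1_pc n). assert (H2 := Cn_fiber_moment n 0 0 0). unfold Vpot. cn. Qed.

Lemma Cn_odd_moment n : Cn (U := E4) (V := CR) n (cover eps) (fun p => odd_moment rad (fiber_point S p)).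
Proof. assert (H1 := Cn_fiber_moment n 1 0 0). assert (H2 := Cn_fiber_moment n 0 1 0). unfold odd_moment. cn. Qed.

Lemma Cn_beta n v : Cn (U := E4) (V := RR) n (cover eps) (fun p => beta rad S p v).
Proof.
  assert (H1 := Cn_odd_moment n). assert (H2 := Cn_theta_e n). assert (H3 := Cn_dperiod_pc n). unfold beta. cn.
Qed.

Lemma is_linear_dtheta p : cover eps p -> is_linear (U := E4) (V := RR) (dtheta S p).
Proof. intros Hp. apply (differential_is_linear (U := E4) (V := RR) (theta_e S) p).
  apply differential_theta_e; try apply H; auto; [now apply (cover_neq_0 eps)|now apply Rgt_not_eq, H].
Qed.
End CnCoframe.

Lemma is_linear_beta rad S p : is_linear (U := E4) (V := RR) (beta rad S p).
Proof.
  assert (D := differential_Rminus _ _ _ _ _ (differential_Rminus _ _ _ _ _ (differential_Ropp _ _ _ (differential_pt2 (zero : E4)))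
    (differential_Rmult _ _ _ _ _ (differential_const (U := E4) (V := RR) (theta_e S p / (2 * PI)) zero) (differential_Im _ _ _ (differential_Cmult_const _ (dperiod S (pc p)) _ _ (differential_pc (zero : E4))))))
    (differential_Rmult _ _ _ _ _ (differential_const (U := E4) (V := RR) (rad / 2) zero) (differential_Re _ _ _ (differential_Cmult_const _ (odd_moment rad (fiber_point S p)) _ _ (differential_Cconj _ _ _ (differential_pc (zero : E4))))))).
  refine (eq_ind _ (fun l => is_linear (U := E4) (V := RR) l) (differential_is_linear _ _ _ D) _ _).
  apply functional_extensionality. intros h. unfold beta. toR. ring.
Qed.

(** * Differentials of the moments and of the coframe *)

(** Differentiating a moment with [j = 0] produces [j = 0] and [j = 1] in this combination, by
    [geo' = geo + geo ^ 2]. *)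
Definition moment_sum (rad : R) (m n : nat) (x : C * R) : C := (moment rad m n 0 x + moment rad m n 1 x)%C.

(** [dmom_base] and [dmom_angle] occur both in the differential of [odd_moment] and in that of the
    real part of [moment rad 0 0 0]. These are the instanton parts of connection and potential, and
    the coincidence is their monopole equation. *)
Definition dmom_base (rad : R) (x : C * R) : C := (moment_sum rad 1 0 x + Cconj (moment_sum rad 0 1 x))%C.
Definition dmom_angle (rad : R) (x : C * R) : R := - 2 * Im (moment_sum rad 0 0 x).
Definition dmom_conj (rad : R) (x : C * R) : C := (moment_sum rad 2 0 x - Cconj (moment_sum rad 0 2 x))%C.

Definition dodd_moment (rad : R) (x h : C * R) : C :=
  (- Ci * RtoC (PI * rad * dmom_angle rad x) * fst h + RtoC (PI * rad) * dmom_conj rad x * Cconj (fst h)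
   + Ci * RtoC (snd h) * dmom_base rad x)%C.

Lemma differential_odd_moment rad (x : C * R) : 0 < rad -> fst x <> RtoC 0 ->
  differential (U := E3) (V := CR) (odd_moment rad) x (dodd_moment rad x).
Proof.
  intros Hr Hx.
  assert (D := differential_Cminus _ _ _ _ _ (differential_moment rad 1 0 0 x Hr Hx) (differential_Cconj _ _ _ (differential_moment rad 0 1 0 x Hr Hx))).
  apply (differential_ext _ _ _ _ D). intros h. unfold moment_diff, dodd_moment, dmom_conj, dmom_base, dmom_angle, moment_sum.
  (* Moments with [m = n = 1] appear here from differentiating [moment rad 1 0 0] in [c] and
     [moment rad 0 1 0] in its conjugate; they reduce to [m = n = 0]. *)
  rewrite !(moment_SS rad 0 0) by auto.
  generalize (moment rad 0 0 0 x) (moment rad 0 0 1 x) (moment rad 1 0 0 x) (moment rad 1 0 1 x) (moment rad 0 1 0 x) (moment rad 0 1 1 x)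
    (moment rad 2 0 0 x) (moment rad 2 0 1 x) (moment rad 0 2 0 x) (moment rad 0 2 1 x).
  destruct h as [[h1 h2] t]. simpl fst. simpl snd. generalize (PI * rad). intros k [] [] [] [] [] [] [] [] [] [].
  asC. simpl INR. apply injective_projections; simpl; ring.
Qed.

Lemma differential_even_moment rad (x : C * R) : 0 < rad -> fst x <> RtoC 0 ->
  differential (U := E3) (V := RR) (fun y => Re (moment rad 0 0 0 y)) x
    (fun h => PI * rad * Re (dmom_base rad x * Cconj (fst h))%C + snd h * dmom_angle rad x / 2).
Proof.
  intros Hr Hx.
  assert (D := differential_Re _ _ _ (differential_moment rad 0 0 0 x Hr Hx)).
  apply (differential_ext _ _ _ _ D). intros h. unfold moment_diff, dmom_base, dmom_angle, moment_sum.
  generalize (moment rad 0 0 0 x) (moment rad 0 0 1 x) (moment rad 1 0 0 x) (moment rad 1 0 1 x) (moment rad 0 1 0 x) (moment rad 0 1 1 x).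
  destruct h as [[h1 h2] t]. simpl fst. simpl snd. generalize (PI * rad). intros k [] [] [] [] [] [].
  asR. simpl INR. simpl. field.
Qed.

Definition ddperiod (S : C -> R) (c : C) : C := (dholo (pd1 (pd1 S)) c + / (c * c))%C.

Lemma differential_dperiod S c : smoothC S -> harmonic S -> c <> RtoC 0 ->
  differential (U := CR) (V := CR) (dperiod S) c (fun h => (ddperiod S c * h)%C).
Proof.
  intros HS HH Hc.
  assert (D := differential_Cminus _ _ _ _ _ (differential_dholo (pd1 S) c (smoothC_pd1 _ HS) (harmonic_pd1 _ HS HH)) (differential_Cinv c Hc)).
  apply (differential_ext _ _ _ _ D). intros h. unfold ddperiod. asC. ring.
Qed.

Section Derivatives.
Context (rad eps : R) (S : C -> R) (H : admissible rad eps S) (p : pt) (Hp : cover eps p).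

Lemma period1_pc_neq : period1 S (pc p) <> 0.
Proof. now apply Rgt_not_eq, H. Qed.

Lemma differential_dperiod_pc : differential (U := E4) (V := CR) (fun q => dperiod S (pc q)) p (fun h => (ddperiod S (pc p) * pc h)%C).
Proof.
  destruct H as [_ [HS [HH _]]].
  exact (differential_comp (U := E4) (V := CR) (W := CR) pc _ _ _ _ (differential_pc p) (differential_dperiod S _ HS HH (cover_neq_0 _ _ Hp))).
Qed.

Lemma differential_theta_cover : differential (U := E4) (V := RR) (theta_e S) p (dtheta S p).
Proof.
  destruct H as [_ [HS [HH _]]]. apply differential_theta_e; auto; [now apply (cover_neq_0 eps)|apply period1_pc_neq].
Qed.

Lemma differential_period1_pc : differential (U := E4) (V := RR) (fun q => period1 S (pc q)) p (fun h => Re (dperiod S (pc p) * pc h)%C).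
Proof.
  destruct H as [_ [HS [HH _]]].
  exact (differential_comp (U := E4) (V := CR) (W := RR) pc _ _ _ _ (differential_pc p) (differential_period1 S _ HS HH (cover_neq_0 _ _ Hp))).
Qed.

(** Expressed through [dtheta] instead of [pt1], the formula is visibly symmetric in [v] and [w],
    which is the closedness of [dtheta]. *)
Lemma differential_dtheta v : differential (U := E4) (V := RR) (fun q => dtheta S q v) p (fun w =>
  - (dtheta S p v * Re (dperiod S (pc p) * pc w)%C + dtheta S p w * Re (dperiod S (pc p) * pc v)%C) / period1 S (pc p)
  - theta_e S p / period1 S (pc p) * Re (ddperiod S (pc p) * pc w * pc v)%C).
Proof.
  assert (N := period1_pc_neq).
  assert (DI := differential_Rcomp _ Rinv _ _ _ differential_period1_pc (is_derive_inv_R _ N)).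
  assert (DT := differential_Re _ _ _ (differential_Cmult_const _ (pc v) _ _ differential_dperiod_pc)).
  assert (D := differential_Rminus _ _ _ _ _ (differential_Rmult _ _ _ _ _ (differential_const (U := E4) (V := RR) (2 * PI * pt1 v) p) DI)
    (differential_Rmult _ _ _ _ _ (differential_Rmult _ _ _ _ _ differential_theta_cover DI) DT)).
  apply (differential_eq_near (U := E4) (V := RR) (fun q => 2 * PI * pt1 v * / period1 S (pc q) - theta_e S q * / period1 S (pc q) * Re (pc v * dperiod S (pc q))%C)).
  - apply filter_forall. intros q. unfold dtheta. rewrite (Cmult_comm (pc v)). reflexivity.
  - apply (differential_ext _ _ _ _ D). intros w. rewrite (Cmult_comm (pc v)), (Cmult_comm (pc v)).
    replace (dtheta S p v) with (2 * PI * pt1 v / period1 S (pc p) - theta_e S p / period1 S (pc p) * Re (dperiod S (pc p) * pc v)%C) by reflexivity.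
    toR. field. exact N.
Qed.

Lemma differential_Vpot : differential (U := E4) (V := RR) (fun q => Vpot rad S (fiber_point S q)) p (fun w =>
  rad / (2 * PI) * (Re (dperiod S (pc p) * pc w)%C + (PI * rad * Re (dmom_base rad (fiber_point S p) * Cconj (pc w))%C + dtheta S p w * dmom_angle rad (fiber_point S p) / 2))).
Proof.
  assert (DM := differential_comp (U := E4) (V := E3) (W := RR) _ _ _ _ _ (differential_fiber_point rad eps S H p Hp)
    (differential_even_moment rad (fiber_point S p) (proj1 H) (cover_neq_0 _ _ Hp))).
  assert (D := differential_Rmult _ _ _ _ _ (differential_const (U := E4) (V := RR) (rad / (2 * PI)) p) (differential_Rplus _ _ _ _ _ differential_period1_pc DM)).
  apply (differential_ext _ _ _ _ D). intros w. cbv beta. simpl fst. simpl snd. toR. ring.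
Qed.

Lemma differential_beta v : differential (U := E4) (V := RR) (fun q => beta rad S q v) p (fun w =>
  - (dtheta S p w / (2 * PI)) * Im (dperiod S (pc p) * pc v)%C - theta_e S p / (2 * PI) * Im (ddperiod S (pc p) * pc w * pc v)%C
  - rad / 2 * Re (dodd_moment rad (fiber_point S p) (pc w, dtheta S p w) * Cconj (pc v))%C).
Proof.
  assert (DM := differential_comp (U := E4) (V := E3) (W := CR) _ _ _ _ _ (differential_fiber_point rad eps S H p Hp)
    (differential_odd_moment rad (fiber_point S p) (proj1 H) (cover_neq_0 _ _ Hp))).
  assert (DO := differential_Re _ _ _ (differential_Cmult_const _ (Cconj (pc v)) _ _ DM)).
  assert (DT := differential_Im _ _ _ (differential_Cmult_const _ (pc v) _ _ differential_dperiod_pc)).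
  assert (D := differential_Rminus _ _ _ _ _ (differential_Rminus _ _ _ _ _ (differential_const (U := E4) (V := RR) (- pt2 v) p)
    (differential_Rmult _ _ _ _ _ (differential_Rmult _ _ _ _ _ differential_theta_cover (differential_const (U := E4) (V := RR) (/ (2 * PI)) p)) DT))
    (differential_Rmult _ _ _ _ _ (differential_const (U := E4) (V := RR) (rad / 2) p) DO)).
  apply (differential_eq_near (U := E4) (V := RR) (fun q => - pt2 v - theta_e S q * / (2 * PI) * Im (pc v * dperiod S (pc q))%C
     - rad / 2 * Re (Cconj (pc v) * odd_moment rad (fiber_point S q))%C)).
  - apply filter_forall. intros q. unfold beta. rewrite (Cmult_comm (pc v)), (Cmult_comm (Cconj (pc v))). reflexivity.
  - apply (differential_ext _ _ _ _ D). intros w. rewrite !(Cmult_comm (Cconj (pc v))), !(Cmult_comm (pc v)).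
    toR. unfold Rdiv. ring.
Qed.
End Derivatives.

(** The inverse of the coframe [(dc, dtheta, beta)] at [p]. *)
Definition frame (rad : R) (S : C -> R) (p : pt) (c : C) (t b : R) : pt :=
  (c, (period1 S (pc p) / (2 * PI) * t + theta_e S p / (2 * PI) * Re (dperiod S (pc p) * c)%C,
       - b - theta_e S p / (2 * PI) * Im (dperiod S (pc p) * c)%C - rad / 2 * Re (odd_moment rad (fiber_point S p) * Cconj c)%C)).

Lemma beta_frame rad S p c t b : beta rad S p (frame rad S p c t b) = b.
Proof.
  unfold beta. change (pc (frame rad S p c t b)) with c.
  change (pt2 (frame rad S p c t b)) with (- b - theta_e S p / (2 * PI) * Im (dperiod S (pc p) * c)%C - rad / 2 * Re (odd_moment rad (fiber_point S p) * Cconj c)%C).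
  ring.
Qed.

Lemma dtheta_frame rad S p c t b : period1 S (pc p) <> 0 -> dtheta S p (frame rad S p c t b) = t.
Proof.
  intros Hp. pose proof PI_RGT_0. unfold dtheta. change (pc (frame rad S p c t b)) with c.
  change (pt1 (frame rad S p c t b)) with (period1 S (pc p) / (2 * PI) * t + theta_e S p / (2 * PI) * Re (dperiod S (pc p) * c)%C).
  field. lra.
Qed.

Lemma frame_coframe rad S p u : period1 S (pc p) <> 0 -> frame rad S p (pc u) (dtheta S p u) (beta rad S p u) = u.
Proof.
  intros Hp. pose proof PI_RGT_0. destruct u as [c [t1 t2]]. unfold frame, beta, dtheta. change (pc (c, (t1, t2))) with c.
  change (pt1 (c, (t1, t2))) with t1. change (pt2 (c, (t1, t2))) with t2.
  f_equal. f_equal; field; lra.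
Qed.

Lemma coframe_inj rad S p u v : period1 S (pc p) <> 0 -> pc u = pc v -> dtheta S p u = dtheta S p v -> beta rad S p u = beta rad S p v -> u = v.
Proof. intros Hp E1 E2 E3. rewrite <- (frame_coframe rad S p u), <- (frame_coframe rad S p v) by auto. now rewrite E1, E2, E3. Qed.

(** Determined by [dc (J u) = i dc (u)] and [w (J u) = i w (u)] for [w = V / R dtheta + i beta].
    Defined through [frame], it reduces each later check to the three coframe components. *)
Definition Jop (rad : R) (S : C -> R) (p u : pt) : pt :=
  frame rad S p (Ci * pc u) (- (rad * / Vpot rad S (fiber_point S p)) * beta rad S p u)
    (Vpot rad S (fiber_point S p) * / rad * dtheta S p u).

Definition good (rad eps : R) (S : C -> R) : Prop :=
  admissible rad eps S /\ (forall x : C * R, B0 eps (fst x) -> 0 < Vpot rad S x).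

(** * Invariance under the period lattice *)

Section Translate.
Context (rad eps : R) (S : C -> R) (H : admissible rad eps S) (D : C -> Prop) (a : C -> R) (Ha : arg_branch eps D a)
  (m n : Z) (p : pt) (Hp : D (pc p)).

Definition dtranslate (u : pt) : pt :=
  (pc u, (pt1 u + IZR m * Re (dperiod S (pc p) * pc u)%C, pt2 u + IZR m * - Im (dperiod S (pc p) * pc u)%C)).

Lemma cover_branch : cover eps p.
Proof. apply (proj2 Ha _ Hp). Qed.

Lemma differential_translate : differential (U := E4) (V := E4) (translate S a m n) p dtranslate.
Proof.
  assert (D1 := differential_Rplus _ _ _ _ _ (differential_pt1 p) (differential_Rmult _ _ _ _ _ (differential_const (U := E4) (V := RR) (IZR m) p) (differential_period1_pc rad eps S H p cover_branch))).
  assert (D2 := differential_comp (U := E4) (V := CR) (W := RR) pc _ _ _ _ (differential_pc p) (differential_period2 eps D a S _ (proj1 (proj2 H)) (proj1 (proj2 (proj2 H))) Ha Hp)).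
  assert (D3 := differential_Rplus _ _ _ _ _ (differential_Rplus _ _ _ _ _ (differential_pt2 p) (differential_Rmult _ _ _ _ _ (differential_const (U := E4) (V := RR) (IZR m) p) D2))
    (differential_const (U := E4) (V := RR) (IZR n * (2 * PI)) p)).
  assert (D4 := differential_pair (U := E4) (V := CR) (W := prod_NormedModule R_AbsRing RR RR) _ _ _ _ _ (differential_pc p)
     (differential_pair (U := E4) (V := RR) (W := RR) _ _ _ _ _ D1 D3)).
  apply (differential_ext _ _ _ _ D4). intros h. unfold dtranslate. f_equal. f_equal; toR; ring.
Qed.

Lemma theta_e_translate : theta_e S (translate S a m n p) = theta_e S p + 2 * PI * IZR m.
Proof.
  assert (N := period1_pc_neq rad eps S H p cover_branch). unfold theta_e. change (pc (translate S a m n p)) with (pc p).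
  change (pt1 (translate S a m n p)) with (pt1 p + IZR m * period1 S (pc p)). field. exact N.
Qed.

Lemma moment_translate k l j : moment rad k l j (fiber_point S (translate S a m n p)) = moment rad k l j (fiber_point S p).
Proof. unfold fiber_point. rewrite theta_e_translate. apply moment_period. Qed.

Lemma Vpot_translate : Vpot rad S (fiber_point S (translate S a m n p)) = Vpot rad S (fiber_point S p).
Proof. unfold Vpot. rewrite moment_translate. reflexivity. Qed.

Lemma dtheta_translate u : dtheta S (translate S a m n p) (dtranslate u) = dtheta S p u.
Proof.
  assert (N := period1_pc_neq rad eps S H p cover_branch). unfold dtheta. rewrite theta_e_translate.
  change (pc (translate S a m n p)) with (pc p). change (pc (dtranslate u)) with (pc u).
  change (pt1 (dtranslate u)) with (pt1 u + IZR m * Re (dperiod S (pc p) * pc u)%C). field. exact N.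
Qed.

(** The shift of [theta_e] by [2 PI m] compensates the shift of [pt2] by [- m Im (dperiod * dc)],
    and the moments are periodic. *)
Lemma beta_translate u : beta rad S (translate S a m n p) (dtranslate u) = beta rad S p u.
Proof.
  pose proof PI_RGT_0. unfold beta, odd_moment. rewrite !moment_translate, theta_e_translate.
  change (pc (translate S a m n p)) with (pc p). change (pc (dtranslate u)) with (pc u).
  change (pt2 (dtranslate u)) with (pt2 u + IZR m * - Im (dperiod S (pc p) * pc u)%C). field. lra.
Qed.

Lemma Jop_translate u : Jop rad S (translate S a m n p) (dtranslate u) = dtranslate (Jop rad S p u).
Proof.
  assert (N := period1_pc_neq rad eps S H p cover_branch).
  apply (coframe_inj rad S (translate S a m n p)); [exact N| | |]; unfold Jop at 1.
  - reflexivity.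
  - rewrite dtheta_frame, dtheta_translate, beta_translate, Vpot_translate by exact N. unfold Jop. now rewrite dtheta_frame.
  - rewrite beta_frame, beta_translate, dtheta_translate, Vpot_translate. unfold Jop. now rewrite beta_frame.
Qed.
End Translate.

(** * The almost complex structure *)

Section Jproperties.
Context (rad eps : R) (S : C -> R) (H : good rad eps S) (p : pt) (Hp : cover eps p).

Lemma Vpot_pos : 0 < Vpot rad S (fiber_point S p).
Proof. apply H. exact Hp. Qed.

Lemma pc_Jop u : pc (Jop rad S p u) = (Ci * pc u)%C.
Proof. reflexivity. Qed.

Lemma dtheta_Jop u : dtheta S p (Jop rad S p u) = - (rad * / Vpot rad S (fiber_point S p)) * beta rad S p u.
Proof. unfold Jop. apply dtheta_frame. now apply (period1_pc_neq rad eps S (proj1 H)). Qed.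

Lemma beta_Jop u : beta rad S p (Jop rad S p u) = Vpot rad S (fiber_point S p) * / rad * dtheta S p u.
Proof. apply beta_frame. Qed.

Lemma pc_linear (u v : E4) k : pc (plus u v) = (pc u + pc v)%C /\ pc (scal k u) = (RtoC k * pc u)%C /\ pc (opp u) = (- pc u)%C.
Proof.
  repeat split. destruct u as [[c1 c2] u]. unfold pc. simpl. apply injective_projections; simpl; unfold scal; simpl; unfold mult; simpl; ring.
Qed.

Lemma Jop_sqr u : Jop rad S p (Jop rad S p u) = opp (u : E4).
Proof.
  pose proof Vpot_pos as HV. assert (Hr : 0 < rad) by apply H. assert (N := period1_pc_neq rad eps S (proj1 H) p Hp).
  assert (L1 := linear_opp _ (u : E4) (is_linear_dtheta rad eps S (proj1 H) p Hp)). assert (L2 := linear_opp _ (u : E4) (is_linear_beta rad S p)).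
  apply (coframe_inj rad S p); [exact N| | |].
  - rewrite !pc_Jop. destruct (pc_linear u u 0) as [_ [_ E]]. rewrite E. generalize (pc u). intros c. rewrite Cmult_assoc, Ci_sqr. ring.
  - rewrite dtheta_Jop, beta_Jop. etransitivity; [|symmetry; exact L1]. toR. field. lra.
  - rewrite beta_Jop, dtheta_Jop. etransitivity; [|symmetry; exact L2]. toR. field. lra.
Qed.
End Jproperties.

(** * The hyperkahler structure *)

Definition metric (rad : R) (S : C -> R) (p u v : pt) : R :=
  / Vpot rad S (fiber_point S p) * (beta rad S p u / (2 * PI) * (beta rad S p v / (2 * PI)))
  + Vpot rad S (fiber_point S p) * (Re (pc u) * Re (pc v) + Im (pc u) * Im (pc v) + dtheta S p u / (2 * PI * rad) * (dtheta S p v / (2 * PI * rad))).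

Definition wform (rad : R) (S : C -> R) (p u : pt) : C :=
  (dtheta S p u * (Vpot rad S (fiber_point S p) / rad), beta rad S p u)%R.

Lemma is_linear_ext {U V : RNorm} (f g : U -> V) : (forall x, f x = g x) -> is_linear f -> is_linear g.
Proof. intros E. now replace g with f by (now apply functional_extensionality). Qed.

Section Tensors.
Context (rad eps : R) (S : C -> R) (H : good rad eps S).

Section Point.
Context (p : pt) (Hp : cover eps p).

Lemma D_dtheta : differential (U := E4) (V := RR) (dtheta S p) zero (dtheta S p).
Proof. apply differential_linear, (is_linear_dtheta rad eps S (proj1 H) p Hp). Qed.

Lemma D_beta : differential (U := E4) (V := RR) (beta rad S p) zero (beta rad S p).
Proof. apply differential_linear, is_linear_beta. Qed.

Lemma D_wform : differential (U := E4) (V := CR) (wform rad S p) zero (wform rad S p).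
Proof.
  assert (D := differential_Cpair _ _ _ _ _ (differential_Rmult _ _ _ _ _ D_dtheta (differential_const (U := E4) (V := RR) (Vpot rad S (fiber_point S p) / rad) zero)) D_beta).
  apply (differential_ext _ _ _ _ D). intros h. unfold wform. f_equal. toR. ring.
Qed.

(** A linear map is its own differential at 0, so linearity of a compound expression can be read off
    from the differentiation rules. *)
Lemma linear_of_D {V : RNorm} (f L : E4 -> V) (l : E4 -> V) : differential f zero L -> (forall h, L h = l h) -> is_linear l.
Proof. intros D E. exact (is_linear_ext _ _ E (differential_is_linear _ _ _ D)). Qed.

Lemma Omega_wform q u v : Omega rad S q u v = (pc u * wform rad S q v - pc v * wform rad S q u)%C.
Proof. reflexivity. Qed.

Lemma bilinear_Omega : is_bilinear (U := E4) (V := CR) (Omega rad S p).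
Proof.
  split; intros x.
  - refine (linear_of_D _ _ _ (differential_Cminus _ _ _ _ _ (differential_Cmult_const _ (pc x) _ _ D_wform) (differential_Cmult_const _ (wform rad S p x) _ _ (differential_pc (zero : E4)))) _).
    intros h. rewrite Omega_wform. asC. ring.
  - refine (linear_of_D _ _ _ (differential_Cminus _ _ _ _ _ (differential_Cmult_const _ (wform rad S p x) _ _ (differential_pc (zero : E4))) (differential_Cmult_const _ (pc x) _ _ D_wform)) _).
    intros h. rewrite Omega_wform. asC. ring.
Qed.

Lemma D_linear_omega x : differential (U := E4) (V := RR) (fun h => omega rad S p x h) zero (fun h => omega rad S p x h).
Proof.
  assert (Dr := differential_Re _ _ _ (differential_pc (zero : E4))). assert (Di := differential_Im _ _ _ (differential_pc (zero : E4))).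
  assert (K := fun k => differential_const (U := E4) (V := RR) k zero).
  assert (D := differential_Rplus _ _ _ _ _
    (differential_Rmult _ _ _ _ _ (K (2 * PI * Vpot rad S (fiber_point S p)))
      (differential_Rminus _ _ _ _ _ (differential_Rmult _ _ _ _ _ (K (Re (pc x))) Di) (differential_Rmult _ _ _ _ _ Dr (K (Im (pc x))))))
    (differential_Rmult _ _ _ _ _ (K (/ (2 * PI * rad)))
      (differential_Rminus _ _ _ _ _ (differential_Rmult _ _ _ _ _ (K (dtheta S p x)) D_beta) (differential_Rmult _ _ _ _ _ D_dtheta (K (beta rad S p x)))))).
  apply (differential_ext _ _ _ _ D). intros h. unfold omega. toR. ring.
Qed.

Lemma omega_antisym q u v : omega rad S q u v = - omega rad S q v u.
Proof. unfold omega. ring. Qed.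

Lemma bilinear_omega : is_bilinear (U := E4) (V := RR) (omega rad S p).
Proof.
  split; intros x.
  - exact (linear_of_D _ _ _ (D_linear_omega x) (fun _ => eq_refl)).
  - exact (linear_of_D _ _ _ (differential_Ropp _ _ _ (D_linear_omega x)) (fun h => eq_sym (omega_antisym p h x))).
Qed.

Lemma is_linear_metric x : is_linear (U := E4) (V := RR) (fun h => 2 * PI * metric rad S p x h).
Proof.
  assert (Dr := differential_Re _ _ _ (differential_pc (zero : E4))). assert (Di := differential_Im _ _ _ (differential_pc (zero : E4))).
  assert (K := fun k => differential_const (U := E4) (V := RR) k zero). set (V := Vpot rad S (fiber_point S p)) in *.
  assert (D := differential_Rplus _ _ _ _ _
    (differential_Rmult _ _ _ _ _ (K (2 * PI * (/ V * (beta rad S p x / (2 * PI) * / (2 * PI))))) D_beta)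
    (differential_Rmult _ _ _ _ _ (K (2 * PI * V))
      (differential_Rplus _ _ _ _ _
        (differential_Rplus _ _ _ _ _ (differential_Rmult _ _ _ _ _ (K (Re (pc x))) Dr) (differential_Rmult _ _ _ _ _ (K (Im (pc x))) Di))
        (differential_Rmult _ _ _ _ _ (K (dtheta S p x / (2 * PI * rad) * / (2 * PI * rad))) D_dtheta)))).
  refine (linear_of_D _ _ _ D _). intros h. unfold metric. fold V. toR. unfold Rdiv. ring.
Qed.

Lemma metric_sym q u v : metric rad S q u v = metric rad S q v u.
Proof. unfold metric. ring. Qed.

Lemma bilinear_metric : is_bilinear (U := E4) (V := RR) (fun u v => 2 * PI * metric rad S p u v).
Proof.
  split; intros x; [apply is_linear_metric|].
  apply (is_linear_ext (U := E4) (V := RR) (fun h => 2 * PI * metric rad S p x h)); [intros h; now rewrite metric_sym|apply is_linear_metric].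
Qed.
End Point.

Lemma Cn_wform n v : Cn (U := E4) (V := CR) n (cover eps) (fun q => wform rad S q v).
Proof.
  assert (H1 := Cn_dtheta rad eps S (proj1 H) n v). assert (H2 := Cn_Vpot rad eps S (proj1 H) n). assert (H3 := Cn_beta rad eps S (proj1 H) n v).
  apply (Cn_pair (U := E4) (V := RR) (W := RR)); cn.
Qed.

Lemma Cn_inv_Vpot n : Cn (U := E4) (V := RR) n (cover eps) (fun q => / Vpot rad S (fiber_point S q)).
Proof.
  apply (Cn_Rinv (U := E4)); [apply open_cover| |apply (Cn_Vpot rad eps S (proj1 H))]. intros p Hp. apply Rgt_not_eq. now apply (Vpot_pos rad eps S H).
Qed.

Lemma smooth_Omega u v : smooth (U := E4) (V := CR) (cover eps) (fun q => Omega rad S q u v).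
Proof.
  intros n. assert (H1 := Cn_wform n u). assert (H2 := Cn_wform n v).
  change (Cn (U := E4) (V := CR) n (cover eps) (fun q => (pc u * wform rad S q v - pc v * wform rad S q u)%C)). cn.
Qed.

Lemma smooth_omega u v : smooth (U := E4) (V := RR) (cover eps) (fun q => omega rad S q u v).
Proof.
  intros n. assert (H1 := Cn_dtheta rad eps S (proj1 H) n u). assert (H2 := Cn_dtheta rad eps S (proj1 H) n v).
  assert (H3 := Cn_beta rad eps S (proj1 H) n u). assert (H4 := Cn_beta rad eps S (proj1 H) n v). assert (H5 := Cn_Vpot rad eps S (proj1 H) n).
  unfold omega. cn.
Qed.

Lemma smooth_metric u v : smooth (U := E4) (V := RR) (cover eps) (fun q => 2 * PI * metric rad S q u v).
Proof.
  intros n. assert (H1 := Cn_dtheta rad eps S (proj1 H) n u). assert (H2 := Cn_dtheta rad eps S (proj1 H) n v).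
  assert (H3 := Cn_beta rad eps S (proj1 H) n u). assert (H4 := Cn_beta rad eps S (proj1 H) n v). assert (H5 := Cn_Vpot rad eps S (proj1 H) n).
  assert (H6 := Cn_inv_Vpot n). unfold metric. cn.
Qed.

Lemma tensor_Omega : tensor2 (V := CR) eps S (Omega rad S).
Proof.
  split; [exact bilinear_Omega|]. split; [exact smooth_Omega|]. intros D a Ha m n p Hp.
  exists (dtranslate S m p). split; [exact (differential_translate rad eps S (proj1 H) D a Ha m n p Hp)|]. intros u v.
  unfold Omega. rewrite !(dtheta_translate rad eps S (proj1 H) D a Ha m n p Hp), !(beta_translate rad eps S (proj1 H) D a Ha m n p Hp),
    (Vpot_translate rad eps S (proj1 H) D a Ha m n p Hp). reflexivity.
Qed.

Lemma tensor_omega : tensor2 (V := RR) eps S (omega rad S).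
Proof.
  split; [exact bilinear_omega|]. split; [exact smooth_omega|]. intros D a Ha m n p Hp.
  exists (dtranslate S m p). split; [exact (differential_translate rad eps S (proj1 H) D a Ha m n p Hp)|]. intros u v.
  unfold omega. rewrite !(dtheta_translate rad eps S (proj1 H) D a Ha m n p Hp), !(beta_translate rad eps S (proj1 H) D a Ha m n p Hp),
    (Vpot_translate rad eps S (proj1 H) D a Ha m n p Hp). reflexivity.
Qed.

Lemma tensor_metric : tensor2 (V := RR) eps S (fun p u v => 2 * PI * metric rad S p u v).
Proof.
  split; [exact bilinear_metric|]. split; [exact smooth_metric|]. intros D a Ha m n p Hp.
  exists (dtranslate S m p). split; [exact (differential_translate rad eps S (proj1 H) D a Ha m n p Hp)|]. intros u v.
  unfold metric. rewrite !(dtheta_translate rad eps S (proj1 H) D a Ha m n p Hp), !(beta_translate rad eps S (proj1 H) D a Ha m n p Hp),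
    (Vpot_translate rad eps S (proj1 H) D a Ha m n p Hp). reflexivity.
Qed.

Lemma riemannian_metric : riemannian eps S (fun p u v => 2 * PI * metric rad S p u v).
Proof.
  split; [exact tensor_metric|]. intros p Hp. split; [intros u v; now rewrite metric_sym|]. intros u Hu. pose proof PI_RGT_0.
  assert (HV := Vpot_pos rad eps S H p Hp). assert (Hr : 0 < rad) by apply H. assert (N := period1_pc_neq rad eps S (proj1 H) p Hp).
  apply Rmult_lt_0_compat; [lra|]. unfold metric. set (V := Vpot rad S (fiber_point S p)) in *.
  assert (HPr : 0 < PI * rad) by (now apply Rmult_lt_0_compat).
  assert (Hne : ~ (Re (pc u) = 0 /\ Im (pc u) = 0 /\ dtheta S p u = 0 /\ beta rad S p u = 0)).
  { intros [E1 [E2 [E3 E4']]]. apply Hu.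
    assert (L1 := linear_zero _ (is_linear_dtheta rad eps S (proj1 H) p Hp)). assert (L2 := linear_zero _ (is_linear_beta rad S p)).
    apply (coframe_inj rad S p); [exact N| |rewrite E3; symmetry; exact L1|rewrite E4'; symmetry; exact L2].
    apply injective_projections; [exact E1|exact E2]. }
  set (x := Re (pc u)) in *. set (y := Im (pc u)) in *. set (t := dtheta S p u) in *. set (b := beta rad S p u) in *.
  assert (Hi : 0 < / V) by now apply Rinv_0_lt_compat.
  assert (A1 : 0 <= / V * (b / (2 * PI) * (b / (2 * PI)))) by (apply Rmult_le_pos; [lra|apply Rle_0_sqr]).
  assert (A2 : 0 <= x * x) by apply Rle_0_sqr. assert (A3 : 0 <= y * y) by apply Rle_0_sqr.
  assert (A4 : 0 <= t / (2 * PI * rad) * (t / (2 * PI * rad))) by apply Rle_0_sqr.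
  assert (A5 : 0 <= V * (x * x + y * y + t / (2 * PI * rad) * (t / (2 * PI * rad)))) by (apply Rmult_le_pos; lra).
  destruct (Rle_lt_dec (/ V * (b / (2 * PI) * (b / (2 * PI))) + V * (x * x + y * y + t / (2 * PI * rad) * (t / (2 * PI * rad)))) 0) as [Hle|]; auto.
  exfalso. apply Hne.
  assert (B1 : b / (2 * PI) * (b / (2 * PI)) = 0) by (apply (Rmult_eq_reg_l (/ V)); lra).
  assert (B2 : x * x + y * y + t / (2 * PI * rad) * (t / (2 * PI * rad)) = 0) by (apply (Rmult_eq_reg_l V); lra).
  assert (B3 : x * x = 0) by lra. assert (B4 : y * y = 0) by lra. assert (B5 : t / (2 * PI * rad) * (t / (2 * PI * rad)) = 0) by lra.
  assert (Q : forall z, z * z = 0 -> z = 0) by (intros z Hz; destruct (Rmult_integral _ _ Hz); auto).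
  apply Q in B1, B3, B4, B5. repeat split; auto.
  - replace t with (t / (2 * PI * rad) * (2 * PI * rad)) by (field; lra). rewrite B5. ring.
  - replace b with (b / (2 * PI) * (2 * PI)) by (field; lra). rewrite B1. ring.
Qed.
End Tensors.

(** * Closedness of the forms *)

Section Closed.
Context (rad eps : R) (S : C -> R) (H : good rad eps S) (p : pt) (Hp : cover eps p).

Definition ddtheta (v w : pt) : R :=
  - (dtheta S p v * Re (dperiod S (pc p) * pc w)%C + dtheta S p w * Re (dperiod S (pc p) * pc v)%C) / period1 S (pc p)
  - theta_e S p / period1 S (pc p) * Re (ddperiod S (pc p) * pc w * pc v)%C.

Definition dVpot (w : pt) : R :=
  rad / (2 * PI) * (Re (dperiod S (pc p) * pc w)%C + (PI * rad * Re (dmom_base rad (fiber_point S p) * Cconj (pc w))%C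
    + dtheta S p w * dmom_angle rad (fiber_point S p) / 2)).

Definition dbeta (v w : pt) : R :=
  - (dtheta S p w / (2 * PI)) * Im (dperiod S (pc p) * pc v)%C - theta_e S p / (2 * PI) * Im (ddperiod S (pc p) * pc w * pc v)%C
  - rad / 2 * Re (dodd_moment rad (fiber_point S p) (pc w, dtheta S p w) * Cconj (pc v))%C.

Definition dwform (v w : pt) : C :=
  (ddtheta v w * (Vpot rad S (fiber_point S p) / rad) + dtheta S p v * (dVpot w / rad), dbeta v w)%R.

Lemma ddtheta_sym v w : ddtheta v w = ddtheta w v.
Proof.
  unfold ddtheta. replace (ddperiod S (pc p) * pc w * pc v)%C with (ddperiod S (pc p) * pc v * pc w)%C by ring. field.
  exact (period1_pc_neq rad eps S (proj1 H) p Hp).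
Qed.

Lemma differential_wform v : differential (U := E4) (V := CR) (fun q => wform rad S q v) p (dwform v).
Proof.
  assert (D := differential_Cpair _ _ _ _ _ (differential_Rmult _ _ _ _ _ (differential_dtheta rad eps S (proj1 H) p Hp v)
    (differential_Rmult _ _ _ _ _ (differential_Vpot rad eps S (proj1 H) p Hp) (differential_const (U := E4) (V := RR) (/ rad) p)))
    (differential_beta rad eps S (proj1 H) p Hp v)).
  apply (differential_ext _ _ _ _ D). intros h. unfold dwform, ddtheta, dVpot, dbeta. f_equal. toR. unfold Rdiv. ring.
Qed.

(** Up to sign, [wcurv] and [kcurv] are the coefficients of [dc /\ dtheta] and of [dc] wedge its
    conjugate in the exterior derivative of [w]. *)
Definition wcurv : C := (/ RtoC (2 * PI) * (dperiod S (pc p) + RtoC (PI * rad) * Cconj (dmom_base rad (fiber_point S p))))%C.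
Definition kcurv : C := (/ 2 * RtoC (PI * rad ^ 2 * dmom_angle rad (fiber_point S p)))%C.

(** The [(1,0)]-form [w] is not closed, but its exterior derivative is a multiple of [dc]. *)
Lemma dwform_antisym v w :
  (dwform v w - dwform w v)%C = (wcurv * (pc w * RtoC (dtheta S p v) - pc v * RtoC (dtheta S p w))
   + kcurv * (pc v * Cconj (pc w) - pc w * Cconj (pc v)))%C.
Proof.
  unfold wcurv, kcurv, dwform. rewrite (ddtheta_sym v w). unfold dVpot, dbeta, dodd_moment. simpl fst. simpl snd.
  pose proof PI_RGT_0. assert (Hr : 0 < rad) by apply H.
  rewrite <- RtoC_inv by lra.
  generalize (ddtheta w v) (dtheta S p v) (dtheta S p w) (dmom_angle rad (fiber_point S p)) (theta_e S p).
  generalize (dperiod S (pc p)) (ddperiod S (pc p)) (dmom_base rad (fiber_point S p)) (dmom_conj rad (fiber_point S p)) (pc v) (pc w).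
  intros [T1 T2] [D1 D2] [b1 b2] [x1 x2] [v1 v2] [w1 w2] dt tv tw s th. generalize (Vpot rad S (fiber_point S p)). intros V.
  apply injective_projections; simpl; field; lra.
Qed.

Lemma closed_Omega : closed2 (U := E4) (V := CR) (Omega rad S) p.
Proof.
  exists (fun u v h => (pc u * dwform v h - pc v * dwform u h)%C). split.
  - intros u v. exact (differential_Cminus _ _ _ _ _ (differential_Cmult_const _ (pc u) _ _ (differential_wform v)) (differential_Cmult_const _ (pc v) _ _ (differential_wform u))).
  - intros u v w. toC.
    (* Regrouped into the cyclic sum that represents [dc /\ dw]. *)
    transitivity (pc u * (dwform v w - dwform w v) + pc v * (dwform w u - dwform u w) + pc w * (dwform u v - dwform v u))%C; [ring|].
    rewrite !dwform_antisym. ring.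
Qed.

Lemma closed_omega : closed2 (U := E4) (V := RR) (omega rad S) p.
Proof.
  exists (fun u v h => 2 * PI * dVpot h * (Re (pc u) * Im (pc v) - Re (pc v) * Im (pc u))
    + / (2 * PI * rad) * (ddtheta u h * beta rad S p v + dtheta S p u * dbeta v h - ddtheta v h * beta rad S p u - dtheta S p v * dbeta u h)).
  split.
  - intros u v.
    assert (D := differential_Rplus _ _ _ _ _
      (differential_Rmult _ _ _ _ _ (differential_Rmult _ _ _ _ _ (differential_const (U := E4) (V := RR) (2 * PI) p) (differential_Vpot rad eps S (proj1 H) p Hp))
         (differential_const (U := E4) (V := RR) (Re (pc u) * Im (pc v) - Re (pc v) * Im (pc u)) p))
      (differential_Rmult _ _ _ _ _ (differential_const (U := E4) (V := RR) (/ (2 * PI * rad)) p)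
        (differential_Rminus _ _ _ _ _
          (differential_Rmult _ _ _ _ _ (differential_dtheta rad eps S (proj1 H) p Hp u) (differential_beta rad eps S (proj1 H) p Hp v))
          (differential_Rmult _ _ _ _ _ (differential_dtheta rad eps S (proj1 H) p Hp v) (differential_beta rad eps S (proj1 H) p Hp u))))).
    apply (differential_ext _ _ _ _ D). intros h. unfold ddtheta, dVpot, dbeta. toR. ring.
  - intros u v w. toR.
    (* [dbeta] enters the cyclic sum through its antisymmetric part, which is the imaginary part of
       that of [dwform]; the derivatives of [dtheta] cancel by symmetry. *)
    assert (EB : forall x y, dbeta x y = dbeta y x + Im (dwform x y - dwform y x)%C) by (intros x y; unfold dwform; simpl; ring).
    rewrite (EB v w), (EB w u), (EB u v), !dwform_antisym, (ddtheta_sym w v), (ddtheta_sym u w), (ddtheta_sym v u).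
    unfold wcurv, kcurv, dVpot. pose proof PI_RGT_0. assert (Hr : 0 < rad) by apply H. rewrite <- RtoC_inv by lra.
    generalize (dbeta w v) (dbeta u w) (dbeta v u) (ddtheta v w) (ddtheta w u) (ddtheta u v) (beta rad S p u) (beta rad S p v) (beta rad S p w)
      (dtheta S p u) (dtheta S p v) (dtheta S p w) (dmom_angle rad (fiber_point S p)).
    generalize (dperiod S (pc p)) (dmom_base rad (fiber_point S p)) (pc u) (pc v) (pc w).
    intros [T1 T2] [b1 b2] [u1 u2] [v1 v2] [w1 w2]. intros. simpl. field. lra.
Qed.
End Closed.

(** * Integrability of the complex structure *)

Lemma differential_unique {U : RNorm} (f : U -> CR) p L1 L2 : differential f p L1 -> differential f p L2 -> forall h, L1 h = L2 h.
Proof.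
  intros D1 D2 h. replace p with (plus p (scal 0 h)) in D1, D2 by (rewrite (scal_zero_l (K := R_AbsRing)); apply plus_zero_r).
  assert (E : forall L, differential f (plus p (scal 0 h)) L -> Derive (fun s : R => Re (f (plus p (scal s h)))) 0 = Re (L h) /\ Derive (fun s : R => Im (f (plus p (scal s h)))) 0 = Im (L h)).
  { intros L D. split; apply is_derive_unique.
    - exact (differential_line (V := RR) _ p h 0 _ (differential_Re _ _ _ D)).
    - exact (differential_line (V := RR) _ p h 0 _ (differential_Im _ _ _ D)). }
  destruct (E _ D1) as [A1 A2]. destruct (E _ D2) as [B1 B2]. asC. apply injective_projections; [change (Re (L1 h) = Re (L2 h))|change (Im (L1 h) = Im (L2 h))]; congruence.
Qed.

Definition e1 : E4 := (RtoC 1, (0, 0)).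
Definition e2 : E4 := (Ci, (0, 0)).
Definition e3 : E4 := (RtoC 0, (1, 0)).
Definition e4 : E4 := (RtoC 0, (0, 1)).

Lemma linear_expand (l : E4 -> CR) (x : E4) : is_linear l ->
  l x = (RtoC (Re (pc x)) * l e1 + RtoC (Im (pc x)) * l e2 + RtoC (pt1 x) * l e3 + RtoC (pt2 x) * l e4)%C.
Proof.
  intros Hl.
  assert (E : x = plus (plus (plus (scal (Re (pc x)) e1) (scal (Im (pc x)) e2)) (scal (pt1 x) e3)) (scal (pt2 x) e4)).
  { revert x. assert (G : forall c1 c2 t1 t2 : R, ((c1, c2, (t1, t2)) : E4) = plus (plus (plus (scal (Re (pc (c1, c2, (t1, t2)))) e1) (scal (Im (pc (c1, c2, (t1, t2)))) e2)) (scal (pt1 (c1, c2, (t1, t2))) e3)) (scal (pt2 (c1, c2, (t1, t2))) e4)); [|intros [[c1 c2] [t1 t2]]; exact (G c1 c2 t1 t2)].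
    intros c1 c2 t1 t2. unfold e1, e2, e3, e4, pc, pt1, pt2. simpl.
    apply injective_projections; apply injective_projections; simpl; unfold plus, scal; simpl; unfold mult; simpl; asR; ring. }
  rewrite E at 1. clear E. rewrite !(linear_plus _ Hl), !(linear_scal _ Hl). toC.
  generalize (l e1) (l e2) (l e3) (l e4). intros [] [] [] []. apply injective_projections; simpl; unfold scal; simpl; unfold mult; simpl; ring.
Qed.

(** The product rule for a varying linear form applied to a varying vector. In the coordinates given
    by [e1], [e2], [e3], [e4] it is the rule for products of scalar functions; uniqueness of
    differentials shows that [DA x h] depends linearly on [x]. *)
Lemma differential_apply (A DA : E4 -> E4 -> CR) (f df : E4 -> E4) p :
  locally p (fun q => is_linear (A q)) -> (forall x, differential (fun q => A q x) p (DA x)) -> differential f p df ->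
  differential (fun q => A q (f q)) p (fun h => (A p (df h) + DA (f p) h)%C).
Proof.
  intros HA HD Hf. assert (HAp := locally_singleton _ _ HA).
  set (C0 := fun x (F : E4 -> C) => (RtoC (Re (pc x)) * F e1 + RtoC (Im (pc x)) * F e2 + RtoC (pt1 x) * F e3 + RtoC (pt2 x) * F e4)%C).
  assert (K : forall g dg, differential g p dg -> differential (V := CR) (fun q => C0 (g q) (A q)) p (fun h => (C0 (dg h) (A p) + C0 (g p) (fun e => DA e h))%C)).
  { intros g dg Dg.
    assert (Dc := differential_comp (U := E4) (V := E4) (W := CR) _ _ _ _ _ Dg (differential_pc (g p))).
    assert (D1 := differential_comp (U := E4) (V := E4) (W := RR) _ _ _ _ _ Dg (differential_pt1 (g p))).
    assert (D2 := differential_comp (U := E4) (V := E4) (W := RR) _ _ _ _ _ Dg (differential_pt2 (g p))).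
    assert (D := differential_Cplus _ _ _ _ _ (differential_Cplus _ _ _ _ _ (differential_Cplus _ _ _ _ _
      (differential_Cmult _ _ _ _ _ (differential_RtoC _ _ _ (differential_Re _ _ _ Dc)) (HD e1))
      (differential_Cmult _ _ _ _ _ (differential_RtoC _ _ _ (differential_Im _ _ _ Dc)) (HD e2)))
      (differential_Cmult _ _ _ _ _ (differential_RtoC _ _ _ D1) (HD e3)))
      (differential_Cmult _ _ _ _ _ (differential_RtoC _ _ _ D2) (HD e4))).
    apply (differential_ext _ _ _ _ D). intros h. unfold C0. asC. ring. }
  assert (EL : forall x h, DA x h = C0 x (fun e => DA e h)).
  { intros x h. apply (differential_unique (fun q => A q x) p (DA x) (fun h => C0 x (fun e => DA e h)) (HD x)).
    apply (differential_eq_near (U := E4) (V := CR) (fun q => C0 x (A q))).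
    - generalize HA. apply filter_imp. intros q Hq. symmetry. exact (linear_expand _ x Hq).
    - apply (differential_ext _ _ _ _ (K (fun _ => x) _ (differential_const x p))). intros k.
      transitivity (C0 zero (A p) + C0 x (fun e => DA e k))%C; [reflexivity|].
      replace (C0 zero (A p)) with (RtoC 0) by (unfold C0; change (pc (zero : E4)) with (RtoC 0); change (pt1 (zero : E4)) with 0; change (pt2 (zero : E4)) with 0; simpl; ring).
      asC. ring. }
  apply (differential_eq_near (U := E4) (V := CR) (fun q => C0 (f q) (A q))).
  - generalize HA. apply filter_imp. intros q Hq. symmetry. exact (linear_expand _ (f q) Hq).
  - apply (differential_ext _ _ _ _ (K f df Hf)). intros h. rewrite EL. f_equal. symmetry. exact (linear_expand _ (df h) HAp).
Qed.

Section Complex.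
Context (rad eps : R) (S : C -> R) (H : good rad eps S).

Lemma smooth_Jop u : smooth (U := E4) (V := E4) (cover eps) (fun q => Jop rad S q u).
Proof.
  intros n. assert (H1 := Cn_dtheta rad eps S (proj1 H) n u). assert (H2 := Cn_beta rad eps S (proj1 H) n u).
  assert (H3 := Cn_Vpot rad eps S (proj1 H) n). assert (H4 := Cn_inv_Vpot rad eps S H n). assert (H5 := Cn_period1_pc rad eps S (proj1 H) n).
  assert (H6 := Cn_theta_e rad eps S (proj1 H) n). assert (H7 := Cn_dperiod_pc rad eps S (proj1 H) n). assert (H8 := Cn_odd_moment rad eps S (proj1 H) n).
  unfold Jop, frame.
  apply (Cn_pair (U := E4) (V := CR) (W := prod_NormedModule R_AbsRing RR RR)); [exact (Cn_const (U := E4) (V := CR) n _ (Ci * pc u)%C)|].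
  apply (Cn_pair (U := E4) (V := RR) (W := RR)); cn.
Qed.

Lemma linear_Jop p : cover eps p -> is_linear (U := E4) (V := E4) (Jop rad S p).
Proof.
  intros Hp. assert (Dt := D_dtheta rad eps S H p Hp). assert (Db := D_beta rad S p).
  assert (K := fun k => differential_const (U := E4) (V := RR) k zero).
  set (V := Vpot rad S (fiber_point S p)).
  assert (Dc := differential_Cmult_const _ Ci _ _ (differential_pc (zero : E4))).
  assert (D := differential_pair (U := E4) (V := CR) (W := prod_NormedModule R_AbsRing RR RR) _ _ _ _ _ Dc
    (differential_pair (U := E4) (V := RR) (W := RR) _ _ _ _ _
     (differential_Rplus _ _ _ _ _ (differential_Rmult _ _ _ _ _ (K (period1 S (pc p) / (2 * PI) * - (rad * / V))) Db)
        (differential_Rmult _ _ _ _ _ (K (theta_e S p / (2 * PI))) (differential_Re _ _ _ (differential_Cmult_const _ (dperiod S (pc p)) _ _ Dc))))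
     (differential_Rminus _ _ _ _ _ (differential_Rminus _ _ _ _ _ (differential_Rmult _ _ _ _ _ (K (- (V * / rad))) Dt)
        (differential_Rmult _ _ _ _ _ (K (theta_e S p / (2 * PI))) (differential_Im _ _ _ (differential_Cmult_const _ (dperiod S (pc p)) _ _ Dc))))
        (differential_Rmult _ _ _ _ _ (K (rad / 2)) (differential_Re _ _ _ (differential_Cmult_const _ (odd_moment rad (fiber_point S p)) _ _ (differential_Cconj _ _ _ Dc))))))).
  refine (linear_of_D _ _ _ D _). intros h. unfold Jop, frame. fold V. f_equal. f_equal; toR; ring.
Qed.

Lemma wform_Jop p u : cover eps p -> wform rad S p (Jop rad S p u) = (Ci * wform rad S p u)%C.
Proof.
  intros Hp. assert (HV := Vpot_pos rad eps S H p Hp). assert (Hr : 0 < rad) by apply H.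
  unfold wform. rewrite (dtheta_Jop rad eps S H p Hp), (beta_Jop rad S p). apply injective_projections; simpl; field; lra.
Qed.

Lemma is_linear_wform p : cover eps p -> is_linear (U := E4) (V := CR) (wform rad S p).
Proof. intros Hp. exact (differential_is_linear _ _ _ (D_wform rad eps S H p Hp)). Qed.

(** The tensor is tested against [dc] and [w]. Differentiating [dc (J x) = i dc (x)] gives
    [dc (dJ x h) = 0]; differentiating [w (J x) = i w (x)] expresses [w (dJ x h)] through the
    derivatives of [w]. Only exterior derivatives of [w] are left, and these have no part of type
    (0,2). *)
Lemma nijenhuis_Jop p : cover eps p -> nijenhuis_zero (U := E4) (Jop rad S) p.
Proof.
  intros Hp.
  (* [nijenhuis_zero] asks for a single function on all constant fields, so a differential is chosen
     for each of them. *)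
  destruct (functional_choice (fun (u : E4) (L : E4 -> E4) => differential (U := E4) (V := E4) (fun q => Jop rad S q u) p L)) as [dJ HdJ].
  { intros u. destruct (smooth_Jop u 1%nat) as [df [H1 _]]. exists (df p). now apply H1. }
  exists dJ. split; [exact HdJ|]. intros u v.
  assert (Lc := differential_is_linear _ _ _ (differential_pc (zero : E4))). assert (Lw := is_linear_wform p Hp).
  assert (Hloc : locally (p : E4) (fun q : E4 => cover eps q)) by (apply open_cover; exact Hp).
  assert (Hlin : locally (p : E4) (fun q : E4 => is_linear (U := E4) (V := CR) (wform rad S q))).
  { generalize Hloc. apply filter_imp. intros q Hq. now apply is_linear_wform. }
  assert (HlocJ : forall x, locally (p : E4) (fun q : E4 => (Ci * wform rad S q x)%C = wform rad S q (Jop rad S q x))).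
  { intros x. generalize Hloc. apply filter_imp. intros q Hq. symmetry. now apply wform_Jop. }
  assert (Jc : forall x h, pc (dJ x h) = RtoC 0).
  { intros x h. apply (differential_unique (U := E4) (fun q => (Ci * pc x)%C) p (fun h => pc (dJ x h)) (fun _ => RtoC 0)).
    - exact (differential_comp (U := E4) (V := E4) (W := CR) _ _ _ _ _ (HdJ x) (differential_pc (Jop rad S p x))).
    - exact (differential_const (U := E4) (V := CR) (Ci * pc x)%C p). }
  assert (Jw : forall x h, wform rad S p (dJ x h) = (Ci * dwform rad S p x h - dwform rad S p (Jop rad S p x) h)%C).
  { intros x h.
    assert (D1 := differential_apply (wform rad S) (dwform rad S p) _ _ p Hlin (differential_wform rad eps S H p Hp) (HdJ x)).
    assert (D2 := differential_Cmult_const _ Ci _ _ (differential_wform rad eps S H p Hp x)).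
    assert (E : (wform rad S p (dJ x h) + dwform rad S p (Jop rad S p x) h)%C = (Ci * dwform rad S p x h)%C).
    { apply (differential_unique _ p _ _ D1 (differential_eq_near _ _ _ _ (HlocJ x) D2)). }
    rewrite <- E. ring. }
  assert (Pc : forall x y : E4, pc (plus x y) = (pc x + pc y)%C) by exact (linear_plus _ Lc).
  assert (Oc : forall x : E4, pc (opp x) = (- pc x)%C) by exact (fun x => linear_opp _ x Lc).
  assert (Pw : forall x y : E4, wform rad S p (plus x y) = (wform rad S p x + wform rad S p y)%C) by exact (linear_plus _ Lw).
  assert (Ow : forall x : E4, wform rad S p (opp x) = (- wform rad S p x)%C) by exact (fun x => linear_opp _ x Lw).
  set (N := @plus E4 (@minus E4 (dJ v (Jop rad S p u)) (dJ u (Jop rad S p v))) (@minus E4 (Jop rad S p (dJ u v)) (Jop rad S p (dJ v u)))).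
  assert (Ec : pc N = RtoC 0).
  { unfold N, minus. rewrite !Pc, !Oc. rewrite !pc_Jop, !Jc. toC. ring. }
  assert (Ew : wform rad S p N = RtoC 0).
  { unfold N, minus. rewrite !Pw, !Ow. rewrite !wform_Jop, !Jw by auto. toC.
    set (J := Jop rad S p) in *.
    (* Four values of the exterior derivative of [w], with [J] applied to one, both or none of the
       arguments. They cancel because each is a multiple of [dc], and [dc (J u) = i dc (u)]. *)
    transitivity (Ci * (dwform rad S p v (J u) - dwform rad S p (J u) v) + Ci * (dwform rad S p (J v) u - dwform rad S p u (J v))
      + (dwform rad S p (J u) (J v) - dwform rad S p (J v) (J u)) + Ci * Ci * (dwform rad S p u v - dwform rad S p v u))%C; [ring|].
    rewrite !(dwform_antisym rad eps S H p Hp). unfold J. rewrite !pc_Jop. generalize (wcurv rad S p) (kcurv rad S p) (pc u) (pc v)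
      (dtheta S p u) (dtheta S p v) (dtheta S p (Jop rad S p u)) (dtheta S p (Jop rad S p v)).
    intros [k1 k2] [l1 l2] [u1 u2] [v1 v2] t1 t2 t3 t4. apply injective_projections; simpl; ring. }
  assert (HV := Vpot_pos rad eps S H p Hp). assert (Hr : 0 < rad) by apply H.
  change (N = zero). apply (coframe_inj rad S p); [exact (period1_pc_neq rad eps S (proj1 H) p Hp)|rewrite Ec; reflexivity| |].
  - etransitivity; [|symmetry; exact (linear_zero _ (is_linear_dtheta rad eps S (proj1 H) p Hp))]. toR.
    apply (f_equal fst) in Ew. change (dtheta S p N * (Vpot rad S (fiber_point S p) / rad) = 0) in Ew.
    apply (Rmult_eq_reg_r (Vpot rad S (fiber_point S p) / rad)); [rewrite Ew; ring|]. apply Rgt_not_eq. now apply Rdiv_lt_0_compat.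
  - etransitivity; [|symmetry; exact (linear_zero _ (is_linear_beta rad S p))].
    apply (f_equal snd) in Ew. exact Ew.
Qed.
End Complex.

Section Hyperkahler.
Context (rad eps : R) (S : C -> R) (H : good rad eps S).

Lemma complex_structure_Jop : complex_structure eps S (Jop rad S).
Proof.
  split; [|split; [|split]].
  - intros p Hp. split; [now apply (linear_Jop rad eps)|]. intros u. now apply (Jop_sqr rad eps).
  - exact (smooth_Jop rad eps S H).
  - exact (nijenhuis_Jop rad eps S H).
  - intros D a Ha m n p Hp. exists (dtranslate S m p). split; [exact (differential_translate rad eps S (proj1 H) D a Ha m n p Hp)|].
    exact (Jop_translate rad eps S (proj1 H) D a Ha m n p Hp).
Qed.

Lemma holomorphic_symplectic_Omega : holomorphic_symplectic eps S (Jop rad S) (Omega rad S).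
Proof.
  split; [split; [exact (tensor_Omega rad eps S H)|]|].
  - intros p Hp u v. rewrite !Omega_wform. toC. ring.
  - intros p Hp. assert (N := period1_pc_neq rad eps S (proj1 H) p Hp).
    assert (HV := Vpot_pos rad eps S H p Hp). assert (Hr : 0 < rad) by apply H.
    split; [exact (closed_Omega rad eps S H p Hp)|]. split.
    + intros u v. rewrite !Omega_wform, pc_Jop, (wform_Jop rad eps S H) by auto. asC. ring.
    + intros u Hu.
      assert (W : forall c t b, wform rad S p (frame rad S p c t b) = (t * (Vpot rad S (fiber_point S p) / rad), b)%R).
      { intros c t b. unfold wform. now rewrite dtheta_frame, beta_frame. }
      (* The test vector with [dc = 1], [w = 0] detects [w (u)], and the one with [dc = 0], [w = i]
         detects [dc (u)]. *)
      assert (E1 := Hu (frame rad S p 1 0 0)). assert (E2 := Hu (frame rad S p 0 0 1)).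
      rewrite Omega_wform, W in E1, E2. change (pc (frame rad S p 1 0 0)) with (RtoC 1) in E1. change (pc (frame rad S p 0 0 1)) with (RtoC 0) in E2.
      assert (F1 : wform rad S p u = RtoC 0).
      { replace (0 * (Vpot rad S (fiber_point S p) / rad), 0)%R with (RtoC 0) in E1 by (rewrite Rmult_0_l; reflexivity).
        transitivity (- (pc u * 0 - 1 * wform rad S p u))%C; [|rewrite E1]; asC; ring. }
      assert (F2 : pc u = RtoC 0).
      { replace (0 * (Vpot rad S (fiber_point S p) / rad), 1)%R with Ci in E2 by (unfold Ci; f_equal; ring).
        transitivity (- (1) * Ci * (pc u * Ci - 0 * wform rad S p u))%C; [|rewrite E2; asC; ring].
        transitivity (- (Ci * Ci) * pc u)%C; [rewrite Ci_sqr; ring|ring]. }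
      apply (coframe_inj rad S p); [exact N|exact F2| |].
      * etransitivity; [|symmetry; exact (linear_zero _ (is_linear_dtheta rad eps S (proj1 H) p Hp))]. toR.
        apply (f_equal fst) in F1. change (dtheta S p u * (Vpot rad S (fiber_point S p) / rad) = 0) in F1.
        apply (Rmult_eq_reg_r (Vpot rad S (fiber_point S p) / rad)); [rewrite F1; ring|]. apply Rgt_not_eq. now apply Rdiv_lt_0_compat.
      * etransitivity; [|symmetry; exact (linear_zero _ (is_linear_beta rad S p))].
        apply (f_equal snd) in F1. exact F1.
Qed.

Lemma kahler_form_omega : kahler_form eps S (Jop rad S) (fun p u v => 2 * PI * metric rad S p u v) (omega rad S).
Proof.
  split; [split; [exact (tensor_omega rad eps S H)|]|].
  - intros p Hp u v. toR. apply omega_antisym.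
  - intros p Hp. pose proof PI_RGT_0.
    assert (HV := Vpot_pos rad eps S H p Hp). assert (Hr : 0 < rad) by apply H.
    split; [exact (closed_omega rad eps S H p Hp)|]. split; intros u v.
    + unfold metric. rewrite !pc_Jop, !(dtheta_Jop rad eps S H p Hp), !beta_Jop.
      generalize (pc u) (pc v). intros [u1 u2] [v1 v2]. simpl. field. lra.
    + unfold metric, omega. rewrite !pc_Jop, !(dtheta_Jop rad eps S H p Hp), !beta_Jop.
      generalize (pc u) (pc v). intros [u1 u2] [v1 v2]. simpl. field. lra.
Qed.

Lemma omega_sqr p : cover eps p -> forall u v w x,
  wedge22 (fun y z => RtoC (omega rad S p y z)) (fun y z => RtoC (omega rad S p y z)) u v w x
  = (/ 2 * wedge22 (Omega rad S p) (fun y z => Cconj (Omega rad S p y z)) u v w x)%C.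
Proof.
  intros Hp u v w x. pose proof PI_RGT_0. assert (Hr : 0 < rad) by apply H.
  replace (/ 2)%C with (RtoC (/ 2)) by (rewrite RtoC_inv by lra; reflexivity).
  unfold wedge22. rewrite !Omega_wform. unfold wform, omega. generalize (Vpot rad S (fiber_point S p)). intros V.
  generalize (dtheta S p u) (dtheta S p v) (dtheta S p w) (dtheta S p x) (beta rad S p u) (beta rad S p v) (beta rad S p w) (beta rad S p x).
  generalize (pc u) (pc v) (pc w) (pc x). intros [u1 u2] [v1 v2] [w1 w2] [x1 x2] tu tv tw tx bu bv bw bx.
  apply injective_projections; simpl; field; lra.
Qed.

Lemma hyperkahler : gives_hyperkahler eps S (Omega rad S) (omega rad S) (fun p u v => 2 * PI * metric rad S p u v).
Proof.
  split; [exact (riemannian_metric rad eps S H)|]. split; [|exact omega_sqr].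
  exists (Jop rad S). split; [exact complex_structure_Jop|]. split; [exact holomorphic_symplectic_Omega|exact kahler_form_omega].
Qed.
End Hyperkahler.

(** * The Gibbons-Hawking form *)

Lemma potential_Vpot rad S (x : C * R) : 0 < rad -> fst x <> RtoC 0 -> potential rad S x = Vpot rad S x.
Proof. destruct x as [c th]. exact (potential_eq rad S c th). Qed.

Lemma Re_imaginary_conj M u h : Re (2 * Ci * RtoC M * (u * Cconj h))%C = 2 * M * Im (Cconj u * h)%C.
Proof. destruct u, h. simpl. ring. Qed.

(** The Bessel series is [i |c| M] and [odd_moment] is [- 2 i M c / |c|] with the same real [M], so
    both instanton terms are the same multiple of [Im (dc / c)]. In particular the connection form
    is real, although it is written with complex quantities. *)
Lemma connection_eq rad eps D a S (x w : C * R) : 0 < rad -> arg_branch eps D a -> D (fst x) ->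
  connection rad S a x w = RtoC (- (/ (4 * PI ^ 2)) * period2 S a (fst x) * snd w - rad / (4 * PI) * Re (odd_moment rad x * Cconj (fst w))%C).
Proof.
  intros Hr Ha Hx. pose proof PI_RGT_0. assert (HB := proj1 (proj2 Ha _ Hx)).
  destruct x as [c th]. simpl fst in *. assert (Hc : c <> RtoC 0) by now apply Cmod_gt_0, HB.
  assert (Hp : 0 < Cmod c) by apply HB. set (rho := Cmod c) in *.
  assert (Hrr : RtoC rho <> RtoC 0) by (intros E; apply RtoC_inj in E; lra).
  destruct (connection_sum rad c th Hr Hc) as [M [EM ES]]. fold rho in EM, ES.
  assert (Eodd : odd_moment rad (c, th) = (2 * Ci * RtoC M * (- c / RtoC rho))%C).
  { rewrite <- EM. unfold odd_moment, moment. simpl fst. simpl snd. fold rho. simpl Cpow. rewrite !Cmult_conj, Cconj_conj.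
    replace (Cconj 1) with (RtoC 1) by (apply injective_projections; simpl; ring). unfold Cminus. ring. }
  unfold connection, A_sf, A_inst. simpl fst. simpl snd. fold rho. rewrite ES, Eodd.
  replace (2 * Ci * RtoC M * (- c / RtoC rho) * Cconj (fst w))%C with (2 * Ci * RtoC M * ((- c / RtoC rho) * Cconj (fst w)))%C by ring.
  rewrite Re_imaginary_conj.
  assert (Ec : (Cconj (- c / RtoC rho) * fst w)%C = (RtoC (- rho) * (fst w / c))%C).
  { assert (E := Cmod_sqr_conj c). fold rho in E. rewrite RtoC_mult in E.
    rewrite Cdiv_conj, Copp_conj by auto. replace (Cconj (RtoC rho)) with (RtoC rho) by (apply injective_projections; simpl; ring).
    transitivity (- (c * Cconj c) / (RtoC rho * c) * fst w)%C; [field; auto|]. rewrite E, RtoC_opp. field. auto. }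
  rewrite Ec.
  assert (Ed : (fst w / c - Cconj (fst w) / Cconj c)%C = (2 * Ci * RtoC (Im (fst w / c)%C))%C).
  { rewrite <- Cdiv_conj by auto. generalize (fst w / c)%C. intros [z1 z2]. apply injective_projections; simpl; ring. }
  rewrite Ed. unfold period2, lnC. generalize (fst w / c)%C. intros [z1 z2].
  replace (RtoC (8 * PI ^ 2)) with (RtoC 8 * RtoC (PI ^ 2))%C by (now rewrite RtoC_mult).
  assert (HP2 : PI ^ 2 <> 0) by (apply pow_nonzero; lra).
  unfold Cdiv. rewrite <- RtoC_mult, <- RtoC_inv by lra.
  apply injective_projections; simpl; field; lra.
Qed.

Definition dVpot3 (rad : R) (S : C -> R) (x h : C * R) : R :=
  rad / (2 * PI) * (Re (dperiod S (fst x) * fst h)%C + (PI * rad * Re (dmom_base rad x * Cconj (fst h))%C + snd h * dmom_angle rad x / 2)).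

(** The differentials of connection and potential share the coefficients [dperiod], [dmom_base] and
    [dmom_angle]; the contribution of [dmom_conj] is symmetric in the two directions and cancels in
    the exterior derivative. For the periods the equation is that of Cauchy and Riemann. *)
Lemma monopole rad eps D a S (x : C * R) : 0 < rad -> smoothC S -> harmonic S -> arg_branch eps D a -> D (fst x) ->
  monopole_eq rad S a x.
Proof.
  intros Hr HS HH Ha Hx. pose proof PI_RGT_0. assert (Hc : fst x <> RtoC 0) by (apply Cmod_gt_0, (proj2 Ha _ Hx)).
  assert (Df : differential (U := E3) (V := CR) (fun y : C * R => fst y) x (fun h : C * R => fst h)) by (apply differential_linear, (is_linear_fst (U := CR) (V := RR))).
  assert (HD : locally (x : E3) (fun y : C * R => D (fst y))) by exact (differential_continuous _ _ _ Df _ (proj1 Ha _ Hx)).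
  exists (fun e h => RtoC (/ (4 * PI ^ 2) * Im (dperiod S (fst x) * fst h)%C * snd e - rad / (4 * PI) * Re (dodd_moment rad x h * Cconj (fst e))%C)).
  exists (dVpot3 rad S x). split; [|split].
  - intros e.
    assert (D2 := differential_comp (U := E3) (V := CR) (W := RR) _ _ _ _ _ Df (differential_period2 eps D a S _ HS HH Ha Hx)).
    assert (D3 := differential_RtoC _ _ _ (differential_Rminus _ _ _ _ _
      (differential_Rmult _ _ _ _ _ D2 (differential_const (U := E3) (V := RR) (- (/ (4 * PI ^ 2)) * snd e) x))
      (differential_Rmult _ _ _ _ _ (differential_const (U := E3) (V := RR) (rad / (4 * PI)) x)
        (differential_Re _ _ _ (differential_Cmult_const _ (Cconj (fst e)) _ _ (differential_odd_moment rad x Hr Hc)))))).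
    apply (differential_eq_near (U := E3) (V := CR) (fun y : C * R => RtoC (period2 S a (fst y) * (- (/ (4 * PI ^ 2)) * snd e) - rad / (4 * PI) * Re (Cconj (fst e) * odd_moment rad y)%C))).
    + generalize HD. apply filter_imp. intros y Hy. rewrite (connection_eq rad eps D a S y e Hr Ha Hy). rewrite (Cmult_comm (Cconj (fst e))).
      asC. f_equal. ring.
    + apply (differential_ext _ _ _ _ D3). intros h. rewrite !(Cmult_comm (Cconj (fst e))). asC. f_equal. toR. ring.
  - assert (D2 := differential_comp (U := E3) (V := CR) (W := RR) _ _ _ _ _ Df (differential_period1 S _ HS HH Hc)).
    assert (D3 := differential_Rmult _ _ _ _ _ (differential_const (U := E3) (V := RR) (rad / (2 * PI)) x) (differential_Rplus _ _ _ _ _ D2 (differential_even_moment rad x Hr Hc))).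
    apply (differential_eq_near (U := E3) (V := RR) (fun y => Vpot rad S y)).
    + generalize HD. apply filter_imp. intros y Hy. symmetry. apply potential_Vpot; auto. apply Cmod_gt_0, (proj2 Ha _ Hy).
    + apply (differential_ext _ _ _ _ D3). intros h. unfold dVpot3. toR. rewrite Rmult_0_l, Rplus_0_l. reflexivity.
  - unfold dVpot3, dodd_moment. simpl fst. simpl snd.
    generalize (dperiod S (fst x)) (dmom_base rad x) (dmom_conj rad x) (dmom_angle rad x). intros [T1 T2] [b1 b2] [x1 x2] s.
    assert (HP2 : PI <> 0) by lra.
    repeat split; apply injective_projections; simpl; field; lra.
Qed.

Lemma ooguri_vafa_metric rad eps S : admissible rad eps S -> ooguri_vafa rad eps S (metric rad S).
Proof.
  intros H D a Ha p Hp. pose proof PI_RGT_0. destruct H as [Hr [HS [HH Hper]]].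
  assert (HB : B0 eps (pc p)) by apply (proj2 Ha _ Hp). assert (Hc : pc p <> RtoC 0) by now apply Cmod_gt_0, HB.
  assert (N : period1 S (pc p) <> 0) by now apply Rgt_not_eq, Hper.
  split; [exact (monopole rad eps D a S (pc p, theta_e S p) Hr HS HH Ha Hp)|].
  exists (dtheta S p). eexists. split; [exact (differential_theta_e S p HS HH Hc N)|]. split; [exact (differential_theta_m eps D a S p HS HH Ha Hp N)|].
  (* The terms with [period2] in [dtheta_m] and in the connection cancel, so that the connection
     form of the fibration is [beta / (2 PI)], free of the branch. *)
  assert (EA : forall u, (- RtoC ((pt2 u + theta_e S p / (2 * PI) * Im (dperiod S (pc p) * pc u)%C - period2 S a (pc p) / (2 * PI) * dtheta S p u) / (2 * PI))
     + connection rad S a (pc p, theta_e S p)%R (pc u, dtheta S p u)%R)%C = RtoC (beta rad S p u / (2 * PI))).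
  { intros u. rewrite (connection_eq rad eps D a S) by auto. simpl fst. simpl snd. fold (fiber_point S p).
    rewrite <- RtoC_opp, <- RtoC_plus. f_equal. unfold beta. field. lra. }
  cbv zeta. intros u v. cbv beta. rewrite !EA, (potential_Vpot rad S) by auto. fold (fiber_point S p). unfold metric.
  rewrite <- !RtoC_mult, <- RtoC_plus. reflexivity.
Qed.

Theorem theorem6p5 (rad eps : R) (S St : C -> R)
  (hrad : 0 < rad) (heps : 0 < eps < 1)
  (hsmooth : smooth (U := CR) (V := RR) (fun _ => True) S)
  (hS0 : S (RtoC 0) = 0)
  (hharm : harmonic S)
  (hconj : harmonic_conjugate S St)
  (hlog : forall c : C, B0 eps c -> ln (Cmod c) < pd1 S c)
  (hpos : positivity_condition rad S) :
  (exists e : R, 0 < e <= eps /\ potential_pos rad e S) /\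
  (forall e : R, 0 < e <= eps -> potential_pos rad e S ->
   exists (Om : pt -> pt -> pt -> C) (om g : pt -> pt -> pt -> R),
     twistor_family rad e S St Om om /\
     gives_hyperkahler e S Om om (fun p u v => 2 * PI * g p u v) /\
     ooguri_vafa rad e S g).
Proof.
  split; [apply potential_pos_small; auto; lra|]. intros e He Hpp.
  assert (Hper : forall c, B0 e c -> 0 < period1 S c).
  { intros c Hc. unfold period1. assert (H := hlog c ltac:(unfold B0 in *; lra)). lra. }
  assert (HA : admissible rad e S) by (repeat split; auto).
  assert (HG : good rad e S).
  { split; [exact HA|]. intros x Hx. rewrite <- (potential_Vpot rad S x hrad) by now apply Cmod_gt_0, Hx. now apply Hpp. }
  exists (Omega rad S), (omega rad S), (metric rad S). split; [|split].
  - now apply twistor.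
  - exact (hyperkahler rad e S HG).
  - exact (ooguri_vafa_metric rad e S HA).
Qed.
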